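(* Let $(\mathcal A,\tau)=*_{i\in I,\mathcal B}(\mathcal A_i,\tau_i)$ and $2\le p<\infty$. Let $x\in\mathcal W$ be written as a finite sum $$x=x_0+x_1+z,\qquad z=\sum_{i,\alpha}a_i(\alpha)\otimes b_i(\alpha),$$ where $x_0\in\mathcal B$, $x_1\in\mathcal W_1$, $a_i(\alpha)\in\mathring{\mathcal A}_i$, and $b_i(\alpha)\in\mathring{\mathcal W}$ with $L_i(b_i(\alpha))=0$. Then, with equivalence constants depending only on $p$, $$\|x\|_p\ \simeq_p\ \|x_0\|_p+\|x_1\|_p+\|z\|_{\mathcal W_1^c\otimes_pL_p(\mathcal A)}+\|z\|_{L_p(\mathcal A)\otimes_p\mathring{\mathcal W}^r},$$ where on the right-hand side $z$ is considered in $\mathcal W_1\otimes\mathring{\mathcal W}$.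
   Context: $(\mathcal A_i,\tau_i)_{i\in I}$ is a family of finite von Neumann algebras with normal faithful tracial states, $\mathcal B$ a common von Neumann subalgebra on which all $\tau_i$ agree, and $\mathbb E:\mathcal A_i\to\mathcal B$ the trace preserving conditional expectations; $\mathring{\mathcal A}_i=\{x-\mathbb E(x):x\in\mathcal A_i\}$. Put $\mathcal W_0=\mathcal B$, $\mathcal W_{(i_1,\dots,i_n)}=\mathring{\mathcal A}_{i_1}\otimes_{\mathcal B}\cdots\otimes_{\mathcal B}\mathring{\mathcal A}_{i_n}$, $\mathcal W_n=\bigoplus_{i_1\neq\cdots\neq i_n}\mathcal W_{(i_1,\dots,i_n)}$ (consecutive indices distinct), and $\mathcal W=\bigoplus_{n\ge0}\mathcal W_n$, a $*$-algebra by concatenation and centering with respect to $\mathcal B$ (so elementary tensors are products). $\mathbb E:\mathcal W\to\mathcal B$ is the natural projection, $\mathring{\mathcal W}=\{x-\mathbb E(x):x\in\mathcal W\}$, $\tau=\tau_i\circ\mathbb E$, and $(\mathcal A,\tau)$ is the von Neumann algebra obtained from $(\mathcal W,\tau)$ by the GNS construction (the amalgamated free product). $L_i$ is the natural projection of $\mathcal W$ onto $\bigoplus_{(i_1,\dots,i_n):\,i_1=i}\mathcal W_{(i_1,\dots,i_n)}$ (words starting in $\mathring{\mathcal A}_i$). $\|\cdot\|_p$ is the norm of $L_p(\mathcal A)$. $\mathcal W_1$ is regarded as a right Hilbert $\mathcal B$-module with $\langle x,y\rangle=\mathbb E(x^*y)$ and $\mathring{\mathcal W}$ as a left Hilbert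 $\mathcal B$-module with $\langle\langle x,y\rangle\rangle=\mathbb E(xy^* )$. For a finite sum $z=\sum_k a_k\otimes b_k$ with $a_k\in\mathcal W_1$, $b_k\in\mathring{\mathcal W}$, $$\|z\|_{\mathcal W_1^c\otimes_pL_p(\mathcal A)}=\Big\|\Big(\sum_{k,l}b_k^*\,\mathbb E(a_k^*a_l)\,b_l\Big)^{1/2}\Big\|_{L_p(\mathcal A)},\qquad \|z\|_{L_p(\mathcal A)\otimes_p\mathring{\mathcal W}^r}=\Big\|\Big(\sum_{k,l}a_k\,\mathbb E(b_kb_l^* )\,a_l^*\Big)^{1/2}\Big\|_{L_p(\mathcal A)}.$$ $A\simeq_pB$ means $c_p^{-1}B\le A\le c_pB$ for a positive constant $c_p$ depending only on $p$. *)

(* Defs.v *)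
From HB Require Import structures.
From mathcomp Require Import all_boot all_order all_algebra sesquilinear complex.
From mathcomp Require Import boolp classical_sets reals exp.

Set Implicit Arguments.
Unset Strict Implicit.
Unset Printing Implicit Defensive.

Import Order.TTheory GRing.Theory Num.Theory.
Local Open Scope ring_scope.
Local Open Scope complex_scope.
Local Open Scope classical_set_scope.

(** * Hilbert spaces and operators *)

(* Inner products are linear in the first variable. *)
Definition dot_norm (R : realType) (V : lmodType R[i])
  (d : {dot V for Num.conj}) (v : V) : R := Num.sqrt (complex.Re (d v v)).

Record hilbert (R : realType) := Hilbert {
  hilbert_sort :> lmodType R[i];
  hdot : {dot hilbert_sort for Num.conj};
  hilbert_complete : forall u : nat -> hilbert_sort,
    (forall e : R, 0 < e -> exists N, forall m n, (N <= m)%N -> (N <= n)%N ->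
       dot_norm hdot (u m - u n) < e) ->
    exists l, forall e : R, 0 < e -> exists N, forall n, (N <= n)%N ->
       dot_norm hdot (u n - l) < e }.

Arguments hdot {R h}.

Definition hnorm (R : realType) (H : hilbert R) (v : H) : R :=
  dot_norm hdot v.

(* Operators on H are plain functions; B(H) is the set of those that are linear
   and bounded. *)
Definition bounded_op (R : realType) (H : hilbert R) : set (H -> H) :=
  [set T | linear T /\ exists M : R, forall v, hnorm (T v) <= M * hnorm v].

Definition op_norm (R : realType) (H : hilbert R) (T : H -> H) : R :=
  sup [set r | exists2 v : H, hnorm v <= 1 & r = hnorm (T v)].

Definition is_adjoint (R : realType) (H : hilbert R) (T S : H -> H) : Prop :=
  forall u v, hdot (S u) v = hdot u (T v).

Definition adjoint (R : realType) (H : hilbert R) (T : H -> H) : H -> H :=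
  xget (fun=> 0) [set S | is_adjoint T S].

Definition commutant (R : realType) (H : hilbert R) (S : set (H -> H)) :
  set (H -> H) :=
  [set T | bounded_op T /\ forall U, S U -> T \o U = U \o T].

Definition von_neumann (R : realType) (H : hilbert R) (M : set (H -> H)) : Prop :=
  (forall T, M T -> M (adjoint T)) /\ M = commutant (commutant M).

Definition op_poly (R : realType) (H : hilbert R) (q : {poly R}) (T : H -> H) :
  H -> H :=
  fun v => \sum_(k < size q) (q`_k)%:C *: iter k T v.

(* Continuous functional calculus f(T) in the von Neumann algebra M, for T >= 0
   in M and f continuous on [0, +oo): since the spectrum of T lies in
   [0, ||T||], f(T) is the norm limit of q(T) for real polynomials q tending to
   f uniformly on [0, ||T||]. *)
Definition fun_calc (R : realType) (H : hilbert R) (M : set (H -> H))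
  (f : R -> R) (T : H -> H) : H -> H :=
  xget (fun=> 0) [set S | M S /\
    forall e : R, 0 < e -> exists2 d : R, 0 < d &
      forall q : {poly R},
        (forall t, 0 <= t <= op_norm T -> `|q.[t] - f t| <= d) ->
        op_norm (fun v => op_poly q T v - S v) <= e].

Definition op_sqrt (R : realType) (H : hilbert R) (M : set (H -> H))
  (T : H -> H) : H -> H := fun_calc M Num.sqrt T.

Definition op_abs (R : realType) (H : hilbert R) (M : set (H -> H))
  (T : H -> H) : H -> H := op_sqrt M (adjoint T \o T).

(* || T ||_p = tau (|T|^p)^(1/p), for T in M. *)
Definition Lp_norm (R : realType) (H : hilbert R) (M : set (H -> H))
  (tau : (H -> H) -> R[i]) (p : R) (T : H -> H) : R :=
  (complex.Re (tau (fun_calc M (fun t => t `^ p) (op_abs M T)))) `^ p^-1.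

(** * Finite von Neumann algebras *)

HB.mixin Record isStarAlgebra (R : realType) A of GRing.Algebra R[i] A := {
  star : A -> A;
  starK : involutive star;
  starP : forall (c : R[i]) (x y : A),
    star (c *: x + y) = Num.conj c *: star x + star y;
  starM : forall x y : A, star (x * y) = star y * star x }.

#[short(type="starAlgType")]
HB.structure Definition StarAlgebra (R : realType) :=
  { A of isStarAlgebra R A & GRing.Algebra R[i] A }.

Definition spos (R : realType) (A : starAlgType R) (x : A) : Prop :=
  exists y : A, x = star y * y.

Definition sle (R : realType) (A : starAlgType R) (x y : A) : Prop :=
  spos (y - x).

Definition star_rep (R : realType) (A : starAlgType R) (H : hilbert R)
  (pi : A -> H -> H) : Prop :=
  [/\ forall x, bounded_op (pi x),
      forall c x y, pi (c *: x + y) = (fun v => c *: pi x v + pi y v),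
      pi 1 = id,
      forall x y, pi (x * y) = pi x \o pi y &
      forall x, is_adjoint (pi x) (pi (star x))].

Definition directed (R : realType) (A : starAlgType R) (D : set A) : Prop :=
  D !=set0 /\
  forall x y, D x -> D y -> exists z, [/\ D z, sle x z & sle y z].

Definition is_lub (R : realType) (A : starAlgType R) (D : set A) (s : A) : Prop :=
  (forall x, D x -> sle x s) /\
  (forall u, (forall x, D x -> sle x u) -> sle s u).

(* tau (sup D) = sup tau(D) for upward directed bounded sets D of self-adjoint
   elements. *)
Definition normal (R : realType) (A : starAlgType R) (tau : A -> R[i]) : Prop :=
  forall (D : set A) (s : A),
    (forall x, D x -> star x = x) -> directed D -> is_lub D s ->
    forall e : R[i], 0 < e -> exists2 x, D x & tau s - e < tau x.

(* A finite von Neumann algebra with a normal faithful tracial state, given as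
   a *-algebra together with an identification with a concrete von Neumann
   algebra on a Hilbert space. *)
Record finite_vN (R : realType) := FiniteVN {
  vN_alg :> starAlgType R;
  vN_space : hilbert R;
  vN_rep : vN_alg -> vN_space -> vN_space;
  vN_repP : star_rep vN_rep;
  vN_rep_inj : injective vN_rep;
  vN_closed : von_neumann (range vN_rep);
  tr : {linear vN_alg -> R[i] | *%R};
  tr1 : tr 1 = 1;
  tr_ge0 : forall x, 0 <= tr (star x * x);
  tr_faithful : forall x, tr (star x * x) = 0 -> x = 0;
  tr_tracial : forall x y, tr (x * y) = tr (y * x);
  tr_normal : normal tr }.

Arguments tr {R f}.
Arguments vN_rep {R f}.

(** * The amalgamated free product *)

Record amalgam (R : realType) (I : eqType) := Amalgam {
  amB : finite_vN R;
  amA : I -> finite_vN R;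
  iota : forall i, {lrmorphism amB -> amA i};
  iota_star : forall i b, iota i (star b) = star (iota i b);
  iota_vN : forall i, von_neumann (range (fun b => vN_rep (iota i b)));
  iota_tr : forall i b, tr (iota i b) = tr b;
  cexp : forall i, {linear amA i -> amB};
  cexp_iota : forall i b, cexp i (iota i b) = b;
  cexp_bimod : forall i b a b',
    cexp i (iota i b * a * iota i b') = b * cexp i a * b';
  cexp_pos : forall i a, spos a -> spos (cexp i a);
  cexp_tr : forall i a, tr (cexp i a) = tr a }.

Section Words.
Variables (R : realType) (I : eqType) (D : amalgam R I).
Local Notation A := (amA D).
Local Notation B := (amB D).

Definition A_centered (i : I) : set (A i) :=
  [set x - iota D i (cexp D i x) | x in setT].

Definition letter := {i : I & A i}.

Definition ltr (i : I) (a : A i) : letter := Tagged A a.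

(* [:: (i_1, a_1); ...; (i_n, a_n)] with i_1 != i_2 != ... != i_n and a_k in
   the centered part of A_(i_k); it stands for a_1 (x) ... (x) a_n. *)
Fixpoint reduced (s : seq letter) : Prop :=
  if s is u :: s' then
    [/\ A_centered (tagged u),
        (if s' is v :: _ then tag u != tag v else true) & reduced s']
  else True.

(* On the words over a fixed (i_1, ..., i_n), such an f is a B-balanced
   multilinear map on the product of the centered parts of the A_(i_k). *)
Definition balanced (V : lmodType R[i]) (f : seq letter -> V) : Prop :=
  (forall s1 s2 i (c : R[i]) (a a' : A i),
     reduced (s1 ++ ltr a :: s2) -> reduced (s1 ++ ltr a' :: s2) ->
     f (s1 ++ ltr (c *: a + a') :: s2) =
     c *: f (s1 ++ ltr a :: s2) + f (s1 ++ ltr a' :: s2)) /\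
  (forall s1 s2 i j (a : A i) (a' : A j) (b : B),
     reduced (s1 ++ ltr a :: ltr a' :: s2) ->
     f (s1 ++ ltr (a * iota D i b) :: ltr a' :: s2) =
     f (s1 ++ ltr a :: ltr (iota D j b * a') :: s2)).

End Words.

(* The *-algebra W. Its underlying space is the direct sum of B and of the
   tensor products over B of the centered parts of A_(i_1), ..., A_(i_n), over
   i_1 != ... != i_n, n >= 1. This sum of tensor products is given by its
   universal property: a linear map out of W amounts to a linear map on B and a
   balanced map on nonempty reduced words. Elementary tensors are products of
   their letters, so that the *-homomorphisms from the A_i encode the product
   by concatenation and centering. *)
Record word_algebra (R : realType) (I : eqType) (D : amalgam R I) := WordAlgebra {
  W_alg :> starAlgType R;
  inB : {lrmorphism amB D -> W_alg};
  inA : forall i, {lrmorphism amA D i -> W_alg};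
  inB_star : forall b, inB (star b) = star (inB b);
  inA_star : forall i a, inA i (star a) = star (inA i a);
  inA_iota : forall i b, inA i (iota D i b) = inB b;
  W_exists : forall (V : lmodType R[i]) (f0 : {linear amB D -> V})
      (f : seq (letter D) -> V), balanced f ->
    exists g : {linear W_alg -> V}, (forall b, g (inB b) = f0 b) /\
      forall s, s <> [::] -> reduced s ->
        g (\prod_(u <- s) inA (tag u) (tagged u)) = f s;
  W_unique : forall (V : lmodType R[i]) (g h : {linear W_alg -> V}),
    (forall b, g (inB b) = h (inB b)) ->
    (forall s, s <> [::] -> reduced s ->
       g (\prod_(u <- s) inA (tag u) (tagged u)) =
       h (\prod_(u <- s) inA (tag u) (tagged u))) ->
    g =1 h }.

Section WordAlgebra.
Variables (R : realType) (I : eqType) (D : amalgam R I) (W : word_algebra D).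

Definition word (s : seq (letter D)) : W :=
  \prod_(u <- s) inA W (tag u) (tagged u).

Definition W_lift (V : lmodType R[i]) (f0 : {linear amB D -> V})
    (f : seq (letter D) -> V) (fP : balanced f) : {linear W -> V} :=
  sval (cid (W_exists W f0 fP)).

Lemma W_lift_inB (V : lmodType R[i]) (f0 : {linear amB D -> V}) f
  (fP : balanced f) b : W_lift f0 fP (inB W b) = f0 b.
Proof. by rewrite /W_lift; case: cid => g /= [gB _]; exact: gB. Qed.

Lemma W_lift_word (V : lmodType R[i]) (f0 : {linear amB D -> V}) f
  (fP : balanced f) s : s <> [::] -> reduced s -> W_lift f0 fP (word s) = f s.
Proof. by rewrite /W_lift; case: cid => g /= [_ gw]; exact: gw. Qed.

Lemma balanced0 (V : lmodType R[i]) :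
  balanced ((fun=> 0) : seq (letter D) -> V).
Proof. by split=> *; rewrite ?scaler0 ?addr0. Qed.

Definition first_letter (i : I) (s : seq (letter D)) : bool :=
  if s is u :: _ then tag u == i else false.

Lemma balanced_first (i : I) :
  balanced (fun s => if first_letter i s then word s else 0).
Proof.
split=> [s1 s2 j c a a' _ _|s1 s2 j k a a' b _].
  have -> : first_letter i (s1 ++ ltr (c *: a + a') :: s2) =
            first_letter i (s1 ++ ltr a' :: s2) by case: s1.
  have -> : first_letter i (s1 ++ ltr a :: s2) =
            first_letter i (s1 ++ ltr a' :: s2) by case: s1.
  case: ifP => _; last by rewrite scaler0 addr0.
  rewrite /word !big_cat /= !big_cons /= linearP mulrDl mulrDr.
  by rewrite -scalerAl -scalerAr.
have -> : first_letter i (s1 ++ ltr (a * iota D j b) :: ltr a' :: s2) =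
          first_letter i (s1 ++ ltr a :: ltr (iota D k b * a') :: s2).
  by case: s1.
case: ifP => // _; rewrite /word !big_cat /= !big_cons /=.
by rewrite !rmorphM /= !inA_iota !mulrA.
Qed.

(* The projection E of W onto B, and L_i of W onto the words starting in A_i. *)
Definition W_exp : {linear W -> amB D} := W_lift idfun (balanced0 (amB D)).

Definition L_proj (i : I) : {linear W -> W} := W_lift \0 (balanced_first i).

Definition W_tr (x : W) : R[i] := tr (W_exp x).

Definition W_centered : set W := [set x - inB W (W_exp x) | x in setT].

Definition W_1 : set W :=
  [set x | exists n (idx : 'I_n -> I) (a : forall k, amA D (idx k)),
     (forall k, A_centered (a k)) /\ x = \sum_(k < n) inA W (idx k) (a k)].

End WordAlgebra.

(** * GNS construction and norms *)

Record gns (R : realType) (I : eqType) (D : amalgam R I) (W : word_algebra D) :=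
  GNS {
  gns_space : hilbert R;
  gns_vec : {linear W -> gns_space};
  gns_dot : forall x y, hdot (gns_vec x) (gns_vec y) = W_tr (star y * x);
  gns_dense : forall (v : gns_space) (e : R), 0 < e ->
    exists x, hnorm (v - gns_vec x) < e;
  gns_rep : W -> gns_space -> gns_space;
  gns_bounded : forall x, bounded_op (gns_rep x);
  gns_repE : forall x y, gns_rep x (gns_vec y) = gns_vec (x * y) }.

Arguments gns_vec {R I D W} g.
Arguments gns_rep {R I D W} g.

Section Norms.
Variables (R : realType) (I : eqType) (D : amalgam R I) (W : word_algebra D).
Variables (G : gns W) (p : R).

(* The amalgamated free product (A, tau). *)
Definition gns_vN : set (gns_space G -> gns_space G) :=
  commutant (commutant (range (gns_rep G))).

Definition gns_tr (T : gns_space G -> gns_space G) : R[i] :=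
  hdot (T (gns_vec G 1)) (gns_vec G 1).

Definition Lp (T : gns_space G -> gns_space G) : R := Lp_norm gns_vN gns_tr p T.

Definition W_Lp (x : W) : R := Lp (gns_rep G x).

(* Norms of z = \sum_k a_k (x) b_k in W_1^c (x)_p L_p(A) and
   L_p(A) (x)_p W^r, for a_k in W_1 and b_k centered. *)
Definition col_norm (n : nat) (a b : 'I_n -> W) : R :=
  Lp (op_sqrt gns_vN (gns_rep G (\sum_(k < n) \sum_(l < n)
    star (b k) * inB W (W_exp W (star (a k) * a l)) * b l))).

Definition row_norm (n : nat) (a b : 'I_n -> W) : R :=
  Lp (op_sqrt gns_vN (gns_rep G (\sum_(k < n) \sum_(l < n)
    a k * inB W (W_exp W (b k * star (b l))) * star (a l)))).

End Norms.

(* Main.v *)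
(** The norm [||x||_p] only involves the trace of powers of [x^# x], and these
    are determined by moments, so the estimates can be carried out in matrix
    algebras over [W] with a positive trace; Bernstein polynomials replace
    spectral theory, and the functional calculus of the GNS space is only
    compared with these traces at the end.

    Write [z = a b], with [a] the row of the letters and [b] the column of the
    right factors. Let [P] remove from the k-th row the words starting in
    [A_(i_k)] and [S y = a (P y)]. Then [P b = b], and freeness turns [z z^#]
    into [a E(b b^#) a^#] plus terms [S(b z^#)], [S(b z^#)^#], [S(P(b b^#)^# a^#)]
    and [S] of the off-diagonal part of [E(b b^#)] times [a^#].

    The maps [L_i], hence [P] and the adjoint [F x = P(a^# x)] of [S], satisfy a
    Cotlar identity, which bounds them on [L_(2q)] once they are bounded on
    [L_q]; starting at [q = 2] and interpolating, they are bounded on [L_p] for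
    [p >= 2]. Testing against the dual space then handles [1 < p/2 <= 2] when
    [E(a^# a) <= 1], and the estimate for [p/2] applied to the error terms gives
    the one for [p]. Replacing [a, b] by [a h, h^-1 b] with [h] close to
    [E(a^# a)^(-1/2)] removes the normalization; [p = 2] is an identity of
    traces. *)

From Stdlib Require Import Setoid Ncring Ncring_tac.
From HB Require Import structures.
From mathcomp Require Import all_boot all_order all_algebra sesquilinear complex.
From mathcomp Require Import boolp classical_sets reals exp.
From mathcomp Require Import ring lra.
Require Import Defs.

Set Implicit Arguments.
Unset Strict Implicit.
Unset Printing Implicit Defensive.

Import Order.TTheory GRing.Theory Num.Theory.
Local Open Scope ring_scope.

(** * Bernstein polynomials and moment functionals *)

(** The word algebra is not complete: square roots, inverses and polar parts of its elements need
    not belong to it. Hence norms are integrals against moment functionals, duality is tested on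
    polynomials in the tested element, and the normalization of [a] is reached only up to an error
    that tends to zero.

    Cotlar's argument gives bounds for exponents at least 2 only. In the duality argument the
    operators act on the test element, so the conjugate exponent of p/2 has to be at least 2; this
    is why that argument stops at p/2 = 2. Beyond, the error terms are estimated directly. Each is
    some S x, the estimate at half the exponent applies to its square, and its norm is at most a
    constant times a geometric mean of two of the quantities being compared, so the
    arithmetic-geometric inequality absorbs it.

    The normalization E(a^# a) <= 1 makes [F] contractive at exponent 2 and lets b^# b stand for the
    column term. Every constant is chosen before the algebra, hence independently of the size of the
    matrices. *)

Section Limits.
Variable R : realType.

Definition tends (u : nat -> R) (l : R) : Prop :=
  forall e, 0 < e -> exists N, forall n, (N <= n)%N -> `|u n - l| <= e.

Lemma tends_const l : tends (fun=> l) l.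
Proof. by move=> e e0; exists 0%N => n _; rewrite subrr normr0 ltW. Qed.

Lemma tends_le u v l m : (forall n, u n <= v n) -> tends u l -> tends v m -> l <= m.
Proof.
move=> uv ul vm; apply/ler_addgt0Pr => e e0.
have e20 : 0 < e / 2 by rewrite divr_gt0.
have [N1 h1] := ul _ e20; have [N2 h2] := vm _ e20.
have := h1 _ (leq_maxl N1 N2); have := h2 _ (leq_maxr N1 N2).
have := uv (maxn N1 N2); rewrite !ler_norml => ? /andP[? ?] /andP[? ?]; lra.
Qed.

Lemma tendsD u v l m : tends u l -> tends v m -> tends (fun n => u n + v n) (l + m).
Proof.
move=> ul vm e e0.
have e20 : 0 < e / 2 by rewrite divr_gt0.
have [N1 h1] := ul _ e20; have [N2 h2] := vm _ e20.
exists (maxn N1 N2) => n; rewrite geq_max => /andP[/h1 a1 /h2 a2].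
have -> : u n + v n - (l + m) = (u n - l) + (v n - m) by ring.
by rewrite (le_trans (ler_normD _ _))// [e]splitr lerD.
Qed.

Lemma tends_ext u v l : (forall n, u n = v n) -> tends u l -> tends v l.
Proof. by move=> uv ul e /ul[N h]; exists N => n /h; rewrite uv. Qed.

Lemma tendsZ a u l : tends u l -> tends (fun n => a * u n) (a * l).
Proof.
move=> ul e e0.
have a0 : 0 < `|a| + 1 by rewrite ltr_wpDl.
have [N h] := ul (e / (`|a| + 1)) (divr_gt0 e0 a0).
exists N => n /h hn; rewrite -mulrBr normrM.
apply: (@le_trans _ _ ((`|a| + 1) * (e / (`|a| + 1)))).
  by rewrite ler_pM// lerDl.
by rewrite mulrC divfK// gt_eqF.
Qed.

Lemma tends_sum n (u : nat -> nat -> R) (l : nat -> R) :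
  (forall k, tends (u k) (l k)) ->
  tends (fun N => \sum_(k < n) u k N) (\sum_(k < n) l k).
Proof.
move=> h; elim: n => [|n IH].
  by rewrite big_ord0; apply: (tends_ext _ (@tends_const 0)) => N; rewrite big_ord0.
rewrite big_ord_recr /=; apply: (tends_ext _ (tendsD IH (h n))) => N.
by rewrite big_ord_recr.
Qed.

Lemma tends_near u v l : tends u l -> tends (fun n => v n - u n) 0 -> tends v l.
Proof.
move=> ul uv; have := tendsD ul uv; rewrite addr0.
by move=> h e /h[N hN]; exists N => n /hN; rewrite [u n + _]addrC subrK.
Qed.

Lemma tends_shift u l : tends u l -> tends (fun n => u n.+1) l.
Proof.
by move=> ul e /ul[N h]; exists N => n Nn; apply: h; rewrite (leq_trans Nn).
Qed.

Lemma tends_inv (c : R) : tends (fun n => c / n.+1%:R) 0.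
Proof.
move=> e e0; have := archi_boundP (divr_ge0 (normr_ge0 c) (ltW e0)).
set N := Num.bound _ => hN; exists N => n Nn.
rewrite subr0 normrM normfV [X in _ / X]ger0_norm// ler_pdivrMr// mulrC -ler_pdivrMr//.
by rewrite (le_trans (ltW hN))// ler_nat (leq_trans Nn).
Qed.

End Limits.

Section Bernstein.
Variable R : realType.

Definition bern (c : R) (N i : nat) : {poly R} :=
  (c ^- N * 'C(N, i)%:R) *: ('X^i * (c%:P - 'X) ^+ (N - i)).

Definition node (c : R) (N i : nat) : R := c * i%:R / N%:R.

Lemma sum_bern c N : c != 0 -> \sum_(i < N.+1) bern c N i = 1.
Proof.
move=> c0; rewrite /bern.
have -> : (1 : {poly R}) = (c ^- N) *: ((c%:P - 'X) + 'X) ^+ N.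
  rewrite subrK -polyC_exp -mul_polyC -polyCM mulVf ?expf_neq0//.
rewrite exprDn scaler_sumr; apply: eq_bigr => i _.
by rewrite -scalerA scaler_nat [X in X *+ _]mulrC.
Qed.

(** Degree and index both move up by one. This shift determines the Bernstein coefficients of powers
    and reappears in [cs_slices]. *)
Lemma mulX_bern c N i : c != 0 ->
  'X * bern c N i = node c N.+1 i.+1 *: bern c N.+1 i.+1.
Proof.
move=> c0; rewrite /bern /node -scalerAr mulrA -exprS scalerA subSS; congr (_ *: _).
have H : N.+1%:R * 'C(N, i)%:R = i.+1%:R * 'C(N.+1, i.+1)%:R :> R.
  by rewrite -!natrM (mul_bin_diag N.+1 i).
rewrite exprS invfM.
have -> : 'C(N, i)%:R = i.+1%:R * 'C(N.+1, i.+1)%:R / N.+1%:R :> R.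
  by rewrite -H mulrC mulKf// pnatr_eq0.
have N1 : N.+1%:R != 0 :> R by rewrite pnatr_eq0.
have cN : c ^+ N != 0 by rewrite expf_neq0.
move: (N.+1%:R : R) (i.+1%:R : R) ('C(N.+1, i.+1)%:R : R) (c ^+ N) N1 cN.
by move=> n1 i1 b cn N1 cN; field; rewrite ?c0 ?N1 ?cN.
Qed.

(** The Bernstein coefficient of 'X^k of degree [N] and index [i]: c^k times the quotient of the
    falling factorials of length k of [i] and [N]. *)
Fixpoint wgt (c : R) (k i N : nat) : R :=
  if k is k'.+1 then
    (if i is i'.+1 then node c N i * wgt c k' i' N.-1 else 0) else 1.

Lemma Xn_bern c k N : c != 0 -> (k <= N)%N ->
  'X^k = \sum_(i < N.+1) wgt c k i N *: bern c N i.
Proof.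
move=> c0; elim: k N => [|k IH] N kN.
  rewrite expr0 -(sum_bern N c0); apply: eq_bigr => i _.
  by rewrite scale1r.
case: N kN => // N kN.
rewrite exprS (IH N kN) mulr_sumr [RHS]big_ord_recl /= scale0r add0r.
apply: eq_bigr => i _.
by rewrite -scalerAr mulX_bern// scalerA /bump /= add1n mulrC.
Qed.

Lemma node_itv c N i : 0 <= c -> (i <= N)%N -> 0 <= node c N i <= c.
Proof.
move=> c0 iN; rewrite /node; case: N iN => [|N] iN.
  by rewrite invr0 mulr0 lexx c0.
rewrite divr_ge0 ?mulr_ge0//= ler_pdivrMr// ler_wpM2l// ler_nat.
by [].
Qed.

Lemma node_shift c N i : 0 <= c -> (i <= N)%N ->
  `|node c N.+1 i.+1 - node c N i| <= c / N.+1%:R.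
Proof.
move=> c0 iN; rewrite /node; case: N iN => [|N] iN.
  by move: iN; rewrite leqn0 => /eqP ->; rewrite invr0 mulr0 subr0 mulr1 ger0_norm// divr_ge0.
have -> : c * i.+1%:R / N.+2%:R - c * i%:R / N.+1%:R =
    c / N.+2%:R * ((N.+1%:R - i%:R) / N.+1%:R) :> R.
  rewrite -[in i.+1%:R]nat1r -[in N.+2%:R]nat1r.
  have N1 : N.+1%:R != 0 :> R by rewrite pnatr_eq0.
  have N2 : 1 + N.+1%:R != 0 :> R by rewrite nat1r pnatr_eq0.
  move: (N.+1%:R : R) (i%:R : R) N1 N2 => n1 i1 N1 N2.
  by field; rewrite ?N1 ?N2.
rewrite normrM ger0_norm ?divr_ge0// ler_piMr ?divr_ge0//.
have Ni : (i%:R : R) <= N.+1%:R by rewrite ler_nat.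
rewrite ger0_norm ?divr_ge0 ?subr_ge0// ler_pdivrMr// mul1r lerBlDr lerDl.
by rewrite ler0n.
Qed.

Lemma lip_exp c k (u v : R) : 0 <= u <= c -> 0 <= v <= c ->
  `|u ^+ k - v ^+ k| <= k%:R * c ^+ k.-1 * `|u - v|.
Proof.
move=> /andP[u0 uc] /andP[v0 vc]; rewrite subrXX normrM mulrC ler_wpM2r//.
rewrite (le_trans (ler_norm_sum _ _ _))//.
apply: (@le_trans _ _ (\sum_(i < k) c ^+ k.-1)); last first.
  by rewrite sumr_const card_ord mulr_natl.
apply: ler_sum => i _; rewrite normrM !normrX !ger0_norm//.
have -> : c ^+ k.-1 = c ^+ (k.-1 - i) * c ^+ i.
  by rewrite -exprD subnK//; have := ltn_ord i; case: k i.
have cc := le_trans u0 uc.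
by apply: ler_pM; rewrite ?exprn_ge0//; apply: lerXn2r.
Qed.

Lemma wgt_near c k : 0 < c -> forall e, 0 < e -> exists N0, forall N i,
  (N0 <= N)%N -> (i <= N)%N -> `|wgt c k i N - node c N i ^+ k| <= e.
Proof.
move=> c0; elim: k => [|k IH] e e0.
  by exists 0%N => N i _ _; rewrite expr0 subrr normr0 ltW.
(* [c] times the Lipschitz constant of the k-th power on [0, c]; going from degree N to N + 1 moves
   a node by at most c / (N + 1). *)
pose K := c * (k%:R * c ^+ k.-1).
have e1 : 0 < e / 2 / c by rewrite !divr_gt0.
have [N0 h0] := IH _ e1.
have [N1 h1] := tends_inv (K * c) (divr_gt0 e0 (ltr0Sn _ 1)).
exists (maxn N0 N1).+1 => N i; case: N => // N NN iN.
have [NN0 NN1] : (N0 <= N)%N /\ (N1 <= N)%N by move: NN; rewrite ltnS geq_max => /andP[].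
case: i iN => [|i] iN.
  by rewrite /node /= mulr0 mul0r expr0n /= subrr normr0 ltW.
rewrite [wgt _ _ _ _]/= exprS -mulrBr normrM.
have /andP[n0 nc] := node_itv (ltW c0) iN.
have mc := node_itv (ltW c0) (iN : (i <= N)%N).
rewrite ger0_norm//.
apply: (@le_trans _ _ (c * (e / 2 / c + k%:R * c ^+ k.-1 * (c / N.+1%:R)))).
  apply: ler_pM => //.
  have -> : wgt c k i N - node c N.+1 i.+1 ^+ k =
    (wgt c k i N - node c N i ^+ k) + (node c N i ^+ k - node c N.+1 i.+1 ^+ k) by ring.
  rewrite (le_trans (ler_normD _ _))// lerD ?h0//.
  rewrite (le_trans (lip_exp k mc _)) ?n0//.
  apply: ler_wpM2l; first by rewrite mulr_ge0// exprn_ge0// ltW.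
  by rewrite distrC node_shift// ltW.
rewrite mulrDr [c * (_ / c)]mulrC divfK ?gt_eqF// [leRHS]splitr lerD2l.
have := h1 N NN1; rewrite subr0 ger0_norm; last first.
  by rewrite /K !mulr_ge0 ?exprn_ge0 ?(ltW c0)// invr_ge0.
by rewrite /K !mulrA.
Qed.

(* By Hausdorff's theorem these are the moment functionals of the positive
   measures on [0, c]; [riem] and [ext] integrate functions against such a
   measure through Bernstein polynomials, without constructing it. *)
Definition haus (c : R) (L : {poly R} -> R) : Prop :=
  [/\ 0 < c, forall r p q, L (r *: p + q) = r * L p + L q &
      forall i j, 0 <= L ('X^i * (c%:P - 'X) ^+ j)].

Definition riem (c : R) (L : {poly R} -> R) (N : nat) (f : R -> R) : R :=
  \sum_(i < N.+1) f (node c N i) * L (bern c N i).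

Section Functional.
Variables (c : R) (L : {poly R} -> R).
Hypothesis hL : haus c L.

Lemma haus0 : L 0 = 0.
Proof.
have [_ lin _] := hL; have := lin 1 0 0.
by rewrite scale1r addr0 mul1r => /esym/eqP; rewrite -subr_eq0 addrK => /eqP.
Qed.

Lemma hausD p q : L (p + q) = L p + L q.
Proof. by have [_ lin _] := hL; rewrite -[p]scale1r lin mul1r scale1r. Qed.

Lemma hausZ r p : L (r *: p) = r * L p.
Proof. by have [_ lin _] := hL; rewrite -[_ *: p]addr0 lin haus0 addr0. Qed.

Lemma hausB p q : L (p - q) = L p - L q.
Proof. by rewrite hausD -scaleN1r hausZ mulN1r. Qed.

Lemma haus_sum (I : Type) (s : seq I) (P : pred I) F :
  L (\sum_(i <- s | P i) F i) = \sum_(i <- s | P i) L (F i).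
Proof. exact: (big_morph L hausD haus0). Qed.

Lemma haus_bern N i : 0 <= L (bern c N i).
Proof.
have [c0 _ p] := hL; rewrite /bern hausZ mulr_ge0// mulr_ge0//.
by rewrite invr_ge0 exprn_ge0// ltW.
Qed.

Lemma haus_c0 : c != 0. Proof. by have [c0 _ _] := hL; rewrite gt_eqF. Qed.

Lemma haus_bern_sum N : \sum_(i < N.+1) L (bern c N i) = L 1.
Proof. by rewrite -haus_sum sum_bern ?haus_c0. Qed.

Lemma haus1_ge0 : 0 <= L 1.
Proof. by rewrite -(haus_bern_sum 0) sumr_ge0// => i _; apply: haus_bern. Qed.

Lemma riem_near (a b : nat -> R) N e :
  (forall i, (i <= N)%N -> `|a i - b i| <= e) ->
  `|\sum_(i < N.+1) a i * L (bern c N i) - \sum_(i < N.+1) b i * L (bern c N i)|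
    <= e * L 1.
Proof.
move=> h; rewrite -sumrB (le_trans (ler_norm_sum _ _ _))//.
rewrite -(haus_bern_sum N) mulr_sumr ler_sum// => i _.
rewrite -mulrBl normrM [X in _ * X]ger0_norm ?haus_bern// ler_wpM2r ?haus_bern//.
by apply: h; rewrite -ltnS ltn_ord.
Qed.

(** Errors come as multiples of the total mass [L 1], which may vanish; hence the division by
    [L 1 + 1]. *)
Lemma tends_L1 (u v : nat -> R) :
  (forall e, 0 < e -> exists N0, forall N, (N0 <= N)%N -> `|u N - v N| <= e * L 1) ->
  tends (fun N => u N - v N) 0.
Proof.
move=> h e e0.
have L0 : 0 < L 1 + 1 by rewrite ltr_wpDl// haus1_ge0.
have [N0 hN] := h _ (divr_gt0 e0 L0); exists N0 => n /hN hn.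
rewrite subr0 (le_trans hn)// -mulrA ler_piMr ?(ltW e0)// ler_pdivrMl// mulr1.
by rewrite lerDl.
Qed.

(** With the exact coefficients [wgt] instead of powers of nodes the sum equals [L 'X^k]; the
    difference is controlled by [wgt_near] and the total mass. *)
Lemma riemXn k : tends (fun N => riem c L N (fun x => x ^+ k)) (L 'X^k).
Proof.
have [c0 _ _] := hL.
apply: (@tends_near _ (fun N => \sum_(i < N.+1) wgt c k i N * L (bern c N i))).
  move=> e e0; exists k => N kN.
  rewrite (Xn_bern haus_c0 kN) haus_sum.
  under [X in _ - X]eq_bigr do rewrite hausZ.
  by rewrite subrr normr0 ltW.
apply: tends_L1 => e e0; have [N0 h] := wgt_near k c0 e0.
exists N0 => N NN; rewrite /riem.
apply: (riem_near (a := fun i => node c N i ^+ k) (b := fun i => wgt c k i N)).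
by move=> i iN; rewrite distrC h.
Qed.

Lemma riem_poly q : tends (fun N => riem c L N (horner q)) (L q).
Proof.
have -> : L q = \sum_(k < size q) q`_k * L 'X^k.
  by rewrite -[in LHS](coefK q) poly_def haus_sum; apply: eq_bigr => k _; rewrite hausZ.
have E N : riem c L N (horner q) =
    \sum_(k < size q) q`_k * riem c L N (fun x => x ^+ k).
  rewrite /riem; under [RHS]eq_bigr do rewrite mulr_sumr.
  rewrite exchange_big /=; apply: eq_bigr => i _.
  by rewrite horner_coef mulr_suml; apply: eq_bigr => k _; rewrite mulrA.
apply: (tends_ext (fun N => esym (E N))).
apply: (@tends_sum _ _ (fun k N => q`_k * riem c L N (fun x => x ^+ k))
  (fun k => q`_k * L 'X^k)) => k.
exact: tendsZ (riemXn k).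
Qed.

(** [L q] is a limit of Bernstein sums with nonnegative terms. This is what replaces positivity of a
    measure. *)
Lemma haus_ge0 q : (forall x, 0 <= x <= c -> 0 <= q.[x]) -> 0 <= L q.
Proof.
move=> q0; apply: (tends_le _ (@tends_const _ 0) (riem_poly q)) => N.
have [c0 _ _] := hL.
apply: sumr_ge0 => i _; rewrite mulr_ge0 ?haus_bern// q0//.
by rewrite node_itv ?(ltW c0)// -ltnS ltn_ord.
Qed.

Lemma haus_le p q : (forall x, 0 <= x <= c -> p.[x] <= q.[x]) -> L p <= L q.
Proof.
move=> pq; rewrite -subr_ge0 -hausB haus_ge0// => x /pq.
by rewrite !hornerE subr_ge0.
Qed.

Lemma hausC r : L r%:P = r * L 1.
Proof. by rewrite -hausZ -mul_polyC mulr1. Qed.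

Lemma haus_norm q M : (forall x, 0 <= x <= c -> `|q.[x]| <= M) -> `|L q| <= M * L 1.
Proof.
move=> h; rewrite ler_norml -mulNr -!hausC.
by apply/andP; split; apply: haus_le => x /h; rewrite !hornerE ler_norml => /andP[].
Qed.

End Functional.

(** Boundedness is part of the definition, so compactness of [0, c] is never invoked. *)
Definition ufc (c : R) (f : R -> R) : Prop :=
  (exists M, forall x, 0 <= x <= c -> `|f x| <= M) /\
  forall e, 0 < e -> exists2 d, 0 < d & forall x y, 0 <= x <= c -> 0 <= y <= c ->
    `|x - y| <= d -> `|f x - f y| <= e.

(** Point evaluation is a moment functional, so the facts on [L (bern c N i)] are also facts on the
    values of Bernstein polynomials. *)
Lemma haus_eval (c x : R) : 0 < c -> 0 <= x <= c -> haus c (fun q => q.[x]).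
Proof.
move=> c0 /andP[x0 xc]; split=> // [r p q|i j]; first by rewrite !hornerE.
by rewrite !(hornerE, horner_exp) mulr_ge0// exprn_ge0// subr_ge0.
Qed.

Theorem weierstrass (c : R) f : 0 < c -> ufc c f -> forall e, 0 < e ->
  exists q : {poly R}, forall x, 0 <= x <= c -> `|q.[x] - f x| <= e.
Proof.
move=> c0 [[M fM] uf] e e0.
have [d d0 hd] := uf _ (divr_gt0 e0 (ltr0Sn _ 1)).
(* Where |x - y| > d, the difference |f x - f y| <= 2 |M| is at most K (x - y)^2; elsewhere it is at
   most e / 2. *)
pose K := 2 * `|M| / d ^+ 2.
have K0 : 0 <= K by rewrite !mulr_ge0// invr_ge0 exprn_ge0// ltW.
have K1 : 0 < K + 1 by rewrite ltr_wpDl.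
have fK x y : 0 <= x <= c -> 0 <= y <= c -> `|f x - f y| <= e / 2 + K * (x - y) ^+ 2.
  move=> hx hy; have [xy|xy] := leP `|x - y| d.
    by rewrite (le_trans (hd _ _ hx hy xy))// lerDl mulr_ge0// sqr_ge0.
  apply: (@le_trans _ _ (2 * `|M|)).
    rewrite (le_trans (ler_normB _ _))// mulr_natl mulr2n lerD//;
    by rewrite (le_trans (fM _ _))// ler_norm.
  apply: (@le_trans _ _ (K * (x - y) ^+ 2)); last by rewrite lerDr divr_ge0// ltW.
  rewrite /K -mulrA ler_peMr ?mulr_ge0// ler_pdivlMl ?exprn_gt0// mulr1.
  by rewrite -[leRHS]real_normK ?num_real// lerXn2r ?nnegrE// ltW.
have [N h2] := wgt_near 2 c0 (divr_gt0 (divr_gt0 e0 (ltr0Sn _ 1)) K1).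
pose m := maxn 2 N.
exists (\sum_(i < m.+1) f (node c m i) *: bern c m i) => x hx.
have hL := haus_eval c0 hx; have c1 := haus_c0 hL.
have -> : (\sum_(i < m.+1) f (node c m i) *: bern c m i).[x] - f x =
    \sum_(i < m.+1) (f (node c m i) - f x) * (bern c m i).[x].
  rewrite horner_sum -[X in _ - X]mulr1 -[in X in _ - _ * X](hornerC 1 x).
  rewrite -[1%:P](sum_bern m c1) horner_sum mulr_sumr -sumrB.
  by apply: eq_bigr => i _; rewrite hornerZ mulrBl.
rewrite (le_trans (ler_norm_sum _ _ _))//.
have nd (i : 'I_m.+1) : 0 <= node c m i <= c by rewrite node_itv ?ltW// -ltnS ltn_ord.
apply: (@le_trans _ _ (\sum_(i < m.+1)
    (e / 2 + K * (node c m i - x) ^+ 2) * (bern c m i).[x])).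
  apply: ler_sum => i _; rewrite normrM [X in _ * X]ger0_norm ?(haus_bern hL)//.
  by rewrite ler_wpM2r ?(haus_bern hL)// fK.
have S k : (k <= m)%N ->
    \sum_(i < m.+1) wgt c k i m * (bern c m i).[x] = x ^+ k.
  move=> km; rewrite -(hornerXn x k) (Xn_bern c1 km) horner_sum.
  apply: eq_bigr => i _.
  by rewrite [RHS]hornerZ.
have m2 : (2 <= m)%N by rewrite leq_maxl.
have S0 := S 0%N isT; have S1 := S 1%N (ltnW m2); have S2 := S 2%N m2.
have E1 : \sum_(i < m.+1) node c m i * (bern c m i).[x] = x.
  rewrite -[RHS]expr1 -S1; apply: eq_bigr => i _; congr (_ * _).
  by case: i => -[|i] im //=; rewrite ?mulr1// /node mulr0 mul0r.
(* The second moment of the nodes is nearly x^2 and, by [E1], their mean is x: the variance about x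
   is small. *)
have D2 : \sum_(i < m.+1) node c m i ^+ 2 * (bern c m i).[x] <= x ^+ 2 + e / 2 / (K + 1).
  rewrite -S2 -lerBlDl -sumrB.
  rewrite (le_trans (ler_norm _))// (le_trans (ler_norm_sum _ _ _))//.
  rewrite -[leRHS]mulr1 -[X in _ * X](hornerC 1 x) -[1%:P](sum_bern m c1) horner_sum mulr_sumr.
  apply: ler_sum => i _; rewrite -mulrBl normrM [X in _ * X]ger0_norm ?(haus_bern hL)//.
  rewrite ler_wpM2r ?(haus_bern hL)// distrC h2//; first by rewrite leq_maxr.
  by rewrite -ltnS ltn_ord.
have -> : \sum_(i < m.+1) (e / 2 + K * (node c m i - x) ^+ 2) * (bern c m i).[x] =
  (e / 2 + K * x ^+ 2) * (\sum_(i < m.+1) wgt c 0 i m * (bern c m i).[x])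
  - 2 * K * x * (\sum_(i < m.+1) node c m i * (bern c m i).[x])
  + K * (\sum_(i < m.+1) node c m i ^+ 2 * (bern c m i).[x]).
  rewrite !mulr_sumr -sumrB -big_split /=; apply: eq_bigr => i _; ring.
rewrite S0 E1 expr0 mulr1.
have := ler_wpM2l K0 D2.
have : K * (e / 2 / (K + 1)) <= e / 2.
  rewrite mulrCA ler_piMr ?divr_ge0 ?(ltW e0)//.
  by rewrite ler_pdivrMr// mul1r lerDl.
rewrite mulrDr; nra.
Qed.

(** An upper integral over polynomial majorants, defined for every [f]. By [ext_uniq] it is the only
    value compatible with uniform approximation when [f] satisfies [ufc]. *)
Definition ext (c : R) (L : {poly R} -> R) (f : R -> R) : R :=
  inf [set L q | q in [set q : {poly R} | forall x, 0 <= x <= c -> f x <= q.[x]]]%classic.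

Section Extension.
Variables (c : R) (L : {poly R} -> R).
Hypothesis hL : haus c L.

Lemma ext_approx f q e :
  (forall x, 0 <= x <= c -> `|q.[x] - f x| <= e) -> `|ext c L f - L q| <= e * L 1.
Proof.
move=> h; rewrite /ext; set E := (X in inf X).
have Eq : E (L q + e * L 1).
  exists (q + e%:P); last by rewrite (hausD hL) (hausC hL).
  by move=> x /h /=; rewrite !hornerE ler_norml; lra.
have lb : lbound E (L q - e * L 1).
  move=> _ [r /= hr <-]; rewrite -(hausC hL) -(hausB hL).
  apply: (haus_le hL) => x hx; have := hr _ hx; have := h _ hx.
  by rewrite !hornerE ler_norml; lra.
rewrite ler_norml; apply/andP; split.
  by rewrite lerBrDl; apply: lb_le_inf; [exists (L q + e * L 1)|].
by rewrite lerBlDl; apply: ge_inf => //; exists (L q - e * L 1).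
Qed.

Lemma ext_poly q : ext c L (horner q) = L q.
Proof.
apply/eqP; rewrite -subr_eq0 -normr_le0.
have := @ext_approx (horner q) q 0; rewrite mul0r; apply => x _.
by rewrite subrr normr0.
Qed.

Lemma ext_uniq f r : ufc c f ->
  (forall e, 0 < e -> forall q, (forall x, 0 <= x <= c -> `|q.[x] - f x| <= e) ->
     `|r - L q| <= e * L 1) -> r = ext c L f.
Proof.
move=> uf h; apply/eqP; rewrite -subr_eq0 -normr_le0; apply/ler_addgt0Pr => e e0.
have [c0 _ _] := hL.
have L0 : 0 < 2 * (L 1 + 1) by rewrite mulr_gt0// ltr_wpDl// (haus1_ge0 hL).
have [q hq] := weierstrass c0 uf (divr_gt0 e0 L0).
rewrite add0r; have -> : r - ext c L f = (r - L q) - (ext c L f - L q) by ring.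
rewrite (le_trans (ler_normB _ _))//.
rewrite (le_trans (lerD (h _ (divr_gt0 e0 L0) _ hq) (ext_approx hq)))//.
have := haus1_ge0 hL => L1.
have a4 : e / (2 * (L 1 + 1)) * L 1 <= e / 2.
  rewrite invfM mulrA -mulrA ler_piMr ?divr_ge0 ?(ltW e0)//.
  by rewrite ler_pdivrMl ?ltr_wpDl// mulr1 lerDl.
lra.
Qed.

Lemma riem_ext f : ufc c f -> tends (fun N => riem c L N f) (ext c L f).
Proof.
move=> uf e e0; have [c0 _ _] := hL.
have L1 := haus1_ge0 hL.
have L0 : 0 < 3 * (L 1 + 1) by rewrite mulr_gt0// ltr_wpDl.
have e1 := divr_gt0 e0 L0.
have [q hq] := weierstrass c0 uf e1.
have [N0 h] := riem_poly hL q (divr_gt0 e0 (ltr0Sn _ 2)).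
exists N0 => N NN; have a1 := h _ NN; have a2 := ext_approx hq.
have a3 : `|riem c L N f - riem c L N (horner q)| <= e / (3 * (L 1 + 1)) * L 1.
  apply: (riem_near hL (a := fun i => f (node c N i)) (b := fun i => q.[node c N i])).
  by move=> i iN; rewrite distrC hq// node_itv// ltW.
have a4 : e / (3 * (L 1 + 1)) * L 1 <= e / 3.
  rewrite invfM mulrA -mulrA ler_piMr ?divr_ge0 ?(ltW e0)//.
  by rewrite ler_pdivrMl ?ltr_wpDl// mulr1 lerDl.
move: a1 a2 a3 a4; rewrite !ler_norml; lra.
Qed.

(** Nodes of degree N + 1 with masses of degree N: the form in which [mulX_bern] delivers the
    sums. *)
Lemma riem_shift f : ufc c f ->
  tends (fun N => \sum_(i < N.+1) f (node c N.+1 i.+1) * L (bern c N i)) (ext c L f).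
Proof.
move=> uf; apply: (tends_near (riem_ext uf)); apply: (tends_L1 hL) => e e0.
have [_ /(_ e e0)[d d0 hd]] := uf; have [c0 _ _] := hL.
have [N0 h] := tends_inv c d0; exists N0 => N /h; rewrite subr0 => hN.
apply: (riem_near hL (a := fun i => f (node c N.+1 i.+1)) (b := fun i => f (node c N i))).
move=> i iN; rewrite hd ?node_itv ?ltnS ?(ltW c0)//.
by rewrite (le_trans (node_shift (ltW c0) iN))// (le_trans (ler_norm _)).
Qed.

Lemma ext_le f g : ufc c f -> ufc c g -> (forall x, 0 <= x <= c -> f x <= g x) ->
  ext c L f <= ext c L g.
Proof.
move=> uf ug fg; apply: (tends_le _ (riem_ext uf) (riem_ext ug)) => N.
have [c0 _ _] := hL.
apply: ler_sum => i _; rewrite ler_wpM2r ?(haus_bern hL)// fg//.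
by rewrite node_itv ?(ltW c0)// -ltnS.
Qed.

Lemma ext_ge0 f : ufc c f -> (forall x, 0 <= x <= c -> 0 <= f x) -> 0 <= ext c L f.
Proof.
move=> uf f0; apply: (tends_le _ (@tends_const _ 0) (riem_ext uf)) => N.
have [c0 _ _] := hL.
apply: sumr_ge0 => i _; rewrite mulr_ge0 ?(haus_bern hL)// f0//.
by rewrite node_itv ?(ltW c0)// -ltnS.
Qed.

Lemma ext_eq f g : (forall x, 0 <= x <= c -> f x = g x) -> ext c L f = ext c L g.
Proof.
move=> fg; congr inf; apply/seteqP; split => _ [q hq <-]; exists q => //= x hx.
- by rewrite -fg// hq.
- by rewrite fg// hq.
Qed.

End Extension.

Lemma ext_le_haus c L L' f : haus c L -> haus c L' -> ufc c f ->
  (forall x, 0 <= x <= c -> 0 <= f x) ->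
  (forall q, (forall x, 0 <= x <= c -> 0 <= q.[x]) -> L q <= L' q) ->
  ext c L f <= ext c L' f.
Proof.
move=> hL hL' uf f0 LL; apply: (tends_le _ (riem_ext hL uf) (riem_ext hL' uf)) => N.
have [c0 _ _] := hL.
have nd (i : 'I_N.+1) : 0 <= node c N i <= c by rewrite node_itv ?(ltW c0)// -ltnS.
apply: ler_sum => i _; apply: ler_wpM2l; first exact: f0.
apply: LL; by move=> x hx; apply: (haus_bern (haus_eval c0 hx)).
Qed.

End Bernstein.

(** * Uniformly continuous functions on bounded intervals *)

Section UniformContinuity.
Variable R : realType.
Implicit Types (c : R) (f g : R -> R).

Lemma ufc_const c r : ufc c (fun=> r).
Proof.
split; first by exists `|r|.
by move=> e e0; exists 1 => // x y _ _ _; rewrite subrr normr0 ltW.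
Qed.

Lemma ufc_id c : ufc c id.
Proof.
split; last by move=> e e0; exists e.
by exists c => x /andP[x0 xc]; rewrite ger0_norm.
Qed.

Lemma ufcD c f g : ufc c f -> ufc c g -> ufc c (fun x => f x + g x).
Proof.
move=> [[M hM] uf] [[M' hM'] ug]; split.
  by exists (M + M') => x hx; rewrite (le_trans (ler_normD _ _))// lerD ?hM ?hM'.
move=> e e0; have e2 := divr_gt0 e0 (ltr0Sn _ 1).
have [d d0 hd] := uf _ e2; have [d' d0' hd'] := ug _ e2.
exists (Num.min d d'); first by rewrite lt_min d0.
move=> x y hx hy; rewrite le_min => /andP[xy xy'].
have := hd _ _ hx hy xy; have := hd' _ _ hx hy xy'; rewrite !ler_norml; lra.
Qed.

Lemma ufcM c f g : ufc c f -> ufc c g -> ufc c (fun x => f x * g x).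
Proof.
move=> [[M hM] uf] [[M' hM'] ug]; split.
  by exists (M * M') => x hx; rewrite normrM ler_pM ?hM ?hM'.
move=> e e0; pose K := `|M| + `|M'| + 1.
have K0 : 0 < K by rewrite ltr_wpDl// addr_ge0.
have e2 : 0 < e / 2 / K by rewrite !divr_gt0.
have [d d0 hd] := uf _ e2; have [d' d0' hd'] := ug _ e2.
exists (Num.min d d'); first by rewrite lt_min d0.
move=> x y hx hy; rewrite le_min => /andP[xy xy'].
have -> : f x * g x - f y * g y = f x * (g x - g y) + (f x - f y) * g y by ring.
rewrite (le_trans (ler_normD _ _))// [e]splitr !normrM.
have fK : `|f x| <= K.
  rewrite (le_trans (hM _ hx))// (le_trans (ler_norm _))// /K.
  by rewrite -addrA lerDl addr_ge0.
have gK : `|g y| <= K.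
  rewrite (le_trans (hM' _ hy))// (le_trans (ler_norm _))// /K.
  by rewrite addrAC lerDr addr_ge0.
have eK : e / 2 = K * (e / 2 / K) by rewrite [RHS]mulrC divfK// gt_eqF.
rewrite eK; apply: lerD; first by apply: ler_pM => //; apply: hd'.
by rewrite mulrC; apply: ler_pM => //; apply: hd.
Qed.

Lemma ufc_poly c (q : {poly R}) : ufc c (horner q).
Proof.
elim/poly_ind: q => [|q r IH].
  have -> : horner (0 : {poly R}) = (fun=> 0) by apply/funext => x; rewrite horner0.
  exact: ufc_const.
have -> : horner (q * 'X + r%:P) = (fun x => q.[x] * x + r).
  by apply/funext => x; rewrite !hornerE.
by apply: ufcD; [apply: ufcM => //; apply: ufc_id | apply: ufc_const].
Qed.

Lemma ufc_comp c c' f g : ufc c' f -> ufc c g ->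
  (forall x, 0 <= x <= c -> 0 <= g x <= c') -> ufc c (fun x => f (g x)).
Proof.
move=> [[M hM] uf] [_ ug] gc; split; first by exists M => x /gc/hM.
move=> e /uf[d d0 hd]; have [d' d0' hd'] := ug _ d0.
by exists d' => // x y hx hy xy; apply: hd; rewrite ?gc//; apply: hd'.
Qed.

Lemma ufc_sub c c' f : c <= c' -> ufc c' f -> ufc c f.
Proof.
move=> cc [[M hM] uf].
have H x : 0 <= x <= c -> 0 <= x <= c' by move=> /andP[-> /le_trans ->].
split; first by exists M => x /H/hM.
by move=> e /uf[d d0 hd]; exists d => // x y /H hx /H hy; apply: hd.
Qed.

(** Divide by u + v and use t <= t^s on [0, 1]. *)
Lemma powR_subadd (s u v : R) : 0 < s <= 1 -> 0 <= u -> 0 <= v ->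
  (u + v) `^ s <= u `^ s + v `^ s.
Proof.
move=> /andP[s0 s1] u0 v0; have [uv|uv] := eqVneq (u + v) 0.
  by rewrite uv powR0 ?gt_eqF// addr_ge0// powR_ge0.
have w0 : 0 < u + v by rewrite lt_neqAle eq_sym uv addr_ge0.
have H t : 0 <= t <= u + v -> t / (u + v) <= t `^ s / (u + v) `^ s.
  move=> /andP[t0 tw]; have [->|tn] := eqVneq t 0.
    by rewrite mul0r divr_ge0// powR_ge0.
  have tp : 0 < t by rewrite lt_neqAle eq_sym tn.
  have -> : t `^ s / (u + v) `^ s = (t / (u + v)) `^ s.
    by rewrite powRM ?invr_ge0 ?(ltW w0)// -[in RHS]powR_inv1 ?(ltW w0)// powRAC powR_inv1 ?powR_ge0.
  apply: ger1_powR => //; rewrite divr_gt0//= ler_pdivrMr// mul1r//.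
have hu := H u; have hv := H v.
have : 1 <= (u `^ s + v `^ s) / (u + v) `^ s.
  rewrite -(@divff _ (u + v)) ?gt_eqF// !mulrDl lerD// ?hu ?hv ?u0 ?v0 ?lerDl ?lerDr//.
by rewrite ler_pdivlMr ?powR_gt0// mul1r.
Qed.

Lemma ufc_powR1 c s : 0 < s <= 1 -> ufc c (fun x => x `^ s).
Proof.
move=> s1; have /andP[s0 _] := s1; split.
  exists (c `^ s) => x /andP[x0 xc]; rewrite ger0_norm ?powR_ge0//.
  by rewrite ge0_ler_powR ?nnegrE ?(ltW s0)// (le_trans x0).
move=> e e0; exists (e `^ s^-1); first exact: powR_gt0.
have H x y : 0 <= y -> y <= x -> x - y <= e `^ s^-1 -> `|x `^ s - y `^ s| <= e.
  move=> y0 yx xy; rewrite ger0_norm; last first.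
    by rewrite subr_ge0 ge0_ler_powR ?nnegrE ?(ltW s0)// (le_trans y0).
  rewrite lerBlDl -[in leLHS](subrK y x) addrC.
  rewrite (le_trans (powR_subadd s1 y0 _)) ?subr_ge0// lerD2l.
  rewrite (@le_trans _ _ ((e `^ s^-1) `^ s))//.
    by rewrite ge0_ler_powR ?nnegrE ?(ltW s0) ?powR_ge0 ?subr_ge0.
  by rewrite -powRrM mulVf ?gt_eqF// powRr1// ltW.
move=> x y /andP[x0 _] /andP[y0 _]; have [yx|xy] := leP y x.
  by rewrite ger0_norm ?subr_ge0//; apply: H.
rewrite distrC [X in _ -> X <= _]distrC ger0_norm; last by rewrite subr_ge0 ltW.
by move=> yx; exact: (H y x x0 (ltW xy) yx).
Qed.

Lemma ufc_ext c f g : (forall x, 0 <= x <= c -> f x = g x) -> ufc c f -> ufc c g.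
Proof.
move=> fg [[M hM] uf]; split; first by exists M => x hx; rewrite -fg// hM.
by move=> e /uf[d d0 hd]; exists d => // x y hx hy; rewrite -!fg//; apply: hd.
Qed.

Lemma ufc_powR c s : 0 <= s -> ufc c (fun x => x `^ s).
Proof.
(* Induction on an integer bound of [s], through t^s = t * t^(s-1). *)
move=> s0; have [n sn] : exists n, s <= n%:R.
  by exists (Num.bound s); rewrite ltW// (archi_boundP s0).
elim: n s s0 sn => [|n IH] s s0 sn.
  have -> : s = 0 by apply: le_anti; rewrite s0 sn.
  by apply: (ufc_ext _ (@ufc_const c 1)) => x _; rewrite powRr0.
have [->|sn0] := eqVneq s 0.
  by apply: (ufc_ext _ (@ufc_const c 1)) => x _; rewrite powRr0.
have sp : 0 < s by rewrite lt_neqAle eq_sym sn0.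
have [s1|s1] := leP s 1; first by apply: ufc_powR1; rewrite sp.
apply: (ufc_ext (f := fun x => x * x `^ (s - 1))) => [x /andP[x0 _]|].
  by rewrite mulr_powRB1.
apply: ufcM; first exact: ufc_id.
by apply: IH; [rewrite subr_ge0 ltW | rewrite lerBlDr natr1].
Qed.

End UniformContinuity.

Section Young.
Variable R : realType.

(* Minimizing over [l] turns the additive Young bound into a product. *)
Lemma young_homog (T A B s s' : R) : 0 <= A -> 0 <= B -> 0 < s -> 0 < s' ->
  s^-1 + s'^-1 = 1 ->
  (forall l : R, 0 < l -> T <= l `^ s * A / s + l `^ (- s') * B / s') ->
  T <= A `^ s^-1 * B `^ s'^-1.
Proof.
move=> A0 B0 s0 s0' ss h.
(* For A = 0 or B = 0 one term disappears and [l] is sent to infinity or to 0. *)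
have S0 : forall K r, 0 <= K -> 0 < r -> (forall l, 0 < l -> T <= l `^ r * K) -> T <= 0.
  move=> K r K0 r0 hT; apply/ler_addgt0Pr => e e0; rewrite add0r.
  have K1 : 0 < K + 1 by rewrite ltr_wpDl.
  apply: le_trans (hT ((e / (K + 1)) `^ r^-1) _) _; first by rewrite powR_gt0// divr_gt0.
  rewrite -powRrM mulVf ?gt_eqF// powRr1 ?divr_ge0 ?(ltW e0) ?(ltW K1)//.
  by rewrite mulrAC ler_pdivrMr// ler_wpM2l ?(ltW e0)// lerDl.
have inv (l : R) : 0 < l -> 0 < l^-1 by rewrite invr_gt0.
have [A1|A1] := eqVneq A 0.
  rewrite A1 powR0 ?mul0r ?invr_neq0 ?gt_eqF//.
  apply: (S0 (B / s') s') => //; first by rewrite divr_ge0// ltW.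
  move=> l l0; have := h l^-1 (inv l l0).
  by rewrite A1 mulr0 mul0r add0r -[l^-1]powR_inv1 ?(ltW l0)// -powRrM mulN1r opprK mulrA.
have [B1|B1] := eqVneq B 0.
  rewrite B1 powR0 ?mulr0 ?invr_neq0 ?gt_eqF//.
  apply: (S0 (A / s) s) => //; first by rewrite divr_ge0// ltW.
  by move=> l l0; have := h l l0; rewrite B1 mulr0 mul0r addr0 mulrA.
have Ap : 0 < A by rewrite lt_neqAle eq_sym A1.
have Bp : 0 < B by rewrite lt_neqAle eq_sym B1.
set P := A `^ s^-1 * B `^ s'^-1.
have P0 : 0 < P by rewrite mulr_gt0 ?powR_gt0.
(* This [l] makes l^s A equal to [P], and then l^(-s') B equals [P] as well because s and s' are
   conjugate. *)
have := h ((P / A) `^ s^-1); rewrite powR_gt0 ?divr_gt0// => /(_ isT).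
rewrite -!powRrM mulVf ?gt_eqF// powRr1 ?divr_ge0 ?(ltW P0) ?(ltW Ap)//.
rewrite divfK ?gt_eqF//.
have s1 : s != 0 by rewrite gt_eqF.
have s1' : s' != 0 by rewrite gt_eqF.
have -> : (P / A) `^ (s^-1 * - s') = P / B.
  have -> : s^-1 * - s' = 1 - s'.
    have : (s^-1 + s'^-1) * s' = s' by rewrite ss mul1r.
    by rewrite mulrDl mulVf//; lra.
  have PA : P / A = B `^ s'^-1 * A `^ (s^-1 - 1).
    rewrite powRB; last by rewrite A1 implybT.
    by rewrite powRr1// /P mulrCA mulrA.
  have As : s^-1 - 1 = - s'^-1 by rewrite -ss; ring.
  rewrite PA As powRM ?powR_ge0// -!powRrM mulrBr mulr1 mulVf//.
  rewrite -[- s'^-1 * _]/(_) mulNr mulrBr mulr1 mulVf// opprB.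
  have -> : 1 - s'^-1 = s^-1 by rewrite -ss; ring.
  rewrite mulrC /P -[RHS]mulrA; congr (_ * _).
  by rewrite powRB ?powRr1// B1 implybT.
rewrite divfK ?gt_eqF// -mulrDr ss mulr1.
by [].
Qed.

End Young.

Global Opaque ext bern.

(** * Tracial *-algebras and their L_p norms *)

(* Real scalars suffice: only traces of self-adjoint elements are ever compared. *)
Record tralg (R : realType) := TrAlg {
  ta_sort :> algType R;
  ast : ta_sort -> ta_sort;
  tau : ta_sort -> R;
  astP : forall r x y, ast (r *: x + y) = r *: ast x + ast y;
  astK : involutive ast;
  astM : forall x y, ast (x * y) = ast y * ast x;
  tauP : forall r x y, tau (r *: x + y) = r * tau x + tau y;
  tau_ast : forall x, tau (ast x) = tau x;
  tauC : forall x y, tau (x * y) = tau (y * x);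
  tau_ge0 : forall x, 0 <= tau (ast x * x);
  tau_bdd : forall x, exists c, forall y,
    tau (ast (x * y) * (x * y)) <= c * tau (ast y * y) }.

Notation "x ^#" := (ast x) : ring_scope.

Section Basics.
Variables (R : realType) (A : tralg R).
Implicit Types (x y z h k : A) (p q : {poly R}).

Lemma tau0 : tau (0 : A) = 0.
Proof.
have := tauP 1 0 (0 : A); rewrite scale1r addr0 mul1r => /esym/eqP.
by rewrite -subr_eq0 addrK => /eqP.
Qed.

Lemma tauZ r x : tau (r *: x) = r * tau x.
Proof. by rewrite -[r *: x]addr0 tauP tau0 addr0. Qed.

Lemma tauD x y : tau (x + y) = tau x + tau y.
Proof. by rewrite -[x]scale1r tauP mul1r scale1r. Qed.

Lemma tauN x : tau (- x) = - tau x.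
Proof. by rewrite -scaleN1r tauZ mulN1r. Qed.

Lemma tauB x y : tau (x - y) = tau x - tau y.
Proof. by rewrite tauD tauN. Qed.

Lemma tau_sum I (s : seq I) P (F : I -> A) :
  tau (\sum_(i <- s | P i) F i) = \sum_(i <- s | P i) tau (F i).
Proof. exact: (big_morph _ tauD tau0). Qed.

Lemma ast0 : (0 : A)^# = 0.
Proof.
have := astP 1 0 (0 : A); rewrite !scale1r addr0 => /esym/eqP.
by rewrite -subr_eq0 addrK => /eqP.
Qed.

Lemma astZ r x : (r *: x)^# = r *: x^#.
Proof. by rewrite -[r *: x]addr0 astP ast0 addr0. Qed.

Lemma astD x y : (x + y)^# = x^# + y^#.
Proof. by rewrite -[x]scale1r astP !scale1r. Qed.

Lemma astN x : (- x)^# = - x^#.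
Proof. by rewrite -scaleN1r astZ scaleN1r. Qed.

Lemma astB x y : (x - y)^# = x^# - y^#.
Proof. by rewrite astD astN. Qed.

Lemma ast1 : (1 : A)^# = 1.
Proof. by rewrite -[1^#]mul1r -{1}[1]astK -astM mul1r astK. Qed.

Lemma ast_sum I (s : seq I) P (F : I -> A) :
  (\sum_(i <- s | P i) F i)^# = \sum_(i <- s | P i) (F i)^#.
Proof. exact: (big_morph _ astD ast0). Qed.

Lemma astX x n : (x ^+ n)^# = x^# ^+ n.
Proof. by elim: n => [|n IH]; rewrite ?expr0 ?ast1// exprS astM IH -exprSr. Qed.

Definition pos h : Prop := h^# = h /\ forall y, 0 <= tau (y^# * h * y).

Lemma pos_sq x : pos (x^# * x).
Proof.
split=> [|y]; first by rewrite astM astK.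
by rewrite !mulrA -astM -mulrA tau_ge0.
Qed.

Lemma pos_sq' x : pos (x * x^#).
Proof. by rewrite -{1}[x]astK; apply: pos_sq. Qed.

Lemma pos0 : pos 0.
Proof. by split=> [|y]; rewrite ?ast0// mulr0 mul0r tau0. Qed.

Lemma pos1 : pos 1.
Proof. by split=> [|y]; rewrite ?ast1// mulr1 tau_ge0. Qed.

Lemma posD h k : pos h -> pos k -> pos (h + k).
Proof.
move=> [h1 h2] [k1 k2]; split=> [|y]; first by rewrite astD h1 k1.
by rewrite mulrDr mulrDl tauD addr_ge0.
Qed.

Lemma posZ r h : 0 <= r -> pos h -> pos (r *: h).
Proof.
move=> r0 [h1 h2]; split=> [|y]; first by rewrite astZ h1.
by rewrite -scalerAr -scalerAl tauZ mulr_ge0.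
Qed.

Lemma pos_conj h y : pos h -> pos (y^# * h * y).
Proof.
move=> [h1 h2]; split=> [|z]; first by rewrite !astM astK h1 mulrA.
by have := h2 (y * z); rewrite astM !mulrA.
Qed.

Lemma pos_conj' h y : pos h -> pos (y * h * y^#).
Proof. by move=> /(pos_conj y^#); rewrite astK. Qed.

Lemma pos_tau h : pos h -> 0 <= tau h.
Proof. by move=> [_ /(_ 1)]; rewrite ast1 mul1r mulr1. Qed.

(* Cauchy-Schwarz for the form [u, v |-> tau (u e v^#)], in AM-GM shape *)
Lemma tau_amgm e x y l : pos e -> 0 < l ->
  2 * tau (x * e * y) <= l * tau (x * e * x^#) + l^-1 * tau (y^# * e * y).
Proof.
move=> [e1 e2] l0; have := e2 (l *: x^# - y).
rewrite astB astZ astK !mulrBl !mulrBr.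
rewrite -!scalerAl -!scalerAr !tauB !tauZ.
have -> : tau (y^# * e * x^#) = tau (x * e * y).
  by rewrite -tau_ast !astM !astK e1 mulrA.
move=> H; rewrite -(ler_pM2l l0) mulrDr !mulrA divff ?gt_eqF// mul1r; lra.
Qed.

Lemma tau_amgm1 x y l : 0 < l ->
  2 * tau (x * y) <= l * tau (x * x^#) + l^-1 * tau (y^# * y).
Proof. by move=> /(tau_amgm x y pos1); rewrite !mulr1. Qed.

Definition bnd (c : R) h : Prop := [/\ 0 < c, pos h & pos (c%:A - h)].

Lemma pos_bnd h : pos h -> exists c, bnd c h.
Proof.
move=> hp; have [h1 h2] := hp.
have [c hc] := tau_bdd h.
pose d := `|c| + 1.
have d0 : 0 < d by rewrite ltr_wpDl.
exists d; split=> //; split=> [|y]; first by rewrite astB astZ ast1 h1.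
rewrite mulrBr mulrBl -scalerAr mulr1 -scalerAl tauB tauZ subr_ge0.
have := tau_amgm1 y^# (h * y) d0.
rewrite mulrA astK => H; have := hc y => Hc.
have Y := tau_ge0 y.
have : d^-1 * tau ((h * y)^# * (h * y)) <= tau (y^# * y).
  rewrite ler_pdivrMl//; apply: le_trans Hc _; rewrite ler_wpM2r//.
  by rewrite (le_trans (ler_norm _))// lerDl.
have : tau (y^# * y) <= d * tau (y^# * y) by rewrite ler_peMl// lerDr.
lra.
Qed.

Lemma bnd_le c c' h : c <= c' -> bnd c h -> bnd c' h.
Proof.
move=> cc [c0 hp hc]; split=> //; first exact: lt_le_trans cc.
have -> : c'%:A - h = (c' - c)%:A + (c%:A - h) by rewrite scalerBl addrA subrK.
by apply: posD => //; apply: posZ; rewrite ?subr_ge0//; apply: pos1.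
Qed.

(* Riesz: [k (n+1) = k n - k n ^ 2] writes a positive contraction as a sum of
   squares up to a term tending to zero. *)
Fixpoint riesz k n : A := if n is n'.+1 then riesz k n' - riesz k n' ^+ 2 else k.

(** u - u^2 = u (1 - u) u + (1 - u) u (1 - u). *)
Lemma riesz_pos k n : pos k -> pos (1 - k) -> pos (riesz k n) /\ pos (1 - riesz k n).
Proof.
move=> k0 k1; elim: n => [//|n [IH0 IH1]] /=.
set u := riesz k n in IH0 IH1 *; have [u1 _] := IH0; have [v1 _] := IH1.
split.
  have -> : u - u ^+ 2 = u * (1 - u) * u + (1 - u) * u * (1 - u).
    rewrite -!mulrA mulrBl mul1r !mulrBr !mulrBl !mulr1 !mul1r expr2.
    by rewrite [RHS]addrC subrK.
  by apply: posD; [rewrite -{1}u1 | rewrite -{1}v1]; apply: pos_conj.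
rewrite opprB addrCA addrC; apply: posD => //.
by rewrite expr2 -{1}u1; apply: pos_sq.
Qed.

(** There is no square root of [k] to move around. After scaling [k] below 1, suppose the trace is
    -d < 0. Subtracting the squares of the Riesz iterates keeps it at most -d, so by Cauchy-Schwarz
    each square has trace at least d^2 / K, and their sum exceeds the trace of [k]. *)
Lemma tau_pos_mul h k : pos h -> pos k -> 0 <= tau (h * k).
Proof.
move=> h0 kp; have [c [c0 _ kc]] := pos_bnd kp.
suff : forall k, pos k -> pos (1 - k) -> 0 <= tau (h * k).
  move=> /(_ (c^-1 *: k)); rewrite -scalerAr tauZ pmulr_rge0 ?invr_gt0//; apply.
    by apply: posZ; rewrite // invr_ge0 ltW.
  have -> : 1 - c^-1 *: k = c^-1 *: (c%:A - k).
    by rewrite scalerBr scalerA mulVf ?gt_eqF// scale1r.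
  by apply: posZ => //; rewrite invr_ge0 ltW.
move=> {c c0 kc kp}k k0 k1; rewrite leNgt; apply/negP => hk.
pose d := - tau (h * k); have d0 : 0 < d by rewrite oppr_gt0.
have P n := riesz_pos n k0 k1.
have S n : tau (h * riesz k n) <= - d.
  elim: n => [|n IH] /=; first by rewrite opprK.
  rewrite mulrBr tauB lerBlDr (le_trans IH)// lerDl.
  have [[u1 _] _] := P n; have [h1 h2] := h0.
  by rewrite expr2 mulrA tauC mulrA -{1}u1.
have T n : tau (riesz k n) + \sum_(i < n) tau (riesz k i ^+ 2) = tau k.
  elim: n => [|n IH]; first by rewrite big_ord0 addr0.
  by rewrite big_ord_recr /= tauB addrA addrAC subrK.
have [h1 _] := h0.
pose K := tau (h * h) + 1.
have K0 : 0 < K by rewrite ltr_wpDl//; have := tau_ge0 h; rewrite h1.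
have Q n : d ^+ 2 / K <= tau (riesz k n ^+ 2).
  have [[u1 _] _] := P n.
  have l0 : 0 < d / K by rewrite divr_gt0.
  have := tau_amgm1 (- h) (riesz k n) l0.
  rewrite astN h1 u1 mulrNN mulNr tauN -expr2 invf_div => H.
  have : d / K * tau (h * h) <= d.
    by rewrite mulrAC ler_pdivrMr// ler_wpM2l ?(ltW d0)// lerDl.
  have HS := S n => Hd.
  have : d <= K / d * tau (riesz k n ^+ 2) by rewrite -expr2 in H *; lra.
  by rewrite mulrAC ler_pdivlMr// -expr2 ler_pdivrMr// mulrC.
have [n hn] : exists n : nat, tau k < n%:R * (d ^+ 2 / K).
  have e0 : 0 < d ^+ 2 / K by rewrite divr_gt0// exprn_gt0.
  exists (Num.bound (tau k / (d ^+ 2 / K))); rewrite -ltr_pdivrMr//.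
  by rewrite archi_boundP// divr_ge0// ?(ltW e0)// pos_tau.
have : n%:R * (d ^+ 2 / K) <= \sum_(i < n) tau (riesz k i ^+ 2).
  rewrite mulr_natl -[X in _ *+ X]card_ord -sumr_const; apply: ler_sum => i _; exact: Q.
have := T n; have := pos_tau (P n).1; lra.
Qed.

Definition pev h q : A := horner_alg h q.

Lemma pevD h p q : pev h (p + q) = pev h p + pev h q.
Proof. exact: rmorphD. Qed.
Lemma pevB h p q : pev h (p - q) = pev h p - pev h q.
Proof. exact: rmorphB. Qed.
Lemma pevM h p q : pev h (p * q) = pev h p * pev h q.
Proof. exact: rmorphM. Qed.
Lemma pevX h : pev h 'X = h.
Proof. exact: horner_algX. Qed.
Lemma pev1 h : pev h 1 = 1.
Proof. exact: rmorph1. Qed.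
Lemma pevC h r : pev h r%:P = r%:A.
Proof. exact: horner_algC. Qed.
Lemma pevZ h r q : pev h (r *: q) = r *: pev h q.
Proof. by rewrite -mul_polyC pevM pevC mulr_algl. Qed.
Lemma pevXn h n : pev h 'X^n = h ^+ n.
Proof. by rewrite /pev rmorphXn /= horner_algX. Qed.
Lemma pev_sum h I (s : seq I) P F :
  pev h (\sum_(i <- s | P i) F i) = \sum_(i <- s | P i) pev h (F i).
Proof. exact: rmorph_sum. Qed.
Lemma pevCM h p q : pev h p * pev h q = pev h q * pev h p.
Proof. by rewrite -!pevM mulrC. Qed.

Lemma pevE h q : pev h q = \sum_(k < size q) q`_k *: h ^+ k.
Proof.
rewrite -{1}[q]coefK poly_def pev_sum; apply: eq_bigr => i _.
by rewrite pevZ pevXn.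
Qed.

Lemma pev_ast h q : (pev h q)^# = pev h^# q.
Proof. by rewrite !pevE ast_sum; apply: eq_bigr => i _; rewrite astZ astX. Qed.

Lemma pev_sa h q : h^# = h -> (pev h q)^# = pev h q.
Proof. by move=> {2}<-; rewrite pev_ast. Qed.

Lemma pev_comp h p q : pev (pev h q) p = pev h (p \Po q).
Proof.
rewrite pevE comp_polyE pev_sum; apply: eq_bigr => i _.
by rewrite pevZ /pev rmorphXn.
Qed.

Lemma pev_swap x q : pev (x * x^#) q * x = x * pev (x^# * x) q.
Proof.
rewrite !pevE mulr_suml mulr_sumr; apply: eq_bigr => i _.
rewrite -scalerAl -scalerAr; congr (_ *: _).
elim: (i : nat) => [|n IH]; first by rewrite !expr0 mulr1 mul1r.
by rewrite exprSr -mulrA -[x * x^# * x]mulrA [_ * (x * _)]mulrA IH -mulrA -exprSr.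
Qed.

Lemma pos_pev_sq h u e : h^# = h -> pos (pev h e) -> pos (pev h (u * e * u)).
Proof. by move=> h1 he; rewrite !pevM -{1}(pev_sa u h1); apply: pos_conj. Qed.

(** The even parts of the exponents form a square around 1, 'X, k or 'X k, where k = c - 'X; and 'X
    k = c^-1 ('X k 'X + k 'X k). *)
Lemma pos_pev_ij c h i j : bnd c h -> pos (pev h ('X^i * (c%:P - 'X) ^+ j)).
Proof.
move=> [c0 hp hc]; have [h1 _] := hp.
pose k : {poly R} := c%:P - 'X.
have kE : pev h k = c%:A - h by rewrite pevB pevC pevX.
have -> : 'X^i * (c%:P - 'X) ^+ j = ('X^(i./2) * k ^+ (j./2)) *
   ('X^(odd i) * k ^+ (odd j)) * ('X^(i./2) * k ^+ (j./2)).
  rewrite -{1}(odd_double_half i) -{1}(odd_double_half j) -!addnn !exprD -/k; ring.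
apply: pos_pev_sq => //.
case: (odd i); case: (odd j); rewrite ?expr1 ?expr0 ?mul1r ?mulr1 ?pevX ?pev1 ?kE//; last exact: pos1.
have -> : 'X * k = c^-1 *: ('X * k * 'X + k * 'X * k).
  have -> : 'X * k * 'X + k * 'X * k = c *: ('X * k).
    rewrite -mul_polyC /k; ring.
  by rewrite scalerA mulVf ?gt_eqF// scale1r.
rewrite pevZ; apply: posZ; first by rewrite invr_ge0 ltW.
by rewrite pevD; apply: posD; apply: pos_pev_sq; rewrite ?pevX ?kE.
Qed.

(** The substitute for the spectral measure of [h] weighted by [k]. *)
Lemma haus_tau c h k : bnd c h -> pos k -> haus c (fun q => tau (k * pev h q)).
Proof.
move=> hc kp; have [c0 _ _] := hc; split=> // [r p q|i j].
  by rewrite pevD pevZ mulrDr -scalerAr tauD tauZ.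
by apply: tau_pos_mul => //; apply: pos_pev_ij.
Qed.

Lemma pos_pev c h q : bnd c h -> (forall t : R, 0 <= t <= c -> 0 <= q.[t]) -> pos (pev h q).
Proof.
move=> hc q0; have [_ [h1 _] _] := hc; split=> [|y]; first exact: pev_sa.
have := haus_ge0 (haus_tau hc (pos_sq' y)) q0.
by rewrite [tau (y^# * _ * _)]tauC mulrA.
Qed.

End Basics.

Global Opaque pev.

Section ExtLin.
Variables (R : realType) (c : R) (L : {poly R} -> R).
Hypothesis hL : haus c L.

Lemma tends_uniq (u : nat -> R) l m : tends u l -> tends u m -> l = m.
Proof. by move=> ul um; apply/le_anti; rewrite (tends_le _ ul um) ?(tends_le _ um ul). Qed.

Lemma extD f g : ufc c f -> ufc c g ->
  ext c L (fun x => f x + g x) = ext c L f + ext c L g.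
Proof.
move=> uf ug; apply: (tends_uniq (riem_ext hL (ufcD uf ug))).
apply: (tends_ext _ (tendsD (riem_ext hL uf) (riem_ext hL ug))) => N.
by rewrite /riem -big_split /=; apply: eq_bigr => i _; rewrite mulrDl.
Qed.

Lemma extZ r f : ufc c f -> ext c L (fun x => r * f x) = r * ext c L f.
Proof.
move=> uf; apply: (tends_uniq (riem_ext hL (ufcM (ufc_const c r) uf))).
apply: (tends_ext _ (tendsZ r (riem_ext hL uf))) => N.
by rewrite /riem mulr_sumr; apply: eq_bigr => i _; rewrite mulrA.
Qed.

Lemma ext_sub c' f : c <= c' -> ufc c' f -> haus c' L -> ext c L f = ext c' L f.
Proof.
move=> cc uf hL'; apply/esym/(ext_uniq hL); first exact: ufc_sub cc uf.
move=> e e0 q hq; apply/ler_addgt0Pr => d d0.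
have L0 : 0 < 2 * (L 1 + 1) by rewrite mulr_gt0// ltr_wpDl// (haus1_ge0 hL).
have d1 := divr_gt0 d0 L0; have [c0' _ _] := hL'.
have [q' hq'] := weierstrass c0' uf d1.
have E1 := ext_approx hL' hq'.
have E2 : `|L (q' - q)| <= (d / (2 * (L 1 + 1)) + e) * L 1.
  apply: (haus_norm hL) => x hx; have hx' : 0 <= x <= c'.
    by move: hx => /andP[-> /le_trans ->].
  have := hq x hx; have := hq' x hx'; rewrite !hornerE !ler_norml; lra.
have L1 := haus1_ge0 hL.
have a4 : d / (2 * (L 1 + 1)) * L 1 <= d / 2.
  rewrite invfM mulrA -mulrA ler_piMr ?divr_ge0 ?(ltW d0)//.
  by rewrite ler_pdivrMl ?ltr_wpDl// mulr1 lerDl.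
move: E2; rewrite (hausB hL) mulrDl => E2.
have -> : ext c' L f - L q = (ext c' L f - L q') + (L q' - L q) by ring.
rewrite (le_trans (ler_normD _ _))//; lra.
Qed.

End ExtLin.

(** * Traces of functions of a positive element *)

Section Powers.
Variables (R : realType) (A : tralg R).
Implicit Types (x y z w h k : A) (p q : {poly R}) (f g : R -> R).

Definition uf f := forall c, ufc c f.

(* A bound of [h], arbitrary among those that exist ([1] if [h] is not positive). *)
Definition cbnd h : R := xget 1 [set c | bnd c h]%classic.

Lemma cbndP h : pos h -> bnd (cbnd h) h.
Proof. by move=> /pos_bnd[c hc]; apply: (@xgetPex _ 1 [set c | bnd c h]%classic); exists c. Qed.

(* The trace of [k f(h)], for positive [h] and [k]. *)
Definition tex k h f : R := ext (cbnd h) (fun q => tau (k * pev h q)) f.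

Lemma texU k h f : tex k h f = ext (cbnd h) (fun q => tau (k * pev h q)) f.
Proof. by []. Qed.

(** Since every bound of [h] gives the same value, two elements can be compared on a common
    interval. *)
Lemma texE c k h f : bnd c h -> pos k -> uf f ->
  tex k h f = ext c (fun q => tau (k * pev h q)) f.
Proof.
move=> hc kp u; have hp : pos h by case: hc.
have hc' := cbndP hp; have H := haus_tau hc kp; have H' := haus_tau hc' kp.
rewrite texU; have [cc|cc] := leP (cbnd h) c; first exact: ext_sub.
by apply/esym/ext_sub => //; exact: ltW.
Qed.

Section Fixed.
Variables (h k : A).
Hypotheses (hp : pos h) (kp : pos k).
Let hc := cbndP hp.
Let hL := haus_tau hc kp.
Let c0 : 0 < cbnd h. Proof. by case: hc. Qed.

Lemma tex_poly q : tex k h (horner q) = tau (k * pev h q).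
Proof. exact: (ext_poly hL). Qed.

Lemma tex_le f g : uf f -> uf g -> (forall t, 0 <= t -> f t <= g t) ->
  tex k h f <= tex k h g.
Proof. by move=> u v fg; apply: (ext_le hL) => // t /andP[t0 _]; apply: fg. Qed.

Lemma tex_ge0 f : uf f -> (forall t, 0 <= t -> 0 <= f t) -> 0 <= tex k h f.
Proof. by move=> u f0; apply: (ext_ge0 hL) => // t /andP[t0 _]; apply: f0. Qed.

Lemma tex_eq f g : (forall t, 0 <= t -> f t = g t) -> tex k h f = tex k h g.
Proof. by move=> fg; apply: ext_eq => t /andP[t0 _]; apply: fg. Qed.

Lemma texD f g : uf f -> uf g -> tex k h (fun t => f t + g t) = tex k h f + tex k h g.
Proof. by move=> u v; apply: (extD hL). Qed.

Lemma texZ (r : R) f : uf f -> tex k h (fun t => r * f t) = r * tex k h f.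
Proof. by move=> u; apply: (extZ hL). Qed.

Lemma tex_id : tex k h id = tau (k * h).
Proof. by rewrite -{2}(pevX h) -tex_poly; apply: tex_eq => t _; rewrite hornerX. Qed.

Lemma tex_near c f q e : bnd c h -> uf f ->
  (forall t, 0 <= t <= c -> `|q.[t] - f t| <= e) ->
  `|tex k h f - tau (k * pev h q)| <= e * tau k.
Proof.
move=> hc' u hq; rewrite (texE hc' kp u).
by have := ext_approx (haus_tau hc' kp) hq; rewrite pev1 mulr1.
Qed.

End Fixed.

Lemma tex_kle k k' h f : pos h -> pos k -> pos (k' - k) -> uf f ->
  (forall t, 0 <= t -> 0 <= f t) -> tex k h f <= tex k' h f.
Proof.
move=> hp kp kk u f0; have hc := cbndP hp.
have kp' : pos k' by rewrite -(subrK k k'); apply: posD.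
apply: (ext_le_haus (haus_tau hc kp) (haus_tau hc kp')) => // [t /andP[t0 _]|q q0].
  exact: f0.
by rewrite -subr_ge0 -tauB -mulrBl tau_pos_mul//; apply: pos_pev hc _.
Qed.

Lemma tex_kD k k' h f : pos h -> pos k -> pos k' -> uf f ->
  tex (k + k') h f = tex k h f + tex k' h f.
Proof.
move=> hp kp kp' u; have hc := cbndP hp.
have H := haus_tau hc kp; have H' := haus_tau hc kp'.
have H2 := haus_tau hc (posD kp kp').
apply: (tends_uniq (riem_ext H2 (u _))).
apply: (tends_ext _ (tendsD (riem_ext H (u _)) (riem_ext H' (u _)))) => N.
rewrite /riem -big_split /=; apply: eq_bigr => i _.
by rewrite mulrDl tauD mulrDr.
Qed.

Lemma uf_comp f g : uf f -> uf g -> (forall t, 0 <= t -> 0 <= g t) ->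
  uf (fun t => f (g t)).
Proof.
move=> u v g0 c; have [[M hM] _] := v c.
apply: (ufc_comp (c' := M)) => // t ht; have /andP[t0 _] := ht.
by rewrite g0// (le_trans (ler_norm _))// hM.
Qed.

Lemma uf_poly q : uf (horner q). Proof. by move=> c; apply: ufc_poly. Qed.
Lemma uf_powR (s : R) : 0 <= s -> uf (fun t => t `^ s).
Proof. by move=> s0 c; apply: ufc_powR. Qed.
Lemma ufD f g : uf f -> uf g -> uf (fun t => f t + g t).
Proof. by move=> u v c; apply: ufcD. Qed.
Lemma ufM f g : uf f -> uf g -> uf (fun t => f t * g t).
Proof. by move=> u v c; apply: ufcM. Qed.
Lemma uf_const (r : R) : uf (fun=> r). Proof. by move=> c; apply: ufc_const. Qed.
Lemma uf_id : uf id. Proof. by move=> c; apply: ufc_id. Qed.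

(** Substitution rule: an approximant of [f] on the range of [r], composed with [r], approximates
    the composite on [0, cbnd h]. Asking for r >= 0 on that interval only makes the rule fit the
    approximants in the duality lemmas. *)
Lemma tex_comp_itv k h f (r : {poly R}) : pos h -> pos k -> uf f ->
  ufc (cbnd h) (fun t => f r.[t]) -> (forall t, 0 <= t <= cbnd h -> 0 <= r.[t]) ->
  pos (pev h r) /\ tex k (pev h r) f = tex k h (fun t => f r.[t]).
Proof.
move=> hp kp u uc r0; have hc := cbndP hp; have [c0 _ _] := hc.
have rp : pos (pev h r) by apply: (pos_pev hc).
split=> //.
have [[M0 hM0] _] := ufc_poly (cbnd h) r.
pose M := `|M0| + 1; have M1 : 0 < M by rewrite ltr_wpDl.
have hM t : 0 <= t <= cbnd h -> 0 <= r.[t] <= M.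
  move=> ht; have /andP[t0 _] := ht; rewrite r0//.
  rewrite (le_trans (ler_norm _))// (le_trans (hM0 _ ht))//.
  by rewrite (le_trans (ler_norm _))// lerDl.
have hb : bnd M (pev h r).
  split=> //; rewrite -(pevC h) -pevB; apply: (pos_pev hc) => t /hM /andP[_ tM].
  by rewrite !hornerE subr_ge0.
have H := haus_tau hc kp; have H' := haus_tau hb kp.
rewrite (texE hb kp u); apply: (ext_uniq H uc) => e e0 q hq.
apply/ler_addgt0Pr => d d0.
have k1 : 0 < tau k + 1 by rewrite ltr_wpDl// pos_tau.
have d1 := divr_gt0 d0 k1.
have d2 := divr_gt0 d1 (ltr0Sn _ 1).
have [q' hq'] := weierstrass M1 (u M) d2.
have E1 := ext_approx H' hq'.
have E2 : `|tau (k * pev h (q' \Po r)) - tau (k * pev h q)| <=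
    (d / (tau k + 1) / 2 + e) * tau k.
  rewrite -(hausB H).
  apply: le_trans (haus_norm H (M := d / (tau k + 1) / 2 + e) _) _; last first.
    by rewrite pev1 mulr1.
  move=> t ht; have := hq' _ (hM _ ht); have := hq _ ht.
  by rewrite !hornerE horner_comp !ler_norml; lra.
move: E1 E2; rewrite pev_comp pev1 mulr1 => E1 E2.
have K0 := pos_tau kp.
have a4 : d / (tau k + 1) / 2 * tau k <= d / 2.
  rewrite mulrAC ler_wpM2r ?invr_ge0// mulrAC ler_pdivrMr//.
  by rewrite ler_wpM2l ?(ltW d0)// lerDl.
move: E2; rewrite mulrDl => E2.
have -> : ext M (fun q0 => tau (k * pev (pev h r) q0)) f - tau (k * pev h q) =
  (ext M (fun q0 => tau (k * pev (pev h r) q0)) f - tau (k * pev h (q' \Po r)))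
  + (tau (k * pev h (q' \Po r)) - tau (k * pev h q)) by ring.
rewrite pev1 mulr1 (le_trans (ler_normD _ _))//; lra.
Qed.

Lemma tex_comp k h f (r : {poly R}) : pos h -> pos k -> uf f ->
  (forall t, 0 <= t -> 0 <= r.[t]) ->
  pos (pev h r) /\ tex k (pev h r) f = tex k h (fun t => f r.[t]).
Proof.
move=> hp kp u r0; apply: tex_comp_itv => // [|t /andP[t0 _]]; last exact: r0.
by apply: uf_comp => //; apply: uf_poly.
Qed.

Lemma tex_kZ (l : R) k h f : 0 <= l -> pos h -> pos k -> uf f ->
  tex (l *: k) h f = l * tex k h f.
Proof.
move=> l0 hp kp u; have hc := cbndP hp.
apply: (tends_uniq (riem_ext (haus_tau hc (posZ l0 kp)) (u _))).
apply: (tends_ext _ (tendsZ l (riem_ext (haus_tau hc kp) (u _)))) => N.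
rewrite /riem mulr_sumr; apply: eq_bigr => i _.
by rewrite -scalerAl tauZ mulrCA.
Qed.

End Powers.

HB.lock Definition pw (R : realType) (A : tralg R) (s : R) (h : A) : R :=
  tex 1 h (fun t => t `^ s).

Section Powers2.
Variables (R : realType) (A : tralg R).
Implicit Types (x y z w h k : A) (p q : {poly R}) (f g : R -> R).

Lemma pwE s h : pw s h = tex 1 h (fun t => t `^ s).
Proof. by rewrite pw.unlock. Qed.

Lemma pw_ge0 s h : 0 <= s -> pos h -> 0 <= pw s h.
Proof.
by move=> s0 hp; rewrite pwE; apply: (tex_ge0 hp (@pos1 _ A) (uf_powR s0)) => t _; apply: powR_ge0.
Qed.

Lemma pw1 h : pos h -> pw 1 h = tau h.
Proof.
move=> hp; rewrite pwE (@tex_eq _ _ h 1 _ id); last by move=> t t0; rewrite powRr1.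
by rewrite tex_id ?mul1r//; apply: pos1.
Qed.

Lemma tex_ext k h k' h' f : pos h -> pos k -> pos h' -> pos k' -> uf f ->
  (forall q, tau (k * pev h q) = tau (k' * pev h' q)) -> tex k h f = tex k' h' f.
Proof.
move=> hp kp hp' kp' u E.
have hc := cbndP hp; have hc' := cbndP hp'.
pose c := Num.max (cbnd h) (cbnd h').
have b : bnd c h by apply: bnd_le hc; rewrite le_max lexx.
have b' : bnd c h' by apply: bnd_le hc'; rewrite le_max lexx orbT.
rewrite (texE b kp u) (texE b' kp' u); congr ext.
by apply/funext.
Qed.

Lemma pw_swap s x : 0 <= s -> pw s (x^# * x) = pw s (x * x^#).
Proof.
move=> s0; rewrite !pwE; apply: tex_ext; [exact: pos_sq|exact: pos1|exact: pos_sq'|exact: pos1|exact: uf_powR|].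
move=> q; rewrite !mul1r !pevE !tau_sum; apply: eq_bigr => i _.
rewrite !tauZ; congr (_ * _); case: (i : nat) => [|n]; first by rewrite !expr0.
have E : (x * x^#) ^+ n * x = x * (x^# * x) ^+ n.
  by have := pev_swap x 'X^n; rewrite !pevXn.
by rewrite exprSr mulrA tauC mulrA exprSr mulrA E -mulrA tauC.
Qed.

Lemma pwZ (s r : R) h : 0 <= s -> 0 <= r -> pos h -> pw s (r *: h) = r `^ s * pw s h.
Proof.
move=> s0 r0 hp; have p1 := @pos1 _ A.
have := tex_comp (r := r *: 'X) hp p1 (uf_powR s0); rewrite pevZ pevX => -[|_ E].
  by move=> t t0; rewrite !hornerE mulr_ge0.
rewrite !pwE E -texZ//; last exact: uf_powR.
by apply: tex_eq => t t0; rewrite !hornerE powRM.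
Qed.

Lemma pw_sq s h : 0 <= s -> pos h -> pw s (h * h) = pw (2 * s) h.
Proof.
move=> s0 hp; have p1 := @pos1 _ A.
have := tex_comp (r := 'X * 'X) hp p1 (uf_powR s0); rewrite pevM pevX => -[|_ E].
  by move=> t t0; rewrite !hornerE mulr_ge0.
rewrite !pwE E; apply: tex_eq => t t0.
by rewrite !hornerE -expr2 powRrM powR_mulrn.
Qed.

(* The numbers [tau (b_i(h) b_j(k))] behave like the masses of a joint
   distribution of [h] and [k]. *)
Lemma joint_le h k (a b d : R -> R) : pos h -> pos k -> uf a -> uf b -> uf d ->
  (forall r r', 0 <= r -> 0 <= r' -> a r + b r * r' <= d r') ->
  tex 1 k a + tex h k b <= tex 1 h d.
Proof.
move=> hp kp ua ub ud hab; have p1 := @pos1 _ A.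
have hc := cbndP hp; have kc := cbndP kp.
set c := cbnd h in hc; set e := cbnd k in kc.
have [c0 _ _] := hc; have [e0 _ _] := kc.
have Hhk := haus_tau kc hp; have H1 := haus_tau kc p1; have H2 := haus_tau hc p1.
have T1 := tendsD (tends_shift (riem_ext H1 (ua _))) (tends_shift (riem_ext Hhk (ub _))).
apply: (tends_le _ T1 (tends_shift (riem_ext H2 (ud _)))) => N; rewrite /riem.
set M := N.+1.
pose m (i j : 'I_M.+1) := tau (pev h (bern c M i) * pev k (bern e M j)).
have m0 i j : 0 <= m i j.
  by apply: tau_pos_mul; [apply: (pos_pev hc)|apply: (pos_pev kc)] => t ht;
     apply: (haus_bern (haus_eval _ ht)).
have hE : h = \sum_(i < M.+1) node c M i *: pev h (bern c M i).
  rewrite -{1}(pevX h) -{1}['X]expr1 (Xn_bern (haus_c0 H2) (ltn0Sn N)) pev_sum.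
  apply: eq_bigr => i _; rewrite pevZ; congr (_ *: _).
  by case: i => -[|i] im //=; rewrite ?mulr1// /node mulr0 mul0r.
have oneh : 1 = \sum_(i < M.+1) pev h (bern c M i).
  by rewrite -pev_sum sum_bern ?pev1// gt_eqF.
have onek : 1 = \sum_(j < M.+1) pev k (bern e M j).
  by rewrite -pev_sum sum_bern ?pev1// gt_eqF.
have EL : \sum_(j < M.+1) b (node e M j) * tau (h * pev k (bern e M j)) =
    \sum_(j < M.+1) \sum_(i < M.+1) b (node e M j) * node c M i * m i j.
  apply: eq_bigr => j _; rewrite {1}hE mulr_suml tau_sum mulr_sumr.
  by apply: eq_bigr => i _; rewrite -scalerAl tauZ /m mulrA.
have E1 : \sum_(i < M.+1) d (node c M i) * tau (1 * pev h (bern c M i)) =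
   \sum_(j < M.+1) \sum_(i < M.+1) d (node c M i) * m i j.
  rewrite exchange_big; apply: eq_bigr => i _.
  by rewrite -mulr_sumr -tau_sum -mulr_sumr -onek mulr1 mul1r.
have E2 : \sum_(j < M.+1) a (node e M j) * tau (1 * pev k (bern e M j)) =
   \sum_(j < M.+1) \sum_(i < M.+1) a (node e M j) * m i j.
  apply: eq_bigr => j _.
  by rewrite -mulr_sumr -tau_sum -mulr_suml -oneh.
rewrite EL E1 E2 -big_split; apply: ler_sum => j _ /=.
rewrite -big_split; apply: ler_sum => i _ /=.
rewrite -mulrDl ler_wpM2r// hab//.
  by have /andP[] := node_itv (ltW e0) (ltn_ord j : (j <= M)%N).
by have /andP[] := node_itv (ltW c0) (ltn_ord i : (i <= M)%N).
Qed.

Lemma tex_self k f : pos k -> uf f -> tex k k f = tex 1 k (fun t => f t * t).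
Proof.
move=> kp u; have p1 := @pos1 _ A; have hc := cbndP kp.
apply/esym/(ext_uniq (haus_tau hc kp) (u _)) => e e0 q hq.
have H := haus_tau hc p1.
have -> : tau (k * pev k q) = tex 1 k (horner (q * 'X)).
  by rewrite tex_poly// mul1r pevM pevX tauC.
have -> : tau (k * pev k 1) = tex 1 k id by rewrite pev1 mulr1 tex_id// mul1r.
have ut : uf (fun t => f t * t) by move=> c; apply: ufcM => //; apply: ufc_id.
have uq : uf (horner (q * 'X)) by move=> c; apply: ufc_poly.
rewrite ler_norml -mulNr -!texZ//; try by move=> c; apply: ufc_id.
have -> : tex 1 k (fun t => f t * t) - tex 1 k (horner (q * 'X)) =
    tex 1 k (fun t => f t * t + (-1) * (q * 'X).[t]).
  by rewrite texD//; [rewrite texZ// mulN1r|move=> c; apply: ufcM => //; apply: ufc_const].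
have uc (r : R) c : ufc c (fun t => r * t) by apply: ufcM; [exact: ufc_const|exact: ufc_id].
have ud c : ufc c (fun t => f t * t + (-1) * (q * 'X).[t]).
  by apply: ufcD; [exact: ut|apply: ufcM; [exact: ufc_const|exact: uq]].
by apply/andP; split; apply: (ext_le H) => // t ht; have /andP[t0 _] := ht;
  have := hq t ht; rewrite hornerM hornerX ler_norml => /andP[? ?]; nra.
Qed.

(** [joint_le] applied to Young's inequality r' f(r) <= r'^s / s + f(r)^s' / s'. *)
Lemma holder_add h k f (s s' : R) : pos h -> pos k -> uf f ->
  (forall t, 0 <= t -> 0 <= f t) -> 0 < s -> 0 < s' -> s^-1 + s'^-1 = 1 ->
  tex h k f <= pw s h / s + tex 1 k (fun t => f t `^ s') / s'.
Proof.
move=> hp kp u f0 s0 s0' ss; have p1 := @pos1 _ A.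
have us := uf_powR (ltW s0).
have us' : uf (fun t => f t `^ s') := uf_comp (uf_powR (ltW s0')) u f0.
have ua : uf (fun t => - s'^-1 * f t `^ s') by move=> c; apply: ufcM => //; apply: ufc_const.
have ud : uf (fun t => s^-1 * t `^ s).
  by move=> c; apply: ufcM; [exact: ufc_const|exact: us].
have := joint_le hp kp ua u ud.
rewrite pwE !texZ// mulNr ![_ / _]mulrC addrC lerBlDr; apply => r r' r0 r0'.
have := conjugate_powR r0' (f0 r r0) s0 s0' ss.
by rewrite ![_ / _]mulrC; lra.
Qed.

Lemma holder h k f (s s' : R) : pos h -> pos k -> uf f ->
  (forall t, 0 <= t -> 0 <= f t) -> 0 < s -> 0 < s' -> s^-1 + s'^-1 = 1 ->
  tex h k f <= pw s h `^ s^-1 * tex 1 k (fun t => f t `^ s') `^ s'^-1.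
Proof.
move=> hp kp u f0 s0 s0' ss; have p1 := @pos1 _ A.
have us' : uf (fun t => f t `^ s') := uf_comp (uf_powR (ltW s0')) u f0.
apply: young_homog => //; first exact/pw_ge0/hp/ltW.
  by apply: tex_ge0 => // t _; apply: powR_ge0.
(* The additive form for l h and l^-1 f has the same left-hand side. *)
move=> l l0; have li : 0 <= l^-1 by rewrite invr_ge0 ltW.
have lp := posZ (ltW l0) hp.
have uli : uf (fun t => l^-1 * f t) by apply: ufM => //; apply: uf_const.
have := holder_add lp kp uli _ s0 s0' ss.
rewrite pwZ ?(ltW s0) ?(ltW l0)//.
have -> : tex (l *: h) k (fun t => l^-1 * f t) = tex h k f.
  by rewrite texZ// tex_kZ// ?(ltW l0)// mulKf// gt_eqF.
have -> : tex 1 k (fun t => (l^-1 * f t) `^ s') =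
    l `^ (- s') * tex 1 k (fun t => f t `^ s').
  rewrite -texZ//; apply: tex_eq => t t0.
  by rewrite powRM ?f0// -[l^-1]powR_inv1 ?(ltW l0)// -powRrM mulN1r.
by apply => t t0; rewrite mulr_ge0// f0.
Qed.

End Powers2.

Global Opaque cbnd tex.

Section Slices.
Variables (R : realType) (A : tralg R).
Implicit Types (x y z u v w h k : A) (f g : R -> R).

(* Cauchy-Schwarz on each Bernstein slice [b_i(w w^#)], which moves across [w]
   as [b_i(w w^#) w = w b_i(w^# w)]. *)
Lemma cs_slices x y w (th : R) : 0 <= th < 1 ->
  2 * tau (x * y * w) <= tex (y^# * y) (w * w^#) (fun t => t `^ th)
                       + tex (x * x^#) (w^# * w) (fun t => t `^ (1 - th)).
Proof.
move=> /andP[th0 th1].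
have P1 := pos_sq y; have P2 := pos_sq' x; have W1 := pos_sq' w; have W2 := pos_sq w.
set c := Num.max (cbnd (w * w^#)) (cbnd (w^# * w)).
have b1 : bnd c (w * w^#) by apply: bnd_le (cbndP W1); rewrite le_max lexx.
have b2 : bnd c (w^# * w) by apply: bnd_le (cbndP W2); rewrite le_max lexx orbT.
have u1 := uf_powR th0; have u2 : uf (fun t => t `^ (1 - th)).
  by apply: uf_powR; rewrite subr_ge0 ltW.
have [c0 _ _] := b1.
have H1 := haus_tau b1 P1; have H2 := haus_tau b2 P2.
rewrite (texE b1 P1 u1) (texE b2 P2 u2).
have T1 := riem_shift H1 (u1 _); have T2 := tends_shift (riem_ext H2 (u2 _)).
apply: (tends_le _ (tends_const _) (tendsD T1 T2)) => N.
(* Degree N faces degree N + 1, because 'X times b_i of degree N is a multiple of b_(i+1) of degree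
   N + 1. The unmatched node 0 contributes nothing, as 1 - th > 0. *)
rewrite /riem [X in _ + X]big_ord_recl.
have -> : node c N.+1 (ord0 : 'I_N.+2) `^ (1 - th) = 0.
  by rewrite /node mulr0 mul0r powR0// subr_eq0 eq_sym lt_eqF.
rewrite mul0r add0r.
have E : x * y * w = \sum_(i < N.+1) x * y * pev (w * w^#) (bern c N i) * w.
  by rewrite -mulr_suml -mulr_sumr -pev_sum sum_bern ?pev1 ?mulr1// gt_eqF.
rewrite E tau_sum mulr_sumr -big_split; apply: ler_sum => i _ /=.
set e := pev _ _.
have ep : pos e by apply: (pos_pev b1) => t ht; apply: (haus_bern (haus_eval c0 ht)).
set n := node c N.+1 i.+1; rewrite /bump /= add1n -/n.
have n0 : 0 < n by rewrite /n /node divr_gt0// mulr_gt0.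
(* With the weight n^th in Cauchy-Schwarz, the factor n coming from [mulX_bern] leaves n^(1 - th) on
   the other side. *)
have l0 : 0 < n `^ th by rewrite powR_gt0.
have := tau_amgm y (w * x) ep l0.
have -> : tau (x * y * e * w) = tau (y * e * (w * x)) by rewrite -!mulrA tauC !mulrA.
have -> : tau (y * e * y^#) = tau (y^# * y * e) by rewrite tauC mulrA.
have -> : (w * x)^# * e * (w * x) = x^# * (n *: pev (w^# * w) (bern c N.+1 i.+1)) * x.
  rewrite astM -!mulrA; congr (_ * _); rewrite !mulrA; congr (_ * _).
  by rewrite -mulrA pev_swap mulrA -[in X in _ = X]pevZ -mulX_bern ?gt_eqF// pevM pevX.
move=> H; apply: le_trans H _; rewrite lerD2l.
have -> : tau (x^# * (n *: pev (w^# * w) (bern c N.+1 i.+1)) * x) =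
   n * tau (x * x^# * pev (w^# * w) (bern c N.+1 i.+1)).
  by rewrite -scalerAr -scalerAl tauZ [tau (x^# * _ * x)]tauC mulrA.
have nn : n != 0 by rewrite gt_eqF.
by rewrite mulrA powRB ?nn ?implybT// powRr1 ?(ltW n0)// [_^-1 * n]mulrC.
Qed.

End Slices.

HB.lock Definition nm (R : realType) (A : tralg R) (p : R) (x : A) : R :=
  pw (p / 2) (x^# * x) `^ p^-1.
(* For positive [h] both are the L_q norm ([nm_pos]); [Np] avoids squaring [h]. *)
HB.lock Definition Np (R : realType) (A : tralg R) (q : R) (h : A) : R :=
  pw q h `^ q^-1.

(** * Hölder inequalities and duality *)

Section Norms.
Variables (R : realType) (A : tralg R).
Implicit Types (x y z u v w h k : A) (f g : R -> R).

Lemma nmE p x : nm p x = pw (p / 2) (x^# * x) `^ p^-1. Proof. by rewrite nm.unlock. Qed.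
Lemma NpE q h : Np q h = pw q h `^ q^-1. Proof. by rewrite Np.unlock. Qed.

Lemma nm_ge0 p x : 0 <= nm p x. Proof. by rewrite nmE powR_ge0. Qed.
Lemma Np_ge0 q h : 0 <= Np q h. Proof. by rewrite NpE powR_ge0. Qed.

Lemma nm_ast p x : 0 <= p -> nm p x^# = nm p x.
Proof. by move=> p0; rewrite !nmE astK -pw_swap// divr_ge0. Qed.

Lemma nm_Np p x : nm (2 * p) x = Np p (x^# * x) `^ 2^-1.
Proof. by rewrite !nmE !NpE mulrC mulKf ?pnatr_eq0// -powRrM -invfM mulrC. Qed.

Lemma nm_sq p x : 0 <= p -> nm (2 * p) x ^+ 2 = Np p (x^# * x).
Proof.
move=> p0; rewrite nm_Np -powR_mulrn ?powR_ge0// -powRrM mulVf ?pnatr_eq0// powRr1//.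
exact: Np_ge0.
Qed.

Lemma nm_sq' p x : 0 <= p -> nm (2 * p) x ^+ 2 = Np p (x * x^#).
Proof.
move=> p0; have p2 : 0 <= 2 * p by rewrite mulr_ge0.
by have := nm_sq x^# p0; rewrite astK (nm_ast x p2).
Qed.

Lemma nm_pos p h : 0 <= p -> pos h -> nm p h = Np p h.
Proof.
move=> p0 hp; rewrite !nmE !NpE; have [h1 _] := hp.
have p2 : 0 <= p / 2 by rewrite divr_ge0.
rewrite h1 (pw_sq p2 hp); have -> : 2 * (p / 2) = p by field.
by [].
Qed.

Lemma sq_scale (l : R) x : (l *: x)^# * (l *: x) = l ^+ 2 *: (x^# * x).
Proof. by rewrite astZ -scalerAl -scalerAr scalerA. Qed.

Lemma sq_scale' (l : R) x : (l *: x) * (l *: x)^# = l ^+ 2 *: (x * x^#).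
Proof. by rewrite astZ -scalerAl -scalerAr scalerA. Qed.

(** [cs_slices] with th = 1/2 shares [w] equally between [x] and [y]; Hölder then applies to each
    half. *)
Lemma tau_nm3 x y w (q q' : R) : 0 < q -> 0 < q' -> q^-1 + q'^-1 = 1 ->
  tau (x * y * w) <= nm (2 * q) x * nm (2 * q) y * nm q' w.
Proof.
move=> q0 q0' qq.
have P1 := pos_sq y; have P2 := pos_sq' x; have W1 := pos_sq' w; have W2 := pos_sq w.
have hu : uf (fun t : R => t `^ 2^-1) by apply: uf_powR; rewrite invr_ge0.
set E1 := tex (y^# * y) (w * w^#) (fun t => t `^ 2^-1).
set E2 := tex (x * x^#) (w^# * w) (fun t => t `^ 2^-1).
have E1p : 0 <= E1 by apply: tex_ge0 => // t _; apply: powR_ge0.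
have E2p : 0 <= E2 by apply: tex_ge0 => // t _; apply: powR_ge0.
have T : tau (x * y * w) <= E2 `^ 2^-1 * E1 `^ 2^-1.
  apply: young_homog => //; first by rewrite -[LHS]mulr2n -[_ *+ 2]mulr_natl divff ?pnatr_eq0.
  move=> l l0; have li : 0 <= l^-1 by rewrite invr_ge0 ltW.
  have h12 : 0 <= (2^-1 : R) < 1 by rewrite invr_ge0 ler0n invf_lt1// ltr1n.
  have := cs_slices (l *: x) (l^-1 *: y) w h12.
  have -> : l *: x * (l^-1 *: y) * w = x * y * w.
    by rewrite -scalerAl -scalerAr scalerA mulfV ?gt_eqF// scale1r.
  rewrite sq_scale sq_scale'.
  have -> : 1 - 2^-1 = 2^-1 :> R by lra.
  rewrite !tex_kZ ?exprn_ge0 ?(ltW l0)//.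
  rewrite -/E1 -/E2 powRN !powR_mulrn ?(ltW l0)// exprVn; lra.
apply: le_trans T _.
have Wd (k : A) f : pos k -> (forall t : R, 0 <= t -> f t = t `^ (q' / 2)) ->
    tex 1 k f = pw (q' / 2) k.
  by move=> kp hf; rewrite pwE; apply: tex_eq => t t0; apply: hf.
have B1 : E1 <= Np q (y^# * y) * nm q' w.
  apply: le_trans (holder P1 W1 hu _ q0 q0' qq) _; first by move=> t _; apply: powR_ge0.
  rewrite !NpE nmE ler_wpM2l ?powR_ge0// (Wd (w * w^#))//.
    by rewrite -pw_swap ?divr_ge0// ltW.
  by move=> t t0; rewrite -powRrM mulrC.
have B2 : E2 <= Np q (x^# * x) * nm q' w.
  apply: le_trans (holder P2 W2 hu _ q0 q0' qq) _; first by move=> t _; apply: powR_ge0.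
  have E := pw_swap x (ltW q0); rewrite NpE nmE E.
  apply: ler_wpM2l; first exact: powR_ge0.
  rewrite (Wd (w^# * w))//.
  by move=> t t0; rewrite -powRrM mulrC.
have half (a b : R) : 0 <= a -> a <= b -> a `^ 2^-1 <= b `^ 2^-1.
  by move=> a0 ab; rewrite ge0_ler_powR ?nnegrE ?invr_ge0// (le_trans a0).
apply: le_trans (ler_pM (powR_ge0 _ _) (powR_ge0 _ _) (half _ _ E2p B2) (half _ _ E1p B1)) _.
rewrite !powRM ?Np_ge0 ?nm_ge0// -!nm_Np mulrACA -powRD; last first.
  by rewrite -[X in X == 0]mulr2n -[_ *+ 2]mulr_natl divff ?pnatr_eq0// oner_eq0.
have -> : 2^-1 + 2^-1 = 1 :> R by lra.
by rewrite powRr1 ?nm_ge0.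
Qed.

(** With th = 1 - q'/2 the slice integral of [y] alone is the q'-th power of its norm, and Hölder
    bounds the one that also involves [w]. The condition q >= 2 makes th nonnegative. *)
Lemma tau_nm2 w y (q q' : R) : 2 <= q -> 0 < q' -> q^-1 + q'^-1 = 1 ->
  tau (w * y) <= nm q w * nm q' y.
Proof.
move=> q2 q0' qq; have q0 : 0 < q by apply: lt_le_trans q2.
have W1 := pos_sq w; have Y1 := pos_sq' y; have Y2 := pos_sq y; have p1 := @pos1 _ A.
have iq : q^-1 <= 2^-1 by rewrite lef_pV2 ?posrE.
have iq' : q'^-1 = 1 - q^-1 by rewrite -qq addrAC subrr add0r.
have q2' : q' <= 2 by rewrite -lef_pV2 ?posrE// iq'; lra.
have q1' : 1 < q' by rewrite -(@invf_lt1 _ q')// iq' ltrBlDr ltrDl invr_gt0.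
set th := 1 - q' / 2.
have th1 : 0 <= th < 1 by rewrite /th; apply/andP; split; lra.
have th0 : 0 <= th by case/andP: th1.
set E1 := tex (w^# * w) (y * y^#) (fun t => t `^ th).
set Y := pw (q' / 2) (y^# * y).
have E1p : 0 <= E1 by apply: tex_ge0 => // [|t _]; [apply: uf_powR|apply: powR_ge0].
have Yp : 0 <= Y by apply: pw_ge0 => //; rewrite divr_ge0// ltW.
have T : tau (w * y) <= E1 `^ 2^-1 * Y `^ 2^-1.
  apply: young_homog => //; first by lra.
  move=> l l0; have li : 0 <= l^-1 by rewrite invr_ge0 ltW.
  have := cs_slices (l^-1%:A) (l *: w) y th1.
  have -> : l^-1%:A * (l *: w) * y = w * y.
    by rewrite mulr_algl scalerA mulVf ?gt_eqF// scale1r.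
  rewrite sq_scale sq_scale' ast1 mulr1.
  have u1 := uf_powR th0; have u2 : uf (fun t : R => t `^ (1 - th)).
    by apply: uf_powR; rewrite /th; lra.
  rewrite (tex_kZ _ Y1 W1 u1) ?exprn_ge0 ?(ltW l0)//.
  rewrite (tex_kZ _ Y2 p1 u2) ?exprn_ge0 ?(ltW l0)//.
  rewrite -/E1; have -> : tex 1 (y^# * y) (fun t => t `^ (1 - th)) = Y.
    by rewrite /Y pwE; congr tex; apply/funext => t; congr (_ `^ _); rewrite /th; ring.
  rewrite powRN !powR_mulrn ?(ltW l0)// exprVn; lra.
apply: le_trans T _.
have [qe|qe] := eqVneq q 2.
  have qe' : q' = 2 by apply: (@invr_inj _); rewrite iq' qe; lra.
  rewrite !nmE -/Y qe qe' divff ?pnatr_eq0// ler_wpM2r ?powR_ge0//.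
  rewrite ge0_ler_powR ?nnegrE ?invr_ge0 ?pw_ge0// /E1 /th qe' divff ?pnatr_eq0// subrr.
  rewrite pw1// (@tex_eq _ _ _ _ _ (horner 1)); last by move=> t t0; rewrite powRr0 hornerE.
  by rewrite tex_poly// pev1 mulr1.
have qgt : 2 < q by rewrite lt_neqAle eq_sym qe.
have s0 : 0 < q / 2 by lra.
have s0' : 0 < q / (q - 2) by rewrite divr_gt0// subr_gt0.
have ss : (q / 2)^-1 + (q / (q - 2))^-1 = 1.
  rewrite !invf_div -mulrDl addrC subrK divff// gt_eqF//.
have B : E1 <= pw (q / 2) (w^# * w) `^ (q / 2)^-1 * Y `^ (q / (q - 2))^-1.
  apply: le_trans (holder W1 Y1 (uf_powR th0) _ s0 s0' ss) _; first by move=> t _; apply: powR_ge0.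
  apply: ler_wpM2l; first exact: powR_ge0.
  have q20 : 0 <= q' / 2 by rewrite divr_ge0// ltW.
  have E := pw_swap y q20; rewrite /Y E pwE.
  rewrite le_eqVlt; apply/orP; left; apply/eqP; congr (_ `^ _).
  apply: tex_eq => t t0; rewrite -powRrM; congr (_ `^ _).
  have qd : q' = q / (q - 1).
    apply: (@invr_inj _); rewrite iq' invf_div mulrBl divff ?gt_eqF// mul1r//.
  rewrite /th qd; field; rewrite ?subr_eq0 ?gt_eqF//; lra.
rewrite !nmE -/Y; apply: (@le_trans _ _ ((pw (q / 2) (w^# * w) `^ (q / 2)^-1 *
   Y `^ (q / (q - 2))^-1) `^ 2^-1 * Y `^ 2^-1)).
  by rewrite ler_wpM2r ?powR_ge0// ge0_ler_powR ?nnegrE ?mulr_ge0 ?powR_ge0 ?invr_ge0.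
rewrite powRM ?powR_ge0// -!powRrM -mulrA -powRD; last first.
  apply/implyP => /eqP H; exfalso; move: H; apply/eqP; rewrite gt_eqF//.
  by rewrite addr_gt0 ?mulr_gt0 ?invr_gt0.
have -> : (q / 2)^-1 / 2 = q^-1 by field; rewrite gt_eqF.
have -> : (q / (q - 2))^-1 / 2 + 2^-1 = q'^-1.
  rewrite iq' invf_div; field; by rewrite gt_eqF.
by [].
Qed.

(** [P] is the q-th power of the norm to be bounded. Testing gives P <= K P^(1/q'), up to the error
    [d] made in approximating the extremal test element. *)
Lemma root_bound (P K q q' : R) : 0 <= P -> 0 <= K -> 0 < q -> 0 < q' -> q^-1 + q'^-1 = 1 ->
  (forall d, 0 < d -> P <= K * (P + d) `^ q'^-1) -> P `^ q^-1 <= K.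
Proof.
move=> P0 K0 q0 q0' qq h; have [->|Pn] := eqVneq P 0.
  by rewrite powR0// gt_eqF// invr_gt0.
have Pp : 0 < P by rewrite lt_neqAle eq_sym Pn.
have H : P `^ q' <= K `^ q' * P.
  apply/ler_addgt0Pr => e e0.
  have K1 : 0 < K `^ q' + 1 by rewrite ltr_wpDl// powR_ge0.
  have d0 := divr_gt0 e0 K1.
  apply: (@le_trans _ _ (K `^ q' * (P + e / (K `^ q' + 1)))).
    have -> : K `^ q' * (P + e / (K `^ q' + 1)) =
        (K * (P + e / (K `^ q' + 1)) `^ q'^-1) `^ q'.
      rewrite powRM ?powR_ge0// -[in RHS]powRrM mulVf ?gt_eqF// powRr1// addr_ge0// ltW//.
    by rewrite ge0_ler_powR ?nnegrE ?(ltW q0') ?mulr_ge0 ?powR_ge0 ?h.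
  by rewrite mulrDr lerD2l mulrA ler_pdivrMr// mulrC ler_wpM2l ?(ltW e0)// lerDl.
have -> : q^-1 = (q' - 1) / q' by rewrite mulrBl divff ?gt_eqF// mul1r -qq addrK.
rewrite powRrM.
have : P `^ (q' - 1) <= K `^ q'.
  by rewrite powRB ?Pn ?implybT// powRr1// ler_pdivrMr.
move=> HP; apply: (@le_trans _ _ ((K `^ q') `^ q'^-1)).
  by rewrite ge0_ler_powR ?nnegrE ?powR_ge0 ?invr_ge0 ?(ltW q0').
by rewrite -powRrM mulfV ?gt_eqF// powRr1.
Qed.

Lemma approx_above (c : R) f e : 0 < c -> ufc c f -> 0 < e -> exists r : {poly R},
  forall t, 0 <= t <= c -> f t <= r.[t] <= f t + e.
Proof.
move=> c0 u e0; have [r hr] := weierstrass c0 u (divr_gt0 e0 (ltr0Sn _ 1)).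
exists (r + (e / 2)%:P) => t /hr; rewrite !hornerE ler_norml => /andP[? ?].
by apply/andP; split; lra.
Qed.

(** The extremal test element h^(q-1) is approximated from above by a polynomial. That polynomials
    in [h] suffice matters for [Np_ce]: a conditional expectation fixing [h] fixes all of them. *)
Lemma dual_pos h (q q' K : R) : pos h -> 0 < q -> 0 < q' -> q^-1 + q'^-1 = 1 -> 0 <= K ->
  (forall r, pos (pev h r) -> tau (h * pev h r) <= K * Np q' (pev h r)) -> Np q h <= K.
Proof.
move=> hp q0 q0' qq K0 hK; have p1 := @pos1 _ A.
rewrite NpE; apply: (root_bound _ K0 q0 q0' qq); first exact/pw_ge0/hp/ltW.
move=> d d0; have hc := cbndP hp; have H := haus_tau hc p1; have [c0 _ _] := hc.
set c := cbnd h in hc H c0.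
have q1 : 1 < q by rewrite -(@invf_lt1 _ q)// -qq ltrDl invr_gt0.
have q10 : 0 <= q - 1 by rewrite subr_ge0 ltW.
pose M := c `^ (q - 1) + 1.
have t1 : 0 < tau (1 : A) + 1 by rewrite ltr_wpDl// pos_tau.
have [_ /(_ _ (divr_gt0 d0 t1))[e e0 he]] := ufc_powR M (ltW q0').
pose e' := Num.min e 1; have e0' : 0 < e' by rewrite lt_min e0 ltr01.
have uq1 := ufc_powR c q10.
have [r hr] := approx_above c0 uq1 e0'.
have r0 t : 0 <= t <= c -> 0 <= r.[t].
  by move=> /hr/andP[+ _]; apply: le_trans; apply: powR_ge0.
have rM t : 0 <= t <= c -> t `^ (q - 1) <= M /\ r.[t] <= M.
  move=> ht; have /andP[t0 tc] := ht.
  have A1 : t `^ (q - 1) <= c `^ (q - 1) by rewrite ge0_ler_powR ?nnegrE ?(ltW c0).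
  split; first by rewrite (le_trans A1)// lerDl.
  have /andP[_ +] := hr t ht; move=> /le_trans; apply; apply: lerD => //.
  by rewrite ge_min lexx orbT.
have close t : 0 <= t <= c -> `|r.[t] `^ q' - t `^ q| <= d / (tau (1 : A) + 1).
  move=> ht; have [m1 m2] := rM t ht; have /andP[t0 _] := ht.
  have -> : t `^ q = (t `^ (q - 1)) `^ q'.
    rewrite -powRrM; congr (_ `^ _).
    have : (q^-1 + q'^-1) * (q * q') = q * q' by rewrite qq mul1r.
    by rewrite mulrDl mulrA mulVf ?gt_eqF// mul1r mulrCA mulVf ?gt_eqF// mulr1 mulrBl mul1r; lra.
  apply: he; rewrite ?r0 ?powR_ge0//.
  have /andP[h1 h2] := hr t ht; rewrite ger0_norm ?subr_ge0//.
  rewrite lerBlDl (le_trans h2)// lerD2l ge_min lexx//.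
have ur : ufc c (fun t => r.[t] `^ q').
  apply: (ufc_comp (c' := M) (ufc_powR _ (ltW q0')) (ufc_poly _ r)) => t ht.
  by rewrite r0// (rM t ht).2.
have [yp yE] := tex_comp_itv hp p1 (uf_powR (ltW q0')) ur r0.
apply: (@le_trans _ _ (tau (h * pev h r))).
  have -> : tau (h * pev h r) = tau (1 * pev h ('X * r)) by rewrite mul1r pevM pevX.
  rewrite -(ext_poly H) pwE texU -/c; apply: (ext_le H); first exact/ufc_powR/ltW.
    exact: ufc_poly.
  move=> t ht; have /andP[t0 _] := ht; have /andP[h1 _] := hr t ht.
  by rewrite hornerM hornerX -(mulr_powRB1 t0 q0) ler_wpM2l.
apply: le_trans (hK _ yp) _; rewrite ler_wpM2l// NpE.
rewrite ge0_ler_powR ?nnegrE ?invr_ge0 ?(ltW q0') ?pw_ge0 ?(ltW q0')//.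
  by rewrite addr_ge0 ?(ltW d0)// pw_ge0// ltW.
rewrite pwE yE.
apply: (@le_trans _ _ (tex 1 h (fun t => t `^ q + d / (tau (1 : A) + 1)))).
  rewrite !texU; apply: (ext_le H) => //; first by apply: ufcD; [exact/ufc_powR/ltW|exact: ufc_const].
  by move=> t /close; rewrite ler_norml => /andP[_ ?]; lra.
rewrite texD//; [|exact/uf_powR/ltW|exact: uf_const].
rewrite [pw q h]pwE lerD2l (@tex_eq _ _ _ _ _ (horner (d / (tau (1 : A) + 1))%:P)); last by move=> t _; rewrite hornerC.
rewrite tex_poly// pevC mul1r tauZ mulrAC ler_pdivrMr// ler_wpM2l ?(ltW d0)// lerDl//.
Qed.

End Norms.

Section Norms2.
Variables (R : realType) (A : tralg R).
Implicit Types (x y z u v w h k : A) (f g : R -> R).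

Lemma conj_sum (q q' : R) : 0 < q -> 0 < q' -> q^-1 + q'^-1 = 1 -> q + q' = q * q'.
Proof.
move=> q0 q0' qq; rewrite -[RHS]mulr1 -qq mulrDr mulfK ?gt_eqF//.
by rewrite mulrAC mulfV ?gt_eqF// mul1r addrC.
Qed.

(** The extremal test element is h^(q/2 - 1) w^# with h = w^# w; q >= 2 keeps the exponent
    nonnegative. *)
Lemma dual_nm w (q q' K : R) : 2 <= q -> 0 < q' -> q^-1 + q'^-1 = 1 -> 0 <= K ->
  (forall y, tau (w * y) <= K * nm q' y) -> nm q w <= K.
Proof.
move=> q2 q0' qq K0 hK; have p1 := @pos1 _ A; have q0 : 0 < q by apply: lt_le_trans q2.
pose h := w^# * w; have hp : pos h by exact: pos_sq.
have qh0 : 0 <= q / 2 - 1 by rewrite subr_ge0 ler_pdivlMr// mul1r.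
have qh : 0 < q / 2 by rewrite divr_gt0.
have qh' : 0 <= q' / 2 by rewrite divr_ge0// ltW.
rewrite nmE; apply: (root_bound _ K0 q0 q0' qq); first exact/pw_ge0/hp/ltW.
move=> d d0; have hc := cbndP hp; have H := haus_tau hc p1; have [c0 _ _] := hc.
rewrite -/h; set c := cbnd h in hc H c0.
have uq1 := ufc_powR c qh0.
have t1 : 0 < tau (1 : A) + 1 by rewrite ltr_wpDl// pos_tau.
pose M1 := c `^ (q / 2 - 1) + 1; have M10 : 0 <= M1 by rewrite addr_ge0// powR_ge0.
pose M := c * M1 ^+ 2.
have [_ /(_ _ (divr_gt0 d0 t1))[e e0 he]] := ufc_powR M qh'.
pose L := c * (2 * M1) + 1; have L0 : 0 < L.
  by rewrite ltr_wpDl// !mulr_ge0// ltW.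
pose e' := Num.min (e / L) 1; have e0' : 0 < e' by rewrite lt_min divr_gt0//= ltr01.
have [r hr] := approx_above c0 uq1 e0'.
have r0 t : 0 <= t <= c -> 0 <= r.[t].
  by move=> /hr/andP[+ _]; apply: le_trans; apply: powR_ge0.
have rM t : 0 <= t <= c -> t `^ (q / 2 - 1) <= M1 /\ r.[t] <= M1.
  move=> ht; have /andP[t0 tc] := ht.
  have A1 : t `^ (q / 2 - 1) <= c `^ (q / 2 - 1) by rewrite ge0_ler_powR ?nnegrE ?(ltW c0).
  split; first by rewrite (le_trans A1)// lerDl.
  have /andP[_ +] := hr t ht; move=> /le_trans; apply; apply: lerD => //.
  by rewrite ge_min lexx orbT.
pose r2 := 'X * (r * r).
have r2E t : r2.[t] = t * r.[t] ^+ 2 by rewrite hornerM hornerX hornerM expr2.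
have r2M t : 0 <= t <= c -> 0 <= r2.[t] <= M.
  move=> ht; have /andP[t0 tc] := ht; rewrite r2E mulr_ge0 ?exprn_ge0 ?r0//=.
  by rewrite ler_pM ?exprn_ge0 ?r0// lerXn2r ?nnegrE ?r0// (rM t ht).2.
have close t : 0 <= t <= c -> `|r2.[t] `^ (q' / 2) - t `^ (q / 2)| <= d / (tau (1 : A) + 1).
  move=> ht; have [m1 m2] := rM t ht; have /andP[t0 tc] := ht.
  set p := t `^ (q / 2 - 1) in m1; have p0 : 0 <= p by exact: powR_ge0.
  have -> : t `^ (q / 2) = (t * p ^+ 2) `^ (q' / 2).
    have -> : t * p ^+ 2 = t `^ (q - 1).
      rewrite /p -powR_mulrn ?powR_ge0// -powRrM.
      have q1 : 0 < q - 1 by lra.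
      by rewrite -(mulr_powRB1 t0 q1); congr (_ * _ `^ _); field.
    rewrite -powRrM; congr (_ `^ _).
    have := conj_sum q0 q0' qq; lra.
  have /andP[h1 h2] := hr t ht; rewrite -/p in h1 h2.
  apply: he; first exact: r2M.
    rewrite mulr_ge0 ?exprn_ge0//=.
    by rewrite ler_pM ?exprn_ge0// lerXn2r ?nnegrE.
  rewrite r2E -mulrBr subr_sqr normrM ger0_norm//.
  rewrite ger0_norm ?mulr_ge0 ?subr_ge0 ?addr_ge0 ?r0//.
  apply: (@le_trans _ _ (c * (e / L * (M1 + M1)))).
    apply: ler_pM => //; first by rewrite mulr_ge0 ?subr_ge0 ?addr_ge0 ?r0.
    apply: ler_pM; rewrite ?subr_ge0 ?addr_ge0 ?r0 ?lerD//.
    rewrite lerBlDl (le_trans h2)// lerD2l ge_min lexx//.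
  have -> : c * (e / L * (M1 + M1)) = e * (c * (2 * M1) / L) by ring.
  by rewrite ler_piMr ?(ltW e0)// ler_pdivrMr// mul1r /L lerDl.
have ur : ufc c (fun t => r2.[t] `^ (q' / 2)).
  by apply: (ufc_comp (c' := M) (ufc_powR _ qh') (ufc_poly _ r2)).
have r20 t : 0 <= t <= cbnd h -> 0 <= r2.[t] by move=> /r2M/andP[].
have [yp yE] := tex_comp_itv hp p1 (uf_powR qh') ur r20.
apply: (@le_trans _ _ (tau (w * (pev h r * w^#)))).
  have -> : tau (w * (pev h r * w^#)) = tau (1 * pev h ('X * r)).
    by rewrite mul1r pevM pevX /h tauC -mulrA tauC.
  rewrite -(ext_poly H) pwE texU -/c; apply: (ext_le H); first exact/ufc_powR/ltW.
    exact: ufc_poly.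
  move=> t ht; have /andP[t0 _] := ht; have /andP[h1 _] := hr t ht.
  by rewrite hornerM hornerX -(mulr_powRB1 t0 qh) ler_wpM2l.
apply: le_trans (hK _) _; rewrite ler_wpM2l// nmE.
have [h1 _] := hp.
have E := pw_swap (pev h r * w^#) qh'; rewrite E astM astK pev_sa//.
have -> : pev h r * w^# * (w * pev h r) = pev h r2.
  have C := pevCM h 'X r; rewrite pevX in C.
  by rewrite /r2 !pevM pevX [RHS]mulrA C -!mulrA /h !mulrA.
rewrite ge0_ler_powR ?nnegrE ?invr_ge0 ?(ltW q0')//.
    exact: pw_ge0.
  by rewrite addr_ge0 ?(ltW d0)// pw_ge0// ltW.
rewrite pwE yE.
apply: (@le_trans _ _ (tex 1 h (fun t => t `^ (q / 2) + d / (tau (1 : A) + 1)))).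
  rewrite !texU; apply: (ext_le H) => //; first by apply: ufcD; [exact/ufc_powR/ltW|exact: ufc_const].
  by move=> t /close; rewrite ler_norml => /andP[_ ?]; lra.
rewrite texD//; [|exact/uf_powR/ltW|exact: uf_const].
rewrite [pw (q / 2) h]pwE lerD2l (@tex_eq _ _ _ _ _ (horner (d / (tau (1 : A) + 1))%:P)); last by move=> t _; rewrite hornerC.
by rewrite tex_poly// pevC mul1r tauZ mulrAC ler_pdivrMr// ler_wpM2l ?(ltW d0)// lerDl.
Qed.

Lemma conjP (q : R) : 1 < q -> exists q', [/\ 1 < q', q^-1 + q'^-1 = 1 & q' = q / (q - 1)].
Proof.
move=> q1; have q0 : 0 < q by apply: lt_trans q1.
exists (q / (q - 1)); split=> //; first by rewrite ltr_pdivlMr ?subr_gt0// mul1r ltrBlDr ltrDl.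
by rewrite invf_div; field; rewrite gt_eqF.
Qed.

Lemma Np1 h : pos h -> Np 1 h = tau h.
Proof. by move=> hp; rewrite NpE pw1// invr1 powRr1// pos_tau. Qed.

Lemma tau_Np2 h k (q q' : R) : pos h -> pos k -> 0 < q -> 0 < q' -> q^-1 + q'^-1 = 1 ->
  tau (h * k) <= Np q h * Np q' k.
Proof.
move=> hp kp q0 q0' qq; rewrite -(tex_id kp hp) !NpE.
apply: le_trans (holder hp kp (@uf_id R) _ q0 q0' qq) _; first by [].
by rewrite !pwE.
Qed.

Lemma Np_le q h k : 1 <= q -> pos h -> pos (k - h) -> Np q h <= Np q k.
Proof.
rewrite le_eqVlt => /orP[/eqP <-|q1] hp kh.
  have kp : pos k by rewrite -(subrK h k); apply: posD.
  by rewrite !Np1// -subr_ge0 -tauB pos_tau.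
have kp : pos k by rewrite -(subrK h k); apply: posD.
have [q' [q1' qq _]] := conjP q1.
have q0 := lt_trans ltr01 q1; have q0' := lt_trans ltr01 q1'.
apply: (dual_pos hp q0 q0' qq (Np_ge0 q k)) => r rp.
apply: le_trans (tau_Np2 kp rp q0 q0' qq).
by rewrite -subr_ge0 -tauB -mulrBl tau_pos_mul.
Qed.

Lemma NpD q h k : 1 <= q -> pos h -> pos k -> Np q (h + k) <= Np q h + Np q k.
Proof.
rewrite le_eqVlt => /orP[/eqP <-|q1] hp kp.
  by rewrite !Np1//; [rewrite tauD|apply: posD].
have [q' [q1' qq _]] := conjP q1.
have q0 := lt_trans ltr01 q1; have q0' := lt_trans ltr01 q1'.
apply: (dual_pos (posD hp kp) q0 q0' qq); first by rewrite addr_ge0 ?Np_ge0.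
by move=> r rp; rewrite mulrDl tauD mulrDl lerD// tau_Np2.
Qed.

Lemma NpZ q r h : 0 < q -> 0 <= r -> pos h -> Np q (r *: h) = r * Np q h.
Proof.
move=> q0 r0 hp; rewrite !NpE pwZ ?(ltW q0)// powRM ?powR_ge0 ?pw_ge0 ?(ltW q0)//.
by rewrite -powRrM mulfV ?gt_eqF// powRr1.
Qed.

Lemma nmM q u v : 2 <= q -> nm q (u * v) <= nm (2 * q) u * nm (2 * q) v.
Proof.
move=> q2; have q1 : 1 < q by lra.
have [q' [q1' qq _]] := conjP q1.
have q0 := lt_trans ltr01 q1; have q0' := lt_trans ltr01 q1'.
apply: (dual_nm q2 q0' qq); first by rewrite mulr_ge0 ?nm_ge0.
by move=> y; apply: tau_nm3.
Qed.

Lemma nmD q u v : 2 <= q -> nm q (u + v) <= nm q u + nm q v.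
Proof.
move=> q2; have q1 : 1 < q by lra.
have [q' [q1' qq _]] := conjP q1.
have q0 := lt_trans ltr01 q1; have q0' := lt_trans ltr01 q1'.
apply: (dual_nm q2 q0' qq); first by rewrite addr_ge0 ?nm_ge0.
by move=> y; rewrite mulrDl tauD mulrDl lerD// tau_nm2.
Qed.

Lemma nmN q u : nm q (- u) = nm q u.
Proof. by rewrite !nmE astN mulrNN. Qed.

Lemma nmB q u v : 2 <= q -> nm q (u - v) <= nm q u + nm q v.
Proof. by move=> q2; rewrite -(nmN q v); apply: nmD. Qed.

Lemma nmZ q r u : 0 < q -> nm q (r *: u) = `|r| * nm q u.
Proof.
move=> q0; have q20 : 0 <= q / 2 by rewrite divr_ge0// ltW.
have up := pos_sq u.
rewrite !nmE sq_scale pwZ ?sqr_ge0// powRM ?powR_ge0 ?pw_ge0//.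
rewrite -(real_normK (num_real r)) -powR_mulrn// -!powRrM; congr (_ * _).
have -> : 2 * (q / 2 / q) = 1 by field; rewrite gt_eqF.
by rewrite powRr1.
Qed.

Lemma nm2 u : nm 2 u ^+ 2 = tau (u^# * u).
Proof. by rewrite -[2]mulr1 nm_sq// Np1//; apply: pos_sq. Qed.

Lemma sa_bnd k : k^# = k -> exists c, [/\ 0 < c, pos (c%:A - k) & pos (c%:A + k)].
Proof.
move=> k1; have [c hc] := tau_bdd k.
pose d := `|c| + 1; have d0 : 0 < d by rewrite ltr_wpDl.
have K (s : R) y : s = 1 \/ s = -1 -> s * tau (y^# * k * y) <= d * tau (y^# * y).
  move=> hs; have s1 : s ^+ 2 = 1 by case: hs => ->; rewrite ?expr1n// sqrrN expr1n.
  have := tau_amgm1 y^# (s *: (k * y)) d0.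
  rewrite -scalerAr tauZ mulrA astK sq_scale s1 scale1r -[y^# * k * y]mulrA.
  have H := hc y; have Y := tau_ge0 y.
  have : d^-1 * tau ((k * y)^# * (k * y)) <= tau (y^# * y).
    rewrite ler_pdivrMl//; apply: le_trans H _; rewrite ler_wpM2r//.
    by rewrite (le_trans (ler_norm _))// lerDl.
  have : tau (y^# * y) <= d * tau (y^# * y) by rewrite ler_peMl// lerDr.
  lra.
exists d; split=> //; split=> [|y].
- by rewrite astB astZ ast1 k1.
- rewrite mulrBr mulrBl -scalerAr mulr1 -scalerAl tauB tauZ subr_ge0.
  by have := K 1 y (or_introl erefl); rewrite mul1r.
- by rewrite astD astZ ast1 k1.
- rewrite mulrDr mulrDl -scalerAr mulr1 -scalerAl tauD tauZ.
  by have := K (-1) y (or_intror erefl); rewrite mulN1r; lra.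
Qed.

Lemma ufc_negpart c (d : R) : ufc c (fun t => Num.max (d - t) 0).
Proof.
split; first exists (`|d| + `|c|).
  move=> x /andP[x0 xc]; rewrite ger0_norm ?le_max ?lexx ?orbT//.
  rewrite ge_max addr_ge0// andbT lerBlDr (le_trans (ler_norm d))// -addrA lerDl addr_ge0//.
move=> e e0; exists e => // x y _ _ xy.
have H (a b : R) : `|a - b| <= e -> Num.max (d - a) 0 - Num.max (d - b) 0 <= e.
  rewrite ler_norml => /andP[h1 h2]; rewrite lerBlDr ge_max; apply/andP; split.
    have : d - b <= Num.max (d - b) 0 by rewrite le_max lexx.
    lra.
  by rewrite addr_ge0 ?(ltW e0)// le_max lexx orbT.
rewrite ler_norml; apply/andP; split; last exact: H.
by rewrite lerNl opprB; apply: H; rewrite distrC.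
Qed.

(* The moments of a self-adjoint element determine whether it is positive, since
   [tau (y^# f(k) y)] is dominated by a multiple of [tau (f(k))]. *)
Lemma pos_moments k : k^# = k -> (forall r, 0 <= tau (k * (pev k r * pev k r))) -> pos k.
Proof.
move=> k1 hk; have p1 := @pos1 _ A.
have [c [c0 kc kc']] := sa_bnd k1.
(* A positive shift of [k]; the function [f] below reads off the negative part of [k] from it. *)
pose h := c%:A + k; have hp : pos h by [].
have hb : bnd (2 * c) h.
  split; rewrite ?mulr_gt0//.
  have -> : (2 * c)%:A - h = c%:A - k.
    by rewrite /h mulrC mulr_natr mulr2n scalerDl opprD addrACA subrr add0r.
  by [].
have hk' r : 0 <= tau (1 * pev h (('X - c%:P) * (r * r))).
  have -> : h = pev k (c%:P + 'X) by rewrite pevD pevC pevX.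
  rewrite pev_comp mul1r comp_polyM comp_polyM pevM comp_polyB comp_polyX comp_polyC.
  by rewrite addrAC subrr add0r pevX pevM.
pose f t := Num.max (c - t) 0.
have fu : uf f by move=> c'; apply: ufc_negpart.
have f0 t : 0 <= t -> 0 <= f t by move=> _; rewrite le_max lexx orbT.
have H := haus_tau hb p1; have T1 := pos_tau p1.
(* For [r] near [f] the hypothesis says that the trace of k f(h)^2 is nearly nonnegative, while (t -
   c) f(t)^2 = - f(t)^3. *)
have f3 : tex 1 h (fun t => f t * (f t * f t)) <= 0.
  have u3 : uf (fun t => f t * (f t * f t)) by do 2!apply: ufM => //.
  apply/ler_addgt0Pr => e e0; rewrite add0r.
  have [[M hM] _] := fu (2 * c).
  pose K := c * (2 * `|M| + 1) * (tau (1 : A) + 1).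
  have K0 : 0 < K by rewrite !mulr_gt0// ltr_wpDl// mulr_ge0.
  pose d := Num.min 1 (e / K); have d0 : 0 < d by rewrite lt_min ltr01 divr_gt0.
  have c20 : 0 < 2 * c by rewrite mulr_gt0.
  have [r hr] := weierstrass c20 (fu _) d0.
  have Q := hk' r.
  have N : tex 1 h (fun t => f t * (f t * f t)) + tau (1 * pev h (('X - c%:P) * (r * r)))
     <= (c * (2 * `|M| + 1) * d) * tau (1 : A).
    rewrite -tauZ -[_ *: _](pevC h) -[pev _ _%:P]mul1r.
    rewrite -(tex_poly hp p1) -(tex_poly hp p1) -texD//; last exact: uf_poly.
    rewrite (texE hb p1); last by apply: ufD => //; apply: uf_poly.
    rewrite (texE hb p1); last exact: uf_poly.
    apply: (ext_le H); [|exact: ufc_poly|].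
      by apply: ufcD; [exact: u3|exact: ufc_poly].
    move=> t ht; rewrite hornerM [(r * r).[t]]hornerM hornerC hornerXsubC; have /andP[t0 tc] := ht.
    have a1 := hr t ht; have a2 := hM t ht.
    have a3 : `|r.[t] + f t| <= 2 * `|M| + 1.
      have -> : r.[t] + f t = (r.[t] - f t) + 2 * f t by ring.
      rewrite (le_trans (ler_normD _ _))// addrC lerD//.
        by rewrite normrM ger0_norm// ler_wpM2l// (le_trans a2)// ler_norm.
      by rewrite (le_trans a1)// ge_min lexx.
    have a4 : `|(t - c) * (r.[t] * r.[t] - f t * f t)| <= c * ((2 * `|M| + 1) * d).
      rewrite normrM ler_pM//.
        by rewrite ler_norml; apply/andP; split; lra.
      rewrite -!expr2 subr_sqr mulrC normrM ler_pM//.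
    have a5 : f t * (f t * f t) <= - ((t - c) * (f t * f t)).
      rewrite -mulNr opprB /f; have [tc'|tc'] := leP (c - t) 0; first by rewrite !mulr0.
      by [].
    have -> : (t - c) * (r.[t] * r.[t]) =
        (t - c) * (r.[t] * r.[t] - f t * f t) + (t - c) * (f t * f t).
      by rewrite mulrBr subrK.
    rewrite addrCA -[leRHS]addr0 lerD//.
      by rewrite (le_trans (ler_norm _))// -mulrA.
    by rewrite -lerBrDr sub0r.
  apply: (@le_trans _ _ ((c * (2 * `|M| + 1) * d) * tau (1 : A))); first by lra.
  apply: (@le_trans _ _ (c * (2 * `|M| + 1) * (e / K) * (tau (1 : A) + 1))).
    apply: ler_pM => //; rewrite ?lerDl//.
      by rewrite !mulr_ge0 ?(ltW c0) ?(ltW d0)// addr_ge0// mulr_ge0.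
    apply: ler_wpM2l; first by rewrite !mulr_ge0 ?(ltW c0)// addr_ge0// mulr_ge0.
    by rewrite ge_min lexx orbT.
  by rewrite mulrAC -/K mulrC divfK// gt_eqF.
(* The bound passes from f^3 to f because f <= f^3 / d^2 + d for every d > 0. *)
have fz : tex 1 h f <= 0.
  apply/ler_addgt0Pr => e e0; rewrite add0r.
  have t1 : 0 < tau (1 : A) + 1 by rewrite ltr_wpDl.
  pose d := e / (tau (1 : A) + 1); have d0 : 0 < d by rewrite divr_gt0.
  have u3 : uf (fun t => d^-1 ^+ 2 * (f t * (f t * f t))).
    by apply: ufM; [exact: uf_const|do 2!apply: ufM => //].
  apply: (@le_trans _ _ (tex 1 h (fun t => d^-1 ^+ 2 * (f t * (f t * f t)) + d))).
    apply: tex_le => //; first by apply: ufD => //; apply: uf_const.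
    move=> t t0; have := f0 t t0; set s := f t => s0.
    have [sd|ds] := leP s d.
      by apply: (le_trans sd); rewrite lerDr !mulr_ge0// invr_ge0 ltW.
    apply: (@le_trans _ _ (d^-1 ^+ 2 * (s * (s * s)))); last by rewrite lerDl ltW.
    rewrite mulrCA ler_peMr// -expr2 -exprMn expr_ge1 ?mulr_ge0 ?invr_ge0 ?(ltW d0)//.
    by rewrite ler_pdivlMl// mulr1 ltW.
  rewrite texD//; last exact: uf_const.
  rewrite texZ//; last by do 2!apply: ufM => //.
  have -> : tex 1 h (fun=> d) = d * tau (1 : A).
    rewrite (@tex_eq _ _ _ _ _ (horner d%:P)); last by move=> t _; rewrite hornerC.
    by rewrite tex_poly// pevC mul1r tauZ.
  have : d^-1 ^+ 2 * tex 1 h (fun t => f t * (f t * f t)) <= 0.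
    by rewrite pmulr_rle0// exprn_gt0// invr_gt0.
  have : d * tau (1 : A) <= e by rewrite /d mulrAC ler_pdivrMr// ler_wpM2l ?(ltW e0)// lerDl.
  lra.
split=> // y; have mp := pos_sq' y.
have [C hC] := pos_bnd mp; have [C0 _ mC] := hC.
have S : tex (y * y^#) h f <= 0.
  apply: le_trans (tex_kle hp mp mC fu f0) _.
  by rewrite tex_kZ ?(ltW C0)// pmulr_rle0.
have -> : tau (y^# * k * y) = tau (y * y^# * pev h ('X - c%:P)).
  by rewrite pevB pevX pevC /h [_ + k]addrC addrK [tau (y^# * _ * _)]tauC mulrA.
rewrite -(tex_poly hp mp).
have : 0 <= tex (y * y^#) h (horner ('X - c%:P)) + tex (y * y^#) h f.
  rewrite -texD//; last exact: uf_poly.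
  apply: tex_ge0 => //; first by apply: ufD => //; apply: uf_poly.
  move=> t t0; rewrite !hornerE /f.
  have : c - t <= Num.max (c - t) 0 by rewrite le_max lexx.
  lra.
lra.
Qed.

End Norms2.

(** * Conditional expectations *)

Section CondExp.
Variables (R : realType) (A : tralg R).
Implicit Types (x y z u v w h k : A).

Record condexp (E : A -> A) : Prop := CondExp {
  ceP : forall r x y, E (r *: x + y) = r *: E x + E y;
  ce_ast : forall x, E x^# = (E x)^#;
  ce1 : E 1 = 1;
  ce_l : forall x y, E x = x -> E (x * y) = x * E y;
  ce_id : forall x, E (E x) = E x;
  ce_tau : forall x, tau (E x) = tau x }.

Variable E : A -> A.
Hypothesis hE : condexp E.

Lemma ceD x y : E (x + y) = E x + E y.
Proof. by have := ceP hE 1 x y; rewrite !scale1r. Qed.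

Lemma ce0 : E 0 = 0.
Proof. by apply: (addrI (E 0)); rewrite -ceD !addr0. Qed.

Lemma ceZ r x : E (r *: x) = r *: E x.
Proof. by have := ceP hE r x 0; rewrite ce0 !addr0. Qed.

Lemma ceB x y : E (x - y) = E x - E y.
Proof. by rewrite ceD -scaleN1r ceZ scaleN1r. Qed.

Lemma ce_r x y : E y = y -> E (x * y) = E x * y.
Proof.
move=> yE; rewrite -[x * y]astK astM (ce_ast hE) (ce_l hE); last by rewrite (ce_ast hE) yE.
by rewrite astM astK -(ce_ast hE) astK.
Qed.

Lemma ce_M x y : E x = x -> E y = y -> E (x * y) = x * y.
Proof. by move=> xE yE; rewrite (ce_l hE)// yE. Qed.

Lemma ce_pev k r : E k = k -> E (pev k r) = pev k r.
Proof.
move=> kE; elim/poly_ind: r => [|p c IH].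
  have -> : pev k 0 = 0 by rewrite -[X in pev _ X](scale0r (1 : {poly R})) pevZ scale0r.
  exact: ce0.
rewrite pevD pevM pevX pevC ceD ce_M// ceZ (ce1 hE)//.
Qed.

Lemma ce_tau_l x y : E x = x -> tau (x * E y) = tau (x * y).
Proof. by move=> xE; rewrite -(ce_l hE)// (ce_tau hE). Qed.

(** Positivity follows from the module property and the trace: by [pos_moments] one tests with
    squares of polynomials in [E h], which [E] fixes. *)
Lemma ce_pos h : pos h -> pos (E h).
Proof.
move=> [h1 h2]; apply: pos_moments; first by rewrite -(ce_ast hE) h1.
move=> r; set d := pev _ _.
have dE : E d = d by apply: ce_pev; apply: (ce_id hE).
have d1 : d^# = d by apply: pev_sa; rewrite -(ce_ast hE) h1.
by rewrite tauC ce_tau_l ?ce_M// tauC mulrA tauC mulrA -{1}d1 h2.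
Qed.

(** The test elements of [dual_pos] are polynomials in [E h], hence fixed by [E], so under the trace
    [E h] may be replaced by [h]. *)
Lemma Np_ce q h : 1 <= q -> pos h -> Np q (E h) <= Np q h.
Proof.
move=> + hp; have ep := ce_pos hp; rewrite le_eqVlt => /orP[/eqP <-|q1].
  by rewrite !Np1// (ce_tau hE).
have [q' [q1' qq _]] := conjP q1.
have q0 := lt_trans ltr01 q1; have q0' := lt_trans ltr01 q1'.
apply: (dual_pos ep q0 q0' qq (Np_ge0 q h)) => r rp.
rewrite tauC ce_tau_l; last by apply: ce_pev; apply: (ce_id hE).
by rewrite tauC; apply: tau_Np2.
Qed.

(** Expand E ((x - E x)^# (x - E x)). *)
Lemma ce_schwarz x : pos (E (x^# * x) - (E x)^# * E x).
Proof.
have -> : E (x^# * x) - (E x)^# * E x = E ((x - E x)^# * (x - E x)).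
  have e1 : E (E x) = E x := ce_id hE x.
  have e2 : E (E x)^# = (E x)^# by rewrite (ce_ast hE) e1.
  rewrite astB !mulrBl !mulrBr !ceB (ce_l hE _ e2) (ce_l hE _ e2) (ce_r _ e1) e1 (ce_ast hE).
  by rewrite subrr subr0.
exact/ce_pos/pos_sq.
Qed.

Lemma nm_ce q x : 2 <= q -> nm q (E x) <= nm q x.
Proof.
move=> q2; have qE : q = 2 * (q / 2) by field.
have q1 : 1 <= q / 2 by rewrite ler_pdivlMr// mul1r.
rewrite qE !nm_Np ge0_ler_powR ?nnegrE ?invr_ge0 ?Np_ge0//.
apply: le_trans (Np_ce q1 (pos_sq x)).
by apply: Np_le; [|exact: pos_sq|exact: ce_schwarz].
Qed.

End CondExp.

Lemma powR_prod_le (R : realType) (X Y a b : R) : 0 <= X -> 0 <= Y -> 0 < a -> 0 < b ->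
  a^-1 + b^-1 = 1 -> X `^ a^-1 * Y `^ b^-1 <= X + Y.
Proof.
move=> X0 Y0 a0 b0 ab.
have := conjugate_powR (powR_ge0 X a^-1) (powR_ge0 Y b^-1) a0 b0 ab.
rewrite -!powRrM !mulVf ?gt_eqF// !powRr1// => /le_trans; apply.
have ai : 0 < a^-1 by rewrite invr_gt0.
have bi : 0 < b^-1 by rewrite invr_gt0.
by apply: lerD; rewrite ler_piMr//; lra.
Qed.

(** * Positive bilinear forms with dominated marginals *)

Section Theta.
Variables (R : realType) (A : tralg R).
Implicit Types (x y z u v w h k : A).

Lemma bern_split c h N : bnd c h ->
  1 = \sum_(i < N.+1) pev h (bern c N i).
Proof. by move=> [c0 _ _]; rewrite -pev_sum sum_bern ?pev1// gt_eqF. Qed.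

Lemma bern_id c h N : bnd c h ->
  h = \sum_(i < N.+2) node c N.+1 i *: pev h (bern c N.+1 i).
Proof.
move=> [c0 _ _].
rewrite -{1}(pevX h) -{1}['X]expr1 (@Xn_bern _ c 1 N.+1) ?gt_eqF// pev_sum.
apply: eq_bigr => i _; rewrite pevZ; congr (_ *: _).
by case: i => -[|i] im //=; rewrite ?mulr1// /node mulr0 mul0r.
Qed.

Variable T : A -> A -> R.
Hypothesis Tl : forall r u u' v, T (r *: u + u') v = r * T u v + T u' v.
Hypothesis Tr : forall r u v v', T u (r *: v + v') = r * T u v + T u v'.
Hypothesis T0 : forall u v, pos u -> pos v -> 0 <= T u v.

Let TDl u u' v : T (u + u') v = T u v + T u' v.
Proof. by have := Tl 1 u u' v; rewrite scale1r mul1r. Qed.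
Let TDr u v v' : T u (v + v') = T u v + T u v'.
Proof. by have := Tr 1 u v v'; rewrite scale1r mul1r. Qed.
Let T0l v : T 0 v = 0.
Proof. by apply: (addrI (T 0 v)); rewrite -TDl !addr0. Qed.
Let T0r u : T u 0 = 0.
Proof. by apply: (addrI (T u 0)); rewrite -TDr !addr0. Qed.
Let TZl r u v : T (r *: u) v = r * T u v.
Proof. by have := Tl r u 0 v; rewrite !addr0 T0l addr0. Qed.
Let TZr r u v : T u (r *: v) = r * T u v.
Proof. by have := Tr r u v 0; rewrite !addr0 T0r addr0. Qed.

Let Tsum I (s : seq I) (F : I -> A) v : T (\sum_(i <- s) F i) v = \sum_(i <- s) T (F i) v.
Proof. exact: (big_morph (T ^~ v) (fun x y => TDl x y v) (T0l v)). Qed.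
Let Tsum' I (s : seq I) (F : I -> A) u : T u (\sum_(i <- s) F i) = \sum_(i <- s) T u (F i).
Proof. exact: (big_morph (T u) (TDr u) (T0r u)). Qed.

Variables (R0 C0 : A).
Hypotheses (R0p : pos R0) (C0p : pos C0).
Hypothesis T1 : forall u, pos u -> T u 1 <= tau (R0 * u).
Hypothesis T2 : forall v, pos v -> T 1 v <= tau (C0 * v).

(* As in [holder_add], [T (b_i(w)) (b_j(k))] are the masses of a joint
   distribution, whose marginals are dominated by those of [R0] and [C0]. *)
Lemma theta_add w k (a b : R) : pos w -> pos k -> 0 < a -> 0 < b -> a^-1 + b^-1 = 1 ->
  T w k <= tex R0 w (fun t => t `^ a) / a + tex C0 k (fun t => t `^ b) / b.
Proof.
move=> wp kp a0 b0 ab.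
have hc := cbndP wp; have kc := cbndP kp.
set c := cbnd w in hc; set d := cbnd k in kc.
have [c0 _ _] := hc; have [d0 _ _] := kc.
have ua := uf_powR (ltW a0); have ub := uf_powR (ltW b0).
rewrite (texE hc R0p ua) (texE kc C0p ub).
have L := tendsD (tendsZ a^-1 (tends_shift (riem_ext (haus_tau hc R0p) (ua _))))
                 (tendsZ b^-1 (tends_shift (riem_ext (haus_tau kc C0p) (ub _)))).
rewrite ![_ / _]mulrC; apply: (tends_le _ (tends_const _) L) => N; rewrite /riem.
pose m (i j : 'I_N.+2) := T (pev w (bern c N.+1 i)) (pev k (bern d N.+1 j)).
have bw i : pos (pev w (bern c N.+1 i)).
  by apply: (pos_pev hc) => t ht; apply: (haus_bern (haus_eval c0 ht)).
have bk i : pos (pev k (bern d N.+1 i)).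
  by apply: (pos_pev kc) => t ht; apply: (haus_bern (haus_eval d0 ht)).
have EL : T w k = \sum_(i < N.+2) \sum_(j < N.+2) node c N.+1 i * node d N.+1 j * m i j.
  rewrite {1}(bern_id N hc) {1}(bern_id N kc) Tsum; apply: eq_bigr => i _.
  by rewrite Tsum'; apply: eq_bigr => j _; rewrite TZl TZr mulrA.
have E1 : \sum_(i < N.+2) node c N.+1 i `^ a * tau (R0 * pev w (bern c N.+1 i)) >=
   \sum_(i < N.+2) \sum_(j < N.+2) node c N.+1 i `^ a * m i j.
  apply: ler_sum => i _; rewrite -mulr_sumr -Tsum' -(bern_split N.+1 kc).
  by rewrite ler_wpM2l ?powR_ge0// T1.
have E2 : \sum_(j < N.+2) node d N.+1 j `^ b * tau (C0 * pev k (bern d N.+1 j)) >=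
   \sum_(i < N.+2) \sum_(j < N.+2) node d N.+1 j `^ b * m i j.
  rewrite exchange_big; apply: ler_sum => j _; rewrite -mulr_sumr -Tsum -(bern_split N.+1 hc).
  by rewrite ler_wpM2l ?powR_ge0// T2.
have ai : 0 <= a^-1 by rewrite invr_ge0 ltW.
have bi : 0 <= b^-1 by rewrite invr_ge0 ltW.
apply: le_trans (lerD (ler_wpM2l ai E1) (ler_wpM2l bi E2)).
rewrite EL !mulr_sumr -big_split; apply: ler_sum => i _ /=.
rewrite !mulr_sumr -big_split; apply: ler_sum => j _ /=.
rewrite [a^-1 * _]mulrA [b^-1 * _]mulrA -mulrDl ler_wpM2r ?T0// ![_^-1 * _]mulrC.
have nc : 0 <= node c N.+1 i by have /andP[] := node_itv (ltW c0) (ltn_ord i : (i <= N.+1)%N).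
have nd : 0 <= node d N.+1 j by have /andP[] := node_itv (ltW d0) (ltn_ord j : (j <= N.+1)%N).
exact: conjugate_powR.
Qed.

(** The exponents a = (q-1)/(q-2) and b = q-1 are conjugate, with a q' = s and b q' = q. Hölder
    against [R0] and [C0] in L_q thus yields the norm of [w] in L_s to the power a and that of [k]
    in L_q to the power b. *)
Lemma theta_bound w k (q s : R) : pos w -> pos k -> 2 < q -> s = q / (q - 2) ->
  T w k <= Np s w * Np q k * (Np q R0 + Np q C0).
Proof.
move=> wp kp q2 sE; have q0 : 0 < q by apply: lt_trans q2.
have q1 : 1 < q by lra.
have [q' [q1' qq qE]] := conjP q1; have q0' := lt_trans ltr01 q1'.
have p1 : 0 < q - 1 by lra. have p2 : 0 < q - 2 by lra.
pose a := (q - 1) / (q - 2); pose b := q - 1.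
have a0 : 0 < a by rewrite divr_gt0.
have ab : a^-1 + b^-1 = 1 by rewrite /a /b; field; rewrite ?gt_eqF.
have s0 : 0 < s by rewrite sE divr_gt0.
set TA := tex R0 w (fun t => t `^ a); set TB := tex C0 k (fun t => t `^ b).
have ua := uf_powR (ltW a0); have ub : uf (fun t : R => t `^ b) by apply: uf_powR; apply: ltW.
have TA0 : 0 <= TA by apply: tex_ge0 => // t _; apply: powR_ge0.
have TB0 : 0 <= TB by apply: tex_ge0 => // t _; apply: powR_ge0.
have H : T w k <= TA `^ a^-1 * TB `^ b^-1.
  apply: young_homog => // l l0.
  have l1 : 0 <= l^-1 by rewrite invr_ge0 ltW.
  have := theta_add (posZ (ltW l0) wp) (posZ l1 kp) a0 p1 ab.
  rewrite TZl TZr mulVKf ?gt_eqF//.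
  have S (m : R) v V f : 0 < m -> pos V -> pos v -> 0 < f ->
      tex V (m *: v) (fun t => t `^ f) = m `^ f * tex V v (fun t => t `^ f).
    move=> m0 Vp vp f0; have uf' := uf_powR (ltW f0).
    have := tex_comp (r := m *: 'X) vp Vp uf'; rewrite pevZ pevX => -[|_ ->].
      by move=> t t0; rewrite hornerZ hornerX mulr_ge0 ?(ltW m0).
    rewrite -texZ//; apply: tex_eq => t t0.
    by rewrite hornerZ hornerX powRM ?(ltW m0).
  rewrite !S ?invr_gt0// -/TA -/TB.
  by rewrite -[in X in X -> _](powR_inv1 (ltW l0)) -powRrM mulN1r.
apply: le_trans H _.
have BA : TA <= Np q R0 * Np s w `^ a.
  apply: le_trans (holder R0p wp ua _ q0 q0' qq) _; first by move=> t _; apply: powR_ge0.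
  rewrite -NpE; apply: ler_wpM2l; first exact: Np_ge0.
  rewrite !NpE -powRrM.
  have -> : s^-1 * a = q'^-1 by rewrite qE sE /a; field; rewrite ?gt_eqF.
  rewrite le_eqVlt; apply/orP; left; apply/eqP; congr (_ `^ _); rewrite pwE.
  apply: tex_eq => t _; rewrite -powRrM; congr (_ `^ _).
  by rewrite qE sE /a; field; rewrite ?gt_eqF.
have BB : TB <= Np q C0 * Np q k `^ b.
  apply: le_trans (holder C0p kp ub _ q0 q0' qq) _; first by move=> t _; apply: powR_ge0.
  rewrite -NpE; apply: ler_wpM2l; first exact: Np_ge0.
  rewrite !NpE -powRrM.
  have -> : q^-1 * b = q'^-1 by rewrite qE /b; field; rewrite ?gt_eqF.
  rewrite le_eqVlt; apply/orP; left; apply/eqP; congr (_ `^ _); rewrite pwE.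
  apply: tex_eq => t _; rewrite -powRrM; congr (_ `^ _).
  by rewrite qE /b; field; rewrite ?gt_eqF.
have X1 : TA `^ a^-1 <= Np q R0 `^ a^-1 * Np s w.
  apply: (@le_trans _ _ ((Np q R0 * Np s w `^ a) `^ a^-1)).
    by rewrite ge0_ler_powR ?nnegrE ?invr_ge0 ?(ltW a0) ?mulr_ge0 ?Np_ge0 ?powR_ge0.
  rewrite (powRM _ (Np_ge0 _ _) (powR_ge0 _ _)) -(powRrM (Np s w)) mulfV ?gt_eqF//.
  by rewrite (powRr1 (Np_ge0 _ _)).
have X2 : TB `^ b^-1 <= Np q C0 `^ b^-1 * Np q k.
  apply: (@le_trans _ _ ((Np q C0 * Np q k `^ b) `^ b^-1)).
    by rewrite ge0_ler_powR ?nnegrE ?invr_ge0 ?(ltW p1) ?mulr_ge0 ?Np_ge0 ?powR_ge0.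
  rewrite (powRM _ (Np_ge0 _ _) (powR_ge0 _ _)) -(powRrM (Np q k)) mulfV ?(gt_eqF p1)//.
  by rewrite (powRr1 (Np_ge0 _ _)).
apply: le_trans (ler_pM (powR_ge0 _ _) (powR_ge0 _ _) X1 X2) _.
rewrite mulrACA [leLHS]mulrC; apply: ler_wpM2l.
  exact: mulr_ge0 (Np_ge0 _ _) (Np_ge0 _ _).
set X := Np q R0; set Y := Np q C0.
have X0 : 0 <= X by exact: Np_ge0. have Y0 : 0 <= Y by exact: Np_ge0.
exact: powR_prod_le.
Qed.

End Theta.

Section Small.
Variables (R : realType) (A : tralg R).
Implicit Types (h : A).

Lemma pw_small (s c : R) h : 1 <= s -> bnd c h -> pw s h <= c `^ (s - 1) * tau h.
Proof.
move=> s1 hc; have [c0 hp _] := hc; have p1 := @pos1 _ A.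
have s0 : 0 < s by apply: lt_le_trans s1.
have -> : c `^ (s - 1) * tau h = tex 1 h (horner (c `^ (s - 1) *: 'X)).
  by rewrite (tex_poly hp p1) pevZ pevX mul1r tauZ.
rewrite pwE (texE hc p1 (uf_powR (ltW s0))) (texE hc p1 (uf_poly _)).
apply: (ext_le (haus_tau hc p1)); [exact/ufc_powR/ltW|exact: ufc_poly|].
move=> t /andP[t0 tc]; rewrite hornerZ hornerX mulrC -(mulr_powRB1 t0 s0).
by rewrite ler_wpM2l// ge0_ler_powR ?nnegrE ?subr_ge0// ltW.
Qed.

End Small.

(** * Cotlar's argument and interpolation *)

Section RealInterp.
Variable R : realType.

(** The value 1 at negative [t] keeps it in [0, 1] on the whole line. *)
Definition cutoff (t0 t : R) : R := if 0 <= t then t0 / (t + t0) else 1.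
(** On t >= 0 this is t^2 / (t + t0), comparable to min(t, t^2 / t0): a K-functional of the pair
    L_2, L_4 evaluated at t = |x|^2. *)
Definition gfun (t0 t : R) : R := t * (1 - cutoff t0 t).

Lemma cutoff_itv t0 t : 0 < t0 -> 0 <= cutoff t0 t <= 1.
Proof.
move=> h0; rewrite /cutoff; case: ifP => t1; last by rewrite ler01 lexx.
have p : 0 < t + t0 by rewrite ltr_wpDl.
by rewrite divr_ge0 ?(ltW h0) ?(ltW p)//= ler_pdivrMr// mul1r lerDr.
Qed.

Lemma uf_cutoff t0 : 0 < t0 -> uf (cutoff t0).
Proof.
move=> h0 c; split.
  by exists 1 => x _; have /andP[? ?] := cutoff_itv x h0; rewrite ger0_norm.
move=> e e0; exists (e * t0); first by rewrite mulr_gt0.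
move=> x y /andP[x0 _] /andP[y0 _] xy; rewrite /cutoff x0 y0.
have px : 0 < x + t0 by rewrite ltr_wpDl.
have py : 0 < y + t0 by rewrite ltr_wpDl.
have -> : t0 / (x + t0) - t0 / (y + t0) = t0 / (x + t0) * ((y - x) / (y + t0)).
  by field; rewrite !gt_eqF.
rewrite normrM ger0_norm ?divr_ge0 ?(ltW h0) ?(ltW px)//.
apply: (@le_trans _ _ (1 * e)); last by rewrite mul1r.
apply: ler_pM; rewrite ?divr_ge0 ?(ltW h0) ?(ltW px)//.
  by rewrite ler_pdivrMr// mul1r lerDr.
rewrite normrM normfV [X in _ / X]ger0_norm ?(ltW py)// ler_pdivrMr//.
rewrite distrC (le_trans xy)// ler_wpM2l ?(ltW e0)// lerDr//.
Qed.

Lemma uf_gfun t0 : 0 < t0 -> uf (gfun t0).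
Proof.
move=> h0; apply: ufM; first exact: uf_id.
have -> : (fun t => 1 - cutoff t0 t) = (fun t => 1 + (-1) * cutoff t0 t).
  by apply/funext => t; rewrite mulN1r.
by apply: ufD; [exact: uf_const|apply: ufM; [exact: uf_const|exact: uf_cutoff]].
Qed.

Lemma gfunE t0 t : 0 < t0 -> 0 <= t -> gfun t0 t = t ^+ 2 / (t + t0).
Proof.
move=> h0 t1; rewrite /gfun /cutoff t1; have p : 0 < t + t0 by rewrite ltr_wpDl.
by field; rewrite gt_eqF.
Qed.

Lemma gfun_ge0 t0 t : 0 < t0 -> 0 <= t -> 0 <= gfun t0 t.
Proof.
by move=> h0 t1; have /andP[? ?] := cutoff_itv t h0; rewrite mulr_ge0// subr_ge0.
Qed.

(* Tangent line inequality for the convex function [gfun t0], whose derivative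
   at [r] is [1 - cutoff t0 r ^ 2]. *)
Lemma gfun_tangent t0 r s : 0 < t0 -> 0 <= r -> 0 <= s ->
  - (r * cutoff t0 r * (1 - cutoff t0 r)) + (1 - cutoff t0 r ^+ 2) * s <= gfun t0 s.
Proof.
move=> h0 r0 s0; rewrite gfunE//.
have p : 0 < s + t0 by rewrite ltr_wpDl.
have pr : 0 < r + t0 by rewrite ltr_wpDl.
rewrite ler_pdivlMr//; set e := cutoff t0 r.
have re : r * e = t0 * (1 - e).
  by rewrite /e /cutoff r0; field; rewrite gt_eqF.
rewrite re.
have : 0 <= (e * s - t0 * (1 - e)) ^+ 2 by exact: sqr_ge0.
nra.
Qed.

Lemma gscale (q b t : R) : 0 < q -> 0 < b -> 0 < t ->
  b `^ (q - 1) * gfun b t = t `^ q * ((b / t) `^ (q - 1) / (1 + b / t)).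
Proof.
move=> q0 b0 tp; have t0 := ltW tp.
have bt : 0 < t + b by rewrite addr_gt0.
rewrite gfunE// powRM ?invr_ge0 ?(ltW b0)//.
have -> : t^-1 `^ (q - 1) = (t `^ (q - 1))^-1.
  by rewrite -powR_inv1// -powRrM mulN1r powRN.
rewrite -(mulr_powRB1 t0 q0); have := powR_gt0 (q - 1) tp.
set Q := t `^ (q - 1) => Q0; field; rewrite !gt_eqF//.
Qed.

(* With [psi s = s^al / (1 + s^al)], the increments of [psi] along [s, 2 s, 4 s ...]
   dominate [s^(q-1) / (1 + s)]; the sums below telescope. *)
Lemma dyadic_upper (q : R) : 1 < q < 2 -> exists K, 0 <= K /\
  forall (N : nat) (a t : R), 0 < a -> 0 <= t ->
  \sum_(n < N) (2 ^+ n * a) `^ (q - 1) * gfun (2 ^+ n * a) t <= K * t `^ q.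
Proof.
move=> /andP[q1 q2]; have q0 : 0 < q by lra.
(* s^(q-1) / (1 + s) is at most s^al for s <= 1 and s^(-al) for s > 1, and the increments of [psi]
   decay at the same rates. *)
pose al := Num.min (q - 1) (2 - q).
have al0 : 0 < al by rewrite lt_min; apply/andP; split; lra.
have al1 : al <= q - 1 by rewrite ge_min lexx.
have al2 : al <= 2 - q by rewrite ge_min lexx orbT.
have w1 : 1 < (2 : R) `^ al.
  rewrite -[ltLHS](powRr0 2); rewrite /powR gt_eqF// ltr_expR mul0r.
  by rewrite mulr_gt0// ln_gt0// ltr1n.
pose w := (2 : R) `^ al; pose psi s := s `^ al / (1 + s `^ al).
have psi01 s : 0 <= psi s <= 1.
  have P : 0 <= s `^ al by exact: powR_ge0.
  have P1 : 0 < 1 + s `^ al by rewrite ltr_wpDr.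
  by rewrite divr_ge0 ?(ltW P1)//= ler_pdivrMr// mul1r lerDr.
have one : (1 : R) `^ al = 1 by rewrite powR1.
pose K := 4 * w / (w - 1).
have w10 : 0 < w - 1 by rewrite subr_gt0.
have K0 : 0 <= K by rewrite divr_ge0 ?(ltW w10)// mulr_ge0// powR_ge0.
have key s : 0 < s -> s `^ (q - 1) / (1 + s) <= K * (psi (2 * s) - psi s).
  move=> s0; set P := s `^ al; have P0 : 0 < P by exact: powR_gt0.
  have w0 : 0 < w by exact: powR_gt0.
  have P1 : 0 < 1 + P by rewrite ltr_wpDr// ltW.
  have s1 : 0 < 1 + s by rewrite ltr_wpDr// ltW.
  have P2 : 0 < 1 + w * P by rewrite ltr_wpDr// mulr_ge0 ?ltW.
  have X : s `^ (q - 1) / (1 + s) <= 4 * (P / (1 + P) ^+ 2).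
    have [sle|sgt] := leP s 1.
      apply: (@le_trans _ _ P).
        rewrite ler_pdivrMr//; apply: (@le_trans _ _ P).
          by rewrite /P ger_powR// s0.
        by rewrite ler_peMr ?(ltW P0)// lerDl ltW.
      rewrite mulrCA ler_peMr ?(ltW P0)// ler_pdivlMr ?exprn_gt0// mul1r.
      have P11 : P <= 1 by rewrite /P -[X in _ <= X]one ge0_ler_powR ?nnegrE ?(ltW al0) ?(ltW s0).
      have : (1 + P) ^+ 2 <= 2 ^+ 2 by rewrite lerXn2r ?nnegrE ?(ltW P1)//; lra.
      by lra.
    have P11 : 1 <= P by rewrite /P -[X in X <= _]one ge0_ler_powR ?nnegrE ?(ltW al0) ?(ltW s0) ?ltW.
    apply: (@le_trans _ _ (s `^ (q - 1) / s)).
      by rewrite ler_wpM2l ?powR_ge0// lef_pV2 ?posrE// lerDr.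
    apply: (@le_trans _ _ P^-1).
      have -> : s `^ (q - 1) / s = s `^ (q - 2).
        have sn : s != 0 by rewrite gt_eqF.
        have -> : q - 2 = (q - 1) - 1 by ring.
        by rewrite [in RHS]powRB ?sn ?implybT// powRr1// ltW.
      rewrite /P -powRN ler_powR ?(ltW sgt)//; lra.
    rewrite mulrA ler_pdivlMr ?exprn_gt0// ler_pdivrMl//.
    have : (1 + P) ^+ 2 <= (2 * P) ^+ 2 by rewrite lerXn2r ?nnegrE ?mulr_ge0 ?(ltW P0) ?(ltW P1)//; lra.
    by rewrite exprMn -[2 ^+ 2]/(_) expr2; lra.
  apply: le_trans X _.
  have -> : psi (2 * s) - psi s = (w - 1) * P / ((1 + w * P) * (1 + P)).
    rewrite /psi powRM ?(ltW s0)// -/w -/P; field.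
    by rewrite !gt_eqF.
  rewrite /K.
  have -> : 4 * w / (w - 1) * ((w - 1) * P / ((1 + w * P) * (1 + P))) =
     4 * (P / (((1 + w * P) / w) * (1 + P))).
    by field; rewrite !gt_eqF.
  rewrite ler_wpM2l// ler_wpM2l ?(ltW P0)// lef_pV2 ?posrE ?exprn_gt0 ?mulr_gt0 ?divr_gt0 ?invr_gt0//.
  rewrite expr2 ler_wpM2r ?(ltW P1)// ler_pdivrMr// mulrDl mul1r mulrC lerD2r ltW//.
exists K; split=> // N a t a0 t0.
have [->|tn] := eqVneq t 0.
  rewrite powR0 ?gt_eqF// mulr0 big1// => n _.
  by rewrite /gfun mul0r mulr0.
have tp : 0 < t by rewrite lt_neqAle eq_sym tn.
apply: (@le_trans _ _ (\sum_(n < N) K * t `^ q * (psi (2 ^+ n.+1 * a / t) - psi (2 ^+ n * a / t)))).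
  apply: ler_sum => n _; set b := 2 ^+ n * a.
  have b0 : 0 < b by rewrite mulr_gt0// exprn_gt0.
  rewrite gscale//.
  have -> : 2 ^+ n.+1 * a / t = 2 * (b / t) by rewrite exprS /b !mulrA.
  rewrite [leRHS](_ : _ = t `^ q * (K * (psi (2 * (b / t)) - psi (b / t)))); last by ring.
  apply: ler_wpM2l; first exact: powR_ge0.
  by apply: key; rewrite divr_gt0.
rewrite -mulr_sumr -(big_mkord xpredT (fun n => psi (2 ^+ n.+1 * a / t) - psi (2 ^+ n * a / t))).
rewrite telescope_sumr// ler_piMr ?(mulr_ge0 K0 (powR_ge0 _ _))//.
have /andP[? ?] := psi01 (2 ^+ N * a / t); have /andP[? ?] := psi01 (2 ^+ 0 * a / t).
by lra.
Qed.

(** For psi(b) = t^q b / (t + b) the increment psi(2 b) - psi(b) is at most the term at scale b, and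
    psi increases from 0 to t^q. Starting at a small [a] and stopping at a large 2^N a costs at most
    [e], uniformly on [0, c]. *)
Lemma dyadic_lower (q c : R) : 1 < q < 2 -> 0 < c -> forall e, 0 < e ->
  exists (N : nat) (a : R), 0 < a /\ forall t, 0 <= t <= c ->
  t `^ q <= \sum_(n < N) (2 ^+ n * a) `^ (q - 1) * gfun (2 ^+ n * a) t + e.
Proof.
move=> /andP[q1 q2] c0 e e0; have q0 : 0 < q by lra.
pose C := c `^ (q - 1) + 1.
have C0 : 0 < C by rewrite ltr_wpDl// powR_ge0.
pose a := e / 2 / C; have a0 : 0 < a by rewrite !divr_gt0.
have [N hN] : exists N : nat, c `^ (q - 1) * c ^+ 2 / (e / 2) <= 2 ^+ N * a.
  pose B := c `^ (q - 1) * c ^+ 2 / (e / 2) / a.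
  have e20 : 0 < e / 2 by rewrite divr_gt0.
  have B0 : 0 <= B.
    apply: divr_ge0; last exact: ltW.
    apply: divr_ge0; last exact: ltW.
    by rewrite mulr_ge0 ?powR_ge0 ?exprn_ge0 ?(ltW c0).
  exists (Num.bound B); rewrite -ler_pdivrMr// -/B.
  apply: (le_trans (ltW (archi_boundP B0))).
  by rewrite -natrX ler_nat ltnW// ltn_expl.
exists N, a; split=> // t /andP[t0 tc].
have [->|tn] := eqVneq t 0.
  rewrite powR0 ?gt_eqF// addr_ge0 ?(ltW e0)// sumr_ge0// => n _.
  by rewrite /gfun mul0r mulr0.
have tp : 0 < t by rewrite lt_neqAle eq_sym tn.
pose psi b := t `^ q * ((b / t) / (1 + b / t)).
have step b : 0 < b -> psi (2 * b) - psi b <= b `^ (q - 1) * gfun b t.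
  move=> b0; rewrite /psi -mulrBr gscale// ler_wpM2l ?powR_ge0//.
  have -> : 2 * b / t = 2 * (b / t) by rewrite mulrA.
  set s := b / t; have s0 : 0 < s by rewrite divr_gt0.
  have s1 : 0 < 1 + s by rewrite addr_gt0.
  have s2 : 0 < 1 + 2 * s by rewrite addr_gt0// mulr_gt0.
  have -> : 2 * s / (1 + 2 * s) - s / (1 + s) = s / (1 + 2 * s) / (1 + s).
    by field; rewrite !gt_eqF.
  rewrite ler_wpM2r ?invr_ge0 ?(ltW s1)// ler_pdivrMr//.
  have E : s = s `^ (q - 1) * s `^ (2 - q).
    have sn : s != 0 by rewrite gt_eqF.
    rewrite -powRD ?sn ?implybT//.
    have -> : q - 1 + (2 - q) = 1 by ring.
    by rewrite powRr1// ltW.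
  rewrite {1}E ler_wpM2l ?powR_ge0//.
  have [sle|sgt] := leP s 1.
    apply: (@le_trans _ _ 1); last by rewrite lerDl mulr_ge0// ltW.
    by rewrite -[leRHS](powRr0 s) ger_powR ?s0// ?sle//; lra.
  apply: (@le_trans _ _ s); last by lra.
  by rewrite -[leRHS]powRr1 ?(ltW s0)// ler_powR ?(ltW sgt)//; lra.
have tele : psi (2 ^+ N * a) - psi a <=
    \sum_(n < N) (2 ^+ n * a) `^ (q - 1) * gfun (2 ^+ n * a) t.
  have -> : psi (2 ^+ N * a) - psi a =
      \sum_(n < N) (psi (2 ^+ n.+1 * a) - psi (2 ^+ n * a)).
    rewrite -(big_mkord xpredT (fun n => psi (2 ^+ n.+1 * a) - psi (2 ^+ n * a))).
    by rewrite telescope_sumr// expr0 mul1r.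
  apply: ler_sum => n _; rewrite exprS -mulrA; apply: step.
  by rewrite mulr_gt0// exprn_gt0.
have Q1 : t `^ (q - 1) <= c `^ (q - 1).
  by rewrite ge0_ler_powR ?nnegrE ?(ltW c0)//; lra.
have psiE b : 0 < b -> psi b = t `^ (q - 1) * t * (b / (t + b)).
  move=> b0; rewrite /psi -(mulr_powRB1 t0 q0); field.
  by rewrite !gt_eqF// addr_gt0.
set B := 2 ^+ N * a in hN tele *; have B0 : 0 < B by rewrite mulr_gt0// exprn_gt0.
have h1 : t `^ q - psi B <= e / 2.
  rewrite psiE// -(mulr_powRB1 t0 q0).
  have -> : t * t `^ (q - 1) - t `^ (q - 1) * t * (B / (t + B)) =
      t `^ (q - 1) * t ^+ 2 / (t + B).
    by field; rewrite gt_eqF// addr_gt0.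
  rewrite ler_pdivrMr ?addr_gt0//.
  move: hN; rewrite ler_pdivrMr ?divr_gt0// => hN.
  apply: (@le_trans _ _ (c `^ (q - 1) * c ^+ 2)).
    by apply: ler_pM; rewrite ?powR_ge0 ?exprn_ge0// lerXn2r ?nnegrE// ltW.
  by apply: (le_trans hN); rewrite mulrC ler_wpM2l ?divr_ge0 ?(ltW e0)// lerDr.
have h2 : psi a <= e / 2.
  rewrite psiE// -mulrA.
  have : t * (a / (t + a)) <= a.
    rewrite mulrA ler_pdivrMr ?addr_gt0// mulrC ler_wpM2l ?(ltW a0)// lerDl ltW//.
  have aC : a * C = e / 2 by rewrite /a divfK// gt_eqF.
  move=> h; apply: (@le_trans _ _ (C * a)); last by rewrite mulrC aC.
  apply: ler_pM => //; rewrite ?powR_ge0//.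
    by rewrite mulr_ge0// divr_ge0 ?(ltW a0)// addr_ge0// ltW.
  by rewrite (le_trans Q1)// lerDl.
lra.
Qed.

End RealInterp.

Section Cotlar.
Variables (R : realType) (A : tralg R).
Implicit Types (x y z u v w h k : A).

(* The hypotheses on [F] under which Cotlar's argument applies; [D] bounds the
   defect in Cotlar's identity. *)
Record cotlar (F D : A -> A) : Prop := Cotlar {
  co_lin : forall r x y, F (r *: x + y) = r *: F x + F y;
  co_2 : forall x, tau ((F x)^# * F x) <= tau (x^# * x);
  co_pos : forall h, pos h -> pos (D h);
  co_D : forall q h, 1 <= q -> pos h -> Np q (D h) <= Np q h;
  co_id : forall x y, pos y -> tau (F x * (F x)^# * y) <=
     2 * tau (F (x * (F x)^#) * y) - tau (F (F (x * x^#))^# * y) + tau (D (x * x^#) * y) }.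

Variables (F D : A -> A).
Hypothesis hF : cotlar F D.

Let FD x y : F (x + y) = F x + F y.
Proof. by have := co_lin hF 1 x y; rewrite !scale1r. Qed.

Lemma quad_bound (N X f : R) : 0 <= N -> 0 <= X -> 0 <= f ->
  N ^+ 2 <= 2 * f * (X * N) + f ^+ 2 * X ^+ 2 + X ^+ 2 -> N <= (3 * f + 1) * X.
Proof.
move=> N0 X0 f0 H; rewrite leNgt; apply/negP => K.
have f1 : 0 <= 3 * f + 1 by rewrite addr_ge0// mulr_ge0.
have : 0 < (N - (3 * f + 1) * X) * (N + (f + 1) * X).
  rewrite mulr_gt0 ?subr_gt0//.
  have N1 : 0 < N by apply: le_lt_trans K; rewrite mulr_ge0.
  by rewrite ltr_wpDr// mulr_ge0// addr_ge0.
have : 0 <= f * X ^+ 2 by rewrite mulr_ge0// exprn_ge0.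
have : 0 <= f * X * N by rewrite !mulr_ge0.
have : 0 <= f ^+ 2 * X ^+ 2 by rewrite mulr_ge0// exprn_ge0.
nra.
Qed.

(** The square of an L_(2q) norm is an L_q norm, where [F] is already bounded. Testing [co_id] with
    positive y gives N^2 <= 2 f X N + f^2 X^2 + X^2 for N, X the norms of [F x] and [x]. *)
Lemma cotlar_step (q f : R) : 2 <= q -> 0 <= f -> (forall x, nm q (F x) <= f * nm q x) ->
  forall x, nm (2 * q) (F x) <= (3 * f + 1) * nm (2 * q) x.
Proof.
move=> q2 f0 hf x; have q1 : 1 < q by lra.
have q0 : 0 < q by lra.
have [q' [q1' qq _]] := conjP q1; have q0' := lt_trans ltr01 q1'.
have q20 : 0 <= 2 * q by rewrite mulr_ge0// ltW.
have xx := pos_sq' x; have fx := pos_sq' (F x).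
have NE := nm_sq' (F x) (ltW q0); have XE := nm_sq' x (ltW q0).
have N0 := nm_ge0 (2 * q) (F x); have X0 := nm_ge0 (2 * q) x.
have n1 : nm q (F (x * (F x)^#)) <= f * (nm (2 * q) x * nm (2 * q) (F x)).
  apply: le_trans (hf _) _; apply: (ler_wpM2l f0).
  by have := nmM x (F x)^# q2; rewrite (nm_ast _ q20).
have n2 : nm q (F (F (x * x^#))^#) <= f * (f * nm (2 * q) x ^+ 2).
  apply: le_trans (hf _) _; apply: (ler_wpM2l f0).
  rewrite (nm_ast _ (ltW q0)); apply: le_trans (hf _) _; apply: (ler_wpM2l f0).
  by rewrite (nm_pos (ltW q0) xx) XE.
have n3 := co_D hF (ltW q1) xx; rewrite -XE in n3.
move: n1 n2 n3 NE N0 X0.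
move: (nm (2 * q) x) (nm (2 * q) (F x)) => X N n1 n2 n3 NE N0 X0.
apply: quad_bound => //; rewrite NE.
have K0 : 0 <= 2 * f * (X * N) + f ^+ 2 * X ^+ 2 + X ^+ 2.
  by rewrite !addr_ge0 ?mulr_ge0 ?exprn_ge0.
apply: (dual_pos fx q0 q0' qq K0) => r yp; move: (pev _ r) yp => y yp.
have yE := nm_pos (ltW q0') yp.
have t1 := tau_nm2 (F (x * (F x)^#)) y q2 q0' qq.
have t2 := tau_nm2 (- F (F (x * x^#))^#) y q2 q0' qq.
have t3 := tau_Np2 (co_pos hF xx) yp q0 q0' qq.
have t4 := co_id hF x yp.
have Y0 := Np_ge0 q' y.
rewrite yE in t1; rewrite yE nmN mulNr tauN in t2.
move: t1 t2 t3 t4 Y0 n1 n2 n3.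
move: (Np q' y) (tau _) (tau _) (tau _) (tau _) (nm q _) (nm q _) (Np q (D _)).
move=> Y T1 T2 T3 T4 A1 A2 A3 t1 t2 t3 t4 Y0 n1 n2 n3.
have := ler_wpM2r Y0 n1; have := ler_wpM2r Y0 n2; have := ler_wpM2r Y0 n3.
rewrite !mulrDl; lra.
Qed.

Lemma parallelogram u v : (u + v)^# * (u + v) + (u - v)^# * (u - v) =
  2 *: (u^# * u) + 2 *: (v^# * v).
Proof.
have add2 (p q : A) : (p + q) + (p - q) = 2 *: p.
  by rewrite addrACA subrr addr0 scaler_nat mulr2n.
rewrite astD astB !mulrBl !mulrDl !mulrBr !mulrDr opprB addrACA add2; congr (_ + _).
by rewrite [X in X + _]addrC add2.
Qed.

Lemma nm4 v : nm 4 v ^+ 4 = tau ((v^# * v) * (v^# * v)).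
Proof.
have vp := pos_sq v; have p1 := @pos1 _ A.
have -> : nm 4 v ^+ 4 = (nm (2 * 2) v ^+ 2) ^+ 2 by rewrite -exprM -natrM.
rewrite nm_sq// NpE -powR_mulrn ?powR_ge0// -powRrM mulVf ?pnatr_eq0// powRr1; last first.
  by rewrite pw_ge0.
rewrite pwE (@tex_eq _ _ _ _ _ (horner ('X * 'X))).
  by rewrite tex_poly// mul1r pevM pevX.
by move=> t t0; rewrite powR_mulrn// hornerM hornerX expr2.
Qed.

(* Real interpolation between 2 and 4: split [x] as [x (1 - r(h)) + x r(h)] with
   [h = x^# x] and [r] close to [cutoff t0]. *)
Lemma interp_slice (f t0 : R) x : 0 <= f -> 0 < t0 ->
  (forall x, nm 4 (F x) <= f * nm 4 x) ->
  tex 1 ((F x)^# * F x) (gfun t0) <= (2 + 64 * f ^+ 4) * tex 1 (x^# * x) (gfun t0).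
Proof.
move=> f0 h0 hf; have p1 := @pos1 _ A; have ug := uf_gfun h0.
set h := x^# * x; set k := (F x)^# * F x.
have hp : pos h by exact: pos_sq. have kp : pos k by exact: pos_sq.
have [h1 _] := hp.
pose e := cutoff t0; have ue : uf e := uf_cutoff h0.
pose ga r := - (r * e r * (1 - e r)); pose gb r := 1 - e r ^+ 2.
have u1e : uf (fun r => 1 - e r).
  have -> : (fun r => 1 - e r) = (fun r => 1 + (-1) * e r).
    by apply/funext => t; rewrite mulN1r.
  by apply: ufD; [exact: uf_const|apply: ufM; [exact: uf_const|]].
have uga : uf ga.
  have -> : ga = (fun r => (-1) * ((r * e r) * (1 - e r))).
    by apply/funext => t; rewrite mulN1r.
  by apply: ufM; [exact: uf_const|apply: ufM => //; apply: ufM => //; exact: uf_id].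
have ugb : uf gb.
  have -> : gb = (fun r => 1 + (-1) * (e r * e r)).
    by apply/funext => t; rewrite mulN1r -expr2.
  by apply: ufD; [exact: uf_const|apply: ufM; [exact: uf_const|apply: ufM]].
have gb0 t : 0 <= t -> 0 <= gb t.
  move=> _; have /andP[a1 a2] := cutoff_itv t h0.
  by rewrite subr_ge0 exprn_ile1.
have split2 u v : x = u + v ->
    tex 1 k (gfun t0) <= 2 * tau (u^# * u) + 8 * f ^+ 4 / t0 * tau ((v^# * v) * (v^# * v)).
  move=> xuv; pose a1 := (F u)^# * F u; pose a2 := (F v)^# * F v.
  have a1p : pos a1 by exact: pos_sq. have a2p : pos a2 by exact: pos_sq.
  have b1p : pos (4 *: a1) by apply: posZ. have b2p : pos (4 *: a2) by apply: posZ.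
  (* The parallelogram law for F x = F u + F v: [k] lies below the mean of 4 a1 and 4 a2. *)
  have b3p : pos (4 *: a1 + 4 *: a2 - 2 *: k).
    have -> : 4 *: a1 + 4 *: a2 - 2 *: k = 2 *: ((F u - F v)^# * (F u - F v)).
      have -> : 4 *: a1 + 4 *: a2 = 2 *: (2 *: a1 + 2 *: a2).
        by rewrite scalerDr !scalerA -natrM.
      by rewrite -scalerBr -parallelogram /k xuv FD addrC addKr.
    by apply: posZ => //; exact: pos_sq.
  have k2p : pos (2 *: k) by apply: posZ.
  (* Convexity under the trace: the tangent line at the points of [k], integrated by [joint_le]. For
     b = k there is equality, which is [J4]. *)
  have J b : pos b -> tex 1 k ga + tex b k gb <= tex 1 b (gfun t0).
    by move=> bp; apply: joint_le => // r s r0 s0; apply: gfun_tangent.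
  have J1 := J _ b1p; have J2 := J _ b2p.
  have J3 : 2 * tex k k gb <= tex (4 *: a1) k gb + tex (4 *: a2) k gb.
    rewrite -tex_kD// -tex_kZ//; exact: tex_kle.
  have J4 : tex 1 k (gfun t0) = tex 1 k ga + tex k k gb.
    rewrite tex_self// -texD//; last by apply: ufM => //; exact: uf_id.
    by apply: tex_eq => t _; rewrite /ga /gb /gfun -/(e t); ring.
  have J5 : tex 1 (4 *: a1) (gfun t0) <= 4 * tau a1.
    rewrite -tauZ -[4 *: a1 in leRHS]mul1r -tex_id//.
    apply: tex_le => //; first exact: uf_id.
    move=> t t1; have /andP[c1 c2] := cutoff_itv t h0.
    by rewrite /gfun ler_piMr// lerBlDr lerDl.
  have J6 : tex 1 (4 *: a2) (gfun t0) <= 16 / t0 * tau (a2 * a2).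
    have -> : 16 / t0 * tau (a2 * a2) = tau (1 * pev (4 *: a2) (t0^-1 *: ('X * 'X))).
      rewrite mul1r pevZ pevM pevX -scalerAl -scalerAr !tauZ; ring.
    rewrite -tex_poly//; apply: tex_le => //; first exact: uf_poly.
    move=> t t1; rewrite gfunE// hornerZ hornerM hornerX -expr2 mulrC.
    by rewrite ler_wpM2r ?exprn_ge0// lef_pV2 ?posrE ?lerDr// ltr_wpDl.
  have J7 : tau a1 <= tau (u^# * u) by exact: co_2 hF u.
  have J8 : tau (a2 * a2) <= f ^+ 4 * tau ((v^# * v) * (v^# * v)).
    rewrite -!nm4 -exprMn lerXn2r ?nnegrE ?nm_ge0 ?mulr_ge0 ?nm_ge0//.
  have J9 : 16 / t0 * tau (a2 * a2) <= 16 / t0 * (f ^+ 4 * tau (v^# * v * (v^# * v))).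
    by rewrite ler_wpM2l// divr_ge0// ltW.
  have -> : 8 * f ^+ 4 / t0 * tau (v^# * v * (v^# * v)) =
     (16 / t0 * (f ^+ 4 * tau (v^# * v * (v^# * v)))) / 2 by field; rewrite gt_eqF.
  lra.
have G0 : 0 <= tex 1 h (gfun t0) by apply: tex_ge0 => // t; apply: gfun_ge0.
have hc := cbndP hp; set c := cbnd h in hc; have [c0 _ _] := hc.
have T1 := pos_tau p1.
apply/ler_addgt0Pr => d d0.
(* [C] collects what the error dl of [r] adds to the two parts of the splitting; both contributions
   carry dl^2. *)
pose C := 2 * (c * tau (1 : A)) + 8 * f ^+ 4 / t0 * (8 * c ^+ 2 * tau (1 : A)).
have C0 : 0 <= C.
  apply: addr_ge0; first by rewrite mulr_ge0// mulr_ge0// ltW.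
  apply: mulr_ge0; last by rewrite mulr_ge0// mulr_ge0// exprn_ge0// ltW.
  by apply: divr_ge0; [rewrite mulr_ge0// exprn_ge0|exact: ltW].
have C1 : 0 < C + 1 by rewrite ltr_wpDl.
pose dl := Num.min 1 (d / (C + 1)); have dl0 : 0 < dl by rewrite lt_min ltr01 divr_gt0.
have dl1 : dl <= 1 by rewrite ge_min lexx.
have dlC : dl ^+ 2 * C <= d.
  apply: (@le_trans _ _ (dl * (C + 1))).
    apply: ler_pM => //; rewrite ?exprn_ge0 ?(ltW dl0) ?lerDl//.
    by rewrite expr2 ler_piMr// ltW.
  by rewrite -ler_pdivlMr// ge_min lexx orbT.
have [r hr] := approx_above c0 (ue c) dl0.
have re t : 0 <= t <= c -> [/\ 0 <= e t, e t <= 1, e t <= r.[t] & r.[t] <= e t + dl].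
  move=> ht; have /andP[a1 a2] := cutoff_itv t h0; have /andP[a3 a4] := hr t ht.
  by split.
have := split2 (x * pev h (1 - r)) (x * pev h r).
rewrite -mulrDr pevB pev1 subrK mulr1 -(pev1 h) -pevB => /(_ erefl).
have sq q : (x * pev h q)^# * (x * pev h q) = pev h ('X * (q * q)).
  rewrite astM pev_sa// -mulrA [x^# * _]mulrA -/h.
  have Cm := pevCM h 'X q; rewrite pevX in Cm.
  by rewrite !pevM pevX mulrA -Cm -mulrA.
rewrite !sq -pevM.
have E1 : tau (pev h ('X * ((1 - r) * (1 - r)))) <= tex 1 h (gfun t0) + c * dl ^+ 2 * tau (1 : A).
  rewrite -tauZ -(pevC h) -[pev h _%:P]mul1r -[pev h ('X * _)]mul1r -!tex_poly//.
  rewrite -texD//; last exact: uf_poly.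
  rewrite !texU; apply: (ext_le (haus_tau hc p1)); [exact: ufc_poly| |].
    by apply: ufcD; [exact: ug|exact: ufc_poly].
  move=> t ht; have [a1 a2 a3 a4] := re t ht; have /andP[t1 tc] := ht.
  rewrite hornerM hornerX hornerM hornerD hornerN !hornerC /gfun -/(e t).
  set s := r.[t] in a3 a4 *.
  have [s1|s1] := leP s 1.
    apply: (@le_trans _ _ (t * (1 - e t))); last by rewrite lerDl !mulr_ge0 ?exprn_ge0 ?(ltW c0) ?(ltW dl0).
    have s0 : 0 <= s by exact: le_trans a3.
    rewrite ler_wpM2l// (@le_trans _ _ (1 - s))//; last by lra.
    by rewrite ler_piMr; lra.
  apply: (@le_trans _ _ (c * dl ^+ 2)); last by rewrite lerDr mulr_ge0// subr_ge0.
  apply: ler_pM => //; first by rewrite -expr2 sqr_ge0.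
  by rewrite -expr2 -sqrrN opprB lerXn2r ?nnegrE ?subr_ge0 ?(ltW s1) ?(ltW dl0)//; lra.
have E2 : tau (pev h ('X * (r * r) * ('X * (r * r)))) <=
    8 * t0 * tex 1 h (gfun t0) + 8 * c ^+ 2 * dl ^+ 2 * tau (1 : A).
  rewrite -tauZ -(pevC h) -[pev h _%:P]mul1r -[pev h ('X * _ * _)]mul1r -!tex_poly//.
  have u8 : uf (fun t => 8 * t0 * gfun t0 t) by apply: ufM => //; exact: uf_const.
  rewrite -texZ// -texD//; last exact: uf_poly.
  rewrite !texU; apply: (ext_le (haus_tau hc p1)); [exact: ufc_poly| |].
    by apply: ufcD; [exact: u8|exact: ufc_poly].
  move=> t ht; have [a1 a2 a3 a4] := re t ht; have /andP[t1 tc] := ht.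
  have tt : 0 < t + t0 by rewrite ltr_wpDl.
  have gE : t0 * gfun t0 t = t ^+ 2 * e t.
    by rewrite gfunE// /e /cutoff t1; field; rewrite gt_eqF.
  rewrite -[8 * t0 * _]mulrA gE !hornerM hornerX hornerC.
  set s := r.[t] in a3 a4 *; have s0 : 0 <= s by apply: le_trans a3.
  have -> : t * (s * s) * (t * (s * s)) = t ^+ 2 * s ^+ 4 by ring.
  have s4 : s ^+ 4 <= 8 * e t + 8 * dl ^+ 2.
    apply: (@le_trans _ _ ((e t + dl) ^+ 4)).
      by rewrite lerXn2r ?nnegrE ?addr_ge0 ?(ltW dl0).
    apply: (@le_trans _ _ (8 * e t ^+ 4 + 8 * dl ^+ 4)).
      have : 0 <= (e t - dl) ^+ 2 by exact: sqr_ge0.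
      have : 0 <= (e t ^+ 2 - dl ^+ 2) ^+ 2 by exact: sqr_ge0.
      have : 0 <= (e t ^+ 2 + dl ^+ 2 + 2 * (e t * dl)) * (e t - dl) ^+ 2.
        by rewrite mulr_ge0 ?sqr_ge0// !addr_ge0 ?sqr_ge0// !mulr_ge0// ltW.
      nra.
    apply: lerD; rewrite ler_wpM2l//.
      by rewrite exprSr ler_piMl// exprn_ile1.
    by rewrite (exprD dl 2 2) ler_piMl ?exprn_ge0 ?(ltW dl0)// exprn_ile1// ltW.
  apply: (@le_trans _ _ (t ^+ 2 * (8 * e t + 8 * dl ^+ 2))).
    by rewrite ler_wpM2l ?exprn_ge0.
  rewrite mulrDr mulrCA lerD2l mulrCA -mulrA ler_wpM2l//.
  by rewrite ler_wpM2r ?exprn_ge0 ?(ltW dl0)// lerXn2r ?nnegrE// ltW.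
move=> H; apply: le_trans H _.
have K : 0 <= 8 * f ^+ 4 / t0 by rewrite divr_ge0 ?mulr_ge0 ?exprn_ge0 ?(ltW h0).
apply: le_trans (lerD (ler_wpM2l (ler0n _ 2) E1) (ler_wpM2l K E2)) _.
have -> : 2 * (tex 1 h (gfun t0) + c * dl ^+ 2 * tau (1 : A)) +
   8 * f ^+ 4 / t0 * (8 * t0 * tex 1 h (gfun t0) + 8 * c ^+ 2 * dl ^+ 2 * tau (1 : A)) =
   (2 + 64 * f ^+ 4) * tex 1 h (gfun t0) + dl ^+ 2 * C.
  by rewrite /C; field; rewrite gt_eqF.
by rewrite pev1 lerD2l.
Qed.

(** t^q is, up to a factor, a sum of functions [gfun] over dyadic scales, and [interp_slice] holds
    at each scale with the same constant. *)
Lemma cotlar_interp (q f K : R) : 1 < q < 2 -> 0 <= f -> 0 <= K ->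
  (forall (N : nat) (a t : R), 0 < a -> 0 <= t ->
   \sum_(n < N) (2 ^+ n * a) `^ (q - 1) * gfun (2 ^+ n * a) t <= K * t `^ q) ->
  (forall x, nm 4 (F x) <= f * nm 4 x) ->
  forall x, nm (2 * q) (F x) <= ((2 + 64 * f ^+ 4) * K) `^ (2 * q)^-1 * nm (2 * q) x.
Proof.
move=> q12 f0 K0 hK hf x; have /andP[q1 q2] := q12; have p1 := @pos1 _ A.
have q0 : 0 < q by lra.
set h := x^# * x; set k := (F x)^# * F x.
have hp : pos h by exact: pos_sq. have kp : pos k by exact: pos_sq.
set M := 2 + 64 * f ^+ 4; have M0 : 0 <= M by rewrite addr_ge0// mulr_ge0// exprn_ge0.
have uq := uf_powR (ltW q0).
have main : pw q k <= M * K * pw q h.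
  apply/ler_addgt0Pr => d d0.
  have kc := cbndP kp; have [c0 _ _] := kc.
  have T1 := pos_tau p1.
  have t1 : 0 < tau (1 : A) + 1 by rewrite ltr_wpDl.
  have [N [a [a0 ha]]] := dyadic_lower q12 c0 (divr_gt0 d0 t1).
  pose b n : R := 2 ^+ n * a; have b0 n : 0 < b n by rewrite mulr_gt0// exprn_gt0.
  pose w n := b n `^ (q - 1); have w0 n : 0 <= w n by exact: powR_ge0.
  pose S t := \sum_(n < N) w n * gfun (b n) t.
  have uS n : uf (fun t => \sum_(i < n) w i * gfun (b i) t).
    elim: n => [|n IH].
      have -> : (fun t => \sum_(i < 0) w i * gfun (b i) t) = (fun=> 0).
        by apply/funext => t; rewrite big_ord0.
      exact: uf_const.
    have -> : (fun t => \sum_(i < n.+1) w i * gfun (b i) t) =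
       (fun t => \sum_(i < n) w i * gfun (b i) t + w n * gfun (b n) t).
      by apply/funext => t; rewrite big_ord_recr.
    by apply: ufD => //; apply: ufM; [exact: uf_const|exact: uf_gfun].
  have tS n v : pos v -> tex 1 v (fun t => \sum_(i < n) w i * gfun (b i) t) =
      \sum_(i < n) w i * tex 1 v (gfun (b i)).
    move=> vp; elim: n => [|n IH].
      rewrite big_ord0 (@tex_eq _ _ _ _ _ (horner 0)); last by move=> t _; rewrite big_ord0 horner0.
      rewrite tex_poly// -(tau0 A) -[X in pev _ X](scale0r (1 : {poly R})) pevZ scale0r mulr0//.
    rewrite big_ord_recr /= -IH -texZ//; last exact: uf_gfun.
    rewrite -texD//; last by apply: ufM; [exact: uf_const|exact: uf_gfun].
    by apply: tex_eq => t _; rewrite big_ord_recr.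
  have L : pw q k <= tex 1 k S + d.
    apply: (@le_trans _ _ (tex 1 k (fun t => S t + d / (tau (1 : A) + 1)))).
      rewrite pwE !texU; apply: (ext_le (haus_tau kc p1)); [exact: uq| |].
        by apply: ufcD; [exact: uS|exact: ufc_const].
      by move=> t ht; apply: ha.
    rewrite texD//; [|exact: uS|exact: uf_const]; rewrite lerD2l.
    rewrite (@tex_eq _ _ _ _ _ (horner (d / (tau (1 : A) + 1))%:P)); last by move=> t _; rewrite hornerC.
    by rewrite tex_poly// pevC mul1r tauZ mulrAC ler_pdivrMr// ler_wpM2l ?(ltW d0)// lerDl.
  apply: le_trans L _; rewrite lerD2r.
  have S1 : tex 1 k S <= M * tex 1 h S.
    rewrite !tS// mulr_sumr; apply: ler_sum => i _; rewrite mulrCA ler_wpM2l//.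
    exact: interp_slice.
  apply: le_trans S1 _; rewrite -mulrA ler_wpM2l// pwE -texZ//.
  apply: tex_le => //; first exact: uS.
    by apply: ufM => //; exact: uf_const.
  by move=> t t0; apply: hK.
rewrite !nmE.
have -> : 2 * q / 2 = q by field.
rewrite -/h -/k -powRM ?mulr_ge0 ?pw_ge0 ?(ltW q0)//.
by rewrite ge0_ler_powR ?nnegrE ?invr_ge0 ?mulr_ge0 ?pw_ge0 ?(ltW q0).
Qed.

End Cotlar.

Lemma tau_ast_l (R : realType) (A : tralg R) (u y : A) : y^# = y -> tau (u^# * y) = tau (u * y).
Proof. by move=> hy; rewrite -tau_ast astM astK hy tauC. Qed.

(** [f] is chosen before the algebra and thus depends on [q] only. Exponents strictly between 2 and
    4 come from interpolation, and [n] counts the doublings needed beyond 4. *)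
Theorem cotlar_bounded (R : realType) (q : R) : 2 <= q -> exists f : R, 0 <= f /\
  forall (A : tralg R) (F D : A -> A), cotlar F D -> forall x, nm q (F x) <= f * nm q x.
Proof.
move=> q2.
have B2 (A : tralg R) (F D : A -> A) : cotlar F D -> forall x, nm 2 (F x) <= 1 * nm 2 x.
  move=> hF x; rewrite mul1r -(@ler_pXn2r _ 2) ?nnegrE ?nm_ge0// !nm2.
  exact: co_2 hF x.
have B4 (A : tralg R) (F D : A -> A) : cotlar F D -> forall x, nm 4 (F x) <= 4 * nm 4 x.
  move=> hF x; have := cotlar_step hF (lexx 2) ler01 (B2 _ _ _ hF) x.
  have -> : 2 * 2 = 4 :> R by rewrite -natrM.
  by have -> : 3 * 1 + 1 = 4 :> R by ring.
have [n hn] : exists n : nat, q <= 4 * 2 ^+ n.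
  exists (Num.bound q); apply: (le_trans (ltW (archi_boundP _))); first by lra.
  rewrite (@le_trans _ _ (2 ^+ Num.bound q))//; last by rewrite ler_peMl ?exprn_ge0//; lra.
  by rewrite -natrX ler_nat ltnW// ltn_expl.
elim: n q q2 hn => [|n IH] q q2 hn.
  have [q4|q4] := eqVneq q 4; first by exists 4; split; [exact: ler0n|rewrite q4; exact: B4].
  have [qe|qe] := eqVneq q 2; first by exists 1; split; [exact: ler01|rewrite qe; exact: B2].
  have q12 : 1 < q / 2 < 2.
    have : q < 4 by rewrite lt_neqAle q4 -[4]mulr1 -[X in _ * X](expr0 2).
    have : 2 < q by rewrite lt_neqAle eq_sym qe.
    by move=> *; apply/andP; split; lra.
  have [K [K0 hK]] := dyadic_upper q12.
  exists (((2 + 64 * 4 ^+ 4) * K) `^ q^-1); split; first exact: powR_ge0.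
  move=> A F D hF x.
  have := cotlar_interp hF q12 (ler0n _ 4) K0 hK (B4 _ _ _ hF) x.
  by have -> : 2 * (q / 2) = q by field.
have [q4|q4] := leP q 4; first by apply: IH => //; rewrite (le_trans q4)// ler_peMr// exprn_ege1// ler1n.
have [||f [f0 hf]] := IH (q / 2).
- lra.
- by rewrite ler_pdivrMr// -mulrA -exprSr.
exists (3 * f + 1); split; first by rewrite addr_ge0// mulr_ge0.
move=> A F D hF x; have qh : 2 <= q / 2 by lra.
have := cotlar_step hF qh f0 (hf _ _ _ hF) x.
by have -> : 2 * (q / 2) = q by field.
Qed.

(** * The word algebra *)

Section StarAlg.
Variables (R : realType) (A : starAlgType R).
Implicit Types (x y : A) (c : R[i]).

Lemma star0 : star (0 : A) = 0.
Proof.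
have := starP 1 0 (0 : A); rewrite rmorph1 !scale1r addr0 => /esym/eqP.
by rewrite -subr_eq0 addrK => /eqP.
Qed.

Lemma starZ c x : star (c *: x) = Num.conj c *: star x.
Proof. by rewrite -[c *: x]addr0 starP star0 addr0. Qed.

Lemma starD x y : star (x + y) = star x + star y.
Proof. by rewrite -[x]scale1r starP rmorph1 !scale1r. Qed.

Lemma starN x : star (- x) = - star x.
Proof. by rewrite -scaleN1r starZ rmorphN1 scaleN1r. Qed.

Lemma starB x y : star (x - y) = star x - star y.
Proof. by rewrite starD starN. Qed.

Lemma star1 : star (1 : A) = 1.
Proof. by rewrite -[star 1]mul1r -{1}[1]starK -starM mul1r starK. Qed.

Lemma star_sum I (s : seq I) P (F : I -> A) :
  star (\sum_(i <- s | P i) F i) = \sum_(i <- s | P i) star (F i).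
Proof. exact: (big_morph _ starD star0). Qed.

End StarAlg.

Section Amalgam.
Variables (R : realType) (I : eqType) (D : amalgam R I).

Lemma centeredP i (a : amA D i) : A_centered a <-> cexp D i a = 0.
Proof.
split=> [[x _ <-]|h]; first by rewrite linearB /= cexp_iota subrr.
by exists a => //; rewrite h linear0 subr0.
Qed.

Lemma cexp_l i b (a : amA D i) : cexp D i (iota D i b * a) = b * cexp D i a.
Proof. by rewrite -[X in X = _](congr1 (cexp D i) (mulr1 _)) -(rmorph1 (iota D i)) cexp_bimod mulr1. Qed.

Lemma cexp_r i b (a : amA D i) : cexp D i (a * iota D i b) = cexp D i a * b.
Proof. by rewrite -[a]mul1r -(rmorph1 (iota D i)) cexp_bimod rmorph1 !mul1r. Qed.

(* By positivity, the defect vanishes on every [x^* x]; polarize. *)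
Lemma cexp_star i (a : amA D i) : cexp D i (star a) = star (cexp D i a).
Proof.
pose f x := star (cexp D i (star x)) - cexp D i x.
have fP c x y : f (c *: x + y) = c *: f x + f y.
  by rewrite /f starP !linearP /= starP conjCK scalerDr addrACA.
have f0 : f 0 = 0.
  by rewrite /f star0 !linear0 star0 addr0.
have fD x y : f (x + y) = f x + f y by rewrite -[x in LHS]scale1r fP scale1r.
have fZ c x : f (c *: x) = c *: f x by rewrite -[c *: x]addr0 fP f0 addr0.
have fs x : f (star x * x) = 0.
  have [y hy] := cexp_pos (ex_intro _ x erefl : spos (star x * x)).
  by rewrite /f starM starK hy starM starK subrr.
have key c x : c *: f (star x) + Num.conj c *: f x = 0.
  have := fs (x + c *: 1); rewrite starD starZ star1 mulrDl !mulrDr.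
  rewrite -!scalerAl -!scalerAr !mulr1 !mul1r scalerA.
  have f1 : f 1 = 0 by have := fs 1; rewrite star1 mul1r.
  by rewrite !fD !fZ fs f1 scaler0 addr0 add0r.
have k1 := key 1 a; have k2 := key 'i%C a.
rewrite rmorph1 !scale1r in k1.
have k3 : f (star a) = f a.
  have : 'i%C *: (f (star a) - f a) = 0.
    by rewrite scalerBr -k2 conjCi scaleNr.
  move/eqP; rewrite scaler_eq0 => /orP[/eqP h|]; last by rewrite subr_eq0 => /eqP.
  by case: h => /eqP; rewrite oner_eq0.
move: k1; rewrite k3 -mulr2n -scaler_nat => /eqP; rewrite scaler_eq0 pnatr_eq0 /=.
by rewrite /f subr_eq0 => /eqP <-; rewrite starK.
Qed.

Definition tags (s : seq (letter D)) : seq I := map tag s.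
Definition all_centered (s : seq (letter D)) : Prop :=
  foldr (fun u P => A_centered (tagged u) /\ P) True s.

Lemma reducedP s :
  reduced s <-> all_centered s /\ sorted (fun i j => i != j) (tags s).
Proof.
elim: s => [|u s IH] //=; split.
  move=> [h1 h2 /IH [h3 h4]]; split=> //; case: s h2 h4 {IH h3} => //= v s -> //.
move=> [[h1 h3] h2]; split=> //; first by case: s h2 {IH h3} => //= v s /andP[].
by apply/IH; split=> //; exact: path_sorted h2.
Qed.

Definition rstar (s : seq (letter D)) : seq (letter D) :=
  rev [seq ltr (star (tagged u)) | u : letter D <- s].

Lemma all_centered_cat s t : all_centered (s ++ t) <-> all_centered s /\ all_centered t.
Proof. by elim: s => [|u s IH] /=; [tauto|rewrite IH; tauto]. Qed.

Lemma reduced_rstar s : reduced s -> reduced (rstar s).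
Proof.
move=> /reducedP [h1 h2]; apply/reducedP; split.
  elim: s h1 {h2} => //= u s IH [hu /IH hs].
  rewrite /rstar map_cons rev_cons -cats1; apply/all_centered_cat; split=> //=; split=> //.
  by apply/centeredP; rewrite /= cexp_star; move/centeredP: hu => ->; rewrite star0.
rewrite /rstar /tags map_rev rev_sorted -map_comp.
under eq_map do rewrite /=.
by rewrite (eq_sorted (e' := fun i j => i != j))// => i j; rewrite eq_sym.
Qed.

End Amalgam.

(** * Words: expectation, projections on first and last letters, trace *)

Section Words.
Variables (R : realType) (I : eqType) (D : amalgam R I) (W : word_algebra D).
Implicit Types (x y u v w : W) (i j k : I).

Local Notation L := (L_proj W).
Local Notation A := (inA W).

Definition Eb x : W := inB W (W_exp W x).
Definition Rp i x : W := star (L i (star x)).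

Lemma word_ind (P : W -> Prop) :
  (forall b, P (inB W b)) ->
  (forall i (a : amA D i) u, cexp D i a = 0 -> L i u = 0 -> P u -> P (A i a * u)) ->
  forall s, reduced s -> P (word W s).
Proof.
move=> P0 PS; elim=> [|[i a] s IH] hs.
  by rewrite /word big_nil -(rmorph1 (inB W)); exact: P0.
have [h1 h2 h3] := hs; rewrite /word big_cons /=; apply: PS => //; last exact: IH.
  exact/centeredP.
case: s h2 h3 {IH hs} => [|v s] h2 h3.
  by rewrite big_nil -(rmorph1 (inB W)) /L_proj W_lift_inB.
rewrite -/(word W (v :: s)) /L_proj W_lift_word//=.
by rewrite eq_sym (negPf h2).
Qed.

(** Induction on words for an identity between linear maps. The parameter [t] allows the induction
    hypothesis to be used at other indices or other second factors than those of the goal. *)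
Lemma W_ind (T : Type) (V : lmodType R[i]) (g h : T -> W -> V) :
  (forall t, linear (g t)) -> (forall t, linear (h t)) ->
  (forall t b, g t (inB W b) = h t (inB W b)) ->
  (forall i (a : amA D i) u, cexp D i a = 0 -> L i u = 0 ->
     (forall t, g t u = h t u) -> forall t, g t (A i a * u) = h t (A i a * u)) ->
  forall t x, g t x = h t x.
Proof.
move=> lg lh H0 HS t.
pose g' := GRing.isLinear.Build _ _ _ _ (g t) (lg t).
pose h' := GRing.isLinear.Build _ _ _ _ (h t) (lh t).
pose gl : {linear W -> V} := HB.pack (g t) g'.
pose hl : {linear W -> V} := HB.pack (h t) h'.
apply: (@W_unique _ _ _ W V gl hl) => [b|s _ hs]; first exact: H0.
have K : forall t, g t (word W s) = h t (word W s).
  exact: (word_ind (P := fun x => forall t, g t x = h t x)) hs.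
exact: K.
Qed.

Lemma W_exp_inB b : W_exp W (inB W b) = b.
Proof. by rewrite /W_exp W_lift_inB. Qed.

Lemma L_inB i b : L i (inB W b) = 0.
Proof. by rewrite /L_proj W_lift_inB. Qed.

Lemma Rp_linear i : linear (Rp i).
Proof. by move=> c x y; rewrite /Rp starP linearP starP conjCK. Qed.

Lemma Eb_linear : linear Eb.
Proof. by move=> c x y; rewrite /Eb !linearP. Qed.

Lemma cent_r i (a : amA D i) b : cexp D i a = 0 -> cexp D i (a * iota D i b) = 0.
Proof. by move=> h; rewrite cexp_r h mul0r. Qed.

Lemma cent_l i (a : amA D i) b : cexp D i a = 0 -> cexp D i (iota D i b * a) = 0.
Proof. by move=> h; rewrite cexp_l h mulr0. Qed.

Lemma A_inB i (a : amA D i) b : A i a * inB W b = A i (a * iota D i b).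
Proof. by rewrite [in RHS]rmorphM /= inA_iota. Qed.

Lemma inB_A i (a : amA D i) b : inB W b * A i a = A i (iota D i b * a).
Proof. by rewrite [in RHS]rmorphM /= inA_iota. Qed.

Lemma L_letter1 i j (a : amA D j) : cexp D j a = 0 ->
  L i (A j a) = if j == i then A j a else 0.
Proof.
move=> h; have rd : reduced [:: ltr a] by split=> //; exact/centeredP.
have -> : A j a = word W [:: ltr a] by rewrite /word big_seq1.
by rewrite /L_proj W_lift_word.
Qed.

Lemma W_exp_letter1 j (a : amA D j) : cexp D j a = 0 -> W_exp W (A j a) = 0.
Proof.
move=> h; have rd : reduced [:: ltr a] by split=> //; exact/centeredP.
have -> : A j a = word W [:: ltr a] by rewrite /word big_seq1.
by rewrite /W_exp W_lift_word.
Qed.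

(** The elements without words starting in A_j are the [x - L j x]. In this form both sides are
    linear in an arbitrary [x], and the uniqueness of linear maps on W applies. *)
Lemma letter_sub j (a : amA D j) (V : lmodType R[i]) (g h : {linear W -> V}) :
  cexp D j a = 0 ->
  (forall a' : amA D j, cexp D j a' = 0 -> g (A j a') = h (A j a')) ->
  (forall s, reduced (ltr a :: s) -> g (word W (ltr a :: s)) = h (word W (ltr a :: s))) ->
  forall x, g (A j a * (x - L j x)) = h (A j a * (x - L j x)).
Proof.
move=> ha h1 h2 x.
pose g' x := g (A j a * (x - L j x)); pose h' x := h (A j a * (x - L j x)).
have E x0 c y : A j a * ((c *: x0 + y) - L j (c *: x0 + y)) =
    c *: (A j a * (x0 - L j x0)) + A j a * (y - L j y).
  by rewrite linearP /= opprD addrACA -scalerBr mulrDr -scalerAr.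
have lg : linear g' by move=> c x0 y; rewrite /g' E linearP.
have lh : linear h' by move=> c x0 y; rewrite /h' E linearP.
pose gl : {linear W -> V} := HB.pack g' (GRing.isLinear.Build _ _ _ _ g' lg).
pose hl : {linear W -> V} := HB.pack h' (GRing.isLinear.Build _ _ _ _ h' lh).
apply: (@W_unique _ _ _ W V gl hl) => [b|s s0 hs]; rewrite /= /g' /h'.
  by rewrite L_inB subr0 A_inB; apply: h1; exact: cent_r.
rewrite -/(word W s) /L_proj W_lift_word//; case: ifP => hf.
  by rewrite subrr mulr0 !linear0.
rewrite subr0; have -> : A j a * word W s = word W (ltr a :: s) by rewrite /word big_cons.
apply: h2; split=> //; first exact/centeredP.
by case: s s0 hs hf => //= v s _ _; rewrite eq_sym => ->.
Qed.

Lemma L_letter_sub i j (a : amA D j) x : cexp D j a = 0 ->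
  L i (A j a * (x - L j x)) = if j == i then A j a * (x - L j x) else 0.
Proof.
move=> ha; have [<-|ne] := eqVneq j i.
  apply: (letter_sub (h := idfun) ha) => [a' h'|s hs] /=; first by rewrite L_letter1// eqxx.
  by rewrite /L_proj W_lift_word//= eqxx.
apply: (letter_sub (h := \0) ha) => [a' h'|s hs] /=; first by rewrite L_letter1// (negPf ne).
by rewrite /L_proj W_lift_word//= (negPf ne).
Qed.

Lemma L_letter i j (a : amA D j) u : cexp D j a = 0 -> L j u = 0 ->
  L i (A j a * u) = if j == i then A j a * u else 0.
Proof. by move=> ha hu; have := L_letter_sub i u ha; rewrite hu subr0. Qed.

Lemma W_exp_letter j (a : amA D j) u : cexp D j a = 0 -> L j u = 0 ->
  W_exp W (A j a * u) = 0.
Proof.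
move=> ha hu.
have : W_exp W (A j a * (u - L j u)) = (\0 : {linear W -> amB D}) (A j a * (u - L j u)).
  apply: (letter_sub ha) => [a' h'|s hs] /=; first by rewrite W_exp_letter1.
  by rewrite /W_exp W_lift_word.
by rewrite hu subr0.
Qed.

Lemma inA_split i (a : amA D i) :
  exists2 a0 : amA D i, cexp D i a0 = 0 & A i a = A i a0 + inB W (cexp D i a).
Proof.
exists (a - iota D i (cexp D i a)); first by rewrite linearB /= cexp_iota subrr.
by rewrite raddfB /= inA_iota subrK.
Qed.

Lemma W_exp_inA i (a : amA D i) : W_exp W (A i a) = cexp D i a.
Proof.
have [a0 h0 ->] := inA_split a; rewrite linearD /= W_exp_letter1// add0r.
exact: W_exp_inB.
Qed.

Lemma L_inA i j (a : amA D j) : L i (A j a) = if j == i then A j a - Eb (A j a) else 0.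
Proof.
have [a0 h0 E] := inA_split a; rewrite /Eb W_exp_inA E linearD /= L_inB addr0 L_letter1//.
by rewrite addrK.
Qed.

Lemma W_exp_star x : W_exp W (star x) = star (W_exp W x).
Proof.
rewrite -[LHS]starK; congr star.
pose g (_ : unit) x := star (W_exp W (star x)).
have lg : linear (g tt) by move=> c u v; rewrite /g starP linearP /= starP conjCK.
pose gl : {linear W -> amB D} := HB.pack (g tt) (GRing.isLinear.Build _ _ _ _ (g tt) lg).
apply: (@W_unique _ _ _ W _ gl (W_exp W)) => [b|s s0 hs] /=; rewrite /g.
  by rewrite -inB_star !W_exp_inB starK.
rewrite -/(word W s) {2}/W_exp W_lift_word//.
(* The star reverses words, so induction on the first letter does not help; the reversed word is
   reduced again. *)
have -> : star (word W s) = word W (rstar s).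
  elim: s {s0 hs} => [|u s IH]; first by rewrite /word /rstar !big_nil star1.
  rewrite /rstar map_cons rev_cons -cats1 /word big_cat big_seq1 big_cons starM /=.
  by rewrite inA_star; congr (_ * _).
rewrite /W_exp W_lift_word ?star0//; last exact: reduced_rstar.
by case: s s0 {hs} => // u s _; rewrite /rstar map_cons rev_cons; case: rev.
Qed.

Lemma Eb_star x : Eb (star x) = star (Eb x).
Proof. by rewrite /Eb W_exp_star inB_star. Qed.

Lemma Eb_inB b : Eb (inB W b) = inB W b.
Proof. by rewrite /Eb W_exp_inB. Qed.

Lemma W_exp_l b x : W_exp W (inB W b * x) = b * W_exp W x.
Proof.
move: x; apply: (W_ind (T := unit) (g := fun _ x => W_exp W (inB W b * x))
   (h := fun _ x => b * W_exp W x)) tt => [t c x y|t c x y|_ b'|i a u ha hu _ _].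
- by rewrite mulrDr -scalerAr linearP.
- by rewrite linearP /= mulrDr -scalerAr.
- by rewrite -rmorphM !W_exp_inB.
by rewrite mulrA inB_A !W_exp_letter ?mulr0//; exact: cent_l.
Qed.

Lemma W_exp_r b x : W_exp W (x * inB W b) = W_exp W x * b.
Proof. by rewrite -[LHS]starK -W_exp_star starM -inB_star W_exp_l starM W_exp_star !starK. Qed.

Lemma EbM b x : Eb (inB W b * x) = inB W b * Eb x.
Proof. by rewrite /Eb W_exp_l rmorphM. Qed.

Lemma L_l i b x : L i (inB W b * x) = inB W b * L i x.
Proof.
move: x; apply: (W_ind (T := unit) (g := fun _ x => L i (inB W b * x))
   (h := fun _ x => inB W b * L i x)) tt => [t c x y|t c x y|_ b'|j a u ha hu _ _].
- by rewrite mulrDr -scalerAr linearP.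
- by rewrite linearP /= mulrDr -scalerAr.
- by rewrite -rmorphM !L_inB mulr0.
rewrite mulrA inB_A !L_letter//; last exact: cent_l.
by case: ifP => _; rewrite ?mulr0// -inB_A mulrA.
Qed.

Lemma LL i j x : L i (L j x) = if j == i then L j x else 0.
Proof.
move: x; apply: (W_ind (T := unit) (g := fun _ x => L i (L j x))
   (h := fun _ x => if j == i then L j x else 0)) tt => [t c x y|t c x y|_ b'|k a u ha hu _ _].
- by rewrite !linearP.
- by case: ifP => _; rewrite ?linearP// scaler0 addr0.
- by rewrite L_inB linear0 if_same.
rewrite !L_letter//; case: (eqVneq k j) => [kj|_]; last by rewrite linear0 if_same.
by rewrite L_letter//; case: ifP; rewrite -kj => ->.
Qed.

Lemma W_exp_L i x : W_exp W (L i x) = 0.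
Proof.
move: x; apply: (W_ind (T := unit) (g := fun _ x => W_exp W (L i x))
   (h := fun _ x => 0)) tt => [t c x y|t c x y|_ b'|k a u ha hu _ _].
- by rewrite !linearP.
- by rewrite scaler0 addr0.
- by rewrite L_inB linear0.
by rewrite L_letter//; case: ifP => _; rewrite ?linear0// W_exp_letter.
Qed.

Lemma Eb_L i x : Eb (L i x) = 0.
Proof. by rewrite /Eb W_exp_L linear0. Qed.

Lemma Eb_letter j (a : amA D j) u : cexp D j a = 0 -> L j u = 0 -> Eb (A j a * u) = 0.
Proof. by move=> ha hu; rewrite /Eb W_exp_letter// linear0. Qed.

(* [x |-> L_i (x a)] for a letter [a]: only the last letter of [x] interacts. *)
Lemma L_inA_r j s (a : amA D s) x :
  L j (x * A s a) = L j x * A s a + if j == s then Eb x * A s a - Eb (x * A s a) else 0.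
Proof.
move: j x; apply: (W_ind (g := fun j x => L j (x * A s a))
   (h := fun j x => L j x * A s a + if j == s then Eb x * A s a - Eb (x * A s a) else 0)).
- by move=> t c x y; rewrite mulrDl -scalerAl linearP.
- move=> t c x y; rewrite linearP mulrDl -scalerAl.
  case: ifP => _; last by rewrite !addr0.
  rewrite mulrDl -scalerAl !Eb_linear mulrDl -scalerAl opprD !scalerDr scalerN.
  rewrite -!addrA; congr (_ + _); rewrite [LHS]addrCA; congr (_ + _).
  by rewrite [RHS]addrCA; congr (_ + _); rewrite addrCA.
- move=> j b; rewrite inB_A L_inA L_inB mul0r add0r Eb_inB inB_A eq_sym.
  by case: ifP.
move=> t a' v ha' hv IH j.
have := IH t; rewrite hv mul0r add0r; set c := (if t == s then _ else _) => hc.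
have E1 : L j (A t a' * (v * A s a)) =
    (if t == j then A t a' * (v * A s a - c) else 0) + L j (A t a' * c).
  by rewrite -{1}[v * _](subrK c) mulrDr linearD /= -hc L_letter_sub.
have EE : Eb (A t a' * (v * A s a)) = Eb (A t a' * c).
  rewrite -{1}[v * _](subrK c) -hc mulrDr /Eb linearD /= W_exp_letter ?add0r//.
  by rewrite linearB /= LL eqxx subrr.
have Ev : Eb (A t a' * v) = 0 by exact: Eb_letter.
have Lc : L j (A t a' * c) = if t == j then A t a' * c - Eb (A t a' * c) else 0.
  rewrite /c; have [ts|ts] := eqVneq t s; last by rewrite mulr0 linear0 /Eb !linear0 addr0 if_same.
  move: a' ha' Ev {hc c EE E1 IH}; rewrite ts => a' ha' Ev.
  rewrite mulrBr linearB /=.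
  have -> : A s a' * (Eb v * A s a) = A s (a' * (iota D s (W_exp W v) * a)).
    by rewrite /Eb inB_A -rmorphM.
  have -> : A s a' * Eb (v * A s a) = A s (a' * iota D s (W_exp W (v * A s a))).
    by rewrite A_inB.
  rewrite -linearB /= -raddfB L_inA /=.
  by [].
rewrite -mulrA E1 Lc L_letter// Ev mul0r sub0r EE.
have [tj|tj] := eqVneq t j.
  rewrite mulrBr addrA subrK mulrA -tj /c; congr (_ + _).
  by case: ifP => // _; rewrite mulr0 /Eb !linear0.
rewrite mul0r !add0r /c; have [ts|ts] := eqVneq t s.
  case: eqVneq => // js; suff : t == j by rewrite (negPf tj).
  by rewrite ts js.
by rewrite mulr0 /Eb !linear0 if_same.
Qed.


Lemma Rp_star i x : Rp i (star x) = star (L i x).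
Proof. by rewrite /Rp starK. Qed.

Lemma L_star i x : L i (star x) = star (Rp i x).
Proof. by rewrite /Rp starK. Qed.

Lemma Rp_inB i b : Rp i (inB W b) = 0.
Proof. by rewrite /Rp -inB_star L_inB star0. Qed.

Lemma RpRp i x : Rp i (Rp i x) = Rp i x.
Proof. by rewrite /Rp starK LL eqxx. Qed.

Lemma Eb_Rp i x : Eb (Rp i x) = 0.
Proof. by rewrite /Rp Eb_star Eb_L star0. Qed.

Lemma Rp_inA_l j k (a : amA D k) x :
  Rp j (A k a * x) = A k a * Rp j x + if j == k then A k a * Eb x - Eb (A k a * x) else 0.
Proof.
rewrite /Rp starM -inA_star L_inA_r starD starM inA_star starK; congr (_ + _).
case: ifP => _; last by rewrite star0.
by rewrite starB starM !Eb_star !starK -Eb_star starM !starK.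
Qed.

Lemma Rp_inB_l j b x : Rp j (inB W b * x) = inB W b * Rp j x.
Proof.
move: x; apply: (W_ind (T := unit) (g := fun _ x => Rp j (inB W b * x))
   (h := fun _ x => inB W b * Rp j x)) tt => [t c x y|t c x y|_ b'|i a u ha hu IH _].
- by rewrite mulrDr -scalerAr Rp_linear.
- by rewrite Rp_linear mulrDr -scalerAr.
- by rewrite -rmorphM !Rp_inB mulr0.
rewrite mulrA inB_A !Rp_inA_l; have hb := cent_l b ha.
by rewrite !Eb_letter// -inB_A !subr0 mulrDr; case: ifP => _; rewrite ?mulr0// !mulrA.
Qed.

Lemma L_Rp i j x : L i (Rp j x) = Rp j (L i x).
Proof.
move: x; apply: (W_ind (g := fun ij x => L ij.1 (Rp ij.2 x))
   (h := fun ij x => Rp ij.2 (L ij.1 x)) _ _ _ _ (i, j)) => [t c x y|t c x y|t b|k a u ha hu IH [{}i {}j]] /=.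
- by rewrite Rp_linear linearP.
- by rewrite linearP Rp_linear.
- by rewrite Rp_inB L_inB linear0 /Rp star0 linear0 star0.
have R0 : Rp j 0 = 0 by rewrite /Rp star0 linear0 star0.
have h1 : L k (Rp j u) = 0 by rewrite (IH (k, j)) /= hu R0.
rewrite L_letter// Rp_inA_l Eb_letter// subr0 linearD /= L_letter//.
have -> : L i (if j == k then A k a * Eb u else 0) =
   if k == i then if j == k then A k a * Eb u else 0 else 0.
  case: ifP => _; last by rewrite linear0 if_same.
  by rewrite L_letter// L_inB.
case: ifP => _; last by rewrite R0 addr0.
by rewrite Rp_inA_l Eb_letter// subr0.
Qed.

Lemma Eb0 : Eb 0 = 0. Proof. by rewrite /Eb !linear0. Qed.
Lemma EbD x y : Eb (x + y) = Eb x + Eb y. Proof. by rewrite /Eb !linearD. Qed.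
Lemma EbB x y : Eb (x - y) = Eb x - Eb y. Proof. by rewrite /Eb !linearB. Qed.
Lemma EbZ c x : Eb (c *: x) = c *: Eb x. Proof. by rewrite /Eb !linearZ. Qed.
Lemma EbK x : Eb (Eb x) = Eb x. Proof. exact: Eb_inB. Qed.
Lemma Rp0 i : Rp i 0 = 0. Proof. by rewrite /Rp star0 linear0 star0. Qed.
Lemma RpD i x y : Rp i (x + y) = Rp i x + Rp i y.
Proof. by rewrite -[x in LHS]scale1r Rp_linear scale1r. Qed.
Lemma RpN i x : Rp i (- x) = - Rp i x.
Proof. by rewrite -scaleN1r -[_ *: x]addr0 Rp_linear Rp0 addr0 scaleN1r. Qed.
Lemma RpB i x y : Rp i (x - y) = Rp i x - Rp i y.
Proof. by rewrite RpD RpN. Qed.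

(* A letter only pairs with the words that start and end with its index. *)
Lemma Eb_letter_LR k (a : amA D k) x : cexp D k a = 0 ->
  Eb (A k a * x) = Eb (A k a * L k (Rp k x)).
Proof.
move=> ha.
have h1 y : Eb (A k a * y) = Eb (A k a * L k y).
  apply/eqP; rewrite -subr_eq0 -EbB -mulrBr; apply/eqP; apply: Eb_letter => //.
  by rewrite linearB /= LL eqxx subrr.
rewrite h1 L_Rp; set y := L k x.
have := congr1 Eb (Rp_inA_l k a y); rewrite eqxx Eb_Rp EbD EbB EbK.
have -> : Eb (A k a * Eb y) = 0 by apply: Eb_letter => //; rewrite L_inB.
by rewrite sub0r => /esym/eqP; rewrite subr_eq0 => /eqP <-.
Qed.

(** If [x] consists of words starting in A_i and [y] of words ending in A_j, this says that [x * y]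
    starts in A_i or ends in A_j, up to a part in B that occurs only for i = j. The induction peels
    off the first letter of [x], for all i, j and y at once. *)
Theorem cotlar_identity i j x y :
  L i x * Rp j y - L i (x * Rp j y) - Rp j (L i x * y) + L i (Rp j (x * y)) =
  if i == j then Eb (L i x * Rp j y) else 0.
Proof.
pose g (t : I * I * W) x := L t.1.1 x * Rp t.1.2 t.2 - L t.1.1 (x * Rp t.1.2 t.2)
   - Rp t.1.2 (L t.1.1 x * t.2) + L t.1.1 (Rp t.1.2 (x * t.2)).
pose h (t : I * I * W) x := if t.1.1 == t.1.2 then Eb (L t.1.1 x * Rp t.1.2 t.2) else 0.
apply: (W_ind (g := g) (h := h) _ _ _ _ (i, j, y)) => {i j x y} [[[i j] y] c u v|[[i j] y] c u v|[[i j] y] b|].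
- rewrite /g /= !linearP /= !mulrDl -!scalerAl !Rp_linear !linearP /=.
  rewrite !scalerDr; do 2! (rewrite [RHS]addrACA; congr (_ + _)).
  by rewrite [RHS]addrACA.
- rewrite /h /=; case: ifP => _; last by rewrite scaler0 addr0.
  by rewrite linearP mulrDl -scalerAl Eb_linear.
- rewrite /g /h /= L_inB !mul0r Rp0 Eb0 if_same subr0 sub0r L_l Rp_inB_l L_l.
  by rewrite addNr.
move=> s a u ha hu IH [[i j] y]; rewrite /g /h /=.
(* Full cancellation would match the first letter [a] with a last letter of y' from A_s. *)
have K y' : Rp s y' = 0 -> Eb (A s a * u * y') = 0.
  move=> hy; have := IH (s, s, y'); rewrite /g /h /= eqxx hy hu !mulr0 !mul0r Rp0 linear0 Eb0.
  rewrite !subr0 add0r => LR; rewrite -mulrA Eb_letter_LR// LR mulr0 Eb0//.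
set x := A s a * u in K *.
have Ls : L s x = x by rewrite /x L_letter// eqxx.
have Ex : Eb (x * Rp s y) = Eb (x * y).
  apply/esym/eqP; rewrite -subr_eq0 -EbB -mulrBr; apply/eqP/K.
  by rewrite RpB RpRp subrr.
(* The failure of [Rp j] to commute with left multiplication by [u]. By the induction hypothesis it
   has no words starting in A_s, so [a] times it consists of words starting in A_s. *)
set v := Rp j (u * y) - u * Rp j y + if j == s then Eb (u * y) else 0.
have Lv : L s v = 0.
  have := IH (s, j, y); rewrite /g /h /= hu !mul0r Rp0 Eb0 if_same subr0 sub0r => H.
  rewrite /v linearD linearB /= [L s (if _ then _ else _)](_ : _ = 0).
    by rewrite addr0 addrC.
  by case: ifP => _; rewrite ?L_inB ?linear0.
have Q : Rp j (x * y) = x * Rp j y + A s a * v - if j == s then Eb (x * y) else 0.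
  rewrite /x -mulrA Rp_inA_l /v mulrDr mulrBr -[A s a * u * _]mulrA addrA addrCA subrr addr0.
  rewrite -addrA; congr (_ + _).
  by case: ifP => _; rewrite ?mulr0 ?subr0.
have LQ k : L k (Rp j (x * y)) = L k (x * Rp j y) + if s == k then A s a * v else 0.
  rewrite Q linearB linearD /= L_letter// [X in _ - X](_ : _ = 0) ?subr0//.
  by case: ifP => _; rewrite ?L_inB ?linear0.
have [is_|is_] := eqVneq s i; last first.
  rewrite {1 2 4}/x !L_letter// (negPf is_) !mul0r Rp0 Eb0 if_same subr0 sub0r LQ.
  by rewrite (negPf is_) addr0 addNr.
rewrite -is_ Ls LQ eqxx Q.
have [js|js] := eqVneq s j.
  by rewrite -js Ex addrAC addrA subrK opprB addrC subrK.
by rewrite subr0 addrAC addrA subrK subrr.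
Qed.


Lemma L_Rp0 i b y : L i b = 0 -> Rp i y = 0 -> L i (Rp i (b * y)) = 0.
Proof.
move=> hb hy; have := cotlar_identity i i b y.
by rewrite eqxx hb hy !mulr0 !mul0r Rp0 linear0 Eb0 !subr0 add0r.
Qed.

(** For a product to reach B, the first letter of the left word has to cancel the last letter of the
    right one. *)
Lemma Eb_L_orth i x y : Rp i y = 0 -> Eb (L i x * y) = 0.
Proof.
move=> hy; move: x; apply: (W_ind (T := unit) (g := fun _ x => Eb (L i x * y))
  (h := fun _ => fun=> 0)) tt => [t c u v|t c u v|_ b|k a u ha hu _ _].
- by rewrite linearP mulrDl -scalerAl Eb_linear.
- by rewrite scaler0 addr0.
- by rewrite L_inB mul0r Eb0.
rewrite L_letter//; have [ki|_] := eqVneq k i; last by rewrite mul0r Eb0.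
by rewrite -mulrA Eb_letter_LR// L_Rp0 ?mulr0 ?Eb0// ki.
Qed.

Lemma Eb_Rp_orth i x y : L i x = 0 -> Eb (x * Rp i y) = 0.
Proof.
move=> hx; rewrite -[LHS]starK -Eb_star starM /Rp starK Eb_L_orth ?star0//.
by rewrite Rp_star hx star0.
Qed.

Lemma W_exp_letter_inA i (a : amA D i) u : L i u = 0 ->
  W_exp W (A i a * u) = cexp D i a * W_exp W u.
Proof.
move=> hu; have [a0 h0 ->] := inA_split a.
by rewrite mulrDl linearD /= W_exp_letter// add0r W_exp_l.
Qed.

Lemma L_letter_inA i (a : amA D i) u : L i u = 0 ->
  L i (A i a * u) = A i a * u - Eb (A i a) * u.
Proof.
move=> hu; have [a0 h0 E] := inA_split a; rewrite {1}/Eb W_exp_inA E.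
by rewrite [in RHS]mulrDl addrK mulrDl linearD /= L_letter// eqxx L_l hu mulr0 addr0.
Qed.

(** Cyclicity for one factor from A_i, deduced from the trace of A_i; [W_trC] then moves the letters
    of a word across one by one. *)
Lemma tr_letterC i (a : amA D i) x : W_tr (A i a * x) = W_tr (x * A i a).
Proof.
rewrite /W_tr; move: x; apply: (W_ind (T := unit) (V := R[i]^o) (g := fun _ x => tr (W_exp W (A i a * x)))
  (h := fun _ x => tr (W_exp W (x * A i a)))) tt => [t c u v|t c u v|_ b|t a' u ha hu _ _].
- by rewrite mulrDr -scalerAr !linearP.
- by rewrite mulrDl -scalerAl !linearP.
- by rewrite A_inB inB_A !W_exp_inA !cexp_tr tr_tracial.
have E1 : W_exp W (A t a' * u * A i a) =
    W_exp W (A t a' * (if t == i then Eb u * A i a else 0)).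
  rewrite -mulrA -{1}[u * _](subrK (L t (u * A i a))) mulrDr linearD /= W_exp_letter//; last first.
    by rewrite linearB /= LL eqxx subrr.
  rewrite add0r L_inA_r hu mul0r add0r; case: ifP => _ //.
  rewrite mulrBr linearB /= [X in _ - X](_ : _ = 0) ?subr0//.
  by apply: W_exp_letter => //; rewrite L_inB.
rewrite E1 mulrA; case: (eqVneq t i) => [ti|ti]; last first.
  rewrite mulr0 linear0 -mulrA W_exp_letter_inA; last by rewrite L_letter// (negPf ti).
  by rewrite W_exp_letter// mulr0 linear0.
move: a' ha {E1}; rewrite ti in hu *; move=> a' ha.
have -> : A i a * A i a' * u = A i (a * a') * u by rewrite rmorphM.
have -> : A i a' * (Eb u * A i a) = A i (a' * iota D i (W_exp W u) * a).
  by rewrite mulrA /Eb A_inB -rmorphM.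
rewrite W_exp_letter_inA// W_exp_inA -cexp_r !cexp_tr [RHS]tr_tracial mulrA.
by [].
Qed.

Lemma W_trC x y : W_tr (x * y) = W_tr (y * x).
Proof.
rewrite /W_tr; apply: (W_ind (V := R[i]^o) (g := fun y x => tr (W_exp W (x * y)))
  (h := fun y x => tr (W_exp W (y * x)))) => {x y} [y c u v|y c u v|y b|t a u ha hu IH y].
- by rewrite mulrDl -scalerAl !linearP.
- by rewrite mulrDr -scalerAr !linearP.
- by rewrite W_exp_l W_exp_r tr_tracial.
have T := tr_letterC a; rewrite /W_tr in T.
by rewrite -mulrA T -mulrA IH mulrA.
Qed.

End Words.

(** * From the GNS space to a trace on matrices over W *)

Section Hilb.
Variables (R : realType) (H : hilbert R).
Implicit Types (u v : H).

Lemma hdotC u v : hdot u v = Num.conj (hdot v u).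
Proof. by rewrite hermC /= expr0 mul1r. Qed.

Lemma hdot_ge0 u : 0 <= hdot u u :> R[i].
Proof.
have [->|u0] := eqVneq u 0; first by rewrite linear0.
by rewrite ltW// neq0_dnorm_gt0.
Qed.

Lemma hdot_real u : hdot u u = (complex.Re (hdot u u))%:C%C.
Proof. by have := ger0_real (hdot_ge0 u); move=> /RRe_real. Qed.

Lemma Re_hdot_ge0 u : 0 <= complex.Re (hdot u u).
Proof. by have := hdot_ge0 u; rewrite hdot_real lecR. Qed.

Lemma hnorm_sq u : hnorm u ^+ 2 = complex.Re (hdot u u).
Proof. by rewrite /hnorm /dot_norm sqr_sqrtr// Re_hdot_ge0. Qed.

Lemma hnorm_ge0 u : 0 <= hnorm u.
Proof. exact: sqrtr_ge0. Qed.

End Hilb.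

Section Trace.
Variables (R : realType) (I : eqType) (D : amalgam R I) (W : word_algebra D) (G : gns W).
Implicit Types (x y : W).

Definition retr x : R := complex.Re (W_tr x).

Lemma retrP (r : R) x y : retr (r%:C%C *: x + y) = r * retr x + retr y.
Proof.
rewrite /retr /W_tr !linearP /=; case: (tr _) => a b; case: (tr _) => c d /=.
by rewrite mul0r subr0.
Qed.

Lemma retrD x y : retr (x + y) = retr x + retr y.
Proof. by rewrite /retr /W_tr !linearD /=; case: (tr _); case: (tr _). Qed.

Lemma retrN x : retr (- x) = - retr x.
Proof. by rewrite /retr /W_tr !linearN /=; case: (tr _). Qed.

Lemma retrC x y : retr (x * y) = retr (y * x).
Proof. by rewrite /retr W_trC. Qed.

(** Symmetry, positivity and boundedness of the trace are read off the GNS space instead of being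
    proved on words. *)
Lemma retr_star x : retr (star x) = retr x.
Proof.
rewrite /retr -[star x]mulr1 -(gns_dot G) hdotC gns_dot star1 mul1r.
by case: W_tr.
Qed.

Lemma retr_dot x : retr (star x * x) = hnorm (gns_vec G x) ^+ 2.
Proof. by rewrite hnorm_sq gns_dot. Qed.

Lemma retr_ge0 x : 0 <= retr (star x * x).
Proof. by rewrite retr_dot exprn_ge0// hnorm_ge0. Qed.

Lemma retr_bdd x : exists2 c, 0 <= c & forall y,
  retr (star (x * y) * (x * y)) <= c * retr (star y * y).
Proof.
have [_ [M hM]] := gns_bounded G x; exists (M ^+ 2); first exact: sqr_ge0.
move=> y; rewrite !retr_dot -gns_repE -exprMn.
have h0 := hnorm_ge0 (gns_rep G x (gns_vec G y)).
by rewrite lerXn2r ?nnegrE//; apply: le_trans (hM _).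
Qed.

End Trace.

Section Matrices.
Variables (R : realType) (I : eqType) (D : amalgam R I) (W : word_algebra D) (G : gns W).
Variable N : nat.

(** A separate name, so that the scalars are the reals instead of [W]. *)
Definition mtx := 'M[W]_N.+1.
HB.instance Definition _ := GRing.NzRing.on mtx.

Definition mscale (r : R) (x : mtx) : mtx := \matrix_(i, j) (r%:C%C *: x i j).

Lemma mscaleA (r s : R) x : mscale r (mscale s x) = mscale (r * s) x.
Proof. by apply/matrixP => i j; rewrite !mxE scalerA -rmorphM. Qed.

Lemma mscale1 : left_id 1 mscale.
Proof. by move=> x; apply/matrixP => i j; rewrite !mxE scale1r. Qed.

Lemma mscaleDr : right_distributive mscale +%R.
Proof. by move=> r x y; apply/matrixP => i j; rewrite !mxE scalerDr. Qed.

Lemma mscaleDl x : {morph mscale^~ x : r s / r + s}.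
Proof. by move=> r s; apply/matrixP => i j; rewrite !mxE rmorphD scalerDl. Qed.

HB.instance Definition _ :=
  GRing.Zmodule_isLmodule.Build R mtx mscaleA mscale1 mscaleDr mscaleDl.

Lemma mscaleAl (r : R) (x y : mtx) : r *: (x * y) = (r *: x) * y.
Proof.
apply/matrixP => i j; rewrite !mxE scaler_sumr; apply: eq_bigr => k _.
by rewrite !mxE scalerAl.
Qed.

HB.instance Definition _ := GRing.Lmodule_isLalgebra.Build R mtx mscaleAl.

Lemma mscaleAr (r : R) (x y : mtx) : r *: (x * y) = x * (r *: y).
Proof.
apply/matrixP => i j; rewrite !mxE scaler_sumr; apply: eq_bigr => k _.
by rewrite !mxE scalerAr.
Qed.

HB.instance Definition _ := GRing.Lalgebra_isAlgebra.Build R mtx mscaleAr.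

Definition mast (x : mtx) : mtx := \matrix_(i, j) star (x j i).
Definition mtau (x : mtx) : R := \sum_i retr (x i i).

Lemma mastP (r : R) (x y : mtx) : mast (r *: x + y) = r *: mast x + mast y.
Proof. by apply/matrixP => i j; rewrite !mxE starP; congr (_ *: _ + _); exact: conjc_real. Qed.

Lemma mastK : involutive mast.
Proof. by move=> x; apply/matrixP => i j; rewrite !mxE starK. Qed.

Lemma mastM (x y : mtx) : mast (x * y) = mast y * mast x.
Proof.
apply/matrixP => i j; rewrite !mxE star_sum; apply: eq_bigr => k _.
by rewrite !mxE starM.
Qed.

Lemma mtauP (r : R) (x y : mtx) : mtau (r *: x + y) = r * mtau x + mtau y.
Proof. by rewrite /mtau mulr_sumr -big_split; apply: eq_bigr => i _; rewrite !mxE retrP. Qed.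

Lemma mtau_ast x : mtau (mast x) = mtau x.
Proof. by apply: eq_bigr => i _; rewrite !mxE (retr_star G). Qed.

Lemma retr_sum J (s : seq J) P (F : J -> W) :
  retr (\sum_(i <- s | P i) F i) = \sum_(i <- s | P i) retr (F i).
Proof.
apply: big_morph; first exact: retrD.
by rewrite /retr /W_tr !linear0.
Qed.

Lemma mtauM (x y : mtx) : mtau (x * y) = \sum_i \sum_j retr (x i j * y j i).
Proof. by apply: eq_bigr => i _; rewrite !mxE retr_sum. Qed.

Lemma mtauC x y : mtau (x * y) = mtau (y * x).
Proof.
rewrite !mtauM exchange_big; apply: eq_bigr => i _; apply: eq_bigr => j _.
exact: retrC.
Qed.

Lemma mtau_sq (x : mtx) : mtau (mast x * x) = \sum_i \sum_j retr (star (x i j) * x i j).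
Proof. by rewrite mtauM exchange_big; apply: eq_bigr => i _; apply: eq_bigr => j _; rewrite mxE. Qed.

Lemma mtau_ge0 x : 0 <= mtau (mast x * x).
Proof. by rewrite mtau_sq; do 2 (apply: sumr_ge0 => ? _); apply: retr_ge0 G _. Qed.

(** Each term costs a factor 2 through |u + v|^2 <= 2 |u|^2 + 2 |v|^2. The growth in the number of
    terms is harmless: [mtau_bdd] asks only for some finite bound. *)
Lemma retr_sum_sq (J : Type) (s : seq J) (F : J -> W) :
  retr (star (\sum_(i <- s) F i) * (\sum_(i <- s) F i)) <=
  2 ^+ size s * \sum_(i <- s) retr (star (F i) * F i).
Proof.
elim: s => [|i s IH]; first by rewrite !big_nil mulr0 mulr0 /retr /W_tr !linear0.
rewrite !big_cons; set u := F i; set v := \sum_(i <- s) F i.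
have := retr_ge0 G (u - v).
rewrite starB mulrBl !mulrBr starD mulrDl !mulrDr !(retrD, retrN) => h.
have hu : retr (star u * u) <= 2 ^+ size s * retr (star u * u).
  by rewrite ler_peMl ?(retr_ge0 G)// exprn_ege1// ler1n.
by rewrite /= exprS -!mulrA; move: IH hu h; rewrite -/v; lra.
Qed.

Lemma mtau_bdd (x : mtx) : exists c, forall y,
  mtau (mast (x * y) * (x * y)) <= c * mtau (mast y * y).
Proof.
have /choice[c hc] : forall ij : 'I_N.+1 * 'I_N.+1, exists c, 0 <= c /\ forall y,
    retr (star (x ij.1 ij.2 * y) * (x ij.1 ij.2 * y)) <= c * retr (star y * y).
  by move=> ij; have [c c0 h] := retr_bdd G (x ij.1 ij.2); exists c.
pose C := \sum_i \sum_j c (i, j).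
have cC i j : c (i, j) <= C.
  rewrite /C (bigD1 i)//= (bigD1 j)//= -addrA lerDl addr_ge0//.
    by apply: sumr_ge0 => k _; have [] := hc (i, k).
  by apply: sumr_ge0 => k _; apply: sumr_ge0 => l _; have [] := hc (k, l).
exists (N.+1%:R * (2 ^+ N.+1 * C)) => y; rewrite !mtau_sq.
rewrite -mulrA mulr_natl -[X in _ *+ X]card_ord -sumr_const.
apply: ler_sum => i _; rewrite [X in _ <= _ * X]exchange_big /= mulr_sumr.
apply: ler_sum => j _; rewrite !mxE.
apply: le_trans (retr_sum_sq _ _) _; rewrite /index_enum -enumT size_enum_ord -mulrA.
rewrite ler_wpM2l ?exprn_ge0// mulr_sumr enumT; apply: ler_sum => k _.
have [_ h] := hc (i, k); apply: le_trans (h _) _.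
by rewrite ler_wpM2r// retr_ge0.
Qed.

Definition mta : tralg R := @TrAlg R mtx mast mtau mastP mastK mastM mtauP
  mtau_ast mtauC mtau_ge0 mtau_bdd.

End Matrices.

#[global] Instance pzring_ops (V : pzRingType) :
  @Ring_ops V 0 1 +%R *%R (fun x y => x - y) -%R eq := {}.
#[global] Instance pzring_ring (V : pzRingType) : Ring (Ro := pzring_ops V).
Proof.
split; try exact _.
all: rewrite /addition /multiplication /subtraction /opposite /equality /zero /one /=.
all: rewrite /add_notation /mul_notation /sub_notation /opp_notation.
all: rewrite /eq_notation /zero_notation /one_notation /=.
all: try by move=> x y -> // u v ->.
- exact: add0r.
- exact: addrC.
- exact: addrA.
- exact: mul1r.
- exact: mulr1.
- exact: mulrA.
- exact: mulrDl.
- by move=> x y z; exact: mulrDr.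
- by [].
- exact: subrr.
Qed.

Ltac ncring := non_commutative_ring.

(** * Complementary projections: removing words by their first or last letter *)

Section WordProj.
Variables (R : realType) (I : eqType) (D : amalgam R I) (W : word_algebra D).
Implicit Types (x y u v w : W) (i j k : I).
Local Notation L := (L_proj W).

Definition Pe i x : W := x - L i x.
Definition Qe i x : W := x - Rp i x.

Lemma Pe_sum i J (s : seq J) (F : J -> W) : Pe i (\sum_(m <- s) F m) = \sum_(m <- s) Pe i (F m).
Proof. by rewrite /Pe linear_sum sumrB. Qed.

Lemma PeD i x y : Pe i (x + y) = Pe i x + Pe i y.
Proof. by rewrite /Pe linearD opprD addrACA. Qed.

Lemma PeB i x y : Pe i (x - y) = Pe i x - Pe i y.
Proof. by rewrite /Pe linearB; ncring. Qed.

Lemma Rp_sum i J (s : seq J) (F : J -> W) : Rp i (\sum_(m <- s) F m) = \sum_(m <- s) Rp i (F m).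
Proof. exact: (big_morph (Rp i) (RpD i) (Rp0 W i)). Qed.

Lemma Qe_sum i J (s : seq J) (F : J -> W) : Qe i (\sum_(m <- s) F m) = \sum_(m <- s) Qe i (F m).
Proof. by rewrite /Qe Rp_sum sumrB. Qed.

Lemma Eb_sum J (s : seq J) (F : J -> W) : Eb (\sum_(m <- s) F m) = \sum_(m <- s) Eb (F m).
Proof. exact: (big_morph (@Eb _ _ _ W) (@EbD _ _ _ W) (@Eb0 _ _ _ W)). Qed.

Lemma L_Pe i x : L i (Pe i x) = 0.
Proof. by rewrite /Pe linearB /= LL eqxx subrr. Qed.

Lemma Rp_Qe i x : Rp i (Qe i x) = 0.
Proof. by rewrite /Qe RpB RpRp subrr. Qed.

Lemma Pe_id i x : L i x = 0 -> Pe i x = x.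
Proof. by rewrite /Pe => ->; rewrite subr0. Qed.

Lemma Qe_star i x : Qe i (star x) = star (Pe i x).
Proof. by rewrite /Qe /Pe Rp_star starB. Qed.

Lemma Pe_star i x : Pe i (star x) = star (Qe i x).
Proof. by rewrite -[x in RHS]starK Qe_star starK. Qed.

(** The defect in Cotlar's identity does not change when both projections are replaced by their
    complements; this is why [L i] and [Rp j] remain under the expectation. *)
Lemma cotlar_perp i j u v :
  Pe i u * Qe j v = Pe i (u * Qe j v) + Qe j (Pe i u * v) - Pe i (Qe j (u * v))
    + if i == j then Eb (L i u * Rp j v) else 0.
Proof.
rewrite -cotlar_identity /Pe /Qe !mulrBl !mulrBr !(linearB, RpB) /= L_Rp.
by ncring.
Qed.

Lemma Eb_split i u v : Eb (u * v) = Eb (Pe i u * Qe i v) + Eb (L i u * Rp i v).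
Proof.
have -> : u * v = Pe i u * Qe i v + L i u * Rp i v + Pe i u * Rp i v + L i u * Qe i v.
  by rewrite /Pe /Qe; ncring.
by rewrite !EbD (Eb_L_orth u (Rp_Qe i v)) (Eb_Rp_orth v (L_Pe i u)) !addr0.
Qed.

(** Take [b] to be the adjoint of the expectation of [x] and use faithfulness on B. *)
Lemma Eb_eq0 x : (forall b, W_tr (inB W b * x) = 0) -> Eb x = 0.
Proof.
move=> h; rewrite /Eb; suff -> : W_exp W x = 0 by rewrite linear0.
by apply: tr_faithful; rewrite -W_exp_l; exact: h.
Qed.

(* A word ending in [A_i] followed by one not starting in [A_i]: no cancellation.
   The trace reduces this to [Eb_Rp_orth]. *)
Lemma Eb_Rp_L i x y : L i y = 0 -> Eb (Rp i x * y) = 0.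
Proof.
move=> hy; apply: Eb_eq0 => b; rewrite mulrA -Rp_inB_l W_trC /W_tr.
by have := congr1 (W_exp W) (Eb_Rp_orth (inB W b * x) hy); rewrite /Eb W_exp_inB => ->; rewrite !linear0.
Qed.

Definition letter_in i x : Prop := exists2 a : amA D i, cexp D i a = 0 & x = inA W i a.

Lemma letter0 i : letter_in i 0.
Proof. by exists 0; rewrite ?linear0. Qed.

Lemma letterD i x y : letter_in i x -> letter_in i y -> letter_in i (x + y).
Proof.
move=> [a ha ->] [b hb ->]; exists (a + b); last by rewrite raddfD.
by rewrite raddfD /= ha hb addr0.
Qed.

Lemma letter_sum i J (s : seq J) (F : J -> W) :
  (forall m, letter_in i (F m)) -> letter_in i (\sum_(m <- s) F m).
Proof. by move=> h; elim/big_ind: _ => // *; [exact: letter0|exact: letterD]. Qed.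

Lemma letter_r i x b : letter_in i x -> letter_in i (x * inB W b).
Proof.
by move=> [a ha ->]; exists (a * iota D i b); [exact: cent_r|exact: A_inB].
Qed.

Lemma letter_star i x : letter_in i x -> letter_in i (star x).
Proof.
move=> [a ha ->]; exists (star a); last by rewrite inA_star.
by rewrite cexp_star ha star0.
Qed.

Lemma letter_L i j x u : letter_in i x -> L i u = 0 -> L j (x * u) = if i == j then x * u else 0.
Proof. by move=> [a ha ->] hu; exact: L_letter. Qed.

Lemma letter_Pe i x u : letter_in i x -> L i u = 0 -> Pe i (x * u) = 0.
Proof. by move=> hx hu; rewrite /Pe (letter_L i hx hu) eqxx subrr. Qed.

Lemma letter_Eb i x u : letter_in i x -> L i u = 0 -> Eb (x * u) = 0.
Proof. by move=> [a ha ->] hu; exact: Eb_letter. Qed.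

Lemma letter_Eb_LR i x u : letter_in i x -> L i (Rp i u) = 0 -> Eb (x * u) = 0.
Proof. by move=> [a ha ->] hu; rewrite Eb_letter_LR// hu mulr0 Eb0. Qed.

Lemma letter_Eb_LR' i x u : letter_in i x -> L i (Rp i u) = 0 -> Eb (u * x) = 0.
Proof.
move=> hx hu; rewrite -[LHS]starK -Eb_star starM (letter_Eb_LR (letter_star hx)) ?star0//.
by rewrite Rp_star L_star -L_Rp hu star0.
Qed.

Lemma letter_Pe_r i j x u : letter_in j x ->
  Pe i (u * x) = Pe i u * x - if i == j then Eb u * x - Eb (u * x) else 0.
Proof. by move=> [a ha ->]; rewrite /Pe L_inA_r mulrBl opprD addrA. Qed.

Lemma letter_Qe_l i j x u : letter_in i x ->
  Qe j (x * u) = x * Qe j u - if j == i then x * Eb u - Eb (x * u) else 0.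
Proof. by move=> [a ha ->]; rewrite /Qe Rp_inA_l mulrBr opprD addrA. Qed.

(** The centered part of x y is a letter, so it produces words starting in A_i, which [Pe i]
    removes. *)
Lemma letter_PeM i x y u : letter_in i x -> letter_in i y -> L i u = 0 ->
  Pe i (x * y * u) = Eb (x * y) * u.
Proof.
move=> [a ha ->] [b hb ->] hu; rewrite -rmorphM /Pe L_letter_inA//.
by rewrite opprB addrC subrK.
Qed.

End WordProj.

(** * Expectations and projections on matrices *)

Section Matrix.
Variables (R : realType) (I : eqType) (D : amalgam R I) (W : word_algebra D) (G : gns W).
Variable N : nat.
Local Notation A := (mta G N).
Local Notation ix := 'I_N.+1.
Implicit Types (x y u v h : A) (k l m : ix).

Definition en x k l : W := (x : 'M[W]_N.+1) k l.
Definition mk (f : ix -> ix -> W) : A := \matrix_(k, l) f k l.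

Lemma en_mk f k l : en (mk f) k l = f k l.
Proof. by rewrite /en mxE. Qed.

Lemma en_inj x y : (forall k l, en x k l = en y k l) -> x = y.
Proof. by move=> h; apply/matrixP. Qed.

Lemma en0 k l : en 0 k l = 0. Proof. exact: mxE. Qed.
Lemma enD x y k l : en (x + y) k l = en x k l + en y k l. Proof. exact: mxE. Qed.
Lemma enN x k l : en (- x) k l = - en x k l. Proof. exact: mxE. Qed.
Lemma enB x y k l : en (x - y) k l = en x k l - en y k l. Proof. by rewrite enD enN. Qed.
Lemma enZ (r : R) x k l : en (r *: x) k l = r%:C%C *: en x k l. Proof. exact: mxE. Qed.
Lemma en1 k l : en 1 k l = (k == l)%:R. Proof. exact: mxE. Qed.
Lemma enM x y k l : en (x * y) k l = \sum_m en x k m * en y m l. Proof. exact: mxE. Qed.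
Lemma en_ast x k l : en x^# k l = star (en x l k). Proof. exact: mxE. Qed.
Lemma tauE x : tau x = \sum_k retr (en x k k). Proof. by []. Qed.
Lemma tauME x y : tau (x * y) = \sum_k \sum_l retr (en x k l * en y l k).
Proof. exact: mtauM. Qed.

Lemma retr_Eb (x : W) : retr (Eb x) = retr x.
Proof. by rewrite /retr /W_tr /Eb W_exp_inB. Qed.

(** Two labelings are used: a constant one, giving the entrywise expectation [Em], and [iot], giving
    the expectation that keeps only the blocks of equal index. *)
Definition Ed (T : eqType) (s : ix -> T) x : A :=
  mk (fun k l => if s k == s l then Eb (en x k l) else 0).

Lemma en_Ed (T : eqType) (s : ix -> T) x k l :
  en (Ed s x) k l = if s k == s l then Eb (en x k l) else 0.
Proof. exact: en_mk. Qed.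

Lemma condexp_Ed (T : eqType) (s : ix -> T) : condexp (Ed s).
Proof.
split=> [r x y|x| |x y xE|x|x].
- apply: en_inj => k l; rewrite en_Ed !(enD, enZ) !en_Ed.
  by case: ifP => _; rewrite ?EbD ?EbZ// scaler0 addr0.
- apply: en_inj => k l; rewrite en_ast !en_Ed en_ast eq_sym.
  by case: ifP => _; rewrite ?star0// Eb_star.
- apply: en_inj => k l; rewrite en_Ed en1; have [->|_] := eqVneq k l.
    by rewrite eqxx -(rmorph1 (inB W)) Eb_inB.
  by rewrite Eb0 if_same.
- apply: en_inj => k l; rewrite en_Ed !enM Eb_sum.
  have -> : (if s k == s l then \sum_(m <- index_enum ix) Eb (en x k m * en y m l) else 0) =
     \sum_m if s k == s l then Eb (en x k m * en y m l) else 0.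
    by case: ifP => // _; rewrite big1.
  apply: eq_bigr => m _; rewrite en_Ed -xE en_Ed.
  have [km|km] := eqVneq (s k) (s m); last by rewrite !mul0r Eb0 if_same.
  by rewrite km EbM; case: ifP => _; rewrite ?mulr0.
- apply: en_inj => k l; by rewrite !en_Ed; case: (s k == s l); rewrite ?EbK.
by rewrite !tauE; apply: eq_bigr => k _; rewrite en_Ed eqxx retr_Eb.
Qed.

Definition Em : A -> A := Ed (fun _ : ix => tt).
Lemma en_Em x k l : en (Em x) k l = Eb (en x k l). Proof. by rewrite en_Ed eqxx. Qed.
Lemma condexp_Em : condexp Em. Proof. exact: condexp_Ed. Qed.

Variable iot : ix -> I.

Definition Pm x : A := mk (fun k l => Pe (iot k) (en x k l)).
(** It acts on last letters, column by column, and by [PmC] is the transpose of [Pm] for the pairing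
    tau (y x). *)
Definition Ps x : A := (Pm x^#)^#.
Definition Lm x : A := x - Pm x.
Local Notation Eo := (Ed iot).

Lemma en_Pm x k l : en (Pm x) k l = Pe (iot k) (en x k l).
Proof. exact: en_mk. Qed.

Lemma en_Ps x k l : en (Ps x) k l = Qe (iot l) (en x k l).
Proof. by rewrite /Ps en_ast en_Pm en_ast Pe_star starK. Qed.

Lemma en_Lm x k l : en (Lm x) k l = L_proj W (iot k) (en x k l).
Proof. by rewrite enB en_Pm /Pe opprB addrC subrK. Qed.

Lemma PmP (r : R) x y : Pm (r *: x + y) = r *: Pm x + Pm y.
Proof.
apply: en_inj => k l; rewrite en_Pm !(enD, enZ) !en_Pm /Pe linearP /=.
by rewrite opprD addrACA -scalerBr.
Qed.

Lemma PmD x y : Pm (x + y) = Pm x + Pm y.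
Proof. by have := PmP 1 x y; rewrite !scale1r. Qed.

Lemma Pm0 : Pm 0 = 0.
Proof. by apply: (addrI (Pm 0)); rewrite -PmD !addr0. Qed.

Lemma PmN x : Pm (- x) = - Pm x.
Proof. by rewrite -scaleN1r -[_ *: x]addr0 PmP Pm0 addr0 scaleN1r. Qed.

Lemma PmB x y : Pm (x - y) = Pm x - Pm y.
Proof. by rewrite PmD PmN. Qed.

Lemma PmK x : Pm (Pm x) = Pm x.
Proof. by apply: en_inj => k l; rewrite !en_Pm Pe_id// L_Pe. Qed.

Lemma Pm_Ed (T : eqType) (s : ix -> T) x : Pm (Ed s x) = Ed s x.
Proof.
apply: en_inj => k l; rewrite en_Pm en_Ed Pe_id//.
by case: ifP => _; rewrite ?L_inB ?linear0.
Qed.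

Lemma Ed_Pm (T : eqType) (s : ix -> T) x : Ed s (Pm x) = Ed s x.
Proof. by apply: en_inj => k l; rewrite !en_Ed en_Pm /Pe EbB Eb_L subr0. Qed.

Lemma PmC x y : tau (y * Pm x) = tau (Ps y * x).
Proof.
rewrite !tauME; apply: eq_bigr => k _; apply: eq_bigr => l _; rewrite en_Pm en_Ps.
set u := en y k l; set v := en x l k; set i := iot l.
have R1 : retr (Qe i u * L_proj W i v) = 0.
  by rewrite retrC -retr_Eb Eb_L_orth ?Rp_Qe// /retr /W_tr !linear0.
have R2 : retr (Rp i u * Pe i v) = 0.
  by rewrite -retr_Eb Eb_Rp_L ?L_Pe// /retr /W_tr !linear0.
have -> : u * Pe i v = Qe i u * v + Rp i u * Pe i v - Qe i u * L_proj W i v.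
  by rewrite /Pe /Qe; ncring.
by rewrite !(retrD, retrN) R1 R2 addr0 subr0.
Qed.

Lemma Pm_orth x y : tau ((Pm x)^# * y) = tau ((Pm x)^# * Pm y).
Proof. by rewrite PmC /Ps astK PmK. Qed.

Lemma Eo_split x y : Eo (x * y^#) = Eo (Pm x * (Pm y)^#) + Eo (Lm x * (Lm y)^#).
Proof.
apply: en_inj => k l; rewrite enD !en_Ed !enM; case: ifP => [/eqP kl|_]; last by rewrite addr0.
rewrite !Eb_sum -big_split; apply: eq_bigr => m _ /=.
rewrite !en_ast !en_Lm !en_Pm (Eb_split (iot k)) -Qe_star kl.
by rewrite -[X in _ = _ + Eb (_ * X)]Rp_star.
Qed.

Lemma cotlar_mx x y : Pm x * (Pm y)^# = Pm (x * (Pm y)^#) + Ps (Pm x * y^#)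
  - Pm (Ps (x * y^#)) + Eo (Lm x * (Lm y)^#).
Proof.
apply: en_inj => k l; rewrite enD enB enD !(en_Pm, en_Ps, en_Ed, enM).
have -> : (if iot k == iot l then Eb (\sum_m en (Lm x) k m * en (Lm y)^# m l) else 0) =
  \sum_m if iot k == iot l then Eb (en (Lm x) k m * en (Lm y)^# m l) else 0.
  by case: ifP => _; rewrite ?Eb_sum// big1.
rewrite !Qe_sum !Pe_sum -big_split -sumrB -big_split /=.
apply: eq_bigr => m _; rewrite !en_ast !en_Lm !en_Pm -Rp_star -!Qe_star.
by rewrite cotlar_perp; case: eqVneq => // <-.
Qed.

(** By [Eo_split] the defect Eo (Lm x (Lm x)^#) is at most Eo (x x^#). *)
Lemma cotlar_Pm : cotlar Pm Eo.
Proof.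
have E := condexp_Ed iot; split.
- exact: PmP.
- move=> x; rewrite -Pm_orth.
  have := tau_amgm1 (Pm x)^# x ltr01; rewrite astK Pm_orth invr1 !mul1r; lra.
- exact: (ce_pos E).
- by move=> q h; exact: (Np_ce E).
move=> x y yp; have [yE _] := yp.
have ES := Eo_split x x; have := cotlar_mx x x.
move: (Eo (Lm x * (Lm x)^#)) ES => d ES ->.
rewrite !mulrDl mulNr !(tauD, tauN).
have -> : Ps (Pm x * x^#) = (Pm (x * (Pm x)^#))^# by rewrite /Ps astM astK.
have -> : Ps (x * x^#) = (Pm (x * x^#))^# by rewrite /Ps astM astK.
rewrite tau_ast_l//.
have : 0 <= tau (Eo (Pm x * (Pm x)^#) * y) by apply: tau_pos_mul => //; exact/(ce_pos E)/pos_sq'.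
by rewrite ES mulrDl tauD; lra.
Qed.


Section Letters.
Variable a : A.
Hypothesis ha : forall m k, letter_in (iot k) (en a m k).

Definition Fm x : A := Pm (a^# * x).
Definition gram : A := Em (a^# * a).
Local Notation S y := (a * Pm y).

Lemma ha_star m k : letter_in (iot k) (en a^# k m).
Proof. by rewrite en_ast; exact/letter_star. Qed.

Lemma L_letter_ne k l n (u : W) : iot k != iot l -> L_proj W (iot l) u = 0 ->
  L_proj W (iot k) (en a n l * u) = 0.
Proof. by move=> kl hu; rewrite (letter_L _ (ha n l) hu) eq_sym (negPf kl). Qed.

Lemma L_1 i : L_proj W i 1 = 0.
Proof. by rewrite -(rmorph1 (inB W)) L_inB. Qed.

Lemma Eb_letters_ne k l m : iot k != iot l -> Eb (en a^# k m * en a m l) = 0.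
Proof.
move=> kl; apply: (letter_Eb (ha_star m k)).
by rewrite -[en a m l]mulr1 L_letter_ne// L_1.
Qed.

(** When two letters have the same index, [Pm] removes the centered part of their product and leaves
    its expectation. When the indices differ nothing cancels: the whole product starts in A_(iot k),
    so [Pm] kills it, and the entry of [gram] vanishes too. *)
Lemma Fm_S y : Fm (S y) = gram * Pm y.
Proof.
apply: en_inj => k l; rewrite /Fm /gram mulrA en_Pm !enM Pe_sum.
apply: eq_bigr => n _; rewrite en_Em !enM mulr_suml Pe_sum Eb_sum mulr_suml.
apply: eq_bigr => m _; rewrite en_Pm; set v := Pe (iot n) _.
have hv : L_proj W (iot n) v = 0 by exact: L_Pe.
have [kn|kn] := eqVneq (iot k) (iot n).
  by rewrite letter_PeM ?kn//; rewrite -kn; exact: ha_star.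
rewrite Eb_letters_ne// mul0r -mulrA (letter_Pe (ha_star m k))//.
exact: L_letter_ne.
Qed.

Lemma Eo_gram : Eo gram = gram.
Proof.
apply: en_inj => k l; rewrite en_Ed en_Em EbK enM Eb_sum; case: eqVneq => // kl.
by rewrite big1// => m _; exact: Eb_letters_ne.
Qed.

Lemma gramE : Eo (a^# * a) = gram.
Proof.
rewrite -Eo_gram; apply: en_inj => k l; rewrite !en_Ed; case: (iot k == iot l); rewrite ?EbK//.
Qed.

(** For u = Fm x one has tau (u^# u) = tau ((a u)^# x), and [Fm_S] with gram <= 1 bounds the norm of
    a u by that of u. *)
Lemma Fm_L2 : pos (1 - gram) -> forall x, tau ((Fm x)^# * Fm x) <= tau (x^# * x).
Proof.
move=> hg x; rewrite -Pm_orth.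
set u := Fm x; have uP : Pm u = u by exact: PmK.
have -> : (Pm (a^# * x))^# * (a^# * x) = (a * u)^# * x by rewrite astM mulrA.
have := tau_amgm1 (a * u)^# x ltr01; rewrite astK !mul1r invr1 mul1r.
have E1 : tau ((a * u)^# * x) = tau (u^# * u).
  by rewrite astM -mulrA -{1}uP Pm_orth uP.
have E2 : tau ((a * u)^# * (a * u)) = tau (u^# * gram * u).
  by rewrite astM -mulrA -{1}uP Pm_orth -{2}uP -[Pm (_ * _)]/(Fm _) Fm_S uP mulrA.
have E3 : tau (u^# * gram * u) <= tau (u^# * u).
  by have [_ /(_ u)] := hg; rewrite mulrBr mulrBl mulr1 tauB subr_ge0.
by rewrite E1 E2; lra.
Qed.

(** A letter on the left does not affect last letters, unless the word to its right is in B or the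
    product falls into B. [Pm] kills the first exception; the second is the extra term. *)
Lemma Ps_a u : Pm (Ps (a^# * u)) = Pm (a^# * Ps u) + Eo (a^# * u).
Proof.
have := ha_star; move: (a^#) => c hc.
apply: en_inj => i j; rewrite enD !en_Pm en_Ps en_Ed !enM.
have -> : (if iot i == iot j then Eb (\sum_m en c i m * en u m j) else 0) =
  \sum_m if iot i == iot j then Eb (en c i m * en u m j) else 0.
  by case: ifP => _; rewrite ?Eb_sum// big1.
rewrite Qe_sum !Pe_sum -big_split; apply: eq_bigr => m _ /=.
rewrite (letter_Qe_l _ _ (hc m i)) en_Ps eq_sym; case: eqVneq => ij; last by rewrite subr0 addr0.
rewrite opprB addrCA addrC PeD PeB; congr (_ + _); last by rewrite Pe_id// L_inB.
by rewrite (letter_Pe (hc m i) (L_inB _ _ _)) subr0.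
Qed.

(** The extra term of [Ps_a] is subtracted in Cotlar's identity and outweighs its defect by
    [Eo_split]; hence the bound zero for the defect. *)
Lemma cotlar_Fm : pos (1 - gram) -> cotlar Fm (fun=> 0).
Proof.
move=> hg; split.
- by move=> r x y; rewrite /Fm mulrDr -scalerAr PmP.
- exact: Fm_L2.
- by move=> h _; exact: pos0.
- by move=> q h q1 hp; apply: (Np_le q1 (pos0 A)); rewrite subr0; exact: hp.
move=> x y yp; have [yE _] := yp.
have E := condexp_Ed iot.
have ES := Eo_split (a^# * x) (a^# * x); have := cotlar_mx (a^# * x) (a^# * x).
move: (Eo (Lm (a^# * x) * (Lm (a^# * x))^#)) ES => d ES; rewrite -/(Fm x) => ->.
rewrite !mulrDl mulNr !(tauD, tauN) mul0r tau0 addr0.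
have -> : Ps (Fm x * (a^# * x)^#) = (Fm (x * (Fm x)^#))^#.
  by rewrite /Ps /Fm !astM !astK !mulrA.
have -> : Pm (Ps (a^# * x * (a^# * x)^#)) = Fm (Fm (x * x^#))^# + Eo (a^# * x * (a^# * x)^#).
  rewrite -[a^# * x * _]mulrA Ps_a; congr (Pm (_ * _) + _).
  by rewrite /Ps /Fm !astM !astK !mulrA.
rewrite tau_ast_l// -/(Fm x) -[X in Pm X]mulrA -/(Fm _) ES mulrDl !tauD.
have : 0 <= tau (Eo (Fm x * (Fm x)^#) * y) by apply: tau_pos_mul => //; exact/(ce_pos E)/pos_sq'.
rewrite -/(Fm x) mulrDl tauD; lra.
Qed.

(* The correction in [Pm (u * a^#)] comes from the diagonal blocks only. *)
Lemma Pm_a u : (forall k m, iot k = iot m -> L_proj W (iot m) (Rp (iot m) (en u k m)) = 0) ->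
  Pm (u * a^#) = Pm u * a^# - Eo u * a^#.
Proof.
move=> hu; apply: en_inj => k l; rewrite enB en_Pm !enM Pe_sum -sumrB; apply: eq_bigr => m _.
have hl : letter_in (iot m) (en a^# m l) by exact: ha_star.
rewrite (letter_Pe_r _ _ hl) en_Pm en_Ed; case: eqVneq => km; last by rewrite mul0r.
by rewrite (letter_Eb_LR' hl) ?subr0// hu.
Qed.

(** Because of this, [test_identity] may replace Em M - Eo M by Em M. *)
Lemma Eo_FF y : Eo (Fm (Fm y)^#) = 0.
Proof.
rewrite /Fm Ed_Pm; apply: en_inj => k l; rewrite en_Ed en0 enM Eb_sum; case: eqVneq => // kl.
rewrite big1// => m _; apply: (letter_Eb_LR (ha_star m k)).
by rewrite en_ast en_Pm Rp_star kl L_Pe star0 linear0.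
Qed.

Section Product.
Variable b : A.
Hypothesis hb : Pm b = b.
Let z := a * b.
Let M := b * b^#.
Let rho := Em M.

Lemma L_b k l : L_proj W (iot k) (en b k l) = 0.
Proof. by rewrite -hb en_Pm L_Pe. Qed.

Lemma M_LR k m : iot k = iot m -> L_proj W (iot m) (Rp (iot m) (en M k m)) = 0.
Proof.
move=> km; rewrite enM Rp_sum linear_sum big1// => n _; apply: L_Rp0; first by rewrite -km L_b.
by rewrite en_ast Rp_star L_b star0.
Qed.

Lemma M_sa : M^# = M. Proof. by rewrite /M astM astK. Qed.

Lemma Pm_off : Pm ((rho - Eo M) * a^#) = (rho - Eo M) * a^#.
Proof.
have D0 k m : iot k = iot m -> en (rho - Eo M) k m = 0.
  by move=> km; rewrite enB en_Em en_Ed km eqxx subrr.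
rewrite Pm_a; last by move=> k m km; rewrite D0// Rp0 linear0.
have -> : Eo (rho - Eo M) = 0.
  by apply: en_inj => k m; rewrite en_Ed en0; case: eqVneq => // km; rewrite D0// Eb0.
by rewrite mul0r subr0 PmB !Pm_Ed.
Qed.

(** Cotlar's identity for [b], whose defect vanishes since Pm b = b, writes M = Pm M + Ps M - Pm (Ps
    M). Multiply by [a] and a^#; [Pm_a] moves [Pm] across a^#, and its corrections combine into rho
    - Eo M. *)
Lemma product_identity :
  z * z^# = a * rho * a^# + S (b * z^#) + (S (b * z^#))^# - S (Ps M * a^#) - S ((rho - Eo M) * a^#).
Proof.
have E1 : Pm (b * z^#) = Pm M * a^# - Eo M * a^#.
  by rewrite -Pm_a; [rewrite /z astM mulrA|exact: M_LR].
have E2 : Pm (Ps M * a^#) = Pm (Ps M) * a^# - Eo M * a^#.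
  rewrite Pm_a; last by move=> k m _; rewrite en_Ps Rp_Qe linear0.
  by congr (_ - _ * _); rewrite /Ps (ce_ast (condexp_Ed iot)) Ed_Pm (ce_ast (condexp_Ed iot)) astK.
have E3 := Pm_off.
have EM : M = Pm M + Ps M - Pm (Ps M).
  have L0 : Lm b = 0 by rewrite /Lm hb subrr.
  have := cotlar_mx b b; rewrite L0 hb mul0r (ce0 (condexp_Ed iot)) addr0 -/M => {1}->.
  by [].
have SE : (Pm M)^# = Ps M by rewrite /Ps M_sa.
have SE' : (Eo M)^# = Eo M by rewrite -(ce_ast (condexp_Ed iot)) M_sa.
rewrite E1 E2 E3 astM astB !astM astK SE SE'.
have -> : z * (b^# * a^#) = a * M * a^# by rewrite /z /M !mulrA.
rewrite {1}EM; ncring.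
Qed.

End Product.
End Letters.

End Matrix.

Lemma amgm_sq (R : realType) (t x y : R) : 0 <= x -> 0 <= y -> t ^+ 2 <= x * y -> 2 * t <= x + y.
Proof.
move=> x0 y0 h; rewrite leNgt; apply/negP => k.
have : 0 <= (x - y) ^+ 2 by exact: sqr_ge0.
have : (x + y) ^+ 2 < (2 * t) ^+ 2 by rewrite ltrXn2r ?nnegrE ?addr_ge0//; lra.
nra.
Qed.

(** * The estimate for products of letters *)

Section Setting.
Variables (R : realType) (A : tralg R).
Implicit Types (x y u v h : A).

Lemma scale2 x : 2 *: x = x + x.
Proof. by rewrite scaler_nat mulr2n. Qed.

Lemma parallelogram_ring x y :
  2 *: (x * x) + 2 *: (y * y) - (x - y) * (x - y) = (x + y) * (x + y).
Proof.
have K : x * x + x * x + (y * y + y * y) - (x - y) * (x - y) = (x + y) * (x + y).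
  by ncring.
by rewrite !scale2 K.
Qed.

(* Model: matrices over the word algebra. [E] takes the expectation of the
   entries, [Eo] moreover discards the entries [(k, l)] with [i_k <> i_l]; [P]
   removes from the k-th row the words starting in [A_(i_k)]; the entries of
   the k-th column of [a] are letters of [A_(i_k)]. *)
Record letters (E Eo P : A -> A) (a : A) : Prop := Letters {
  le_E : condexp E;
  le_Eo : condexp Eo;
  le_EEo : forall x, E (Eo x) = Eo x;
  le_EP : forall x, E (P x) = E x;
  le_EoP : forall x, Eo (P x) = Eo x;
  le_PK : forall x, P (P x) = P x;
  le_PB : forall x y, P (x - y) = P x - P y;
  le_PC : forall x y, tau (y * P x) = tau ((P y^#)^# * x);
  le_E_orth : forall x y, E ((P x)^# * y) = E ((P x)^# * P y);
  le_Eo_orth : forall x y, Eo ((P x)^# * y) = Eo ((P x)^# * P y);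
  le_PP : forall x, pos (2 *: E (x * x^#) + 2 *: Eo (x * x^#) - E (P x * (P x)^#));
  le_cotlar : cotlar P Eo;
  le_cotlarF : cotlar (fun x => P (a^# * x)) (fun=> 0);
  le_gram : Eo (a^# * a) = E (a^# * a);
  le_gram1 : pos (1 - E (a^# * a));
  le_FS : forall x, P (a^# * (a * P x)) = E (a^# * a) * P x;
  le_FF : forall y, Eo (P (a^# * (P (a^# * y))^#)) = 0;
  le_off : forall b, P b = b ->
    P ((E (b * b^#) - Eo (b * b^#)) * a^#) = (E (b * b^#) - Eo (b * b^#)) * a^#;
  le_prod : forall b, P b = b -> a * b * (a * b)^# =
    a * E (b * b^#) * a^# + a * P (b * (a * b)^#) + (a * P (b * (a * b)^#))^#
    - a * P ((P (b * b^#))^# * a^#) - a * P ((E (b * b^#) - Eo (b * b^#)) * a^#) }.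

Variables (Em Eo P : A -> A) (a : A).
Hypothesis hl : letters Em Eo P a.
Let Ee : condexp Em := le_E hl.
Let Eoe : condexp Eo := le_Eo hl.
Local Notation F y := (P (a^# * y)).
Local Notation S y := (a * P y).
Local Notation g := (Em (a^# * a)).

Section Product.
Variable b : A.
Hypothesis hb : P b = b.
Local Notation z := (a * b).
Local Notation M := (b * b^#).

(** Under the trace each [S] becomes its adjoint [F] acting on the test element. *)
Lemma test_identity y : y^# = y ->
  tau (z * z^# * y) = tau (a * Em M * a^# * y) + 2 * tau (b * z^# * (F y)^#)
    - tau (b * b^# * F (F y)^#) - tau (b * b^# * Em (F (F y)^#)).
Proof.
move=> yE.
have T x : tau (S x * y) = tau (x * (F y)^#).
  by rewrite tauC mulrA (le_PC hl) tauC astM yE.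
have := le_prod hl hb.
have : tau ((Em M - Eo M) * a^# * (F y)^#) = tau (b * b^# * Em (F (F y)^#)).
  rewrite -mulrA mulrBl tauB -(ce_tau_l Ee _ (ce_id Ee M)) -(ce_tau_l Eoe _ (ce_id Eoe M)).
  rewrite -[X in tau (_ * X) - _](le_EP hl) -[X in _ - tau (_ * X)](le_EoP hl).
  rewrite (le_FF hl) mulr0 tau0 subr0.
  by rewrite tauC (ce_tau_l Ee _ (ce_id Ee _)) tauC.
move: (Em M - Eo M) => o Ho ->; rewrite !mulrDl !mulNr !(tauD, tauN).
rewrite tau_ast_l// !T Ho.
have -> : tau ((P M)^# * a^# * (F y)^#) = tau (b * b^# * F (F y)^#).
  by rewrite (le_PC hl) astM astK -mulrA.
by ring.
Qed.

(** [F] is applied once or twice to the test element only, hence in L_q' with q' >= 2. One estimate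
    [bd] of the difference gives both inequalities. *)
Lemma main_base (q q' f : R) : 1 < q -> q <= 2 -> 2 <= q' -> q^-1 + q'^-1 = 1 -> 0 <= f ->
  (forall x, nm q' (F x) <= f * nm q' x) ->
  nm (2 * q) z ^+ 2 <= Np q (a * Em M * a^#) + 2 * f * (nm (2 * q) b * nm (2 * q) z)
      + 2 * f ^+ 2 * nm (2 * q) b ^+ 2 /\
  Np q (a * Em M * a^#) <= nm (2 * q) z ^+ 2 + 2 * f * (nm (2 * q) b * nm (2 * q) z)
      + 2 * f ^+ 2 * nm (2 * q) b ^+ 2.
Proof.
move=> q1 q2 q2' qq f0 hf.
have q0 := lt_trans ltr01 q1; have q0' : 0 < q' by lra.
set B := nm (2 * q) b; set Z := nm (2 * q) z.
have B0 : 0 <= B by exact: nm_ge0. have Z0 : 0 <= Z by exact: nm_ge0.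
have q20 : 0 <= 2 * q by rewrite mulr_ge0// ltW.
have Rp_ : pos (a * Em M * a^#) by apply/pos_conj'/(ce_pos Ee)/pos_sq'.
set r := Np q _; have r0 : 0 <= r by exact: Np_ge0.
have ZE : Z ^+ 2 = Np q (z * z^#) by exact/nm_sq'/ltW.
have K0 : 0 <= 2 * f * (B * Z) + 2 * f ^+ 2 * B ^+ 2.
  have := mulr_ge0 f0 (mulr_ge0 B0 Z0).
  by have := mulr_ge0 (exprn_ge0 2 f0) (exprn_ge0 2 B0); lra.
have bd (y : A) (yp : pos y) : `|tau (z * z^# * y) - tau (a * Em M * a^# * y)| <=
   (2 * f * (B * Z) + 2 * f ^+ 2 * B ^+ 2) * Np q' y.
  have [yE _] := yp; rewrite (test_identity yE) -(nm_pos (ltW q0') yp).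
  set Y := nm q' y; have Y0 : 0 <= Y by exact: nm_ge0.
  have n1 : nm q' (F y)^# <= f * Y by rewrite (nm_ast _ (ltW q0')); exact: hf.
  have n2 : nm q' (F (F y)^#) <= f ^+ 2 * Y.
    by apply: le_trans (hf _) _; rewrite expr2 -mulrA ler_wpM2l.
  have n3 : nm q' (Em (F (F y)^#)) <= f ^+ 2 * Y.
    exact: le_trans (nm_ce Ee _ q2') n2.
  have t1 (s : R) : s = 1 \/ s = -1 -> s * tau (b * z^# * (F y)^#) <= B * Z * (f * Y).
    move=> hs; have := tau_nm3 (s *: b) z^# (F y)^# q0 q0' qq.
    rewrite -!scalerAl tauZ nmZ ?mulr_gt0// (nm_ast _ q20) -/B -/Z => h.
    have s1 : `|s| = 1 by case: hs => ->; rewrite ?normrN1 ?normr1.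
    by apply: (le_trans h); rewrite s1 mul1r ler_wpM2l// mulr_ge0.
  have t2 (s : R) w : s = 1 \/ s = -1 -> nm q' w <= f ^+ 2 * Y ->
      s * tau (b * b^# * w) <= B * B * (f ^+ 2 * Y).
    move=> hs hw; have := tau_nm3 (s *: b) b^# w q0 q0' qq.
    rewrite -!scalerAl tauZ nmZ ?mulr_gt0// (nm_ast _ q20) -/B => h.
    have s1 : `|s| = 1 by case: hs => ->; rewrite ?normrN1 ?normr1.
    by apply: (le_trans h); rewrite s1 mul1r ler_wpM2l// mulr_ge0.
  have o1 : (1 : R) = 1 \/ (1 : R) = -1 by left.
  have o2 : (-1 : R) = 1 \/ (-1 : R) = -1 by right.
  have := t1 _ o1; have := t1 _ o2; have := t2 _ _ o1 n2; have := t2 _ _ o2 n2.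
  have := t2 _ _ o1 n3; have := t2 _ _ o2 n3.
  rewrite !mul1r !mulN1r ler_norml.
  set X1 := tau (b * z^# * _); set X2 := tau (b * b^# * F _); set X3 := tau (b * b^# * Em _).
  move=> *; apply/andP; split; lra.
split.
  rewrite ZE -addrA; apply: (dual_pos (pos_sq' z) q0 q0' qq); first by rewrite addr_ge0.
  move=> y yp; have := bd _ yp; rewrite ler_norml => /andP[_ h].
  have := tau_Np2 Rp_ yp q0 q0' qq; rewrite -/r mulrDl => h'; lra.
rewrite -addrA; apply: (dual_pos Rp_ q0 q0' qq); first by rewrite addr_ge0// exprn_ge0.
move=> y yp; have := bd _ yp; rewrite ler_norml => /andP[h _].
have := tau_Np2 (pos_sq' z) yp q0 q0' qq; rewrite -ZE [in X in _ -> X]mulrDl => h'; lra.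
Qed.

(** [theta_bound] for T(u, v) = tau (u a E'(b v b^#) a^#). Its marginal at v = 1 is given by a E'(b
    b^#) a^#; the one at u = 1 is dominated by b^# b since E(a^# a) <= 1. *)
Lemma theta_pinch E' (q : R) k : 2 < q -> condexp E' -> E' (a^# * a) = g ->
  pos k -> Np (q / 2) (a * E' (b * k * b^#) * a^#) <=
    Np q k * (Np q (a * E' M * a^#) + Np q (b^# * b)).
Proof.
move=> q2 hE gE kp.
have q0 : 0 < q by lra. have p2 : 0 < q - 2 by lra.
have X0 v : pos v -> pos (a * E' (b * v * b^#) * a^#).
  by move=> vp; apply/pos_conj'/(ce_pos hE)/pos_conj'.
pose T0 u v := tau (u * (a * E' (b * v * b^#) * a^#)).
have s0 : 0 < q / (q - 2) by exact: divr_gt0.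
have qs : (q / 2)^-1 + (q / (q - 2))^-1 = 1 by field; rewrite !gt_eqF.
apply: (dual_pos (X0 _ kp) _ s0 qs); first by rewrite divr_gt0.
  by rewrite mulr_ge0 ?addr_ge0 ?Np_ge0.
move=> r rp; rewrite tauC -/(T0 _ _) mulrC mulrA.
apply: (@theta_bound _ A T0) => //.
- by move=> c u u' v; rewrite /T0 mulrDl -scalerAl tauP.
- move=> c u v v'; rewrite /T0 mulrDr mulrDl -scalerAr -scalerAl (ceP hE).
  by rewrite mulrDr mulrDl -scalerAr -scalerAl mulrDr -scalerAr tauP.
- by move=> u v up vp; apply: tau_pos_mul => //; exact: X0.
- exact/pos_conj'/(ce_pos hE)/pos_sq'.
- exact: pos_sq.
- by move=> u _; rewrite /T0 mulr1 tauC.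
move=> v vp; rewrite /T0 mul1r tauC mulrA tauC -(ce_tau_l hE); last exact: (ce_id hE).
rewrite gE; set Y := E' _.
have Yp : pos Y by apply/(ce_pos hE)/pos_conj'.
have : 0 <= tau (Y * (1 - g)) by apply: tau_pos_mul => //; exact: le_gram1 hl.
rewrite mulrBr mulr1 tauB subr_ge0 => /le_trans; apply.
by rewrite (ce_tau hE) tauC mulrA.
Qed.

(* Here [E (a^# a) <= 1], so that [b^# b] replaces the column term. *)
Definition mainP (q c : R) : Prop :=
  Np q (z * z^#) <= c * (Np q (a * Em M * a^#) + Np q (b^# * b)) /\
  Np q (a * Em M * a^#) <= c * (Np q (z * z^#) + Np q (b^# * b)).

End Product.

Section Step.
Variables (q u p : R).
Hypotheses (q2 : 2 < q) (u0 : 0 <= u) (p0 : 0 <= p).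
Hypothesis IH : forall b, P b = b -> mainP b (q / 2) u.
Hypothesis hp : forall x, nm q (P x) <= p * nm q x.

Let q0 : 0 < q. Proof. by have := q2; lra. Qed.
Let qh : 0 <= q / 2. Proof. by rewrite divr_ge0// ltW. Qed.
Let qh1 : 1 <= q / 2. Proof. by have := q2; lra. Qed.
Let qE : 2 * (q / 2) = q. Proof. by field. Qed.

Lemma nm_sqh x : nm q x ^+ 2 = Np (q / 2) (x^# * x).
Proof. by rewrite -{1}qE nm_sq. Qed.
Lemma nm_sqh' x : nm q x ^+ 2 = Np (q / 2) (x * x^#).
Proof. by rewrite -{1}qE nm_sq'. Qed.

(** S x = a (P x), so the estimate at q / 2 applies with [P x] in place of [b]. *)
Lemma S_bound1 x : nm q (S x) ^+ 2 <= u * (Np (q / 2) (a * Em (P x * (P x)^#) * a^#) + nm q (P x) ^+ 2).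
Proof.
have [h _] := IH (le_PK hl x).
by rewrite (nm_sqh' (S x)) (nm_sqh (P x)); exact: h.
Qed.

Lemma Np_conj_le x y : pos x -> pos (y - x) -> Np (q / 2) (a * x * a^#) <= Np (q / 2) (a * y * a^#).
Proof.
move=> xp yx; apply: Np_le => //; first exact: pos_conj'.
by rewrite -mulrBl -mulrBr; exact: pos_conj'.
Qed.

Lemma Np_conj_le2 x y1 y2 : pos x -> pos y1 -> pos y2 -> pos (2 *: y1 + 2 *: y2 - x) ->
  Np (q / 2) (a * x * a^#) <= 2 * Np (q / 2) (a * y1 * a^#) + 2 * Np (q / 2) (a * y2 * a^#).
Proof.
move=> xp y1p y2p h; apply: le_trans (Np_conj_le xp h) _.
have c1 := pos_conj' a y1p; have c2 := pos_conj' a y2p.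
have qh0 : 0 < q / 2 by have := q2; lra.
rewrite mulrDr mulrDl -!scalerAr -!scalerAl.
by apply: le_trans (NpD _ _ _) _; rewrite ?NpZ//; apply: posZ.
Qed.

Lemma S_bound2 x : nm q (S x) ^+ 2 <= u * (2 * Np (q / 2) (a * Em (x * x^#) * a^#)
  + 2 * Np (q / 2) (a * Eo (x * x^#) * a^#) + p ^+ 2 * nm q x ^+ 2).
Proof.
apply: le_trans (S_bound1 x) _; apply: (ler_wpM2l u0); apply: lerD.
  by apply: Np_conj_le2 (le_PP hl x); [apply: (ce_pos Ee)|apply: (ce_pos Ee)|apply: (ce_pos Eoe)]; exact: pos_sq'.
by rewrite -exprMn lerXn2r ?nnegrE ?nm_ge0 ?mulr_ge0 ?nm_ge0.
Qed.

Variable b : A.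
Hypothesis hb : P b = b.
Local Notation z := (a * b).
Local Notation M := (b * b^#).
Let rho := Em M.
Let off := rho - Eo M.
Let r := Np q (a * rho * a^#).
Let rd := Np q (a * Eo M * a^#).
Let kap := Np q (b^# * b).
Let ze := Np q (z * z^#).

Let r0 : 0 <= r. Proof. exact: Np_ge0. Qed.
Let k0 : 0 <= kap. Proof. exact: Np_ge0. Qed.
Let z0 : 0 <= ze. Proof. exact: Np_ge0. Qed.

Let gE1 : Em (a^# * a) = g. Proof. by []. Qed.
Let gE2 : Eo (a^# * a) = g. Proof. exact: le_gram hl. Qed.

Let th k : pos k -> Np (q / 2) (a * Em (b * k * b^#) * a^#) <= Np q k * (r + kap).
Proof. by move=> kp; apply: theta_pinch. Qed.

Let thd k : pos k -> Np (q / 2) (a * Eo (b * k * b^#) * a^#) <= Np q k * (rd + kap).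
Proof. by move=> kp; apply: theta_pinch. Qed.

Let M2 : M * M = b * (b^# * b) * b^#. Proof. by rewrite !mulrA. Qed.
Let Msa : M^# = M. Proof. by rewrite astM astK. Qed.
Let rsa : rho^# = rho. Proof. by rewrite -(ce_ast Ee) Msa. Qed.
Let dsa : (Eo M)^# = Eo M. Proof. by rewrite -(ce_ast Eoe) Msa. Qed.
Let osa : off^# = off. Proof. by rewrite astB rsa dsa. Qed.

(** off^2 <= 2 rho^2 + 2 (Eo M)^2; Schwarz for [Em] and [Eo] leads to M^2 = b (b^# b) b^#, the form
    required by [theta_pinch]. *)
Lemma off_sq : Np (q / 2) (a * (off * off) * a^#) <= 2 * (kap * (r + kap)) + 2 * (kap * (rd + kap)).
Proof.
have bp := pos_sq b.
have S1 := ce_schwarz Ee M; have S2 := ce_schwarz Eoe M.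
rewrite -/rho rsa Msa in S1; rewrite dsa Msa in S2.
have P1 : pos (rho * rho) by rewrite -{1}rsa; exact: pos_sq.
have P2 : pos (Eo M * Eo M) by rewrite -{1}dsa; exact: pos_sq.
apply: le_trans (@Np_conj_le2 _ (rho * rho) (Eo M * Eo M) _ P1 P2 _) _.
- by rewrite -{1}osa; exact: pos_sq.
- have -> : 2 *: (rho * rho) + 2 *: (Eo M * Eo M) - off * off = (rho + Eo M)^# * (rho + Eo M).
    by rewrite astD rsa dsa parallelogram_ring.
  exact: pos_sq.
apply: lerD; rewrite ler_wpM2l//.
  by apply: le_trans (Np_conj_le P1 S1) _; rewrite M2; exact: th.
by apply: le_trans (Np_conj_le P2 S2) _; rewrite M2; exact: thd.
Qed.

Let t := nm q (S (off * a^#)).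

Lemma off_fixed : P (off * a^#) = off * a^#.
Proof. exact: (le_off hl hb). Qed.

Lemma t_bound : t ^+ 2 <= u * (2 * (2 * (kap * (r + kap)) + 2 * (kap * (rd + kap)))).
Proof.
apply: le_trans (S_bound1 _) _; apply: (ler_wpM2l u0); rewrite off_fixed.
set K := 2 * (kap * (r + kap)) + 2 * (kap * (rd + kap)); have -> : 2 * K = K + K by ring.
have P0 : pos (off * off) by rewrite -{1}osa; exact: pos_sq.
apply: lerD; last first.
  by rewrite nm_sqh astM astK osa !mulrA -[a * off * off]mulrA; exact: off_sq.
apply: le_trans off_sq; apply: Np_conj_le; first exact/(ce_pos Ee)/pos_sq'.
have oE : Em off = off by rewrite /off (ceB Ee) (ce_id Ee) (le_EEo hl).
have -> : Em (off * a^# * (off * a^#)^#) = off * g * off.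
  by rewrite astM astK osa -mulrA (ce_l Ee)// mulrA (ce_r Ee)// mulrA.
have -> : off * off - off * g * off = off^# * (1 - g) * off by rewrite osa; ncring.
exact/pos_conj/(le_gram1 hl).
Qed.

Lemma rd_le : rd <= r + t.
Proof.
have q2' := ltW q2.
rewrite /rd /r -!(nm_pos (ltW q0)); try by apply: pos_conj'; apply: ce_pos => //; exact: pos_sq'.
have -> : a * Eo M * a^# = a * rho * a^# - S (off * a^#) by rewrite off_fixed /off; ncring.
exact: nmB.
Qed.

(** [t_bound] involves [rd], which is itself at most r + t. The resulting quadratic inequality in
    [t] is solved by completing the square. *)
Lemma t_bound2 : t ^+ 2 <= 16 * u * (1 + u) * (kap * (r + kap)).
Proof.
have := t_bound; have := rd_le; have t0 : 0 <= t by exact: nm_ge0.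
move=> h1 h2.
have h3 : kap * rd <= kap * (r + t) by rewrite ler_wpM2l.
have h4 : u * (kap * rd) <= u * (kap * (r + t)) by rewrite ler_wpM2l.
have := sqr_ge0 (t - 4 * (u * kap)).
have := mulr_ge0 (mulr_ge0 u0 u0) (mulr_ge0 k0 r0).
rewrite !expr2 in h2 *; nra.
Qed.

Lemma rd_le2 : rd <= (4 * u + 3) * (r + kap).
Proof.
apply: le_trans rd_le _.
have t0 : 0 <= t by exact: nm_ge0.
have s0 : 0 <= r + kap by exact: addr_ge0.
suff : t <= (4 * u + 2) * (r + kap) by have := k0; move=> *; lra.
rewrite -(@ler_pXn2r _ 2) ?nnegrE ?mulr_ge0 ?addr_ge0 ?mulr_ge0//.
apply: le_trans t_bound2 _.
have : kap * (r + kap) <= (r + kap) * (r + kap) by rewrite ler_wpM2r// lerDr.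
move=> h; rewrite exprMn [X in _ <= _ * X]expr2.
apply: (@le_trans _ _ (16 * u * (1 + u) * ((r + kap) * (r + kap)))).
  by rewrite ler_wpM2l// mulr_ge0 ?addr_ge0// mulr_ge0.
by rewrite ler_wpM2r ?mulr_ge0//; lra.
Qed.

Let C1 := u * (2 + 2 * (4 * u + 4) + p ^+ 2).
Let C10 : 0 <= C1.
Proof. by apply: mulr_ge0 => //; have := sqr_ge0 p; have := u0; lra. Qed.

Let rdk : rd + kap <= (4 * u + 4) * (r + kap).
Proof. by have := rd_le2; have := r0; lra. Qed.

(** Applied to x = b z^# with k = z^# z, and to x = M with k = b^# b. *)
Lemma S_theta x k : pos k -> x * x^# = b * k * b^# -> nm q x ^+ 2 <= Np q k * (r + kap) ->
  nm q (S x) ^+ 2 <= C1 * (Np q k * (r + kap)).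
Proof.
move=> kp xE xn; apply: le_trans (S_bound2 _) _; rewrite xE /C1 -[leRHS]mulrA; apply: (ler_wpM2l u0).
have := th kp; have := thd kp; have := ler_wpM2l (Np_ge0 q k) rdk.
have := ler_wpM2l (sqr_ge0 p) xn.
set X := Np q k * _; set Y := _ * (rd + kap); rewrite [X in _ -> X <= _ -> _]/= => h1 h2 h3 h4.
have e : Np q k * ((4 * u + 4) * (r + kap)) = (4 * u + 4) * X by rewrite /X; ring.
rewrite e in h2; lra.
Qed.

Let bb : nm (2 * q) b ^+ 2 = kap. Proof. by rewrite (nm_sq b (ltW q0)). Qed.
Let zz : nm (2 * q) z ^+ 2 = ze. Proof. by rewrite (nm_sq' z (ltW q0)). Qed.
Let zz' : Np q (z^# * z) = ze. Proof. by rewrite -zz (nm_sq z (ltW q0)). Qed.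

Lemma T1_bound : nm q (S (b * z^#)) ^+ 2 <= C1 * (ze * (r + kap)).
Proof.
rewrite -zz'; apply: S_theta; first exact: pos_sq.
  by rewrite (astM b) astK !mulrA.
have q20 : 0 <= 2 * q by rewrite mulr_ge0// ltW.
have h := nmM b z^# (ltW q2); rewrite (nm_ast z q20) in h.
apply: (@le_trans _ _ (kap * ze)).
  by rewrite -bb -zz -exprMn lerXn2r ?nnegrE ?nm_ge0 ?mulr_ge0 ?nm_ge0.
by rewrite zz' mulrC ler_wpM2l// lerDr.
Qed.

Lemma SM_bound : nm q (S M) ^+ 2 <= C1 * (kap * (r + kap)).
Proof.
apply: S_theta; [exact: pos_sq|by rewrite Msa M2|].
have q20 : 0 <= 2 * q by rewrite mulr_ge0// ltW.
have h := nmM b b^# (ltW q2); rewrite (nm_ast b q20) in h.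
apply: (@le_trans _ _ (kap * kap)).
  by rewrite -bb -exprMn lerXn2r ?nnegrE ?nm_ge0 ?mulr_ge0 ?nm_ge0.
by rewrite ler_wpM2l// lerDr.
Qed.

(** The difference is a sum of two positive terms: the square of M - P M, and what is lost when
    E(a^# a), which appears through [le_FS], is replaced by 1. *)
Lemma E_PsM E' : condexp E' ->
  (forall x y, E' ((P x)^# * y) = E' ((P x)^# * P y)) ->
  pos (E' (M * M) - E' ((P M)^# * a^# * ((P M)^# * a^#)^#)).
Proof.
move=> hE orth.
have PM : pos (E' (M^# * M) - E' ((P M)^# * P M)).
  have h1 : E' (M^# * P M) = E' ((P M)^# * P M).
    by rewrite -[LHS]astK -(ce_ast hE) astM astK orth -(ce_ast hE) astM astK.
  have -> : E' (M^# * M) - E' ((P M)^# * P M) = E' ((M - P M)^# * (M - P M)).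
    by rewrite astB mulrBl !mulrBr !(ceB hE) h1 (orth M M) subrr subr0.
  exact/(ce_pos hE)/pos_sq.
have -> : E' ((P M)^# * a^# * ((P M)^# * a^#)^#) = E' ((P M)^# * g * P M).
  by rewrite -[(P M)^# * g * _]mulrA -(le_FS hl) -orth astM !astK !mulrA.
rewrite -{1}Msa.
have -> : E' (M^# * M) - E' ((P M)^# * g * P M) =
   (E' (M^# * M) - E' ((P M)^# * P M)) + E' ((P M)^# * (1 - g) * P M).
  by rewrite mulrBr mulrBl mulr1 (ceB hE) addrA subrK.
apply: posD PM _.
exact/(ce_pos hE)/pos_conj/(le_gram1 hl).
Qed.

Let C2 := u * (2 + 2 * (4 * u + 4) + p ^+ 2 * C1).
Let C20 : 0 <= C2.
Proof. by apply: mulr_ge0 => //; have := mulr_ge0 (sqr_ge0 p) C10; have := u0; lra. Qed.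

Lemma T2_bound : nm q (S ((P M)^# * a^#)) ^+ 2 <= C2 * (kap * (r + kap)).
Proof.
apply: le_trans (S_bound2 _) _; rewrite /C2 -[leRHS]mulrA; apply: (ler_wpM2l u0).
set x := (P M)^# * a^#.
have n1 : nm q x ^+ 2 <= C1 * (kap * (r + kap)).
  apply: le_trans SM_bound; rewrite -(nm_ast x (ltW q0)) /x astM astK.
  by rewrite !astK.
have n2 : Np (q / 2) (a * Em (x * x^#) * a^#) <= kap * (r + kap).
  apply: le_trans (Np_conj_le _ (E_PsM Ee (le_E_orth hl))) _; first exact/(ce_pos Ee)/pos_sq'.
  by rewrite M2; apply: th; exact: pos_sq.
have n3 : Np (q / 2) (a * Eo (x * x^#) * a^#) <= kap * (rd + kap).
  apply: le_trans (Np_conj_le _ (E_PsM Eoe (le_Eo_orth hl))) _; first exact/(ce_pos Eoe)/pos_sq'.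
  by rewrite M2; apply: thd; exact: pos_sq.
have := ler_wpM2l k0 rdk; have := ler_wpM2l (sqr_ge0 p) n1.
set X := kap * (r + kap) in n1 n2 *.
have e : kap * ((4 * u + 4) * (r + kap)) = (4 * u + 4) * X by rewrite /X; ring.
by rewrite e; lra.
Qed.

Let C3 := 16 * u * (1 + u).
Let C30 : 0 <= C3. Proof. by rewrite !mulr_ge0// addr_ge0. Qed.

Lemma main_step : mainP b q (2 + 8 * C1 + 8 * C2 + 8 * C3 + 4).
Proof.
set T1 := nm q (S (b * z^#)); set T2 := nm q (S ((P M)^# * a^#)).
have a1 := T1_bound; have a2 := T2_bound; have a3 := t_bound2.
rewrite -/T1 in a1; rewrite -/T2 in a2; rewrite -/C3 in a3.
have s0 : 0 <= r + kap by exact: addr_ge0.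
have Zp := pos_sq' z; have Rp_ : pos (a * rho * a^#) by apply/pos_conj'/(ce_pos Ee)/pos_sq'.
have ID := le_prod hl hb; rewrite -/rho -/off in ID.
have q2' := ltW q2; have q0' := ltW q0.
have i1 : ze <= r + 2 * T1 + T2 + t.
  rewrite /ze /r -!(nm_pos q0')// ID.
  apply: le_trans (nmB _ _ q2') _; apply: lerD => //.
  apply: le_trans (nmB _ _ q2') _; apply: lerD => //.
  apply: le_trans (nmD _ _ q2') _; rewrite (nm_ast _ q0') -/T1.
  by rewrite mulrDl mul1r addrA lerD2r; exact: nmD.
have i2 : r <= ze + 2 * T1 + T2 + t.
  rewrite /ze /r -!(nm_pos q0')//.
  have -> : a * rho * a^# = z * z^# - (S (b * z^#) + (S (b * z^#))^#) + S ((P M)^# * a^#) + S (off * a^#).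
    by rewrite ID; ncring.
  apply: le_trans (nmD _ _ q2') _; apply: lerD => //.
  apply: le_trans (nmD _ _ q2') _; apply: lerD => //.
  apply: le_trans (nmB _ _ q2') _; apply: lerD => //.
  by apply: le_trans (nmD _ _ q2') _; rewrite (nm_ast _ q0') -/T1 mulrDl mul1r.
have ks : kap <= r + kap by rewrite lerDr.
have M0 (C X : R) : 0 <= C -> 0 <= X -> 0 <= C * X by move=> *; exact: mulr_ge0.
(* T1 is split twice. Here [ze] gets a coefficient below 1 and can be absorbed when bounding [ze];
   in [b1'] it is r + kap, for the bound of [r]. *)
have b1 : 2 * T1 <= ze / 2 + 2 * C1 * (r + kap).
  apply: amgm_sq; [by have := z0; lra|by have := mulr_ge0 C10 s0; lra|].
  by apply: (le_trans a1); rewrite le_eqVlt; apply/orP; left; apply/eqP; field.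
have b1' : 2 * T1 <= 4 * C1 * ze + (r + kap) / 4.
  apply: amgm_sq; [by have := mulr_ge0 C10 z0; lra|by have := s0; lra|].
  by apply: (le_trans a1); rewrite le_eqVlt; apply/orP; left; apply/eqP; field.
have b2 : 2 * T2 <= 4 * C2 * kap + (r + kap) / 4.
  apply: amgm_sq; [by have := mulr_ge0 C20 k0; lra|by have := s0; lra|].
  by apply: (le_trans a2); rewrite le_eqVlt; apply/orP; left; apply/eqP; field.
have b3 : 2 * t <= 4 * C3 * kap + (r + kap) / 4.
  apply: amgm_sq; [by have := mulr_ge0 C30 k0; lra|by have := s0; lra|].
  by apply: (le_trans a3); rewrite le_eqVlt; apply/orP; left; apply/eqP; field.
have := r0; have := k0; have := z0.
have m1 := M0 _ _ C10 r0; have m2 := M0 _ _ C10 k0; have m3 := M0 _ _ C10 z0.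
have m4 := M0 _ _ C20 r0; have m5 := M0 _ _ C20 k0; have m6 := M0 _ _ C20 z0.
have m7 := M0 _ _ C30 r0; have m8 := M0 _ _ C30 k0; have m9 := M0 _ _ C30 z0.
by rewrite /mainP -/rho -/r -/kap -/ze; split; lra.
Qed.

End Step.

End Setting.

(** [n] bounds the number of halvings that bring [q] into (1, 2], where duality applies. The
    constant precedes the algebra, hence the matrix size. *)
Theorem main_bound (R : realType) (q : R) : 1 < q -> exists c : R, 0 <= c /\
  forall (A : tralg R) (E Eo P : A -> A) (a : A), letters E Eo P a ->
  forall b, P b = b -> mainP E a b q c.
Proof.
move=> q1.
have [n hn] : exists n : nat, q <= 2 * 2 ^+ n.
  exists (Num.bound q); apply: (le_trans (ltW (archi_boundP _))); first by lra.
  rewrite (@le_trans _ _ (2 ^+ Num.bound q))//; last by rewrite ler_peMl ?exprn_ge0// ler1n.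
  by rewrite -natrX ler_nat ltnW// ltn_expl.
elim: n q q1 hn => [|n IH] q q1 hn.
  have q2 : q <= 2 by rewrite (le_trans hn)// expr0 mulr1.
  have [q' [q1' qq qE]] := conjP q1.
  have q2' : 2 <= q' by rewrite qE ler_pdivlMr ?subr_gt0//; lra.
  have [f [f0 hf]] := cotlar_bounded q2'.
  (* From [main_base], with 2 f B Z <= Z^2 / 2 + 2 f^2 B^2 in the first inequality and 2 f B Z <=
     Z^2 + f^2 B^2 in the second. *)
  exists (3 + 8 * f ^+ 2); split; first by rewrite addr_ge0// mulr_ge0// exprn_ge0.
  move=> A E Eo P a hl b hb.
  have [] := main_base hl hb q1 q2 q2' qq f0 (hf _ _ _ (le_cotlarF hl)).
  have q0 := ltW (lt_trans ltr01 q1).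
  rewrite /mainP -(nm_sq b q0) -(nm_sq' (a * b) q0).
  set B := nm _ b; set Z := nm _ (a * b); set r := Np _ _ => h1 h2.
  have r0 : 0 <= r by exact: Np_ge0.
  have := sqr_ge0 (Z - 2 * f * B); have := sqr_ge0 (Z - f * B).
  have := sqr_ge0 (f * B); have := sqr_ge0 (f * Z); have := mulr_ge0 (sqr_ge0 f) r0.
  have := sqr_ge0 B; have := sqr_ge0 Z.
  by split; nra.
have [q2|q2] := leP q 2; first by apply: IH => //; rewrite (le_trans q2)// ler_peMr// exprn_ege1// ler1n.
have [||u [u0 hu]] := IH (q / 2).
- lra.
- by rewrite ler_pdivrMr// -mulrA -exprSr.
have [p [p0 hp]] := cotlar_bounded (ltW q2).
eexists; split; last first.
  move=> A E Eo P a hl b hb.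
  exact: (main_step hl q2 u0 p0 (fun b' hb' => hu _ _ _ _ _ hl b' hb') (hp _ _ _ (le_cotlar hl)) hb).
have pp := sqr_ge0 p.
have c1 : 0 <= u * (2 + 2 * (4 * u + 4) + p ^+ 2) by apply: mulr_ge0 => //; lra.
have c2 := mulr_ge0 pp c1.
have c3 : 0 <= u * (2 + 2 * (4 * u + 4) + p ^+ 2 * (u * (2 + 2 * (4 * u + 4) + p ^+ 2))).
  by apply: mulr_ge0 => //; lra.
have c4 : 0 <= 16 * u * (1 + u) by apply: mulr_ge0; lra.
lra.
Qed.

(** The approximations in [normalize] are small in L_2 and bounded in operator norm; together this
    makes them small in every L_p. *)
Lemma nm_small (R : realType) (p B e : R) : 2 <= p -> 0 < B -> 0 < e -> exists2 d : R, 0 < d &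
  forall (A : tralg R) (x : A), pos (B%:A - x^# * x) -> tau (x^# * x) <= d -> nm p x <= e.
Proof.
move=> p2 B0 e0; have p0 : 0 < p by lra.
have Bp : 0 < B `^ (p / 2 - 1) by exact: powR_gt0.
exists (e `^ p / B `^ (p / 2 - 1)); first by rewrite divr_gt0// powR_gt0.
move=> A x hB ht.
have s1 : 1 <= p / 2 by rewrite ler_pdivlMr// mul1r.
have hb : bnd B (x^# * x) by split => //; exact: pos_sq.
have H := pw_small s1 hb.
have eE : e = (e `^ p) `^ p^-1 by rewrite -powRrM mulfV ?gt_eqF// powRr1 ?ltW.
rewrite nmE eE.
rewrite ge0_ler_powR ?nnegrE ?invr_ge0 ?powR_ge0 ?(ltW p0)//.
  by apply: pw_ge0; [lra|exact: pos_sq].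
apply: le_trans H _; rewrite mulrC -ler_pdivlMr//.
Qed.

(* A polynomial substitute for [t ^ (-1/2)]. *)
Lemma inv_sqrt_poly (R : realType) (c e : R) : 0 < c -> 0 < e -> exists s : {poly R},
  forall t, 0 <= t <= c -> [/\ 0 <= t * s.[t] ^+ 2, t * s.[t] ^+ 2 <= 1 &
    t * (1 - t * s.[t] ^+ 2) <= e].
Proof.
move=> c0 e0; pose d := e / 2; have d0 : 0 < d by rewrite divr_gt0.
pose eta := Num.min 1 (e / (4 * c)).
have h0 : 0 < eta by rewrite lt_min ltr01 divr_gt0// mulr_gt0.
have h1 : eta <= 1 by rewrite ge_min lexx.
have h2 : eta * (4 * c) <= e by rewrite -ler_pdivlMr ?mulr_gt0// ge_min lexx orbT.
(* phi(t) = (t + d)^(-1/2), written through [cutoff], whose continuity is known. *)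
pose phi (t : R) := (d^-1 * cutoff d t) `^ 2^-1.
have up : uf phi.
  apply: (@uf_comp _ (fun t => t `^ 2^-1)); first by apply: uf_powR; rewrite invr_ge0.
    by apply: ufM; [exact: uf_const|exact: uf_cutoff].
  by move=> t _; have /andP[? _] := cutoff_itv t d0; rewrite mulr_ge0// invr_ge0 ltW.
have phi2 t : 0 <= t -> phi t ^+ 2 = (t + d)^-1.
  move=> t0; rewrite /phi -powR_mulrn ?powR_ge0// -powRrM mulVf ?pnatr_eq0//.
  have td : 0 < t + d by rewrite ltr_wpDl.
  rewrite /cutoff t0 powRr1; last by apply: mulr_ge0; [rewrite invr_ge0|apply: divr_ge0]; exact: ltW.
  by field; rewrite !gt_eqF.
have phi0 t : 0 <= phi t by exact: powR_ge0.
(* The minimum of [phi] on [0, c]: an additive error eta * m keeps [s] between (1 - eta) phi and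
   phi. *)
pose m := phi c; have m0 : 0 < m.
  by rewrite lt_neqAle phi0 andbT eq_sym -sqrf_eq0 phi2 ?(ltW c0)// invr_eq0 gt_eqF// addr_gt0.
have phim t : 0 <= t <= c -> m <= phi t.
  move=> /andP[t0 tc]; rewrite -(@ler_pXn2r _ 2) ?nnegrE ?phi0// !phi2 ?(ltW c0)//.
  have td : 0 < t + d by rewrite ltr_wpDl.
  by rewrite lef_pV2 ?posrE ?lerD2r// (lt_le_trans td)// lerD2r.
have uf1 : uf (fun t => (1 - eta) * phi t) by apply: ufM; [exact: uf_const|].
have [s hs] := approx_above c0 (uf1 c) (mulr_gt0 h0 m0).
exists s => t ht; have /andP[t0 tc] := ht; have /andP[s1 s2] := hs t ht.
have td : 0 < t + d by rewrite ltr_wpDl.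
have s0 : 0 <= s.[t] by apply: le_trans s1; rewrite mulr_ge0// subr_ge0.
have s3 : s.[t] <= phi t.
  apply: (le_trans s2); have := ler_wpM2l (ltW h0) (phim t ht); lra.
have q1 : t * s.[t] ^+ 2 <= t / (t + d).
  by rewrite ler_wpM2l// -phi2// lerXn2r ?nnegrE ?phi0.
have q2 : (1 - eta) ^+ 2 * (t / (t + d)) <= t * s.[t] ^+ 2.
  rewrite mulrCA ler_wpM2l// -phi2// -exprMn lerXn2r ?nnegrE ?mulr_ge0 ?phi0 ?subr_ge0//.
have q3 : t / (t + d) <= 1 by rewrite ler_pdivrMr// mul1r lerDl ltW.
have q4 : 0 <= t / (t + d) by rewrite divr_ge0// ltW.
split; [by rewrite mulr_ge0 ?exprn_ge0|exact: le_trans q1 q3|].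
have q5 : t * (1 - t / (t + d)) <= d.
  have -> : t * (1 - t / (t + d)) = d * (t / (t + d)) by field; rewrite gt_eqF.
  by rewrite ler_piMr// ltW.
have q6 : (1 - 2 * eta) * (t / (t + d)) <= (1 - eta) ^+ 2 * (t / (t + d)).
  by apply: ler_wpM2r => //; have := sqr_ge0 eta; rewrite !expr2; lra.
have q7 : t * (t / (t + d)) <= c by rewrite -[c]mulr1 ler_pM.
have q8 := ler_wpM2l t0 (le_trans q6 q2).
have q9 := ler_wpM2l (ltW h0) q7.
by rewrite /d in q5 *; lra.
Qed.

(** Pointwise forms of the estimates in [normalize]; [w] is the value of t s(t)^2. *)
Lemma cut_bounds (R : realType) (c e t w : R) : 0 < c -> 0 < e -> 0 <= t <= c ->
  0 <= w -> w <= 1 -> t * (1 - w) <= e ->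
  [/\ (1 - w) * t * (1 - w) <= (1 + c) * e, c * ((1 - w) * (1 - w)) <= c,
    t * (1 - w) * (t * (1 - w)) <= (1 + c) * e /\ t * (1 - w) * (t * (1 - w)) <= c + c ^+ 2 + 1 &
    t * (1 - w) * ((1 - w) * w) <= (1 + c) * e /\ t * (1 - w) * ((1 - w) * w) <= c + c ^+ 2 + 1].
Proof.
move=> c0 e0 /andP[t0 tc] w0 w1 h.
have v0 : 0 <= 1 - w by lra. have v1 : 1 - w <= 1 by lra.
set u := t * (1 - w) in h *.
have u0 : 0 <= u by rewrite mulr_ge0.
have uc : u <= c by rewrite /u (le_trans _ tc)// ler_piMr.
have c2 : 0 <= c ^+ 2 by exact: sqr_ge0.
have ce : 0 <= c * e by rewrite mulr_ge0// ltW.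
have m0 : 0 <= (1 - w) * w by rewrite mulr_ge0.
have m1 : (1 - w) * w <= 1 by rewrite mulr_ile1.
have h1 : u * (1 - w) <= e * 1 by apply: ler_pM.
have h2 : (1 - w) * (1 - w) <= 1 by rewrite mulr_ile1.
have h3 : u * u <= c * e by apply: ler_pM.
have h4 : u * u <= c ^+ 2 by rewrite expr2; apply: ler_pM.
have h5 : u * ((1 - w) * w) <= e * 1 by apply: ler_pM.
have h6 : u * ((1 - w) * w) <= c * 1 by apply: ler_pM.
split; [by rewrite mulrC mulrA mulrAC -mulrA mulrC -/u; lra|by rewrite ler_piMr// ltW| |]; split; lra.
Qed.

(** * Reduction to the normalized case *)

Section Perturb.
Variables (R : realType) (A : tralg R).
Implicit Types (x y u v h k : A).

Lemma Np_diff q h1 h2 x1 y1 x2 y2 x3 y3 : 1 < q -> pos h1 -> pos h2 ->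
  h1 - h2 = x1 * y1 + x2 * y2 + x3 * y3 ->
  Np q h1 <= Np q h2 + (nm (2 * q) x1 * nm (2 * q) y1 + nm (2 * q) x2 * nm (2 * q) y2
     + nm (2 * q) x3 * nm (2 * q) y3).
Proof.
move=> q1 p1 p2 E; have [q' [q1' qq _]] := conjP q1.
have q0 := lt_trans ltr01 q1; have q0' := lt_trans ltr01 q1'.
apply: (dual_pos p1 q0 q0' qq).
  by rewrite !addr_ge0 ?mulr_ge0 ?nm_ge0 ?Np_ge0.
move=> r rp; set w := pev h1 r in rp *.
have -> : tau (h1 * w) = tau (h2 * w) + (tau (x1 * y1 * w) + tau (x2 * y2 * w) + tau (x3 * y3 * w)).
  by rewrite -!tauD -!mulrDl -E addrC subrK.
have := tau_nm3 x1 y1 w q0 q0' qq; have := tau_nm3 x2 y2 w q0 q0' qq.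
have := tau_nm3 x3 y3 w q0 q0' qq.
have := tau_Np2 p2 rp q0 q0' qq; rewrite -(nm_pos (ltW q0') rp).
by move=> *; rewrite [leRHS]mulrDl; rewrite [X in _ <= _ + X]mulrDl [X in _ <= _ + (X + _)]mulrDl; lra.
Qed.

End Perturb.

Section Normalize.
Variables (R : realType) (A : tralg R).
Implicit Types (x y u v h k : A).

(* As [letters], but without [E (a^# a) <= 1]; [se_scale] allows one to reach that
   normalization by multiplying [a] with a polynomial in [E (a^# a)]. *)
Record setting (E Eo P : A -> A) (a : A) : Prop := Setting {
  se_E : condexp E;
  se_Eo : condexp Eo;
  se_EEo : forall x, E (Eo x) = Eo x;
  se_gram : Eo (a^# * a) = E (a^# * a);
  se_P : forall h x, Eo h = h -> P (h * x) = h * P x;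
  se_scale : forall h, Eo h = h -> pos (1 - E ((a * h)^# * (a * h))) -> letters E Eo P (a * h) }.

Variables (E Eo P : A -> A) (a : A).
Hypothesis hs : setting E Eo P a.
Let Ee := se_E hs.
Let Eoe := se_Eo hs.
Let g := E (a^# * a).

Let gp : pos g. Proof. exact/(ce_pos Ee)/pos_sq. Qed.
Let g1 : g^# = g. Proof. by case: gp. Qed.
Let gEo : Eo g = g. Proof. by rewrite /g -(se_gram hs) (ce_id Eoe). Qed.
Let fixE x : Eo x = x -> E x = x. Proof. by move=> <-; rewrite (se_EEo hs). Qed.
Let pevEo s : Eo (pev g s) = pev g s. Proof. exact: ce_pev. Qed.
Let gE x y : Eo x = x -> Eo y = y -> E (x * (a^# * a) * y) = x * g * y.
Proof. by move=> hx hy; rewrite (ce_r Ee _ (fixE hy)) (ce_l Ee _ (fixE hx)). Qed.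

Section Approx.
Variables (b : A) (q : R).
Hypotheses (hb : P b = b) (q1 : 1 < q).
Let rho := E (b * b^#).

(** Since [g] may be singular, b' is h g b instead of h^-1 b, so that a' b' = a (1 - v) b. The last
    conclusion, that E(a'^# a') acts nearly as the identity on b', later bounds the column term
    through [F]. *)
Lemma normalize e : 0 < e -> exists a' b', [/\ letters E Eo P a', P b' = b',
  [/\ nm (2 * q) (a * b - a' * b') <= e,
     Np q (a * rho * a^#) <= Np q (a' * E (b' * b'^#) * a'^#) + e &
     Np q (a' * E (b' * b'^#) * a'^#) <= Np q (a * rho * a^#) + e],
  Np q (b'^# * b') <= Np q (b^# * g * b) /\ Np q (b^# * g * b) <= Np q (b'^# * b') + e
  & nm (2 * q) (b' - E (a'^# * a') * b') <= e].
Proof.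
move=> e0; have q0 : 0 < q by apply: lt_trans q1.
have qq1 := q1.
have rp : pos rho by apply/(ce_pos Ee)/pos_sq'.
have r1 : rho^# = rho by case: rp.
have rE : E rho = rho by exact: (ce_id Ee).
pose n4 := nm (2 * (2 * q)) b; pose n2 := nm (2 * q) b; pose nr := nm (2 * q) (a * rho).
pose nr4 := nm (2 * (2 * q)) rho.
have n40 : 0 <= n4 by exact: nm_ge0. have n20 : 0 <= n2 by exact: nm_ge0.
have nr0 : 0 <= nr by exact: nm_ge0. have nr40 : 0 <= nr4 by exact: nm_ge0.
pose K := n4 + (2 * nr + nr4) + n2 * n4.
have n24 := mulr_ge0 n20 n40.
have K0 : 0 < K + 1 by rewrite /K; lra.
pose dl := Num.min 1 (e / (K + 1)).
have dl0 : 0 < dl by rewrite lt_min ltr01 divr_gt0.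
have dl1 : dl <= 1 by rewrite ge_min lexx.
have dlK : dl * (K + 1) <= e by rewrite -ler_pdivlMr// ge_min lexx orbT.
have [c hc] := pos_bnd (pos_sq a).
have [c0 _ hca] := hc.
have gc : bnd c g.
  split=> //; have -> : c%:A - g = E (c%:A - a^# * a) by rewrite (ceB Ee) (ceZ Ee) (ce1 Ee).
  exact: (ce_pos Ee).
pose B := c + c ^+ 2 + 1.
have c20 := sqr_ge0 c; have B0 : 0 < B by rewrite /B; lra.
have p2 : 2 <= 2 * q by lra. have p4 : 2 <= 2 * (2 * q) by lra.
have [d2 d20 h2] := nm_small p2 B0 dl0.
have [d4 d40 h4] := nm_small p4 B0 dl0.
pose d := Num.min d2 d4; have d0 : 0 < d by rewrite lt_min d20.
have t1 := pos_tau (@pos1 _ A).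
pose ep := d / ((1 + c) * (tau (1 : A) + 1)).
have k1 : 0 < (1 + c) * (tau (1 : A) + 1) by rewrite mulr_gt0 ?ltr_wpDl//; lra.
have ep0 : 0 < ep by rewrite divr_gt0.
have [s hs'] := inv_sqrt_poly c0 ep0.
(* [h] imitates g^(-1/2) and [v] = 1 - h g h is the defect. As t (1 - w(t)) is small but 1 - w(t) is
   not near 0, [v] becomes small only next to [a] or [g]. *)
pose w := 'X * (s * s); pose v : A := pev g (1 - w); pose h := pev g s.
have wE t : w.[t] = t * s.[t] ^+ 2 by rewrite hornerM hornerX hornerM.
have wi t : 0 <= t <= c -> [/\ 0 <= w.[t], w.[t] <= 1 & t * (1 - w.[t]) <= ep].
  by move=> ht; rewrite wE; exact: hs'.
have sm x (r : {poly R}) : tau (x^# * x) = tau (pev g r) -> pos (B%:A - x^# * x) ->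
    (forall t, 0 <= t <= c -> r.[t] <= (1 + c) * ep) ->
    nm (2 * q) x <= dl /\ nm (2 * (2 * q)) x <= dl.
  move=> tx hB hr.
  have T : tau (x^# * x) <= d.
    rewrite tx; apply: (@le_trans _ _ ((1 + c) * ep * tau (1 : A))).
      rewrite -tauZ -subr_ge0 -tauB -(pevC g) -pevB; apply: pos_tau.
      apply: (pos_pev gc) => t /hr; rewrite hornerD hornerC hornerN subr_ge0//.
    have -> : d = (1 + c) * ep * (tau (1 : A) + 1) by rewrite /ep; field; rewrite !gt_eqF//; lra.
    by rewrite ler_wpM2l ?lerDl// mulr_ge0 ?(ltW ep0)//; lra.
  split; [apply: h2|apply: h4] => //; apply: (le_trans T); by rewrite ge_min lexx ?orbT.
have smp x (r : {poly R}) : x^# * x = pev g r -> 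
    (forall t, 0 <= t <= c -> r.[t] <= (1 + c) * ep /\ r.[t] <= B) ->
    nm (2 * q) x <= dl /\ nm (2 * (2 * q)) x <= dl.
  move=> xE hr; apply: (sm x r); [by rewrite xE| |by move=> t /hr[]].
  rewrite xE -(pevC g) -pevB; apply: (pos_pev gc) => t /hr[_].
  by rewrite hornerD hornerC hornerN subr_ge0.
have v1 : v^# = v by exact: pev_sa.
have h1 : h^# = h by exact: pev_sa.
have vE : v = 1 - h * g * h.
  have -> : h * g * h = g * (h * h) by have := pevCM g 'X s; rewrite pevX -/h mulrA => ->.
  by rewrite /v /w pevB pev1 !pevM pevX.
have gh : g * h = h * g by have := pevCM g 'X s; rewrite pevX.
have gv : g * v = v * g by have := pevCM g 'X (1 - w); rewrite pevX.
have hEo : Eo h = h by exact: pevEo.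
have vEo : Eo v = v by exact: pevEo.
(* Smallness in L_2 follows from tau ((a v)^# a v) = tau (v g v). The operator bound uses a^# a <=
   c, because a^# a itself is not a function of [g]. *)
have [av2 av4] : nm (2 * q) (a * v) <= dl /\ nm (2 * (2 * q)) (a * v) <= dl.
  apply: (sm _ ((1 - w) * 'X * (1 - w))).
  - rewrite -[LHS](ce_tau Ee) astM v1 !mulrA -[v * a^# * a]mulrA gE//.
    by rewrite !pevM pevX.
  - have -> : B%:A - (a * v)^# * (a * v) = v * (c%:A - a^# * a) * v + (B%:A - c *: (v * v)).
      rewrite astM v1 mulrBr mulrBl.
      have -> : v * c%:A * v = c *: (v * v) by rewrite -scalerAr mulr1 -scalerAl.
      by rewrite !mulrA [RHS]addrC addrA subrK.
    apply: posD; first by rewrite -{1}v1; exact: pos_conj.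
    rewrite -pevM -pevZ -(pevC g) -pevB; apply: (pos_pev gc) => t ht.
    have [w0 w1 w2] := wi t ht; rewrite hornerD hornerC hornerN hornerZ hornerM hornerD hornerN hornerC.
    have [_ h5 _ _] := cut_bounds c0 ep0 ht w0 w1 w2; rewrite /B; lra.
  move=> t ht; have [w0 w1 w2] := wi t ht; have /andP[t0 tc] := ht.
  rewrite !hornerM hornerX hornerD hornerN hornerC.
  by have [] := cut_bounds c0 ep0 ht w0 w1 w2.
have gv4 : nm (2 * (2 * q)) (g * v) <= dl.
  have [] // := smp (g * v) ('X * (1 - w) * ('X * (1 - w))).
    by rewrite astM v1 g1 -gv !pevM !pevX.
  move=> t ht; have [w0 w1 w2] := wi t ht; have /andP[t0 tc] := ht.
  rewrite !hornerM !hornerX hornerD hornerN hornerC.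
  by have [] := cut_bounds c0 ep0 ht w0 w1 w2.
have vh4 : nm (2 * (2 * q)) (v * h * g) <= dl.
  have [] // := smp (v * h * g) ('X * (1 - w) * ((1 - w) * w)).
    have -> : v * h * g = pev g ((1 - w) * s * 'X) by rewrite !pevM pevX.
    by rewrite pev_sa// -pevM; congr (pev g _); rewrite /w; ring.
  move=> t ht; have [w0 w1 w2] := wi t ht; have /andP[t0 tc] := ht.
  have wE2 : w.[t] = t * (s.[t] * s.[t]) by rewrite wE expr2.
  rewrite !hornerM !hornerX !hornerD !hornerN !hornerC -wE2.
  by have [] := cut_bounds c0 ep0 ht w0 w1 w2.
have hhg : h * (h * g) = 1 - v by rewrite vE subKr -[in LHS]gh mulrA.
have ghh : g * h * h = 1 - v by rewrite vE subKr gh.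
have hgEo : Eo (h * g) = h * g by exact: ce_M.
have vp : pos v.
  apply: (pos_pev gc) => t /wi[w0 w1 _]; by rewrite hornerD hornerN hornerC subr_ge0.
have b'E : (h * g * b)^# = b^# * (g * h) by rewrite !astM g1 h1.
have rho'E : E (h * g * b * (h * g * b)^#) = h * g * rho * (g * h).
  have ghEo : Eo (g * h) = g * h by exact: ce_M.
  rewrite b'E -[h * g * b * _]mulrA [b * _]mulrA -[(b * b^#) * _]/(_ * (g * h)).
  by rewrite (ce_l Ee _ (fixE hgEo)) (ce_r Ee _ (fixE ghEo)) !mulrA.
have q20 : 0 <= 2 * q by rewrite mulr_ge0// (le_trans ler01)// ltW.
have nm0 : nm (2 * q) (0 : A) = 0.
  by rewrite -(scale0r (1 : A)) nmZ ?normr0 ?mul0r//; lra.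
have dln4 : dl * n4 <= e.
  by apply: le_trans dlK; rewrite ler_wpM2l ?(ltW dl0)// /K; lra.
have Rp1 : pos (a * rho * a^#) by exact: pos_conj'.
have zE : a * b - a * h * (h * g * b) = a * v * b.
  have -> : a * h * (h * g * b) = a * (h * (h * g)) * b by rewrite !mulrA.
  by rewrite hhg; ncring.
have RE : a * rho * a^# - a * h * E (h * g * b * (h * g * b)^#) * (a * h)^# =
    a * v * (rho * a^#) + a * rho * (v * a^#) + - (a * v) * (rho * (v * a^#)).
  have -> : a * h * E (h * g * b * (h * g * b)^#) * (a * h)^# =
      a * (h * (h * g)) * rho * (g * h * h) * a^#.
    by rewrite rho'E astM h1 !mulrA.
  by rewrite hhg ghh; ncring.
have kE : b^# * g * b - (h * g * b)^# * (h * g * b) = b^# * (g * v * b).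
  have -> : (h * g * b)^# * (h * g * b) = b^# * g * (h * (h * g)) * b by rewrite b'E !mulrA.
  by rewrite hhg; ncring.
have nrb : nm (2 * q) (a * v) * nm (2 * q) (rho * a^#) + nm (2 * q) (a * rho) * nm (2 * q) (v * a^#)
   + nm (2 * q) (- (a * v)) * nm (2 * q) (rho * (v * a^#)) <= e.
  have e1 : nm (2 * q) (rho * a^#) = nr by rewrite -(nm_ast _ q20) astM astK r1.
  have e2 : nm (2 * q) (v * a^#) = nm (2 * q) (a * v) by rewrite -(nm_ast _ q20) astM astK v1.
  have e3 : nm (2 * q) (rho * (v * a^#)) <= nr4 * dl.
    apply: le_trans (nmM _ _ p2) _; apply: ler_wpM2l => //.
    by rewrite -(nm_ast _ (_ : 0 <= 2 * (2 * q))) ?astM ?astK ?v1//; lra.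
  rewrite nmN e1 e2 -/nr.
  have x0 := nm_ge0 (2 * q) (a * v).
  have := ler_wpM2r nr0 av2.
  have := ler_pM x0 (nm_ge0 _ _) av2 e3.
  have : dl * (nr4 * dl) <= dl * nr4.
    by apply: ler_wpM2l; [exact: ltW|rewrite ler_piMr].
  have : 0 <= dl * n4 by rewrite mulr_ge0// ltW.
  have : 0 <= dl * (n2 * n4) by rewrite mulr_ge0// ltW.
  move: dlK; rewrite /K mulrDr mulr1 !mulrDr [dl * (2 * nr)]mulrCA; lra.
exists (a * h), (h * g * b); split.
- apply: (se_scale hs hEo).
  have -> : (a * h)^# * (a * h) = h * (a^# * a) * h by rewrite astM h1 !mulrA.
  by rewrite gE// -vE.
- by rewrite (se_P hs)// hb.
- split.
  + by rewrite zE; apply: le_trans (nmM _ _ p2) _; apply: le_trans dln4; apply: ler_wpM2r.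
  + apply: le_trans (Np_diff q1 Rp1 _ RE) _; last by rewrite lerD2l.
    by apply/pos_conj'/(ce_pos Ee)/pos_sq'.
  apply: le_trans (Np_diff (x1 := - (a * v)) (y1 := rho * a^#) (x2 := - (a * rho)) (y2 := v * a^#)
    (x3 := a * v) (y3 := rho * (v * a^#)) q1 _ Rp1 _) _.
  + by apply/pos_conj'/(ce_pos Ee)/pos_sq'.
  + by rewrite -opprB RE; ncring.
  by rewrite lerD2l (nmN _ (a * rho)) (nmN _ (a * v)); move: nrb; rewrite (nmN _ (a * v)).
- split.
    apply: Np_le; [exact: ltW|exact: pos_sq|].
    rewrite kE mulrA [b^# * (g * v)]mulrA -[b^# * g * v]mulrA; apply: pos_conj.
    have -> : g * v = pev g ('X * (1 - w)) by rewrite pevM pevX.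
    apply: (pos_pev gc) => t ht; have [w0 w1 _] := wi t ht; have /andP[t0 _] := ht.
    rewrite hornerM hornerX hornerD hornerN hornerC; apply: mulr_ge0; first exact: t0.
    by rewrite subr_ge0.
  have kE' : b^# * g * b - (h * g * b)^# * (h * g * b) = b^# * (g * v * b) + 0 * 0 + 0 * 0.
    by rewrite kE !mul0r !addr0.
  apply: le_trans (Np_diff q1 (pos_conj b gp) (pos_sq _) kE') _.
  rewrite nm0 !mul0r !addr0 lerD2l (nm_ast _ q20) -/n2.
  apply: (@le_trans _ _ (n2 * (dl * n4))).
    by apply: ler_wpM2l => //; apply: le_trans (nmM _ _ p2) _; apply: ler_wpM2r.
  apply: le_trans dlK; rewrite mulrCA; apply: ler_wpM2l; first exact: ltW.
  by rewrite /K; lra.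
have -> : (a * h)^# * (a * h) = h * (a^# * a) * h by rewrite astM h1 !mulrA.
rewrite gE//.
have -> : h * g * b - h * g * h * (h * g * b) = v * h * g * b.
  by rewrite vE; ncring.
by apply: le_trans (nmM _ _ p2) _; apply: le_trans dln4; apply: ler_wpM2r.
Qed.

End Approx.

(** The case p = 2. The identity P(a^# a b) = g b, known for normalized letters, is transported to
    [a] by the scalar [l]. *)
Lemma trace_case b : P b = b ->
  tau (a * b * (a * b)^#) = tau (b^# * g * b) /\ tau (a * E (b * b^#) * a^#) = tau (b^# * g * b).
Proof.
move=> hb; split; last first.
  rewrite tauC mulrA tauC -(ce_tau_l Ee _ (ce_id Ee _)) -/g tauC (ce_tau_l Ee _ (fixE gEo)).
  by rewrite tauC -mulrA tauC.
have [c hc] := pos_bnd (pos_sq a); have [c0 _ hca] := hc.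
pose l := (c + 1)^-1; have l0 : 0 < l by rewrite invr_gt0; lra.
have hl : letters E Eo P (a * l%:A).
  apply: (se_scale hs); first by rewrite (ceZ Eoe) (ce1 Eoe).
  have -> : (a * l%:A)^# * (a * l%:A) = l ^+ 2 *: (a^# * a).
    by rewrite -scalerAr mulr1 sq_scale.
  have -> : 1 - E (l ^+ 2 *: (a^# * a)) = l ^+ 2 *: E (c%:A - a^# * a) + (1 - l ^+ 2 * c)%:A.
    rewrite (ceB Ee) !(ceZ Ee) (ce1 Ee) scalerBr scalerA scalerBl scale1r.
    by rewrite [RHS]addrC addrA subrK.
  apply: posD; first by apply: posZ; [exact: sqr_ge0|exact: (ce_pos Ee)].
  apply: posZ; last exact: pos1.
  have l1 : l * (c + 1) = 1 by rewrite mulVf// gt_eqF//; lra.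
  have l2 : l <= 1 by rewrite -l1 ler_peMr ?(ltW l0)//; lra.
  have l3 : l * c <= 1 by rewrite -[leRHS]l1 ler_wpM2l ?(ltW l0)//; lra.
  by rewrite expr2 -mulrA subr_ge0 mulr_ile1 ?(ltW l0) ?mulr_ge0 ?(ltW l0) ?(ltW c0).
have FS : P (a^# * (a * b)) = g * b.
  have := le_FS hl b; rewrite hb -scalerAr mulr1 astZ -!scalerAl -!scalerAr !scalerA (ceZ Ee) -scalerAl.
  have PZ r x : P (r *: x) = r *: P x by rewrite -(mulr_algl r x) -(mulr_algl r (P x)) (se_P hs)// (ceZ Eoe) (ce1 Eoe).
  rewrite PZ => /(congr1 (fun x => (l * l)^-1 *: x)); rewrite !scalerA mulVf ?scale1r//.
  by rewrite gt_eqF// mulr_gt0.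
rewrite astM tauC -mulrA.
have -> : b^# * (a^# * (a * b)) = (P b)^# * (a^# * (a * b)) by rewrite hb.
have -> : tau ((P b)^# * (a^# * (a * b))) = tau ((P b)^# * P (a^# * (a * b))).
  by rewrite (le_PC hl) astK (le_PK hl).
by rewrite FS hb mulrA.
Qed.
End Normalize.

Theorem setting_bound (R : realType) (q : R) : 1 <= q -> exists c : R, 0 <= c /\
  forall (A : tralg R) (E Eo P : A -> A) (a : A), setting E Eo P a ->
  forall b, P b = b ->
  let r := Np q (a * E (b * b^#) * a^#) in let z := Np q (a * b * (a * b)^#) in
  let k := Np q (b^# * E (a^# * a) * b) in
  [/\ z <= c * (r + k), r <= c * z & k <= c * z].
Proof.
rewrite le_eqVlt => /orP[/eqP <-|q1].
  exists 1; split => // A E Eo P a hs b hb /=.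
  have [t1 t2] := trace_case hs hb.
  have Ee := se_E hs.
  have g0 : pos (E (a^# * a)) by exact/(ce_pos Ee)/pos_sq.
  rewrite !Np1 ?t1 ?t2; [|exact: pos_conj|exact/pos_conj'/(ce_pos Ee)/pos_sq'|exact: pos_sq'].
  have t0 := pos_tau (pos_conj b g0).
  by split; lra.
have [c [c0 hc]] := main_bound q1.
have q2 : 2 <= 2 * q by lra.
have [f [f0 hf]] := cotlar_bounded q2.
have q0 : 0 <= q by lra.
pose C := 2 * c + c * (1 + f ^+ 2) + f ^+ 2.
have f2 := sqr_ge0 f; have cf := mulr_ge0 c0 f2.
have C0 : 0 <= C by rewrite /C; lra.
exists C; split => // A E Eo P a hs b hb r z k.
set Z := nm (2 * q) (a * b); have Z0 : 0 <= Z by exact: nm_ge0.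
have zE : z = Z ^+ 2 by rewrite /z -nm_sq'.
have r0 : 0 <= r by exact: Np_ge0. have k0 : 0 <= k by exact: Np_ge0.
(* Z' and K' are the norms of a' b' and b' for the normalized pair; [lim] then sends e to 0. *)
have key e : 0 < e -> e <= 1 -> exists Z' K', [/\ 0 <= Z', 0 <= K', Z <= Z' + e /\ Z' <= Z + e,
   Z' ^+ 2 <= c * (r + e + k) /\ r <= c * (Z' ^+ 2 + K' ^+ 2) + e &
   k <= K' ^+ 2 + e /\ K' <= f * Z' + e].
  move=> e0 e1; have [a' [b' [hl hb' [n1 n2 n3] [n4 n5] n6]]] := normalize hs hb q1 e0.
  have [m1 m2] := hc _ _ _ _ _ hl _ hb'.
  exists (nm (2 * q) (a' * b')), (nm (2 * q) b'); split; try exact: nm_ge0.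
  - split; [rewrite /Z -[a * b](subrKC (a' * b'))|rewrite -[a' * b'](subrKC (a * b))].
      by apply: le_trans (nmD _ _ q2) _; rewrite lerD2l.
    by apply: le_trans (nmD _ _ q2) _; rewrite lerD2l -nmN opprB.
  - rewrite (nm_sq' (a' * b') q0) (nm_sq b' q0); split.
      by apply: le_trans m1 _; apply: ler_wpM2l => //; apply: lerD.
    by apply: le_trans n2 _; rewrite lerD2r.
  split; first by rewrite (nm_sq b' q0).
  (* F(a' b') = E(a'^# a') b' is close to b', so boundedness of [F] bounds b' by the product. *)
  have Fz : nm (2 * q) (E (a'^# * a') * b') <= f * nm (2 * q) (a' * b').
    by have := hf _ _ _ (le_cotlarF hl) (a' * b'); rewrite -{1}hb' (le_FS hl) hb'.
  rewrite -[b' in X in X <= _](subrK (E (a'^# * a') * b')).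
  by apply: le_trans (nmD _ _ q2) _; rewrite addrC; apply: lerD.
have lim (u v K : R) : 0 <= K -> (forall e, 0 < e -> e <= 1 -> u <= v + K * e) -> u <= v.
  move=> K0 h; apply/ler_addgt0Pr => d d0.
  pose e := Num.min 1 (d / (K + 1)).
  have e0 : 0 < e by rewrite lt_min ltr01 divr_gt0//; lra.
  have e1 : e <= 1 by rewrite ge_min lexx.
  have e2 : e * (K + 1) <= d by rewrite -ler_pdivlMr ?ge_min ?lexx ?orbT//; lra.
  by have := h e e0 e1; lra.
have fZ := mulr_ge0 f0 Z0.
have sq2 (Z' e : R) : 0 < e -> e <= 1 -> 0 <= Z' -> Z' <= Z + e -> Z' ^+ 2 <= Z ^+ 2 + (2 * Z + 1) * e.
  move=> e0 e1 Z1 h; apply: (@le_trans _ _ ((Z + e) ^+ 2)).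
    by rewrite lerXn2r ?nnegrE// addr_ge0// ltW.
  have : e * e <= 1 * e by rewrite ler_wpM2r// ltW.
  by rewrite !expr2; lra.
have sqK (Z' K' e : R) : 0 < e -> e <= 1 -> 0 <= Z' -> 0 <= K' -> Z' <= Z + e -> K' <= f * Z' + e ->
    K' ^+ 2 <= f ^+ 2 * Z ^+ 2 + (2 * (f * Z) * (f + 1) + (f + 1) ^+ 2) * e.
  move=> e0 e1 Z1 K1 h1 h2; apply: (@le_trans _ _ ((f * Z + (f + 1) * e) ^+ 2)).
    rewrite lerXn2r ?nnegrE ?addr_ge0 ?mulr_ge0 ?addr_ge0 ?(ltW e0)//.
    by have := ler_wpM2l f0 h1; lra.
  have : (f + 1) ^+ 2 * (e * e) <= (f + 1) ^+ 2 * (1 * e).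
    by rewrite ler_wpM2l ?sqr_ge0// ler_wpM2r// ltW.
  by rewrite -exprMn; rewrite !expr2; lra.
have Z20 := sqr_ge0 Z.
have kz : k <= f ^+ 2 * Z ^+ 2.
  apply: (lim _ _ (2 * (f * Z) * (f + 1) + (f + 1) ^+ 2 + 1)).
    by rewrite !addr_ge0 ?sqr_ge0// !mulr_ge0 ?addr_ge0.
  move=> e e0 e1; have [Z' [K' [h1 h2 [h3 h4] [h5 h6] [h7 h8]]]] := key e e0 e1.
  by have := sqK _ _ _ e0 e1 h1 h2 h4 h8; lra.
have rz : r <= c * (1 + f ^+ 2) * Z ^+ 2.
  apply: (lim _ _ (c * ((2 * Z + 1) + (2 * (f * Z) * (f + 1) + (f + 1) ^+ 2)) + 1)).
    by rewrite !addr_ge0 ?mulr_ge0 ?addr_ge0 ?sqr_ge0 ?mulr_ge0 ?addr_ge0.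
  move=> e e0 e1; have [Z' [K' [h1 h2 [h3 h4] [h5 h6] [h7 h8]]]] := key e e0 e1.
  have g1 := sqK _ _ _ e0 e1 h1 h2 h4 h8; have g2 := sq2 _ _ e0 e1 h1 h4.
  apply: (le_trans h6); have := ler_wpM2l c0 (lerD g2 g1).
  set X1 := 2 * (f * Z) * (f + 1) + (f + 1) ^+ 2; set X2 := f ^+ 2 * Z ^+ 2.
  have -> : c * (1 + f ^+ 2) * Z ^+ 2 = c * (Z ^+ 2 + X2) by rewrite /X2; ring.
  by lra.
have zz : Z ^+ 2 <= 2 * c * (r + k).
  apply: (lim _ _ (2 * c + 2)); first by lra.
  move=> e e0 e1; have [Z' [K' [h1 h2 [h3 h4] [h5 h6] [h7 h8]]]] := key e e0 e1.
  have : Z ^+ 2 <= (Z' + e) ^+ 2 by rewrite lerXn2r ?nnegrE ?addr_ge0 ?(ltW e0).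
  have : e * e <= 1 * e by rewrite ler_wpM2r// ltW.
  have := sqr_ge0 (Z' - e); move: h5; rewrite !expr2; lra.
have rk : 0 <= r + k by lra.
have cz := mulr_ge0 c0 Z20; have fz := mulr_ge0 f2 Z20; have cfz := mulr_ge0 cf Z20.
have cr := mulr_ge0 c0 rk; have cfr := mulr_ge0 cf rk; have fr := mulr_ge0 f2 rk.
rewrite zE /C; split; lra.
Qed.

(** * Matrices over the word algebra satisfy the abstract assumptions *)

Section Main.
Variables (R : realType) (I : eqType) (D : amalgam R I) (W : word_algebra D) (G : gns W).
Variables (N : nat) (iot : 'I_N.+1 -> I).
Local Notation A := (mta G N).
Local Notation ix := 'I_N.+1.
Local Notation Eo := (Ed iot).
Local Notation P := (Pm iot).
Local Notation L := (L_proj W).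
Implicit Types (x y u v h : A).

Lemma Eb_L_R i (x y : W) : Rp i x = 0 -> Eb (x * L i y) = 0.
Proof.
move=> hx; rewrite -[LHS]starK -Eb_star starM -Rp_star Eb_Rp_L ?star0//.
by rewrite L_star hx star0.
Qed.

Lemma RpRp_ne i j (x : W) : i != j -> Rp i (Rp j x) = 0.
Proof. by move=> ij; rewrite /Rp starK LL eq_sym (negPf ij) star0. Qed.

(** Rows of different index consist of words with different first letters, which are orthogonal. *)
Lemma Em_Lm x : Em (Lm iot x * (Lm iot x)^#) = Eo (Lm iot x * (Lm iot x)^#).
Proof.
apply: en_inj => k l; rewrite en_Em en_Ed; case: eqVneq => // kl.
rewrite enM Eb_sum big1// => m _; rewrite en_ast !en_Lm -Rp_star.
by rewrite Eb_L_orth// RpRp_ne.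
Qed.

(** With l = x - P x, the parallelogram law gives P x (P x)^# = 2 x x^# + 2 l l^# - (x + l)(x +
    l)^#. The term in [Eo] arises because Em (l l^#) = Eo (l l^#) = Eo (x x^#) - Eo (P x (P
    x)^#). *)
Lemma Em_PP x : pos (2 *: Em (x * x^#) + 2 *: Eo (x * x^#) - Em (P x * (P x)^#)).
Proof.
have Ee := condexp_Em G N; have Eoe := condexp_Ed G iot.
have EL := Em_Lm x; have ES := Eo_split iot x x.
set l := Lm iot x in EL ES; have xE : x = P x + l by rewrite /l /Lm addrC subrK.
have -> : 2 *: Em (x * x^#) + 2 *: Eo (x * x^#) - Em (P x * (P x)^#) =
    Em ((x + l) * (x + l)^#) + 2 *: Eo (P x * (P x)^#).
  have -> : P x * (P x)^# = 2 *: (x * x^#) + 2 *: (l * l^#) - (x + l) * (x + l)^#.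
    have -> : P x = x - l by rewrite /l /Lm opprB addrC subrK.
    by rewrite astB astD !scaler_nat !mulr2n; ncring.
  rewrite (ceB Ee) (ceD Ee) !(ceZ Ee) EL.
  have -> : Eo (2 *: (x * x^#) + 2 *: (l * l^#) - (x + l) * (x + l)^#) = Eo (P x * (P x)^#).
    have -> : P x = x - l by rewrite /l /Lm opprB addrC subrK.
    by congr Eo; rewrite astB astD !scaler_nat !mulr2n; ncring.
  by rewrite ES scalerDr opprB addrCA [2 *: Em (x * x^#) + _]addrCA addrK.
apply: posD; first exact/(ce_pos Ee)/pos_sq'.
by apply: posZ => //; apply/(ce_pos Eoe)/pos_sq'.
Qed.

Lemma Ed_Ps (T : eqType) (s : ix -> T) x y : Ps iot x = x -> Ed s (x * y) = Ed s (x * P y).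
Proof.
move=> hx; apply: en_inj => k l; rewrite !en_Ed; case: ifP => // _.
rewrite !enM !Eb_sum; apply: eq_bigr => m _; rewrite en_Pm.
rewrite /Pe mulrBr EbB Eb_L_R ?subr0//.
by rewrite -hx en_Ps Rp_Qe.
Qed.

Lemma PsP x : (P x)^# = Ps iot x^#.
Proof. by rewrite /Ps astK. Qed.

Lemma PsK x : Ps iot (Ps iot x) = Ps iot x.
Proof. by rewrite /Ps astK PmK. Qed.


Lemma E_orth (T : eqType) (s : ix -> T) x y : Ed s ((P x)^# * y) = Ed s ((P x)^# * P y).
Proof. by rewrite Ed_Ps// PsP PsK. Qed.

Lemma Em_Eo x : Em (Eo x) = Eo x.
Proof.
apply: en_inj => k l; rewrite en_Em en_Ed.
by case: (iot k == iot l); rewrite ?EbK ?Eb0.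
Qed.

Lemma Pm_Eo h x : Eo h = h -> P (h * x) = h * P x.
Proof.
move=> hE; apply: en_inj => k l; rewrite en_Pm !enM Pe_sum; apply: eq_bigr => m _.
rewrite en_Pm -hE en_Ed; case: eqVneq => [->|_]; last by rewrite !mul0r /Pe linear0 subr0.
by rewrite /Pe [Eb _ * _]/(inB W _ * _) L_l mulrBr.
Qed.

Section Letters.
Variable a : A.
Hypothesis ha : forall m k, letter_in (iot k) (en a m k).

Lemma letters_mx : pos (1 - Em (a^# * a)) -> letters (@Em _ _ _ _ G N) Eo P a.
Proof.
move=> hg; split.
- exact: condexp_Em.
- exact: condexp_Ed.
- exact: Em_Eo.
- by move=> x; exact: Ed_Pm.
- by move=> x; exact: Ed_Pm.
- exact: PmK.
- exact: PmB.
- exact: PmC.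
- by move=> x y; exact: E_orth.
- by move=> x y; exact: E_orth.
- exact: Em_PP.
- exact: cotlar_Pm.
- exact: cotlar_Fm.
- exact: gramE.
- exact: hg.
- by move=> x; exact: Fm_S.
- by move=> y; exact: Eo_FF.
- by move=> b hb; exact: (Pm_off ha b).
move=> b hb; rewrite (product_identity ha hb) PsP.
have -> : (b * b^#)^# = b * b^# by rewrite astM astK.
by [].
Qed.

End Letters.

Lemma letters_scale (a h : A) : (forall m k, letter_in (iot k) (en a m k)) -> Eo h = h ->
  forall m k, letter_in (iot k) (en (a * h) m k).
Proof.
move=> ha hE m k; rewrite enM; apply: letter_sum => l; rewrite -hE en_Ed.
case: eqVneq => [<-|_]; last by rewrite mulr0; exact: letter0.
exact: letter_r.
Qed.

Lemma setting_mx (a : A) : (forall m k, letter_in (iot k) (en a m k)) -> setting (@Em _ _ _ _ G N) Eo P a.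
Proof.
move=> ha; split.
- exact: condexp_Em.
- exact: condexp_Ed.
- exact: Em_Eo.
- exact: gramE.
- exact: Pm_Eo.
by move=> h hE hg; apply: letters_mx => //; exact: letters_scale.
Qed.

End Main.

Lemma le_eps_scale (R : realType) (x y C : R) :
  (forall e, 0 < e -> e <= 1 -> x <= y + e * C) -> x <= y.
Proof.
move=> h; rewrite leNgt; apply/negP => yx.
have C0 : 0 < `|C| + 1 by rewrite ltr_wpDl.
pose e := Num.min 1 ((x - y) / 2 / (`|C| + 1)).
have e0 : 0 < e by rewrite lt_min ltr01 !divr_gt0// subr_gt0.
have e1 : e <= 1 by rewrite ge_min lexx.
have := h e e0 e1.
have : e * C <= e * (`|C| + 1) by rewrite ler_pM2l// (le_trans (ler_norm _))// lerDl.
have : e * (`|C| + 1) <= (x - y) / 2 by rewrite -ler_pdivlMr// ge_min lexx orbT.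
lra.
Qed.

(** * Functional calculus on a Hilbert space *)

Section RealDot.
Local Open Scope complex_scope.
Variables (R : realType) (H : hilbert R).
Implicit Types (u v w : H) (r : R).

(** Real parts suffice: [is_adjoint_rd] recovers the complex identity by replacing u with i u. *)
Definition rd u v : R := complex.Re (hdot u v).

Lemma rdC u v : rd u v = rd v u.
Proof. by rewrite /rd hdotC; case: (hdot v u). Qed.

Lemma rdP r u v w : rd (r%:C *: u + v) w = r * rd u w + rd v w.
Proof.
rewrite /rd linearDl /= linearZl_LR /=; case: (hdot u w) => a b; case: (hdot v w) => c d /=.
by rewrite mul0r subr0.
Qed.

Lemma rd0 w : rd 0 w = 0.
Proof. by rewrite /rd linear0l. Qed.

Lemma rdD u v w : rd (u + v) w = rd u w + rd v w.
Proof. by have := rdP 1 u v w; rewrite scale1r mul1r. Qed.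

Lemma rdZ r u w : rd (r%:C *: u) w = r * rd u w.
Proof. by have := rdP r u 0 w; rewrite rd0 !addr0. Qed.

Lemma rdN u w : rd (- u) w = - rd u w.
Proof. by rewrite -scaleN1r -[-1]/(- (1%:C)) -rmorphN rdZ mulN1r. Qed.

Lemma rdB u v w : rd (u - v) w = rd u w - rd v w.
Proof. by rewrite rdD rdN. Qed.

Lemma rdDr u v w : rd w (u + v) = rd w u + rd w v.
Proof. by rewrite rdC rdD !(rdC w). Qed.
Lemma rdZr r u w : rd w (r%:C *: u) = r * rd w u.
Proof. by rewrite rdC rdZ rdC. Qed.
Lemma rdNr u w : rd w (- u) = - rd w u.
Proof. by rewrite rdC rdN rdC. Qed.
Lemma rdBr u v w : rd w (u - v) = rd w u - rd w v.
Proof. by rewrite rdDr rdNr. Qed.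

Lemma rd_sq u : rd u u = hnorm u ^+ 2.
Proof. by rewrite hnorm_sq. Qed.

Lemma hnorm_eq0 u : hnorm u = 0 -> u = 0.
Proof.
move=> hu; apply/eqP/negP => /negP u0; have := @neq0_dnorm_gt0 _ _ _ (@hdot R H) _ u0.
by rewrite hdot_real -hnorm_sq hu expr0n /= ltxx.
Qed.

Lemma hnorm0 : hnorm (0 : H) = 0.
Proof. by apply/eqP; rewrite -sqrf_eq0 -rd_sq rd0. Qed.

Lemma hnormZ (c : R[i]) u : hnorm (c *: u) = complex.Re `|c| * hnorm u.
Proof.
have c0 : 0 <= complex.Re `|c| by case: c => a b; rewrite normc_def /= sqrtr_ge0.
apply/eqP; rewrite -(@eqrXn2 _ 2) ?hnorm_ge0 ?mulr_ge0 ?hnorm_ge0//.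
rewrite exprMn -!rd_sq /rd linearZl_LR linearZr_LR /= hdot_real -mulrA mulrA.
rewrite -[c * _]normCK.
have -> : `|c| = (Normc.normc c)%:C by [].
by rewrite !expr2 /=; apply/eqP; ring.
Qed.

Lemma hnormZr r u : hnorm (r%:C *: u) = `|r| * hnorm u.
Proof. by rewrite hnormZ normc_def /= expr0n /= addr0 sqrtr_sqr. Qed.

Lemma hnormN u : hnorm (- u) = hnorm u.
Proof. by apply/eqP; rewrite -(@eqrXn2 _ 2) ?hnorm_ge0// -!rd_sq rdN rdNr opprK. Qed.

Lemma hnormBC u v : hnorm (u - v) = hnorm (v - u).
Proof. by rewrite -hnormN opprB. Qed.

Lemma cauchy_schwarz u v : rd u v <= hnorm u * hnorm v.
Proof.
set a := hnorm u; set b := hnorm v.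
have [a0|a0] := eqVneq a 0; first by rewrite (hnorm_eq0 a0) rd0 a0 mul0r.
have [b0|b0] := eqVneq b 0; first by rewrite (hnorm_eq0 b0) rdC rd0 b0 mulr0.
have ab : 0 < a * b by rewrite mulr_gt0// lt_neqAle eq_sym ?a0 ?b0 hnorm_ge0.
have : 0 <= rd (b%:C *: u - a%:C *: v) (b%:C *: u - a%:C *: v) by rewrite rd_sq sqr_ge0.
rewrite !(rdB, rdBr, rdZ, rdZr) (rdC v) !rd_sq -/a -/b => h.
by rewrite -(ler_pM2l ab); lra.
Qed.

Lemma hnormD u v : hnorm (u + v) <= hnorm u + hnorm v.
Proof.
rewrite -(@ler_pXn2r _ 2) ?nnegrE ?addr_ge0 ?hnorm_ge0//.
rewrite -rd_sq !(rdD, rdDr) (rdC v) !rd_sq; have := cauchy_schwarz u v; lra.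
Qed.

Lemma hnorm_dist u v w : hnorm (u - w) <= hnorm (u - v) + hnorm (v - w).
Proof. by have := hnormD (u - v) (v - w); rewrite addrA subrK. Qed.

Lemma hnormB u v : hnorm (u - v) <= hnorm u + hnorm v.
Proof. by have := hnormD u (- v); rewrite hnormN. Qed.

Lemma hnorm_le_eq0 u (C : R) : (forall e, 0 < e -> e <= 1 -> hnorm u <= e * C) -> u = 0.
Proof.
move=> h; apply: hnorm_eq0; apply/eqP; rewrite eq_le hnorm_ge0 andbT.
by apply: (le_eps_scale (C := C)) => e e0 e1; rewrite add0r h.
Qed.

Section Linear.
Variable T : H -> H.
Hypothesis hT : linear T.

Lemma lin0 : T 0 = 0.
Proof. by have := hT (-1) 0 0; rewrite scaler0 addr0 scaleN1r addNr. Qed.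
Lemma linD u v : T (u + v) = T u + T v.
Proof. by have := hT 1 u v; rewrite !scale1r. Qed.
Lemma linZ c u : T (c *: u) = c *: T u.
Proof. by have := hT c u 0; rewrite !addr0 lin0 addr0. Qed.
Lemma linN u : T (- u) = - T u.
Proof. by rewrite -scaleN1r linZ scaleN1r. Qed.
Lemma linB u v : T (u - v) = T u - T v.
Proof. by rewrite linD linN. Qed.
Lemma lin_sum J (s : seq J) (F : J -> H) : T (\sum_(i <- s) F i) = \sum_(i <- s) T (F i).
Proof. exact: (big_morph T linD lin0). Qed.

Lemma iter_linear k : linear (iter k T).
Proof. by elim: k => [//|k IH] c u v; rewrite !iterS IH hT. Qed.

Lemma op_polyE n (q : {poly R}) v : (size q <= n)%N ->
  op_poly q T v = \sum_(k < n) (q`_k)%:C *: iter k T v.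
Proof.
move=> qn; rewrite /op_poly (big_ord_widen n (fun k => (q`_k)%:C *: iter k T v) qn).
rewrite [RHS](bigID (fun k : 'I_n => (k < size q)%N)) /= [X in _ = _ + X]big1 ?addr0//.
by move=> k; rewrite -leqNgt => h; rewrite nth_default// scale0r.
Qed.

Lemma op_polyP r p q v : op_poly (r *: p + q) T v = r%:C *: op_poly p T v + op_poly q T v.
Proof.
pose n := maxn (size (r *: p + q)) (maxn (size p) (size q)).
rewrite !(@op_polyE n) ?leq_max ?leqnn ?orbT// scaler_sumr -big_split.
by apply: eq_bigr => k _; rewrite coefD coefZ rmorphD rmorphM scalerDl scalerA.
Qed.

Lemma op_polyD p q v : op_poly (p + q) T v = op_poly p T v + op_poly q T v.
Proof. by have := op_polyP 1 p q v; rewrite !scale1r. Qed.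
Lemma op_poly0 v : op_poly 0 T v = 0.
Proof. by rewrite (@op_polyE 0) ?size_poly0// big_ord0. Qed.
Lemma op_polyZ r p v : op_poly (r *: p) T v = r%:C *: op_poly p T v.
Proof. by have := op_polyP r p 0 v; rewrite op_poly0 !addr0. Qed.
Lemma op_polyB p q v : op_poly (p - q) T v = op_poly p T v - op_poly q T v.
Proof. by rewrite op_polyD -[in LHS]scaleN1r op_polyZ rmorphN scaleN1r. Qed.
Lemma op_polyC r v : op_poly r%:P T v = r%:C *: v.
Proof. by rewrite (@op_polyE 1) ?size_polyC_leq1// big_ord1 coefC. Qed.

Lemma op_polyMX p v : op_poly (p * 'X) T v = T (op_poly p T v).
Proof.
have hs : (size (p * 'X)%R <= (size p).+1)%N.
  by rewrite (leq_trans (size_polyMleq _ _))// size_polyX addn2.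
rewrite (op_polyE _ hs) (@op_polyE (size p)) ?leqnn// big_ord_recl coefMX /= scale0r add0r.
by rewrite lin_sum; apply: eq_bigr => k _; rewrite coefMX /= linZ.
Qed.

Lemma op_poly_linear p : linear (op_poly p T).
Proof.
move=> c u v; rewrite /op_poly scaler_sumr -big_split; apply: eq_bigr => k _.
by rewrite iter_linear scalerDr !scalerA mulrC.
Qed.

Lemma op_polyM p q v : op_poly (p * q) T v = op_poly p T (op_poly q T v).
Proof.
elim/poly_ind: p => [|p r IH]; first by rewrite mul0r !op_poly0.
by rewrite mulrDl mulrAC op_polyD op_polyMX IH mul_polyC op_polyZ op_polyD op_polyMX op_polyC.
Qed.

Lemma op_polyX v : op_poly 'X T v = T v.
Proof. by rewrite -['X]mul1r op_polyMX op_polyC scale1r. Qed.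

Lemma op_poly_comm (U : H -> H) p v : linear U -> (forall w, U (T w) = T (U w)) ->
  U (op_poly p T v) = op_poly p T (U v).
Proof.
move=> hU UT; rewrite /op_poly (big_morph U (id1 := 0) (op1 := +%R)).
- apply: eq_bigr => k _; have := hU (p`_k)%:C (iter k T v) 0.
  have U0 : U 0 = 0 by have := hU (-1) 0 0; rewrite scaler0 addr0 scaleN1r addNr.
  rewrite U0 !addr0 => ->; congr (_ *: _).
  by elim: (k : nat) => [//|m IH]; rewrite !iterS UT IH.
- by move=> a b; have := hU 1 a b; rewrite !scale1r.
by have := hU (-1) 0 0; rewrite scaler0 addr0 scaleN1r addNr.
Qed.

End Linear.

Section OpNorm.
Variable T : H -> H.
Hypothesis hT : bounded_op T.

Lemma op_norm_has_sup : has_sup [set r | exists2 v : H, hnorm v <= 1 & r = hnorm (T v)]%classic.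
Proof.
have [_ [M hM]] := hT; split; first by exists (hnorm (T 0)), 0 => //; rewrite hnorm0 ler01.
exists `|M| => r [v v1 ->]; apply: le_trans (hM v) _.
apply: (@le_trans _ _ (`|M| * hnorm v)); first by rewrite ler_wpM2r ?hnorm_ge0 ?ler_norm.
by rewrite ler_piMr.
Qed.

Lemma op_normP v : hnorm (T v) <= op_norm T * hnorm v.
Proof.
have [lT _] := hT; have [v0|v0] := eqVneq (hnorm v) 0.
  by rewrite (hnorm_eq0 v0) (lin0 lT) hnorm0 mulr0.
have vp : 0 < hnorm v by rewrite lt_neqAle eq_sym v0 hnorm_ge0.
rewrite -ler_pdivrMr// mulrC.
have E w : hnorm (((hnorm v)^-1)%:C *: w) = (hnorm v)^-1 * hnorm w.
  by rewrite hnormZr ger0_norm// invr_ge0 hnorm_ge0.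
rewrite -E -(linZ lT); apply: ub_le_sup; first by case: op_norm_has_sup.
by exists (((hnorm v)^-1)%:C *: v); rewrite ?E ?mulVf.
Qed.

Lemma op_norm_ge0 : 0 <= op_norm T.
Proof.
have [lT _] := hT; have -> : 0 = hnorm (T 0) by rewrite (lin0 lT) hnorm0.
by apply: ub_le_sup; [case: op_norm_has_sup | exists 0; rewrite ?hnorm0 ?ler01].
Qed.

End OpNorm.

Lemma op_norm_le (T : H -> H) c : 0 <= c -> (forall v, hnorm (T v) <= c * hnorm v) -> op_norm T <= c.
Proof.
move=> c0 h; apply: ge_sup; first by exists (hnorm (T 0)), 0 => //; rewrite hnorm0 ler01.
move=> r [v v1 ->]; apply: le_trans (h v) _; by rewrite ler_piMr.
Qed.

Lemma bounded_comp (T S : H -> H) : bounded_op T -> bounded_op S -> bounded_op (T \o S).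
Proof.
move=> hT hS; have [lT _] := hT; have [lS _] := hS; split.
  by move=> c u v; rewrite /= lS lT.
exists (op_norm T * op_norm S) => v; apply: le_trans (op_normP hT _) _.
by rewrite -mulrA ler_wpM2l ?op_norm_ge0// op_normP.
Qed.

End RealDot.

(** * Continuous functional calculus of a positive operator *)

Section Calculus.
Local Open Scope complex_scope.
Variables (R : realType) (H : hilbert R).
Implicit Types (u v w : H) (r : R) (f g : R -> R) (p q : {poly R}) (S T U : H -> H).

Definition posop T : Prop :=
  [/\ bounded_op T, forall u v, rd (T u) v = rd u (T v) & forall v, 0 <= rd (T v) v].

Section Pos.
Variable T : H -> H.
Hypothesis hT : posop T.
Let bT : bounded_op T. Proof. by case: hT. Qed.
Let lT : linear T. Proof. by case: bT. Qed.

Lemma op_poly_sym p u v : rd (op_poly p T u) v = rd u (op_poly p T v).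
Proof.
have [_ sT _] := hT.
elim/poly_ind: p u v => [|p r IH] u v; first by rewrite !op_poly0 rd0 rdC rd0.
rewrite !op_polyD// !op_polyC// !op_polyMX// rdD rdDr rdZ rdZr sT IH.
by rewrite (op_poly_comm _ _ lT).
Qed.

(** The scheme of [haus_tau], with the vector state of [v] in place of the trace. *)
Lemma haus_op v : 0 < op_norm T -> haus (op_norm T) (fun q => rd (op_poly q T v) v).
Proof.
move=> c0; set c := op_norm T in c0 *; have [_ sT pT] := hT.
split=> // [r p q|i j]; first by rewrite op_polyP// rdP.
pose k : {poly R} := c%:P - 'X.
have kp w : 0 <= rd (op_poly k T w) w.
  rewrite op_polyB// op_polyC// op_polyX// rdB rdZ rd_sq subr_ge0 expr2 mulrA.
  apply: le_trans (cauchy_schwarz _ _) _; rewrite ler_wpM2r ?hnorm_ge0//; exact: op_normP.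
have sq_conj s e : (forall w, 0 <= rd (op_poly e T w) w) -> forall w, 0 <= rd (op_poly (s * e * s) T w) w.
  by move=> h w; rewrite !op_polyM// op_poly_sym.
suff : forall w, 0 <= rd (op_poly ('X^i * k ^+ j) T w) w by [].
have -> : 'X^i * k ^+ j = ('X^(i./2) * k ^+ (j./2)) *
   ('X^(odd i) * k ^+ (odd j)) * ('X^(i./2) * k ^+ (j./2)).
  rewrite -{1}(odd_double_half i) -{1}(odd_double_half j) -!addnn !exprD; ring.
apply: (sq_conj) => w.
have Xp w' : 0 <= rd (op_poly 'X T w') w' by rewrite op_polyX.
case: (odd i); case: (odd j); rewrite ?expr1 ?expr0 ?mul1r ?mulr1//; last first.
  by rewrite op_polyC// scale1r rd_sq sqr_ge0.
have -> : 'X * k = c^-1 *: ('X * k * 'X + k * 'X * k).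
  have -> : 'X * k * 'X + k * 'X * k = c *: ('X * k) by rewrite -mul_polyC /k; ring.
  by rewrite scalerA mulVf ?gt_eqF// scale1r.
rewrite op_polyZ// op_polyD// rdZ rdD mulr_ge0 ?invr_ge0 ?(ltW c0)// addr_ge0//.
  exact: sq_conj.
exact: sq_conj.
Qed.

Lemma op_poly_ge0 q v : (forall t, 0 <= t <= op_norm T -> 0 <= q.[t]) -> 0 <= rd (op_poly q T v) v.
Proof.
move=> hq; have := op_norm_ge0 bT; rewrite le_eqVlt => /orP[/eqP c0|c0]; last first.
  exact: (haus_ge0 (haus_op v c0)).
(* A moment functional lives on an interval of positive length; for norm zero T = 0 and only the
   constant term counts. *)
have T0 w : T w = 0.
  by apply: hnorm_eq0; apply/eqP; rewrite eq_le hnorm_ge0 andbT -(mul0r (hnorm w)) c0 op_normP.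
elim/poly_ind: q hq => [|q r IH] hq; first by rewrite op_poly0 rd0.
rewrite op_polyD// op_polyMX// T0 add0r op_polyC// rdZ rd_sq mulr_ge0 ?sqr_ge0//.
have := hq 0; rewrite lexx -c0 lexx => /(_ isT).
by rewrite hornerD hornerM hornerX hornerC mulr0 add0r.
Qed.

Lemma op_poly_norm q e v : 0 <= e -> (forall t, 0 <= t <= op_norm T -> `|q.[t]| <= e) ->
  hnorm (op_poly q T v) <= e * hnorm v.
Proof.
move=> e0 hq; rewrite -(@ler_pXn2r _ 2) ?nnegrE ?mulr_ge0 ?hnorm_ge0//.
rewrite -rd_sq op_poly_sym -op_polyM// rdC exprMn -rd_sq -rdZ -subr_ge0 -rdB.
rewrite -(op_polyC T) -op_polyB//; apply: op_poly_ge0 => t ht.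
rewrite !hornerE -expr2 subr_ge0 -[q.[t] ^+ 2]real_normK ?num_real//.
by rewrite lerXn2r ?nnegrE//; exact: hq.
Qed.

(* Norm estimates are stated on vectors since [op_norm] is a junk value on
   unbounded maps. *)
Definition calc f S : Prop := forall e q, 0 <= e ->
  (forall t, 0 <= t <= op_norm T -> `|q.[t] - f t| <= e) ->
  forall v, hnorm (op_poly q T v - S v) <= e * hnorm v.

Lemma near_poly f e : ufc (op_norm T) f -> 0 < e ->
  exists q, forall t, 0 <= t <= op_norm T -> `|q.[t] - f t| <= e.
Proof.
move=> hf e0; have := op_norm_ge0 bT; rewrite le_eqVlt => /orP[/eqP c0|c0].
  exists (f 0)%:P => t; rewrite -c0 => h; have -> : t = 0 by lra.
  by rewrite hornerC subrr normr0 ltW.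
exact: weierstrass.
Qed.

Lemma calc_ext f g S : (forall t, 0 <= t <= op_norm T -> f t = g t) -> calc f S -> calc g S.
Proof. by move=> fg hS e q e0 hq; apply: hS => // t ht; rewrite fg// hq. Qed.

Lemma calc_poly q : calc (horner q) (op_poly q T).
Proof.
move=> e p e0 h v; rewrite -op_polyB//; apply: op_poly_norm => // t ht.
by rewrite hornerD hornerN h.
Qed.

Lemma calc_le f g S U e : ufc (op_norm T) f -> calc f S -> calc g U -> 0 <= e ->
  (forall t, 0 <= t <= op_norm T -> `|f t - g t| <= e) ->
  forall v, hnorm (S v - U v) <= e * hnorm v.
Proof.
move=> hf hS hU e0 fg v; apply: (le_eps_scale (C := 2 * hnorm v)) => d d0 _.
have [q hq] := near_poly hf d0.
have h1 := hS d q (ltW d0) hq v.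
have h2 : hnorm (op_poly q T v - U v) <= (e + d) * hnorm v.
  apply: hU => [|t ht]; first by rewrite addr_ge0// ltW.
  have -> : q.[t] - g t = (f t - g t) + (q.[t] - f t) by ring.
  by apply: le_trans (ler_normD _ _) _; rewrite lerD ?fg ?hq.
have := hnorm_dist (S v) (op_poly q T v) (U v); rewrite (hnormBC (S v) (op_poly q T v)); lra.
Qed.

Lemma calc_exists f : ufc (op_norm T) f -> exists S, calc f S.
Proof.
move=> hf.
have e0 n : 0 < n.+1%:R^-1 :> R by rewrite invr_gt0 ltr0Sn.
have /choice[q hq] : forall n, exists q, forall t, 0 <= t <= op_norm T -> `|q.[t] - f t| <= n.+1%:R^-1.
  by move=> n; exact: near_poly.
have D m p e v : 0 <= e -> (forall t, 0 <= t <= op_norm T -> `|p.[t] - f t| <= e) ->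
    hnorm (op_poly p T v - op_poly (q m) T v) <= (e + m.+1%:R^-1) * hnorm v.
  move=> ep hp; rewrite -op_polyB//; apply: op_poly_norm => [|t ht].
    by rewrite addr_ge0// ltW.
  have -> : (p - q m).[t] = (p.[t] - f t) - ((q m).[t] - f t) by rewrite hornerD hornerN; ring.
  by apply: le_trans (ler_normB _ _) _; rewrite lerD ?hp ?hq.
have small (d : R) : 0 < d -> exists N, forall n, (N <= n)%N -> n.+1%:R^-1 <= d.
  move=> d0; exists (Num.bound d^-1) => n hn; rewrite -[d]invrK lef_pV2 ?posrE ?ltr0Sn ?invr_gt0//.
  have := archi_boundP (ltW (etrans (invr_gt0 d) d0)) => /ltW h; apply: le_trans h _.
  by rewrite ler_nat (leq_trans hn).
have /choice[S hS] : forall v, exists l, forall e : R, 0 < e -> exists N, forall n, (N <= n)%N ->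
    hnorm (op_poly (q n) T v - l) < e.
  move=> v; apply: hilbert_complete => e ep.
  have dp : 0 < e / 2 / (2 * hnorm v + 1).
    by rewrite !divr_gt0// ltr_wpDl// mulr_ge0// hnorm_ge0.
  have [N hN] := small _ dp; exists N => m n hm hn.
  have := D n (q m) _ v (ltW (e0 m)) (hq m); rewrite -/(hnorm _) => h; apply: le_lt_trans h _.
  apply: (@le_lt_trans _ _ (e / 2 / (2 * hnorm v + 1) * (2 * hnorm v + 1))); last first.
    by rewrite divfK ?gt_eqF ?ltr_wpDl ?mulr_ge0 ?hnorm_ge0//; lra.
  have := hN _ hm; have := hN _ hn; have := hnorm_ge0 v; move: (hnorm v) dp => x dp x0 h1 h2.
  move: (e / 2 / _) (n.+1%:R^-1) (m.+1%:R^-1) dp h1 h2 => s a b s0 h1 h2.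
  have := ler_wpM2r x0 h1; have := ler_wpM2r x0 h2; lra.
exists S => e p ep hp v; apply: (le_eps_scale (C := hnorm v + 1)) => d d0 _.
have [N1 h1] := small d d0; have [N2 h2] := hS v d d0.
pose m := maxn N1 N2; have := h1 m (leq_maxl _ _); have := h2 m (leq_maxr _ _).
have := D m p e v ep hp; have := hnorm_dist (op_poly p T v) (op_poly (q m) T v) (S v).
have := hnorm_ge0 v; move: (m.+1%:R^-1) => x; nra.
Qed.

Lemma calcP f S : ufc (op_norm T) f -> calc f S -> bounded_op S.
Proof.
move=> hf hS; split; last first.
  have [q hq] := near_poly hf ltr01.
  have /(_ q) [lq [M hM]] : forall q, bounded_op (op_poly q T).
    elim/poly_ind => [|p r [lp [M hM]]].
      by split; [exact: op_poly_linear|exists 0 => v; rewrite op_poly0 hnorm0 mul0r].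
    split; first exact: op_poly_linear.
    exists (op_norm T * M + `|r|) => v; rewrite op_polyD// op_polyMX// op_polyC//.
    apply: le_trans (hnormD _ _) _; rewrite hnormZr mulrDl lerD// -mulrA.
    by apply: le_trans (op_normP bT _) _; rewrite ler_wpM2l// op_norm_ge0.
  exists (M + 1) => v; have := hS 1 q ler01 hq v; have := hM v.
  have := hnormB (op_poly q T v) (op_poly q T v - S v); rewrite opprB addrC subrK; lra.
move=> a u v; apply/eqP; rewrite -subr_eq0; apply/eqP.
apply: (hnorm_le_eq0 (C := hnorm (a *: u + v) + complex.Re `|a| * hnorm u + hnorm v)) => e e0 _.
have [q hq] := near_poly hf e0; have h w := hS e q (ltW e0) hq w.
have E : S (a *: u + v) - (a *: S u + S v) = - (op_poly q T (a *: u + v) - S (a *: u + v))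
    + a *: (op_poly q T u - S u) + (op_poly q T v - S v).
  rewrite op_poly_linear// scalerBr opprB.
  by rewrite -[RHS]addrA [X in _ = _ + X]addrACA -opprD addrA subrK.
rewrite E; apply: le_trans (hnormD _ _) _.
have := hnormD (- (op_poly q T (a *: u + v) - S (a *: u + v))) (a *: (op_poly q T u - S u)).
rewrite hnormN hnormZ.
have := h u; have := h v; have := h (a *: u + v).
have : 0 <= complex.Re `|a| by case: (a) => x y; exact: sqrtr_ge0.
move: (complex.Re `|a|) => k k0 h1 h2 h3.
have : k * hnorm (op_poly q T u - S u) <= k * (e * hnorm u) by rewrite ler_wpM2l.
lra.
Qed.

Lemma calc_comm f S U : ufc (op_norm T) f -> calc f S -> bounded_op U ->
  (forall v, U (T v) = T (U v)) -> forall v, U (S v) = S (U v).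
Proof.
move=> hf hS bU UT v; have [lU _] := bU; apply/eqP; rewrite -subr_eq0; apply/eqP.
apply: (hnorm_le_eq0 (C := op_norm U * hnorm v + hnorm (U v))) => e e0 _.
have [q hq] := near_poly hf e0; have h w := hS e q (ltW e0) hq w.
have := hnorm_dist (U (S v)) (U (op_poly q T v)) (S (U v)).
rewrite -(linB lU) (op_poly_comm _ _ lU UT).
have := op_normP bU (S v - op_poly q T v); rewrite hnormBC.
have := h (U v); have := h v; have := op_norm_ge0 bU.
move: (hnorm (U (S v - _))) => x c0 h1 h2 h3.
have : op_norm U * hnorm (op_poly q T v - S v) <= op_norm U * (e * hnorm v) by rewrite ler_wpM2l.
lra.
Qed.

End Pos.
End Calculus.

Section SquareRoot.
Local Open Scope complex_scope.
Variables (R : realType) (H : hilbert R).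
Implicit Types (u v w : H) (r : R) (f g : R -> R) (p q : {poly R}) (S T U : H -> H).

Lemma cauchy_schwarz_abs u v : `|rd u v| <= hnorm u * hnorm v.
Proof.
rewrite ler_norml cauchy_schwarz andbT lerNl -rdN.
by apply: le_trans (cauchy_schwarz _ _) _; rewrite hnormN.
Qed.

Lemma is_adjoint_rd T S : linear T -> linear S -> (forall u v, rd (S u) v = rd u (T v)) -> is_adjoint T S.
Proof.
move=> lT lS h u v; have h1 := h u v; have := h ('i *: u) v.
rewrite (linZ lS) /rd !linearZl_LR /=; move: h1; rewrite /rd.
by case: (hdot _ _) => a b; case: (hdot _ _) => c d /= ->; rewrite !mul0r !mul1r !sub0r => /oppr_inj ->.
Qed.

Lemma adjoint_uniq T S : is_adjoint T S -> adjoint T = S.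
Proof.
move=> hS; apply: xget_unique => // S' hS'; apply: funext => u; apply/eqP; rewrite -subr_eq0; apply/eqP.
by apply: hnorm_eq0; apply/eqP; rewrite -sqrf_eq0 -rd_sq rdB /rd hS hS' subrr.
Qed.

Lemma ufc_sqrt (c : R) : ufc c (@Num.sqrt R).
Proof.
apply: (@ufc_ext _ c (fun t : R => t `^ 2^-1)); last by apply: ufc_powR; rewrite invr_ge0.
by move=> x /andP[x0 _]; rewrite powR12_sqrt.
Qed.

Lemma bounded_sub T S : bounded_op T -> bounded_op S -> bounded_op (fun v => T v - S v).
Proof.
move=> hT hS; have [lT _] := hT; have [lS _] := hS; split=> [a u v|].
  by rewrite lT lS scalerBr opprD addrACA.
exists (op_norm T + op_norm S) => v; apply: le_trans (hnormB _ _) _.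
by rewrite mulrDl lerD// op_normP.
Qed.

Section Pos.
Variable T : H -> H.
Hypothesis hT : posop T.
Let bT : bounded_op T. Proof. by case: hT. Qed.
Let lT : linear T. Proof. by case: bT. Qed.
Local Notation c := (op_norm T).

Lemma calcM f g S U : ufc c f -> ufc c g -> calc T f S -> calc T g U ->
  calc T (fun t => f t * g t) (S \o U).
Proof.
move=> hf hg hS hU e q e0 hq v.
have [[Mf fM] _] := hf; have [[Mg gM] _] := hg.
apply: (le_eps_scale (C := (`|Mf| + 1 + `|Mg|) * hnorm v + (`|Mf| + 1) * hnorm v + hnorm (U v))) => d d0 d1.
have [q1 h1] := near_poly hT hf d0; have [q2 h2] := near_poly hT hg d0.
have b1 t : 0 <= t <= c -> `|q1.[t]| <= `|Mf| + 1.
  move=> ht; have -> : q1.[t] = f t + (q1.[t] - f t) by ring.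
  apply: le_trans (ler_normD _ _) _; rewrite lerD ?(le_trans (fM _ ht)) ?ler_norm//.
  exact: le_trans (h1 _ ht) d1.
have K0 : 0 <= `|Mf| + 1 by rewrite addr_ge0.
have L0 : 0 <= `|Mg| by [].
have A1 : hnorm (op_poly q T v - op_poly q1 T (op_poly q2 T v)) <= (e + d * (`|Mf| + 1 + `|Mg|)) * hnorm v.
  rewrite -op_polyM// -op_polyB//; apply: op_poly_norm => // [|t ht].
    by rewrite addr_ge0// mulr_ge0 ?addr_ge0// ltW.
  rewrite hornerD hornerN hornerM.
  have -> : q.[t] - q1.[t] * q2.[t] = (q.[t] - f t * g t) - (q1.[t] * (q2.[t] - g t) + (q1.[t] - f t) * g t) by ring.
  apply: le_trans (ler_normB _ _) _; rewrite lerD ?hq//.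
  apply: le_trans (ler_normD _ _) _; rewrite [d * _]mulrDr [d * (_ + 1)]mulrC !normrM lerD//.
    by rewrite ler_pM ?h2 ?b1.
  by rewrite ler_pM ?h1// (le_trans (gM _ ht)) ?ler_norm.
have A2 : hnorm (op_poly q1 T (op_poly q2 T v) - op_poly q1 T (U v)) <= (`|Mf| + 1) * (d * hnorm v).
  rewrite -(linB (op_poly_linear lT q1)).
  apply: le_trans (op_poly_norm hT _ K0 b1) _; rewrite ler_wpM2l//; exact: hU (ltW d0) h2 v.
have A3 : hnorm (op_poly q1 T (U v) - S (U v)) <= d * hnorm (U v) by exact: hS (ltW d0) h1 _.
have := hnorm_dist (op_poly q T v) (op_poly q1 T (op_poly q2 T v)) (S (U v)).
have := hnorm_dist (op_poly q1 T (op_poly q2 T v)) (op_poly q1 T (U v)) (S (U v)).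
move: A1 A2 A3 => /=; lra.
Qed.

Lemma calc_addC f S r : calc T f S -> calc T (fun t => f t + r) (fun v => S v + r%:C *: v).
Proof.
move=> hS e q e0 hq v; have := hS e (q - r%:P) e0 _ v.
rewrite op_polyB// op_polyC// opprD addrA addrAC; apply=> t ht.
by rewrite hornerD hornerN hornerC -addrA -opprD addrC [r + _]addrC addrC hq.
Qed.

Lemma calc_uniq f S U : ufc c f -> calc T f S -> calc T f U -> S = U.
Proof.
move=> hf hS hU; apply: funext => v; apply/eqP; rewrite -subr_eq0; apply/eqP.
apply: hnorm_eq0; apply/eqP; rewrite eq_le hnorm_ge0 andbT -(mul0r (hnorm v)).
by apply: (calc_le hT hf hS hU) => // t _; rewrite subrr normr0.
Qed.

Lemma calc_sym f S u v : ufc c f -> calc T f S -> rd (S u) v = rd u (S v).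
Proof.
move=> hf hS; apply/eqP; rewrite -subr_eq0 -normr_le0.
apply: (le_eps_scale (C := 2 * hnorm u * hnorm v)) => e e0 _; rewrite add0r.
have [q hq] := near_poly hT hf e0; have h w := hS e q (ltW e0) hq w.
have -> : rd (S u) v - rd u (S v) = rd u (op_poly q T v - S v) - rd (op_poly q T u - S u) v.
  by rewrite rdBr rdB (op_poly_sym hT); ring.
apply: le_trans (ler_normB _ _) _.
have := cauchy_schwarz_abs u (op_poly q T v - S v); have := cauchy_schwarz_abs (op_poly q T u - S u) v.
have := ler_wpM2l (hnorm_ge0 u) (h v); have := ler_wpM2r (hnorm_ge0 v) (h u).
lra.
Qed.

Lemma calc_ge0 f S v : ufc c f -> calc T f S -> (forall t, 0 <= t <= c -> 0 <= f t) -> 0 <= rd (S v) v.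
Proof.
move=> hf hS f0; apply: (le_eps_scale (C := 2 * hnorm v ^+ 2)) => e e0 _.
have [q hq] := near_poly hT hf e0; have h := hS e q (ltW e0) hq v.
have P : 0 <= rd (op_poly (q + e%:P) T v) v.
  apply: op_poly_ge0 => // t ht; rewrite hornerD hornerC; have := hq t ht; have := f0 t ht.
  rewrite ler_norml => ? /andP[? _]; lra.
move: P; rewrite op_polyD// op_polyC// rdD rdZ rd_sq.
have := cauchy_schwarz (op_poly q T v - S v) v; rewrite rdB.
have := ler_wpM2r (hnorm_ge0 v) h; lra.
Qed.

Lemma calc_posop f S : ufc c f -> calc T f S -> (forall t, 0 <= t <= c -> 0 <= f t) -> posop S.
Proof.
move=> hf hS f0; split; first exact: calcP hf hS.
  by move=> u v; exact: calc_sym hf hS.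
by move=> v; exact: calc_ge0 hf hS f0.
Qed.

Lemma op_poly_bounded q : bounded_op (op_poly q T).
Proof. apply: (calcP hT (f := horner q)); [exact: ufc_poly|exact: calc_poly]. Qed.

(** [fun_calc] is an [xget]: its value is known once [S] meets the specification and any other
    solution agrees with it. A polynomial near [f] compares the two. *)
Lemma fun_calcE (M : set (H -> H)) f S : (forall V, M V -> bounded_op V) -> ufc c f ->
  calc T f S -> M S -> fun_calc M f T = S.
Proof.
move=> Mb hf hS MS; apply: xget_unique.
  split=> // e e0; exists e => // q hq; apply: op_norm_le; first exact: ltW.
  exact: hS (ltW e0) hq.
move=> S' [/Mb bS' hS']; apply: funext => v; apply/eqP; rewrite -subr_eq0; apply/eqP.
apply: (hnorm_le_eq0 (C := 2 * hnorm v)) => e e0 _.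
have [d d0 hd] := hS' e e0.
have m0 : 0 < Num.min d e by rewrite lt_min d0.
have [q hq] := near_poly hT hf m0.
have h1 : hnorm (op_poly q T v - S v) <= e * hnorm v.
  by apply: hS => [|t ht]; [exact: ltW|apply: le_trans (hq t ht) _; rewrite ge_min lexx orbT].
have h2 : hnorm (op_poly q T v - S' v) <= e * hnorm v.
  apply: le_trans (op_normP (bounded_sub (op_poly_bounded q) bS') v) _.
  rewrite ler_wpM2r ?hnorm_ge0// hd// => t ht; apply: le_trans (hq t ht) _; by rewrite ge_min lexx.
have := hnorm_dist (S' v) (op_poly q T v) (S v); rewrite (hnormBC (S' v) (op_poly q T v)); lra.
Qed.

Section Root.
Variable S : H -> H.
Hypothesis hS : calc T Num.sqrt S.

Lemma root_posop : posop S.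
Proof. by apply: calc_posop hS _ => [|t _]; [exact: ufc_sqrt|exact: sqrtr_ge0]. Qed.

Lemma root_sq : S \o S = T.
Proof.
have h := calcM (ufc_sqrt c) (ufc_sqrt c) hS hS.
have h' : calc T (horner 'X) (S \o S).
  by apply: calc_ext h => t /andP[t0 _]; rewrite hornerX -expr2 sqr_sqrtr.
rewrite (calc_uniq (ufc_poly _ _) h' (@calc_poly _ _ _ hT 'X)).
by apply: funext => v; rewrite op_polyX.
Qed.

(** T = S S gives |T| <= |S|^2 for the operator norms, so square roots of points of [0, |T|] stay in
    [0, |S|]. *)
Lemma root_norm t : 0 <= t <= c -> 0 <= Num.sqrt t <= op_norm S.
Proof.
move=> /andP[t0 tc]; rewrite sqrtr_ge0 /=; have [bS _ _] := root_posop.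
have s0 := op_norm_ge0 bS; rewrite -(@ler_pXn2r _ 2) ?nnegrE ?sqrtr_ge0// sqr_sqrtr//.
apply: le_trans tc _; apply: op_norm_le; first exact: sqr_ge0.
move=> v; rewrite -root_sq /= expr2 -mulrA; apply: le_trans (op_normP bS _) _.
by rewrite ler_wpM2l// op_normP.
Qed.

Lemma calc_root_poly q : ufc c (fun t => q.[Num.sqrt t]) /\ calc T (fun t => q.[Num.sqrt t]) (op_poly q S).
Proof.
have [[lS _] _ _] := root_posop.
have uq p : ufc c (fun t => p.[Num.sqrt t]).
  exact: ufc_comp (ufc_poly (op_norm S) p) (ufc_sqrt c) root_norm.
split=> //; elim/poly_ind: q => [|p r IH].
  have -> : op_poly 0 S = op_poly 0 T by apply: funext => v; rewrite !op_poly0.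
  by apply: calc_ext (@calc_poly _ _ _ hT 0) => t _; rewrite !horner0.
have -> : op_poly (p * 'X + r%:P) S = (fun v => (S \o op_poly p S) v + r%:C *: v).
  by apply: funext => v; rewrite op_polyD// op_polyMX// op_polyC.
have h := calc_addC (r := r) (calcM (ufc_sqrt c) (uq p) hS IH).
apply: (calc_ext _ h) => t _.
by rewrite hornerD hornerM hornerX hornerC mulrC.
Qed.

Lemma calc_root g U : calc T (fun t => g (Num.sqrt t)) U -> calc S g U.
Proof.
move=> hU e q e0 hq v; have [uq cq] := calc_root_poly q.
by apply: (calc_le hT uq cq hU) => // t ht; rewrite hq// root_norm.
Qed.

End Root.

End Pos.

Section VN.
Variable M : set (H -> H).
Variable X : set (H -> H).
Hypothesis MX : M = commutant (commutant X).

Lemma vN_bounded V : M V -> bounded_op V. Proof. by rewrite MX => -[]. Qed.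

Lemma vN_calc T f S : posop T -> X T -> ufc (op_norm T) f -> calc T f S -> M S.
Proof.
move=> hT XT hf hS; rewrite MX; split; first exact: calcP hf hS.
move=> U [bU UX]; apply: funext => v /=; apply/esym; apply: (calc_comm hT hf hS bU) => w.
by have := congr1 (fun F => F w) (UX T XT).
Qed.

(** The root [S] is its own modulus, so the p-th power of that modulus is the power p / 2 of [T]. *)
Lemma vN_power T (p : R) : posop T -> X T -> 0 <= p -> exists U S, [/\ calc T (fun t => t `^ (p / 2)) U,
  op_sqrt M T = S, adjoint S \o S = T & fun_calc M (fun t => t `^ p) S = U].
Proof.
move=> hT XT p0.
have [S hS] := calc_exists hT (ufc_sqrt (op_norm T)).
have p20 : 0 <= p / 2 by rewrite divr_ge0.
have up : ufc (op_norm T) (fun t : R => t `^ (p / 2)) := @ufc_powR _ (op_norm T) _ p20.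
have [U hU] := calc_exists hT up.
have sp := root_posop hT hS; have [[lS _] sS _] := sp.
exists U, S; split=> //.
- apply: (fun_calcE hT vN_bounded (ufc_sqrt _) hS); exact: (vN_calc hT XT (ufc_sqrt _) hS).
- by rewrite (adjoint_uniq (is_adjoint_rd lS lS sS)) (root_sq hT hS).
have hU' : calc T (fun t => Num.sqrt t `^ p) U.
  by apply: calc_ext hU => t /andP[t0 _]; rewrite -powR12_sqrt// -powRrM mulrC.
apply: (fun_calcE sp vN_bounded); first exact: ufc_powR.
  exact: (calc_root hT hS (g := fun t => t `^ p) hU').
exact: (vN_calc hT XT up hU).
Qed.

End VN.
End SquareRoot.

(** * Norms on the GNS space as traces over matrices *)

Section GNS.
Local Open Scope complex_scope.
Variables (R : realType) (I : eqType) (D : amalgam R I) (W : word_algebra D) (G : gns W).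
Implicit Types (x y h : W) (u v : gns_space G).
Local Notation vec := (gns_vec G).
Local Notation rep := (gns_rep G).

Lemma rd_vec x y : rd (vec x) (vec y) = retr (star y * x).
Proof. by rewrite /rd gns_dot. Qed.

Lemma dense_eq0 (F : gns_space G -> R) K : (forall u v, F (u - v) = F u - F v) ->
  (forall v, `|F v| <= K * hnorm v) -> (forall x, F (vec x) = 0) -> forall v, F v = 0.
Proof.
move=> FB FK F0 v; apply/eqP; rewrite -normr_le0.
apply: (le_eps_scale (C := `|K|)) => e e0 _; have [x hx] := gns_dense v e0.
rewrite add0r -[F v]subr0 -(F0 x) -FB; apply: le_trans (FK _) _.
apply: (@le_trans _ _ (`|K| * hnorm (v - vec x))); first by rewrite ler_wpM2r ?hnorm_ge0 ?ler_norm.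
by rewrite mulrC ler_wpM2r// ltW.
Qed.

Lemma dense_op_eq (S T : gns_space G -> gns_space G) : bounded_op S -> bounded_op T ->
  (forall x, S (vec x) = T (vec x)) -> S = T.
Proof.
move=> bS bT ST; apply: funext => v; apply/eqP; rewrite -subr_eq0; apply/eqP.
have bU := bounded_sub bS bT; have [lU _] := bU.
apply: (hnorm_le_eq0 (C := op_norm (fun v => S v - T v))) => e e0 _.
have [x hx] := gns_dense v e0.
have -> : S v - T v = S (v - vec x) - T (v - vec x).
  by rewrite [RHS](linB lU) ST subrr subr0.
apply: le_trans (op_normP bU _) _; rewrite mulrC ler_wpM2r ?op_norm_ge0//; exact: ltW.
Qed.

(** It holds on the dense image of W and is extended one variable at a time. *)
Lemma rep_sym x u v : rd (rep x u) v = rd u (rep (star x) v).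
Proof.
have bx := gns_bounded G x; have [lx _] := bx.
have bs := gns_bounded G (star x); have [ls _] := bs.
have step (y : W) : forall u, rd (rep x u) (vec y) - rd u (rep (star x) (vec y)) = 0.
  apply: (dense_eq0 (K := op_norm (rep x) * hnorm (vec y) + hnorm (rep (star x) (vec y)))).
  - by move=> a b; rewrite (linB lx) !rdB; ring.
  - move=> a; apply: le_trans (ler_normB _ _) _; rewrite mulrDl lerD//.
      apply: le_trans (cauchy_schwarz_abs _ _) _; rewrite mulrAC ler_wpM2r ?hnorm_ge0// op_normP//.
    by rewrite mulrC cauchy_schwarz_abs.
  by move=> z; rewrite !gns_repE !rd_vec starM starK mulrA subrr.
apply/eqP; rewrite -subr_eq0; apply/eqP.
apply: (dense_eq0 (F := fun v => rd (rep x u) v - rd u (rep (star x) v))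
   (K := hnorm (rep x u) + hnorm u * op_norm (rep (star x)))).
- by move=> a b; rewrite (linB ls) !rdBr; ring.
- move=> a; apply: le_trans (ler_normB _ _) _; rewrite mulrDl lerD ?cauchy_schwarz_abs//.
  apply: le_trans (cauchy_schwarz_abs _ _) _; rewrite -mulrA ler_wpM2l ?hnorm_ge0// op_normP//.
by move=> y; exact: step.
Qed.

Lemma adjoint_rep x : adjoint (rep x) = rep (star x).
Proof.
have [lx _] := gns_bounded G x; have [ls _] := gns_bounded G (star x).
apply: adjoint_uniq; apply: is_adjoint_rd => // u v.
by rewrite rep_sym starK.
Qed.

Lemma adjoint_rep_comp x : adjoint (rep x) \o rep x = rep (star x * x).
Proof.
rewrite adjoint_rep; apply: dense_op_eq.
- by apply: bounded_comp; exact: gns_bounded.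
- exact: gns_bounded.
by move=> y; rewrite /= !gns_repE mulrA.
Qed.

Lemma rep_posop h : star h = h -> (forall y, 0 <= retr (star y * h * y)) -> posop (rep h).
Proof.
move=> hs hp; have bh := gns_bounded G h; have [lh _] := bh.
split=> // [u v|v]; first by rewrite rep_sym hs.
apply: (le_eps_scale (C := op_norm (rep h) * (2 * hnorm v + 1))) => e e0 e1.
have [x [a [hx hv0]]] : exists x a, hnorm a < e /\ v = vec x + a.
  by have [x hx] := gns_dense v e0; exists x, (v - vec x); split=> //; rewrite addrC subrK.
have P : 0 <= rd (rep h (vec x)) (vec x) by rewrite gns_repE rd_vec mulrA.
have S : rd (rep h a) (vec x) = rd (rep h (vec x)) a by rewrite rep_sym hs rdC.
rewrite [X in rd (rep h X) X]hv0 (linD lh) !(rdD, rdDr) S.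
have hv : hnorm (vec x) <= hnorm v + e.
  by have := hnormB v a; rewrite {1}hv0 addrK; move: hx => /ltW; lra.
have hv' : hnorm (vec x + a) = hnorm v by rewrite hv0.
have n0 := op_norm_ge0 bh.
have A1 := cauchy_schwarz_abs (rep h (vec x)) a.
have A2 := cauchy_schwarz_abs (rep h a) (vec x + a).
have B1 := op_normP bh (vec x); have B2 := op_normP bh a.
have C1 : `|rd (rep h (vec x)) a| <= op_norm (rep h) * (hnorm v + 1) * e.
  apply: le_trans A1 _; rewrite ler_pM ?hnorm_ge0// ?(ltW hx)//.
  by apply: le_trans B1 _; rewrite ler_wpM2l//; lra.
have C2 : `|rd (rep h a) (vec x + a)| <= op_norm (rep h) * e * hnorm v.
  rewrite hv' in A2 *; apply: le_trans A2 _; rewrite ler_wpM2r ?hnorm_ge0//.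
  by apply: le_trans B2 _; rewrite ler_wpM2l// ltW.
move: C1 C2; rewrite rdDr S !ler_norml => /andP[C1 _] /andP[C2 _]; lra.
Qed.

Variable N : nat.
Local Notation A := (mta G N).

(** The corner embedding is multiplicative but in general not unital, so moments agree only in
    positive degree; hence the conditions q.[0] = 0 and f 0 = 0 below. *)
Definition emb x : A := mk G (fun k l => if (k == ord0) && (l == ord0) then x else 0).

Lemma en_emb x k l : en (emb x) k l = if (k == ord0) && (l == ord0) then x else 0.
Proof. exact: en_mk. Qed.

Lemma emb_star x : (emb x)^# = emb (star x).
Proof. by apply: en_inj => k l; rewrite en_ast !en_emb andbC; case: ifP; rewrite ?star0. Qed.

Lemma embM x y : emb x * emb y = emb (x * y).
Proof.
apply: en_inj => k l; rewrite enM en_emb (bigD1 ord0)//= big1 ?addr0.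
  rewrite !en_emb /= andbT; case: (k == ord0); rewrite ?mul0r//=.
  by case: (l == ord0); rewrite ?mulr0.
by move=> m m0; rewrite en_emb (negPf m0) andbF mul0r.
Qed.

Lemma embD x y : emb (x + y) = emb x + emb y.
Proof. by apply: en_inj => k l; rewrite enD !en_emb; case: ifP => _; rewrite ?addr0. Qed.

Lemma emb0 : emb 0 = 0.
Proof. by apply: en_inj => k l; rewrite en_emb en0 if_same. Qed.

Lemma tau_emb x : tau (emb x) = retr x.
Proof.
rewrite tauE (bigD1 ord0)//= big1 ?addr0 ?en_emb// => k k0.
by rewrite en_emb (negPf k0) /retr /W_tr !linear0.
Qed.

Lemma embX x n : emb x ^+ n.+1 = emb (x ^+ n.+1).
Proof. by elim: n => [//|n IH]; rewrite exprS IH embM -exprS. Qed.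

Lemma emb_posop h : pos (emb h) -> posop (rep h).
Proof.
move=> [hs hp]; apply: rep_posop => [|y].
  have := congr1 (fun z : A => en z ord0 ord0) hs; by rewrite emb_star !en_emb.
by have := hp (emb y); rewrite emb_star !embM tau_emb.
Qed.

Lemma iter_rep h n x : iter n (rep h) (vec x) = vec (h ^+ n * x).
Proof. by elim: n => [|n IH]; rewrite ?mul1r// iterS IH gns_repE mulrA -exprS. Qed.

Lemma tr_poly h q : q.[0] = 0 -> rd (op_poly q (rep h) (vec 1)) (vec 1) = tau (1 * pev (emb h) q).
Proof.
move=> q0; have [lh _] := gns_bounded G h.
rewrite mul1r pevE tau_sum /op_poly.
rewrite (big_morph (fun v => rd v (vec 1)) (fun u v => rdD u v (vec 1)) (rd0 (vec 1))).
have q00 : q`_0 = 0 by rewrite -horner_coef0.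
apply: eq_bigr => k _; case: (nat_of_ord k) => [|j].
  by rewrite q00 !scale0r rd0 tau0.
by rewrite rdZ iter_rep rd_vec star1 mul1r mulr1 tauZ embX tau_emb.
Qed.

Lemma tr_calc h f U : pos (emb h) -> uf f -> f 0 = 0 -> calc (rep h) f U ->
  complex.Re (gns_tr U) = tex 1 (emb h) f.
Proof.
move=> hp hf f0 hU; have sp := emb_posop hp.
have [b hb] := pos_bnd hp; have [b0 _ _] := hb.
have n0 : 0 <= op_norm (rep h) by case: sp => /op_norm_ge0.
pose c := b + op_norm (rep h).
have hc : bnd c (emb h) by apply: bnd_le hb; rewrite lerDl.
have [c0 _ _] := hc.
apply/eqP; rewrite -subr_eq0 -normr_le0.
apply: (le_eps_scale (C := 2 * (hnorm (vec 1) ^+ 2 + tau (1 : A)))) => e e0 _; rewrite add0r.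
have [q1 hq1] := weierstrass c0 (hf c) e0.
(* Removing the constant term at most doubles the error, because f 0 = 0. *)
pose q := q1 - (q1.[0])%:P.
have hq t : 0 <= t <= c -> `|q.[t] - f t| <= 2 * e.
  move=> ht; rewrite hornerD hornerN hornerC.
  have -> : q1.[t] - q1.[0] - f t = (q1.[t] - f t) - (q1.[0] - f 0) by rewrite f0; ring.
  apply: le_trans (ler_normB _ _) _; rewrite mulr_natl mulr2n lerD ?hq1//.
  by rewrite lexx ltW.
have q0 : q.[0] = 0 by rewrite hornerD hornerN hornerC subrr.
have e20 : 0 <= 2 * e by rewrite mulr_ge0// ltW.
have h1 := tex_near (pos1 A) hc hf hq.
have h2 : hnorm (op_poly q (rep h) (vec 1) - U (vec 1)) <= 2 * e * hnorm (vec 1).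
  by apply: hU => // t /andP[t0 tc]; apply: hq; rewrite t0 (le_trans tc)// lerDr ltW.
have h3 := cauchy_schwarz_abs (op_poly q (rep h) (vec 1) - U (vec 1)) (vec 1).
have h4 := ler_wpM2r (hnorm_ge0 (vec 1)) h2.
rewrite rdB tr_poly// in h3; rewrite -/(rd (U (vec 1)) (vec 1)).
move: h1 h3; set X := tau _; set Y := rd _ _; set Z := tex _ _ _ => h1 h3.
have -> : Y - Z = - ((X - Y) + (Z - X)) by ring.
rewrite normrN; apply: le_trans (ler_normD _ _) _; lra.
Qed.

Section Norms.
Variable p : R.
Hypothesis p2 : 2 <= p.
Let p0 : 0 <= p. Proof. by have := p2; lra. Qed.
Let q0 : p / 2 != 0. Proof. by rewrite gt_eqF// divr_gt0//; have := p2; lra. Qed.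

(** The second equality is the form to which [W_Lp] unfolds, where the root is the modulus of an
    operator [rep x]. *)
Lemma Lp_root h : pos (emb h) ->
  Lp p (op_sqrt (@gns_vN _ _ _ _ G) (rep h)) = pw (p / 2) (emb h) `^ p^-1 /\
  (complex.Re (gns_tr (fun_calc (@gns_vN _ _ _ _ G) (fun t => t `^ p) (op_sqrt (@gns_vN _ _ _ _ G) (rep h))))) `^ p^-1
   = pw (p / 2) (emb h) `^ p^-1.
Proof.
move=> hp; have sp := emb_posop hp.
have [U [S [cU eS aS eU]]] := vN_power (M := @gns_vN _ _ _ _ G) (X := range rep) erefl sp (ex_intro2 _ _ h Logic.I (erefl (rep h))) p0.
have E : complex.Re (gns_tr U) = pw (p / 2) (emb h).
  rewrite pwE; apply: tr_calc => //; first by apply: uf_powR; rewrite divr_ge0.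
  by rewrite powR0.
split; last by rewrite eS eU E.
by rewrite /Lp eS /Lp_norm /op_abs aS eS eU E.
Qed.

Lemma W_Lp_nm x : W_Lp G p x = nm p (emb x).
Proof.
have hp : pos (emb (star x * x)) by rewrite -embM -emb_star; exact: pos_sq.
rewrite nmE emb_star embM -(Lp_root hp).2 /W_Lp /Lp /Lp_norm /op_abs adjoint_rep_comp.
by [].
Qed.

Lemma col_norm_pw n (a b : 'I_n -> W) (X : A) : pos X ->
  X = emb (\sum_(k < n) \sum_(l < n) star (b k) * inB W (W_exp W (star (a k) * a l)) * b l) ->
  col_norm G p a b = pw (p / 2) X `^ p^-1.
Proof. by move=> hp hX; rewrite /col_norm (Lp_root _).1 -?hX. Qed.

Lemma row_norm_pw n (a b : 'I_n -> W) (X : A) : pos X ->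
  X = emb (\sum_(k < n) \sum_(l < n) a k * inB W (W_exp W (b k * star (b l))) * star (a l)) ->
  row_norm G p a b = pw (p / 2) X `^ p^-1.
Proof. by move=> hp hX; rewrite /row_norm (Lp_root _).1 -?hX. Qed.

End Norms.
End GNS.

(** * Row and column norms *)

Section Families.
Variables (R : realType) (I : eqType) (D : amalgam R I) (W : word_algebra D) (G : gns W).
Implicit Types (x y h : W).

Definition row_sum n (a b : 'I_n -> W) : W := \sum_(k < n) \sum_(l < n)
  a k * inB W (W_exp W (b k * star (b l))) * star (a l).

Definition col_sum n (a b : 'I_n -> W) : W := \sum_(k < n) \sum_(l < n)
  star (b k) * inB W (W_exp W (star (a k) * a l)) * b l.

(** Testing with a matrix amounts to testing [h] with each entry of its first row. *)
Lemma pos_emb_indep N N' h : pos (emb G N h) -> pos (emb G N' h).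
Proof.
move=> [hs hp].
have hs' : star h = h.
  by have := congr1 (fun z : mta G N => en z ord0 ord0) hs; rewrite emb_star !en_emb.
split=> [|y]; first by rewrite emb_star hs'.
rewrite tauME; apply: sumr_ge0 => l _.
rewrite (bigD1 ord0)//= big1 ?addr0; last first.
  move=> k k0; rewrite enM big1; first by rewrite mul0r /retr /W_tr !linear0.
  by move=> m _; rewrite en_emb (negPf k0) andbF mulr0.
rewrite enM (bigD1 ord0)//= big1 ?addr0; last first.
  by move=> m m0; rewrite en_emb (negPf m0) mulr0.
rewrite en_ast en_emb !eqxx /=.
have := hp (emb G N (en y ord0 l)); by rewrite emb_star !embM tau_emb.
Qed.

Section Mx.
Variable N : nat.
Local Notation A := (mta G N).
Variables (a b : 'I_N.+1 -> W).

Definition row_mx1 : A := mk G (fun m k => if m == ord0 then a k else 0).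
Definition col_mx1 : A := mk G (fun k m => if m == ord0 then b k else 0).

Lemma en_row1 m k : en row_mx1 m k = if m == ord0 then a k else 0.
Proof. exact: en_mk. Qed.

Lemma en_col1 m k : en col_mx1 k m = if m == ord0 then b k else 0.
Proof. exact: en_mk. Qed.

Lemma row_mx1_col : row_mx1 * col_mx1 = emb G N (\sum_k a k * b k).
Proof.
apply: en_inj => k l; rewrite en_emb enM; case: eqVneq => /= k0.
  case: eqVneq => l0; last by rewrite big1// => m _; rewrite !(en_row1, en_col1) (negPf l0) mulr0.
  by apply: eq_bigr => m _; rewrite !(en_row1, en_col1) k0 l0 !eqxx.
by rewrite big1// => m _; rewrite !(en_row1, en_col1) (negPf k0) mul0r.
Qed.

Lemma row_mx1_E : row_mx1 * Em (col_mx1 * col_mx1^#) * row_mx1^# = emb G N (row_sum a b).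
Proof.
apply: en_inj => k l; rewrite en_emb enM.
case: (eqVneq k ord0) => k0 /=; last first.
  rewrite big1// => m _; rewrite enM big1 ?mul0r// => j _.
  by rewrite (en_row1, en_col1) (negPf k0) mul0r.
case: eqVneq => l0; last first.
  by rewrite big1// => m _; rewrite en_ast (en_row1, en_col1) (negPf l0) star0 mulr0.
rewrite /row_sum exchange_big; apply: eq_bigr => m _; rewrite en_ast enM mulr_suml.
apply: eq_bigr => j _; rewrite en_Em !(en_row1, en_col1) k0 l0 !eqxx; congr (_ * Eb _ * _).
rewrite enM (bigD1 ord0)//= big1 ?addr0 ?en_ast ?(en_row1, en_col1)// => i i0.
by rewrite (en_row1, en_col1) (negPf i0) mul0r.
Qed.

Lemma col_mx1_E : col_mx1^# * Em (row_mx1^# * row_mx1) * col_mx1 = emb G N (col_sum a b).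
Proof.
apply: en_inj => k l; rewrite en_emb enM.
case: (eqVneq k ord0) => k0 /=; last first.
  rewrite big1// => m _; rewrite enM big1 ?mul0r// => j _.
  by rewrite en_ast (en_row1, en_col1) (negPf k0) star0 mul0r.
case: eqVneq => l0; last first.
  by rewrite big1// => m _; rewrite (en_row1, en_col1) (negPf l0) mulr0.
rewrite /col_sum exchange_big; apply: eq_bigr => m _; rewrite enM mulr_suml.
apply: eq_bigr => j _; rewrite en_Em en_ast !(en_row1, en_col1) k0 l0 !eqxx; congr (_ * Eb _ * _).
rewrite enM (bigD1 ord0)//= big1 ?addr0 ?en_ast ?(en_row1, en_col1)// => i i0.
by rewrite en_ast (en_row1, en_col1) (negPf i0) star0 mul0r.
Qed.

End Mx.

Section Norms.
Variable p : R.
Hypothesis p2 : 2 <= p.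
Let p_half : p = 2 * (p / 2). Proof. by field. Qed.
Let q1 : 1 <= p / 2. Proof. by rewrite ler_pdivlMr// mul1r; exact: p2. Qed.
Let q0 : 0 <= p / 2. Proof. by have := q1; lra. Qed.
Let p0 : 0 < p. Proof. by have := p2; lra. Qed.

Lemma root_sq_Np (A : tralg R) (X : A) : (pw (p / 2) X `^ p^-1) ^+ 2 = Np (p / 2) X.
Proof.
rewrite NpE -powR_mulrn ?powR_ge0// -powRrM; congr (_ `^ _).
by rewrite [in RHS]invfM invrK mulrC.
Qed.

Lemma row_norm_sq N n (a b : 'I_n -> W) : pos (emb G N (row_sum a b)) ->
  row_norm G p a b ^+ 2 = Np (p / 2) (emb G N (row_sum a b)).
Proof. by move=> h; rewrite (row_norm_pw p2 h erefl) root_sq_Np. Qed.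

Lemma col_norm_sq N n (a b : 'I_n -> W) : pos (emb G N (col_sum a b)) ->
  col_norm G p a b ^+ 2 = Np (p / 2) (emb G N (col_sum a b)).
Proof. by move=> h; rewrite (col_norm_pw p2 h erefl) root_sq_Np. Qed.

Lemma W_Lp_sq N x : W_Lp G p x ^+ 2 = Np (p / 2) (emb G N x * (emb G N x)^#).
Proof. by rewrite (W_Lp_nm G N p2) -(nm_sq' _ q0) -p_half. Qed.

Lemma row_norm_ge0 n (a b : 'I_n -> W) : 0 <= row_norm G p a b.
Proof. exact: powR_ge0. Qed.

Lemma col_norm_ge0 n (a b : 'I_n -> W) : 0 <= col_norm G p a b.
Proof. exact: powR_ge0. Qed.

Lemma W_Lp_ge0 x : 0 <= W_Lp G p x.
Proof. exact: powR_ge0. Qed.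

Lemma W_LpD x y : W_Lp G p (x + y) <= W_Lp G p x + W_Lp G p y.
Proof. by rewrite !(W_Lp_nm G 0 p2) embD; exact: nmD. Qed.

Lemma W_LpN x : W_Lp G p (- x) = W_Lp G p x.
Proof.
rewrite !(W_Lp_nm G 0 p2) -[RHS]nmN; congr nm.
by apply: (addIr (emb G 0 x)); rewrite -embD !addNr emb0.
Qed.

Lemma W_LpB x y : W_Lp G p (x - y) <= W_Lp G p x + W_Lp G p y.
Proof. by rewrite -(W_LpN y); exact: W_LpD. Qed.

Lemma W_Lp_E x : W_Lp G p (Eb x) <= W_Lp G p x.
Proof.
rewrite !(W_Lp_nm G 0 p2).
have -> : emb G 0 (Eb x) = Em (emb G 0 x).
  by apply: en_inj => k l; rewrite en_Em !en_emb; case: ifP; rewrite ?Eb0.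
exact: (nm_ce (condexp_Em G 0)).
Qed.


Lemma row_pos n (a b : 'I_n -> W) : pos (emb G 0 (row_sum a b)).
Proof.
case: n a b => [|N] a b; first by rewrite /row_sum big_ord0 emb0; exact: pos0.
apply: (@pos_emb_indep N); rewrite -row_mx1_E; apply: pos_conj'.
exact/(ce_pos (condexp_Em G N))/pos_sq'.
Qed.

Lemma col_pos n (a b : 'I_n -> W) : pos (emb G 0 (col_sum a b)).
Proof.
case: n a b => [|N] a b; first by rewrite /col_sum big_ord0 emb0; exact: pos0.
apply: (@pos_emb_indep N); rewrite -col_mx1_E; apply: pos_conj.
exact/(ce_pos (condexp_Em G N))/pos_sq.
Qed.

End Norms.
End Families.

(** * From families of letters to the theorem *)

Section Bounds.
Variables (R : realType) (p : R).
Hypothesis p2 : 2 <= p.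
Let q1 : 1 <= p / 2. Proof. by rewrite ler_pdivlMr// mul1r; exact: p2. Qed.

Lemma family_bound : exists c : R, 0 <= c /\
  forall (I : eqType) (D : amalgam R I) (W : word_algebra D) (G : gns W)
    (n : nat) (iot : 'I_n -> I) (a b : 'I_n -> W),
    (forall k, letter_in (iot k) (a k)) -> (forall k, L_proj W (iot k) (b k) = 0) ->
    let z := W_Lp G p (\sum_k a k * b k) in
    let r := row_norm G p a b in let k := col_norm G p a b in
    [/\ z ^+ 2 <= c * (r ^+ 2 + k ^+ 2), r ^+ 2 <= c * z ^+ 2 & k ^+ 2 <= c * z ^+ 2].
Proof.
have [c [c0 hc]] := setting_bound q1; exists c; split=> // I D W G [|N] iot a b ha hb /=.
  (* Matrices have size N + 1, so the empty family is treated apart. *)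
  have Z : Np (p / 2) (emb G 0 0) = 0.
    by rewrite emb0 -(scale0r (0 : mta G 0)) NpZ ?mul0r//; [have := q1; lra|exact: pos0].
  have rE := row_norm_sq p2 (row_pos G a b); have cE := col_norm_sq p2 (col_pos G a b).
  have zE : W_Lp G p (\sum_(k < 0) a k * b k) = 0.
    rewrite big_ord0 (W_Lp_nm G 0 p2) emb0 -(scale0r (0 : mta G 0)) nmZ ?normr0 ?mul0r//.
    by have := p2; lra.
  rewrite zE; move: rE cE; rewrite /row_sum /col_sum !big_ord0 Z.
  move: (row_norm _ _ _ _) (col_norm _ _ _ _) => r k -> ->.
  by rewrite expr0n /= addr0 mulr0.
have hs : setting (@Em _ _ _ _ G N) (Ed iot) (Pm iot) (row_mx1 G a).
  apply: setting_mx => m k; rewrite en_row1; case: ifP => _; [exact: ha|exact: letter0].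
have hP : Pm iot (col_mx1 G b) = col_mx1 G b.
  apply: en_inj => k l; rewrite en_Pm en_col1; apply: Pe_id.
  by case: ifP => _; [exact: hb|rewrite linear0].
have := hc _ _ _ _ _ hs _ hP => /=.
rewrite row_mx1_E col_mx1_E row_mx1_col.
have <- := row_norm_sq p2 (pos_emb_indep N (row_pos G a b)).
have <- := col_norm_sq p2 (pos_emb_indep N (col_pos G a b)).
have <- := W_Lp_sq G p2 N (\sum_k a k * b k).
by [].
Qed.

(* The letters of [x_1] are treated as products with right factor [1]. *)
Definition fam m n (T : Type) (f : 'I_m -> T) (g : 'I_n -> T) (k : 'I_(m + n)) : T :=
  match split k with inl i => f i | inr j => g j end.

Lemma fam_l m n T (f : 'I_m -> T) (g : 'I_n -> T) i : fam f g (lshift n i) = f i.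
Proof. by rewrite /fam -[lshift _ _]/(unsplit (inl i)) unsplitK. Qed.

Lemma fam_r m n T (f : 'I_m -> T) (g : 'I_n -> T) j : fam f g (rshift m j) = g j.
Proof. by rewrite /fam -[rshift _ _]/(unsplit (inr j)) unsplitK. Qed.

(** Cross terms contain E(b_k) = 0, and E(1) = 1 leaves the square of the sum of letters. *)
Lemma row_sum_fam (I : eqType) (D : amalgam R I) (W : word_algebra D) m n
  (a b : 'I_m -> W) (a1 : 'I_n -> W) : (forall k, Eb (b k) = 0) ->
  row_sum (fam a a1) (fam b (fun=> 1)) =
  row_sum a b + (\sum_k a1 k) * star (\sum_k a1 k).
Proof.
move=> hb; have E1 : Eb (1 : W) = 1 by rewrite -(rmorph1 (inB W)) Eb_inB.
rewrite /row_sum big_split_ord; congr (_ + _).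
  apply: eq_bigr => k _; rewrite big_split_ord /= [X in _ + X]big1 ?addr0.
    by apply: eq_bigr => l _; rewrite !fam_l.
  move=> l _; rewrite !fam_l !fam_r star1 mulr1 -[inB _ _]/(Eb _) hb mulr0 mul0r//.
rewrite star_sum mulr_suml; apply: eq_bigr => k _.
rewrite big_split_ord /= [X in X + _]big1 ?add0r.
  rewrite mulr_sumr; apply: eq_bigr => l _.
  by rewrite !fam_r star1 mulr1 -[inB _ _]/(Eb _) E1 mulr1.
move=> l _; rewrite !fam_l !fam_r mul1r -[inB _ _]/(Eb _) Eb_star hb star0 mulr0 mul0r//.
Qed.

Lemma sq_le_lin (c s t : R) : 0 <= c -> 0 <= s -> 0 <= t -> s ^+ 2 <= c * t ^+ 2 -> s <= (c + 1) * t.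
Proof.
move=> c0 s0 t0 h; have K0 : 0 <= (c + 1) * t by rewrite mulr_ge0// addr_ge0.
rewrite -(@ler_pXn2r _ 2) ?nnegrE//; apply: le_trans h _; rewrite exprMn.
by rewrite ler_wpM2r ?sqr_ge0//; nra.
Qed.

(** [Y] is the norm of z + x_1 and [s] the row norm of the corresponding family. The lower estimate
    goes through Y <= 2 X, the upper one through [Z]. *)
Lemma equivalence_arith (c X X0 X1 Z Y r k s : R) : 0 <= c ->
  0 <= X -> 0 <= X0 -> 0 <= X1 -> 0 <= Z -> 0 <= Y -> 0 <= r -> 0 <= k ->
  Z ^+ 2 <= c * (r ^+ 2 + k ^+ 2) -> k ^+ 2 <= c * Z ^+ 2 ->
  s ^+ 2 <= c * Y ^+ 2 -> r ^+ 2 <= s ^+ 2 -> X1 ^+ 2 <= s ^+ 2 ->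
  X0 <= X -> Y <= X + X0 -> X <= X0 + X1 + Z -> Z <= Y + X1 ->
  let K := 1 + 6 * (c + 1) + 2 * (c + 1) ^+ 2 in
  K^-1 * (X0 + X1 + k + r) <= X /\ X <= K * (X0 + X1 + k + r).
Proof.
move=> c0 Xp X0p X1p Zp Yp rp kp hZ hk hs hr h1 B0 BY BX BZ K.
have B1 : X1 <= (c + 1) * Y by apply: sq_le_lin => //; exact: le_trans h1 hs.
have BR : r <= (c + 1) * Y by apply: sq_le_lin => //; exact: le_trans hr hs.
have BC : k <= (c + 1) * Z by exact: sq_le_lin.
have BZ' : Z <= (c + 1) * (r + k).
  apply: sq_le_lin => //; first exact: addr_ge0.
  by apply: le_trans hZ _; rewrite ler_wpM2l//; nra.
rewrite /K; have : 1 <= c + 1 by rewrite lerDr.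
move: (c + 1) B1 BR BC BZ' => d B1 BR BC BZ' d1.
have d0 : 0 <= d by lra.
have K0 : 0 < 1 + 6 * d + 2 * d ^+ 2 by have := sqr_ge0 d; lra.
rewrite ler_pdivrMl//; split.
  have E1 : d * Y <= d * (2 * X) by rewrite ler_wpM2l//; lra.
  have E2 : d * Z <= d * (2 * X + d * (2 * X)) by rewrite ler_wpM2l//; lra.
  have E3 : 0 <= d * X by rewrite mulr_ge0.
  rewrite expr2; lra.
have S0 : 0 <= X0 + X1 + k + r by rewrite !addr_ge0.
have E1 : X0 + X1 + Z <= d * (X0 + X1 + k + r).
  have : 0 <= (d - 1) * (X0 + X1) by rewrite mulr_ge0 ?subr_ge0// addr_ge0.
  lra.
apply: le_trans (le_trans BX E1) _; rewrite ler_wpM2r//; have := sqr_ge0 d; lra.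
Qed.

End Bounds.

Theorem theorem4p6 (R : realType) (p : R) (hp : 2 <= p) :
  exists c : R, 0 < c /\
    forall (I : eqType) (D : amalgam R I) (W : word_algebra D) (G : gns W)
           (x : W) (x0 : amB D) (x1 : W)
           (n : nat) (idx : 'I_n -> I) (a : forall k, amA D (idx k))
           (b : 'I_n -> W),
      W_1 x1 ->
      (forall k, A_centered (a k)) ->
      (forall k, W_centered (b k)) ->
      (forall k, L_proj W (idx k) (b k) = 0) ->
      x = inB W x0 + x1 + \sum_(k < n) inA W (idx k) (a k) * b k ->
      let a' := fun k => inA W (idx k) (a k) in
      let rhs := W_Lp G p (inB W x0) + W_Lp G p x1
                 + col_norm G p a' b + row_norm G p a' b in
      c^-1 * rhs <= W_Lp G p x /\ W_Lp G p x <= c * rhs.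
Proof.
have [c [c0 hc]] := family_bound hp.
have C0 : 0 < 1 + 6 * (c + 1) + 2 * (c + 1) ^+ 2.
  by rewrite -addrA ltr_wpDr// addr_ge0// mulr_ge0 ?sqr_ge0// addr_ge0.
exists (1 + 6 * (c + 1) + 2 * (c + 1) ^+ 2); split=> // I D W G x x0 x1 n idx a b.
move=> [n1 [idx1 [a1 [ca1 ->]]]] ca cb Lb ->.
set z := \sum_(k < n) inA W (idx k) (a k) * b k; set x1' := \sum_(k < n1) _.
move=> a' rhs.
have ha k : letter_in (idx k) (a' k) by exists (a k) => //; exact/centeredP.
have ha1 k : letter_in (idx1 k) (inA W (idx1 k) (a1 k)) by exists (a1 k) => //; exact/centeredP.
have L1 i : L_proj W i 1 = 0 by rewrite -(rmorph1 (inB W)) L_inB.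
have Eb_b k : Eb (b k) = 0 by have [y _ <-] := cb k; rewrite EbB Eb_inB subrr.
(* The estimate is used twice: for z alone, giving the upper bound of z and its column norm, and for
   z + x_1, whose row norm dominates both the row norm of z and the norm of x_1. *)
have [Z1 Z2 Z3] := hc _ _ _ G _ _ _ _ ha Lb.
pose iot := fam idx idx1.
pose aa := fam a' (fun k => inA W (idx1 k) (a1 k)); pose bb : 'I_(n + n1) -> W := fam b (fun=> 1).
have haa k : letter_in (iot k) (aa k) by rewrite /iot /aa /fam; case: split.
have hbb k : L_proj W (iot k) (bb k) = 0 by rewrite /iot /bb /fam; case: split.
have [_ Y2 _] := hc _ _ _ G _ _ _ _ haa hbb.
have yE : \sum_k aa k * bb k = z + x1'.
  rewrite big_split_ord; congr (_ + _); apply: eq_bigr => k _; rewrite /aa /bb ?fam_l ?fam_r ?mulr1//.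
rewrite {}yE in Y2.
have rE := row_sum_fam a' (fun k => inA W (idx1 k) (a1 k)) Eb_b.
have pr := row_pos G a' b.
have px : pos (emb G 0 x1' * (emb G 0 x1')^#) by exact: pos_sq'.
have rE' : emb G 0 (row_sum aa bb) = emb G 0 (row_sum a' b) + emb G 0 x1' * (emb G 0 x1')^#.
  by rewrite rE embD emb_star embM.
have q1 : 1 <= p / 2 by rewrite ler_pdivlMr// mul1r.
have R1 : row_norm G p a' b ^+ 2 <= row_norm G p aa bb ^+ 2.
  have := row_norm_sq hp pr; have := row_norm_sq hp (row_pos G aa bb); rewrite rE'.
  move: (row_norm _ _ a' b) (row_norm _ _ _ _) => r s -> ->; apply: Np_le => //.
  by rewrite addrC addKr.
have R2 : W_Lp G p x1' ^+ 2 <= row_norm G p aa bb ^+ 2.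
  have := row_norm_sq hp (row_pos G aa bb); rewrite rE'.
  have := W_Lp_sq G hp 0 x1'.
  move: (row_norm _ _ _ _) (W_Lp _ _ _) => s r -> ->.
  by apply: Np_le => //; rewrite addrK.
set X := W_Lp G p _; pose X0 := W_Lp G p (inB W x0); pose X1 := W_Lp G p x1'.
pose Z := W_Lp G p z; pose Y := W_Lp G p (z + x1').
(* x_1 and z have zero expectation, so E(x) = x_0, and expectations are contractive. *)
have B0 : X0 <= X.
  have -> : X0 = W_Lp G p (Eb (inB W x0 + x1' + z)); last exact: W_Lp_E.
  rewrite !EbD Eb_inB /x1' /z !Eb_sum !big1 ?addr0// => k _; first exact: letter_Eb (ha k) (Lb k).
  by rewrite -[inA _ _ _]mulr1; exact: letter_Eb (ha1 k) (L1 _).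
have BY : Y <= X + X0.
  have -> : Y = W_Lp G p ((inB W x0 + x1' + z) - inB W x0) 
    by congr W_Lp; rewrite -(addrA (inB W x0) x1' z) [inB W x0 + _]addrC addrK addrC.
  exact: W_LpB.
have BX : X <= X0 + X1 + Z.
  apply: le_trans (W_LpD G hp _ _) _; rewrite lerD2r; exact: W_LpD.
have BZ : Z <= Y + X1.
  have -> : Z = W_Lp G p ((z + x1') - x1') by rewrite addrK.
  exact: W_LpB.
exact: (equivalence_arith c0 (W_Lp_ge0 _ _ _) (W_Lp_ge0 _ _ _) (W_Lp_ge0 _ _ _) (W_Lp_ge0 _ _ _)
  (W_Lp_ge0 _ _ _) (row_norm_ge0 _ _ _ _) (col_norm_ge0 _ _ _ _) Z1 Z3 Y2 R1 R2 B0 BY BX BZ).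
Qed.
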